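(* Suppose that the Moments, Smoothness and non-degeneracy, Stability and Identifiability conditions listed in the context hold, that the prior density $\pi_2$ on $\Theta_\alpha$ is continuous and bounded in $\overline\Theta_\alpha$ with $\pi_2(\alpha_0)>0$, and that there is a constant $c_1\in(0,1)$ with $T_n\gtrsim n^{c_1}$. Let $$\mathfrak F_{2,n}(1):=-\frac1{T_n}\log\left(\int_{\Theta_\alpha}\exp\{\mathbb H_{2,n}(\alpha)\}\pi_2(\alpha)d\alpha\right),\qquad\mathbb H_{2,n}(\alpha):=\mathbb H_{2,n}(\alpha,\hat\gamma_n).$$ Then, as $n\to\infty$, $$\mathfrak F_{2,n}(1)=-\frac1{T_n}\mathbb H_{2,n}(\hat\alpha_n)+\frac{p_\alpha}{2T_n}\log T_n+O_p\left(\frac1{T_n}\right).$$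
   Context: Model. $(\Omega,\mathcal F,P)$ is a probability space with expectation $E$ and a filtration $(\mathcal F_t)_{t\ge0}$ to which all processes are adapted. $Z$ is an $r$-dimensional L\'evy process, independent of $X_0$. The $d$-dimensional process $X$ solves $dX_t=a(X_t,\alpha_0)dt+c(X_{t-},\gamma_0)dZ_t$, where $a:\mathbb R^d\times\overline{\Theta}_\alpha\to\mathbb R^d$ and $c:\mathbb R^d\times\overline{\Theta}_\gamma\to\mathbb R^d\otimes\mathbb R^r$ are given functions, $\Theta_\alpha\subset\mathbb R^{p_\alpha}$ and $\Theta_\gamma\subset\mathbb R^{p_\gamma}$ are bounded convex domains, $\Theta=\Theta_\alpha\times\Theta_\gamma$, $\theta=(\alpha,\gamma)$, and $\theta_0=(\alpha_0,\gamma_0)\in\Theta$ is the true value. We observe $\mathbf X_n=(X_{t_j})_{j=0}^n$, $t_j=jh$, with $h=h_n>0$, $T_n:=nh\to\infty$ and $nh^2\to0$ as $n\to\infty$. Notation. $S(x,\gamma)=c(x,\gamma)c(x,\gamma)^\top$; $\Delta_jX=X_{t_j}-X_{t_{j-1}}$; $f_{j-1}(\theta)=f(X_{t_{j-1}},\theta)$; $|A|$ is the determinant of a square matrix $A$; $A^{\otimes2}=AA^\top$; for a matrix $M$ and vectors $u,v$, $M[u,v]=u^\top Mv$, and $M[B]=\mathrm{trace}(MB^\top)$ for a matrix $B$ of the same size; $\lesssim$ and $\gtrsim$ mean inequality (for all large $n$, for sequences) up to a universal positive constant; $\lambda_{\min}$ is the minimum eigenvalue. Two-stage Gaussian quasi-likelihood.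 $$\mathbb H_{1,n}(\gamma)=-\frac12\sum_{j=1}^n\left(\log|2\pi hS_{j-1}(\gamma)|+\frac1hS_{j-1}^{-1}(\gamma)[(\Delta_jX)^{\otimes2}]\right),$$ $$\mathbb H_{2,n}(\alpha,\gamma)=\sum_{j=1}^n\left(S_{j-1}^{-1}(\gamma)[\Delta_jX,a_{j-1}(\alpha)]-\frac h2S_{j-1}^{-1}(\gamma)[a_{j-1}(\alpha)^{\otimes2}]\right).$$ $\hat\gamma_n\in\mathrm{argmax}_\gamma\mathbb H_{1,n}(\gamma)$, $\hat\alpha_n\in\mathrm{argmax}_\alpha\mathbb H_{2,n}(\alpha,\hat\gamma_n)$. Conditions. (Moments) $E[Z_1]=0$, $E[Z_1^{\otimes2}]=I_r$, $E[|Z_1|^q]<\infty$ for all $q>0$. (Smoothness and non-degeneracy) The components $f$ of $a$ and $c$ belong to $\mathcal C^{2,4}_\sharp$: $f(\cdot,\theta)$ is globally Lipschitz uniformly in $\theta\in\overline\Theta$; $f$ is 2 times continuously differentiable in $x$ and 4 times in $\theta$, all partial derivatives are continuous over $\overline\Theta$ for each $x$, and $\max_{i\le2}\max_{j\le4}\sup_{\theta\in\overline\Theta}|\partial_\theta^j\partial_x^if(x,\theta)|\lesssim1+|x|^{C}$ for some $C\ge0$. Also $\sup_{\gamma\in\overline\Theta_\gamma}\lambda_{\min}\{S(x,\gamma)\}^{-1}\lesssim1+|x|^{C_0}$ for some $C_0\ge0$. (Stability) There is a probability measure $\pi$ such that for every $q>0$ there is $\mathsf a>0$ with $\sup_{t\ge0}e^{\mathsf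 at}\sup_{f:|f|\le g}|\int f(y)P_t(x,dy)-\int f(y)\pi(dy)|\lesssim g(x)$ for $x\in\mathbb R^d$, where $g(x)=1+|x|^q$ and $P_t(x,dy)=P(X_t\in dy|X_0=x)$; and $\sup_{t\ge0}E[|X_t|^q]<\infty$ for every $q>0$. (Identifiability) There are $\chi_\gamma,\chi_\alpha>0$ such that for every $\gamma$ and $\alpha$, $-\frac12\int\{\mathrm{trace}(S(x,\gamma)^{-1}S(x,\gamma_0)-I_d)+\log\frac{|S(x,\gamma)|}{|S(x,\gamma_0)|}\}\pi(dx)\le-\chi_\gamma|\gamma-\gamma_0|^2$ and $-\frac12\int S^{-1}(x,\gamma_0)[(a(x,\alpha)-a(x,\alpha_0))^{\otimes2}]\pi(dx)\le-\chi_\alpha|\alpha-\alpha_0|^2$. *)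

(* Defs.v *)
From HB Require Import structures.
From mathcomp Require Import all_boot all_order all_algebra.
From mathcomp Require Import all_classical all_reals all_analysis.

Set Implicit Arguments.
Unset Strict Implicit.
Unset Printing Implicit Defensive.

Import Order.TTheory GRing.Theory Num.Theory.
Import numFieldNormedType.Exports.

Local Open Scope classical_set_scope.
Local Open Scope ring_scope.

(* Linear algebra, norms and derivatives live on column vectors 'cV[R]_n;
   measures on R^n live on n.-tuple R, which carries the product (= Borel)
   sigma-algebra.  [tov] and [tot] are the mutually inverse identifications. *)
Definition tov (R : realType) n (t : n.-tuple R) : 'cV[R]_n := \col_i tnth t i.

Definition tot (R : realType) n (v : 'cV[R]_n) : n.-tuple R :=
  [tuple v i 0 | i < n].

Section linear_algebra.
Context {R : realType}.

(* Euclidean norm; the library norm `|v| on matrices is the max norm. *)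
Definition enorm n (v : 'cV[R]_n) : R := Num.sqrt (\sum_i v i 0 ^+ 2).

(* M[u, v] *)
Definition mxform m n (M : 'M[R]_(m, n)) (u : 'cV[R]_m) (v : 'cV[R]_n) : R :=
  (u^T *m M *m v) 0 0.

(* M[B] *)
Definition mxpair m n (M B : 'M[R]_(m, n)) : R := \tr (M *m B^T).

Definition outer m n (A : 'M[R]_(m, n)) : 'M[R]_m := A *m A^T.

(* Only used for symmetric matrices of positive size, whose spectrum is a
   nonempty finite set of reals. *)
Definition lambda_min n (M : 'M[R]_n) : R := inf [set l | eigenvalue M l].

End linear_algebra.

Lemma product_measure1_sigma_finite d1 d2 (T1 : measurableType d1)
    (T2 : measurableType d2) (R : realType)
    (m1 : {sigma_finite_measure set T1 -> \bar R})
    (m2 : {sigma_finite_measure set T2 -> \bar R}) :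
  sigma_finite setT (m1 \x m2)%E.
Proof.
have /sigma_finiteP[F [TF ndF Foo]] := sigma_finiteT m1.
have /sigma_finiteP[G [TG ndG Goo]] := sigma_finiteT m2.
exists (fun n => F n `*` G n).
  rewrite -setXTT TF TG predeqE => -[x y]; split.
    move=> [/= [n _ Fnx] [k _ Gky]]; exists (maxn n k) => //; split.
    - by move: x Fnx; exact/subsetPset/ndF/leq_maxl.
    - by move: y Gky; exact/subsetPset/ndG/leq_maxr.
  by move=> [n _ []/= ? ?]; split; exists n.
move=> k; have [? ?] := Foo k; have [? ?] := Goo k.
split; first exact: measurableX.
by rewrite product_measure1E// lte_mul_pinfty// ge0_fin_numE.
Qed.

Section lebesgue.
Context {R : realType}.

Definition tcons n (x : measurableTypeR R * n.-tuple R) : n.+1.-tuple R :=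
  [tuple of x.1 :: x.2].

Lemma measurable_tcons n : measurable_fun setT (@tcons n).
Proof.
apply: (@measurable_cons _ _ _ R fst n snd); last exact: measurable_snd.
exact: (@measurable_fst _ _ (measurableTypeR R)).
Qed.

Definition lebesgue_succ n (m : {sigma_finite_measure set (n.-tuple R) -> \bar R})
    : set (n.+1.-tuple R) -> \bar R :=
  pushforward ((@lebesgue_measure R) \x m)%E (@tcons n).

Section lebesgue_succ_measure.
Context n (m : {sigma_finite_measure set (n.-tuple R) -> \bar R}).

Let preim (A : set (n.+1.-tuple R)) :
  measurable A -> measurable (@tcons n @^-1` A).
Proof. by move=> mA; rewrite -[X in measurable X]setTI; exact: measurable_tcons. Qed.

Let succ0 : lebesgue_succ m set0 = 0%E.
Proof. by rewrite /lebesgue_succ /pushforward preimage_set0 measure0. Qed.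

Let succ_ge0 A : (0 <= lebesgue_succ m A)%E.
Proof. by rewrite /lebesgue_succ /pushforward measure_ge0. Qed.

Let succ_sigma_additive : semi_sigma_additive (lebesgue_succ m).
Proof.
move=> F mF tF mUF; rewrite /lebesgue_succ /pushforward preimage_bigcup.
apply: measure_semi_sigma_additive.
- by move=> k; exact: preim.
- apply/trivIsetP => /= i j _ _ ij; rewrite -preimage_setI.
  by move/trivIsetP : tF => /(_ _ _ _ _ ij) ->//; rewrite preimage_set0.
- by rewrite -preimage_bigcup; exact: preim.
Qed.

HB.instance Definition _ := isMeasure.Build _ _ _ (lebesgue_succ m)
  succ0 succ_ge0 succ_sigma_additive.

Let succ_sigma_finite : sigma_finite setT (lebesgue_succ m).
Proof.
have [F TF Foo] := product_measure1_sigma_finite (@lebesgue_measure R) m.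
pose uncons (t : n.+1.-tuple R) : measurableTypeR R * n.-tuple R :=
  (thead t, [tuple of behead t]).
have tconsK : cancel (@tcons n) uncons.
  by move=> [x t]; congr pair; exact/val_inj.
have muncons : measurable_fun setT uncons.
  apply/measurable_fun_pairP => /=; split; first exact: measurable_tnth.
  exact: measurable_behead.
exists (fun k => uncons @^-1` F k).
  by rewrite -preimage_bigcup -TF preimage_setT.
move=> k; have [mFk Fkoo] := Foo k; split.
  by rewrite -[X in measurable X]setTI; exact: muncons.
rewrite /lebesgue_succ /pushforward -comp_preimage.
rewrite (_ : uncons \o _ = id) ?preimage_id//.
by apply/funext => x /=; exact: tconsK.
Qed.

HB.instance Definition _ := Measure_isSigmaFinite.Build _ _ _ (lebesgue_succ m)
  succ_sigma_finite.

End lebesgue_succ_measure.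

(* Lebesgue measure on R^n: the unit mass on R^0, then iterated products. *)
Fixpoint lebesgue_vec n : {sigma_finite_measure set (n.-tuple R) -> \bar R} :=
  match n with
  | 0 => [the {sigma_finite_measure set (0.-tuple R) -> \bar R} of
           dirac [tuple]]
  | n'.+1 => [the {sigma_finite_measure set (n'.+1.-tuple R) -> \bar R} of
               lebesgue_succ (lebesgue_vec n')]
  end.

Lemma lebesgue_vec_box n (A : 'I_n -> set R) : (forall i, measurable (A i)) ->
  lebesgue_vec n [set t | forall i, A i (tnth t i)] =
  (\prod_(i < n) lebesgue_measure (A i))%E.
Proof.
elim: n A => [|n IH] A mA /=.
  rewrite big_ord0 diracE mem_set//= => -[]//.
rewrite big_ord_recl -IH//.
set B := [set t | forall i, A (lift ord0 i) (tnth t i)].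
have mB : measurable B.
  rewrite (_ : B = \bigcap_(i in [set: 'I_n])
      ((fun t : n.-tuple R => tnth t i) @^-1` A (lift ord0 i))).
    apply: fin_bigcap_measurable => // i _.
    rewrite -[X in measurable X]setTI.
    by apply: measurable_tnth => //; exact: mA.
  by apply/seteqP; split => [t /= At i _|t At i]; exact: At.
apply: etrans (product_measure1E (@lebesgue_measure R) (lebesgue_vec n)
  (mA ord0) mB).
rewrite /lebesgue_succ /pushforward; congr (_ _).
apply/seteqP; split => [[x t] /= Axt|[x t] /= [Ax At] i].
  split; first by have := Axt ord0; rewrite tnth0.
  by move=> i; have := Axt (lift ord0 i); rewrite tnthS.
by have [j ->|->] := unliftP ord0 i; rewrite ?tnthS ?tnth0//; exact: At.
Qed.

End lebesgue.

Section functions.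
Context {R : realType}.

(* C^{k,l}_sharp on R^d x closure Theta.  [D I J] is the partial derivative of
   f, in x along the indices I and then in theta along the indices J.  Since
   Theta is only assumed open, theta-derivatives are taken inside Theta and are
   required to extend continuously to the closure. *)
Definition C_sharp d p (k l : nat) (Theta : set 'cV[R]_p)
    (f : 'cV[R]_d -> 'cV[R]_p -> R) : Prop :=
  (exists K : R, forall theta x y, closure Theta theta ->
     `|f x theta - f y theta| <= K * enorm (x - y)) /\
  exists D : seq 'I_d -> seq 'I_p -> 'cV[R]_d -> 'cV[R]_p -> R,
    (forall x theta, closure Theta theta -> D [::] [::] x theta = f x theta) /\
    [/\ forall I i x theta, (size I < k)%N -> closure Theta theta ->
          is_derive x (delta_mx i 0) (D I [::] ^~ theta)
            (D (i :: I) [::] x theta),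
        forall I J j x theta, (size I <= k)%N -> (size J < l)%N ->
          Theta theta ->
          is_derive theta (delta_mx j 0) (D I J x) (D I (j :: J) x theta),
        forall I theta, (size I <= k)%N -> closure Theta theta ->
          continuous (D I [::] ^~ theta),
        forall I J x, (size I <= k)%N -> (size J <= l)%N ->
          {within closure Theta, continuous (D I J x)} &
        exists C K : R, 0 <= C /\
          forall I J x theta, (size I <= k)%N -> (size J <= l)%N ->
            closure Theta theta ->
            `|D I J x theta| <= K * (1 + enorm x `^ C)].

Definition bounded_convex_domain p (Theta : set 'cV[R]_p) : Prop :=
  [/\ open Theta, Theta !=set0, bounded_set Theta &
      convex_set (Theta : set (convex_lmodType 'cV[R]_p))].

Definition is_argmax (T : Type) (A : set T) (f : T -> R) (x : T) : Prop :=
  A x /\ forall y, A y -> f y <= f x.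

Definition cadlag n (f : R -> 'cV[R]_n) : Prop :=
  (forall t, 0 <= t -> f s @[s --> t^'+] --> f t) /\
  (forall t, 0 < t -> cvg (f s @[s --> t^'-])).

End functions.

Section quasi_likelihood.
Context {R : realType} {d r pa pg : nat}.
Variables (a : 'cV[R]_d -> 'cV[R]_pa -> 'cV[R]_d)
          (c : 'cV[R]_d -> 'cV[R]_pg -> 'M[R]_(d, r)).

Definition scale_mx x gamma : 'M[R]_d := outer (c x gamma).

Local Notation S := scale_mx.

(* [x j] is the observation X_{t_j}. *)
Definition GQL1 (n : nat) (h : R) (x : nat -> 'cV[R]_d) gamma : R :=
  - 2^-1 * \sum_(1 <= j < n.+1)
    (ln (\det ((2 * pi * h) *: S (x j.-1) gamma))
     + h^-1 * mxpair (invmx (S (x j.-1) gamma)) (outer (x j - x j.-1))).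

Definition GQL2 (n : nat) (h : R) (x : nat -> 'cV[R]_d) alpha gamma : R :=
  \sum_(1 <= j < n.+1)
    (mxform (invmx (S (x j.-1) gamma)) (x j - x j.-1) (a (x j.-1) alpha)
     - h / 2 * mxpair (invmx (S (x j.-1) gamma)) (outer (a (x j.-1) alpha))).

(* Free energy at inverse temperature 1 of a function Hn on Theta, with prior
   density prior. *)
Definition free_energy p (T : R) (Theta : set 'cV[R]_p) (prior : 'cV[R]_p -> R)
    (Hn : 'cV[R]_p -> R) : R :=
  - T^-1 * ln (\int[lebesgue_vec p]_(t in [set t | Theta (tov t)])
                  (expR (Hn (tov t)) * prior (tov t))).

(* Positivity is explicit because 0^-1 = 0 here, whereas the bound is meant to
   exclude singular S. *)
Definition nondegenerate_scale (Theta_g : set 'cV[R]_pg) : Prop :=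
  exists C0 K : R, 0 <= C0 /\
    forall x gamma, closure Theta_g gamma ->
      0 < lambda_min (S x gamma) /\
      (lambda_min (S x gamma))^-1 <= K * (1 + enorm x `^ C0).

Definition identifiable_gamma (mu : probability (d.-tuple R) R)
    (Theta_g : set 'cV[R]_pg) (gamma0 : 'cV[R]_pg) : Prop :=
  exists2 chi : R, 0 < chi & forall gamma, closure Theta_g gamma ->
    - 2^-1 * \int[mu]_x
      (\tr (invmx (S (tov x) gamma) *m S (tov x) gamma0 - 1%:M)
       + ln (\det (S (tov x) gamma) / \det (S (tov x) gamma0)))
    <= - chi * enorm (gamma - gamma0) ^+ 2.

Definition identifiable_alpha (mu : probability (d.-tuple R) R)
    (Theta_a : set 'cV[R]_pa) (alpha0 : 'cV[R]_pa) (gamma0 : 'cV[R]_pg) : Prop :=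
  exists2 chi : R, 0 < chi & forall alpha, closure Theta_a alpha ->
    - 2^-1 * \int[mu]_x
      mxpair (invmx (S (tov x) gamma0))
             (outer (a (tov x) alpha - a (tov x) alpha0))
    <= - chi * enorm (alpha - alpha0) ^+ 2.

Definition prior_density p (Theta : set 'cV[R]_p) (prior : 'cV[R]_p -> R) : Prop :=
  [/\ forall theta, closure Theta theta -> 0 <= prior theta,
      {within closure Theta, continuous prior},
      (exists K, forall theta, closure Theta theta -> prior theta <= K) &
      (\int[lebesgue_vec p]_(t in [set t | Theta (tov t)])
          (prior (tov t))%:E = 1)%E].

End quasi_likelihood.

(* Processes are indexed by R; only times t >= 0 are relevant. *)
Section processes.
Context {R : realType} {disp : measure_display} {Omega : measurableType disp}.
Variable P : probability Omega R.

(* The sigma-algebra generated by a random vector. *)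
Definition vec_sigma n (U : Omega -> 'cV[R]_n) : set_system Omega :=
  g_sigma_algebra_preimage (fun w => tot (U w)).

Definition random_vector n (U : Omega -> 'cV[R]_n) : Prop :=
  vec_sigma U `<=` measurable.

Definition process_sigma n (Z : R -> Omega -> 'cV[R]_n) : set_system Omega :=
  <<s \bigcup_(t in [set t | 0 <= t]) vec_sigma (Z t) >>.

Definition indep_sigma (G G' : set_system Omega) : Prop :=
  forall A B, G A -> G' B -> P (A `&` B) = (P A * P B)%E.

Definition same_law n (U V : Omega -> 'cV[R]_n) : Prop :=
  forall B : set (n.-tuple R), measurable B ->
    P [set w | B (tot (U w))] = P [set w | B (tot (V w))].

Definition is_Op (Y : nat -> Omega -> R) (u : nat -> R) : Prop :=
  forall eps : R, 0 < eps -> exists M : R, \forall n \near \oo,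
    (P [set w | (M * u n < `|Y n w|)%R] <= eps%:E)%E.

Variable F : R -> set_system Omega.

Definition filtration : Prop :=
  [/\ forall t, 0 <= t -> sigma_algebra setT (F t),
      forall t, 0 <= t -> F t `<=` measurable &
      forall s t, 0 <= s -> s <= t -> F s `<=` F t].

Definition adapted n (X : R -> Omega -> 'cV[R]_n) : Prop :=
  forall t, 0 <= t -> vec_sigma (X t) `<=` F t.

(* Lévy process relative to the filtration F. *)
Definition levy_process n (Z : R -> Omega -> 'cV[R]_n) : Prop :=
  [/\ adapted Z,
      forall w, cadlag (Z ^~ w),
      {ae P, forall w, Z 0 w = 0},
      forall s t, 0 <= s -> s <= t ->
        indep_sigma (F s) (vec_sigma (fun w => Z t w - Z s w)) &
      forall s t, 0 <= s -> s <= t ->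
        same_law (fun w => Z t w - Z s w) (Z (t - s))].

Definition mesh (s : seq R) : R :=
  \big[Num.max/0]_(k < size s) (s`_k - (0 :: s)`_k).

Definition riemann_sum d r (H : R -> Omega -> 'M[R]_(d, r))
    (Z : R -> Omega -> 'cV[R]_r) (s : seq R) (w : Omega) : 'cV[R]_d :=
  \sum_(k < size s) H (0 :: s)`_k w *m (Z s`_k w - Z (0 :: s)`_k w).

(* I_t = \int_0^t H_{s-} dZ_s for an adapted càdlàg H and a semimartingale Z:
   the limit in probability of left-endpoint Riemann sums along the partitions
   of [0, t] as the mesh tends to 0 (as in Kurtz and Protter, Ann. Probab. 19,
   1991).  Although the sums sample H rather than its left limits, their limit
   is the Itô integral of the predictable process H_{s-}. *)
Definition stochastic_integral d r (H : R -> Omega -> 'M[R]_(d, r))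
    (Z : R -> Omega -> 'cV[R]_r) (I : R -> Omega -> 'cV[R]_d) : Prop :=
  forall t, 0 <= t -> forall eps : R, 0 < eps -> exists2 delta : R, 0 < delta &
    forall s, itv_partition 0 t s -> mesh s < delta ->
      (P [set w | (eps < enorm (riemann_sum H Z s w - I t w))%R] <= eps%:E)%E.

(* dX_t = b(X_t) dt + sigma(X_{t-}) dZ_t *)
Definition sde_solution d r (b : 'cV[R]_d -> 'cV[R]_d)
    (sigma : 'cV[R]_d -> 'M[R]_(d, r)) (Z : R -> Omega -> 'cV[R]_r)
    (X : R -> Omega -> 'cV[R]_d) : Prop :=
  [/\ adapted X,
      forall w, cadlag (X ^~ w) &
      stochastic_integral (fun t w => sigma (X t w)) Z
        (fun t w => X t w - X 0 w
           - \col_i \int[lebesgue_measure]_(s in `[0, t]) b (X s w) i 0)].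

(* P_t(x, dy) = P(X_t \in dy | X_0 = x): the Markov transition function common
   to all solutions of the equation, whatever their initial value.  In
   particular kappa t x is the law of X_t when X starts from the point x. *)
Definition transition_function d r (b : 'cV[R]_d -> 'cV[R]_d)
    (sigma : 'cV[R]_d -> 'M[R]_(d, r)) (Z : R -> Omega -> 'cV[R]_r)
    (kappa : R -> R.-pker (d.-tuple R) ~> (d.-tuple R)) : Prop :=
  forall X, sde_solution b sigma Z X ->
    forall s t A B, 0 <= s -> 0 <= t -> F s A -> measurable B ->
      P (A `&` [set w | B (tot (X (s + t) w))]) =
      (\int[P]_(w in A) kappa t (tot (X s w)) B)%E.

Definition moments_Z r (Z : R -> Omega -> 'cV[R]_r) : Prop :=
  [/\ forall i, (\int[P]_w (Z 1 w i 0)%:E = 0)%E,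
      forall i j, (\int[P]_w (outer (Z 1 w) i j)%:E = ((1%:M : 'M[R]_r) i j)%:E)%E &
      forall q : R, 0 < q -> (\int[P]_w (enorm (Z 1 w) `^ q)%:E < +oo)%E].

(* The integrals below are extended-real valued, so the first bound entails
   that g is integrable with respect to mu and to every kappa t x. *)
Definition exponentially_ergodic d
    (kappa : R -> R.-pker (d.-tuple R) ~> (d.-tuple R))
    (mu : probability (d.-tuple R) R) : Prop :=
  forall q : R, 0 < q ->
    let g (x : d.-tuple R) := 1 + enorm (tov x) `^ q in
    exists2 rate : R, 0 < rate & exists K : R,
      forall (x : d.-tuple R) (t : R) (f : d.-tuple R -> R), 0 <= t ->
        measurable_fun setT f -> (forall y, `|f y| <= g y) ->
        ((expR (rate * t))%:E *
           `| \int[kappa t x]_y (f y)%:E - \int[mu]_y (f y)%:E |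
         <= (K * g x)%:E)%E.

Definition bounded_moments d (X : R -> Omega -> 'cV[R]_d) : Prop :=
  forall q : R, 0 < q -> exists K : R, forall t, 0 <= t ->
    (\int[P]_w (enorm (X t w) `^ q)%:E <= K%:E)%E.

End processes.

(* Main.v *)
Require Import Defs.
From HB Require Import structures.
From mathcomp Require Import all_boot all_order all_algebra.
From mathcomp Require Import all_classical all_reals all_analysis.
From mathcomp Require Import measurable_realfun ring lra zify.

Set Implicit Arguments.
Unset Strict Implicit.
Unset Printing Implicit Defensive.

Import Order.TTheory GRing.Theory Num.Theory.
Import numFieldNormedType.Exports.

Local Open Scope classical_set_scope.
Local Open Scope ring_scope.

(** Let delta be the distance from alpha to the true value alpha0 and let H be
    the second-stage quasi-likelihood.  The claim is that the integral of
    exp(H(alpha) - H(alphahat)) against the prior is of exact order T^(- p / 2)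
    in probability.  Laplace's method gives this as soon as, with probability
    close to one and for all alpha at once, H lies between two parabolas,

      - M sqrt(T) delta - M T delta^2 <= H(alpha) - H(alpha0)
                                      <= M sqrt(T) delta - q T delta^2

    (lemmas key_inequality and laplace).  The upper parabola bounds
    H(alphahat) - H(alpha0) and dominates the integral by a Gaussian one; the
    lower one bounds it below by the contribution of a box of side T^(- 1 / 2)
    around alpha0.

    The increment of H is a linear minus a quadratic term (GQL2_increment).  Write
    x for the state at the start of the j-th sampling interval.  The linear term
    is the sum over j of the residuals, that is, of the increments of X over the
    intervals minus h a(x, alpha0), weighted by the inverse of S and by the drift
    difference a(x, alpha) - a(x, alpha0); the quadratic one is h / 2 times the
    sum of the form S^(-1) at the drift differences.  Both are estimated
    uniformly in the diffusion parameter over its closed set, and the first-stage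
    estimator is substituted afterwards.

    - Linear term.  By the mean value theorem it is at most delta times the
      supremum over the joint parameter of a weighted sum of residuals
      (linear_part).  A residual is a drift error, of total expectation
      n h^(3/2), which is O(sqrt T) because n h^2 tends to 0 (drift_remainder),
      plus an increment of the stochastic integral.  Sums of the latter with
      weights that are Lipschitz in the parameter have increments whose moments
      of order Q are at most C |theta - theta'|^Q T^(Q/2) (integral_moment), and
      chaining makes their supremum O(sqrt T) (chaining, score_bound).  The
      moment bound is proved for Riemann sums, which are discrete martingale
      transforms of the driving process (martingale_moment), from the fact that
      the moments of order at least 2 of a Levy increment are linear in the
      length of the interval (levy_increment_moments).

    - Quadratic term.  The upper bound is Markov's inequality.  For the lower
      one, S^(-1) is at least the inverse of a polynomial weight by the
      Cauchy-Schwarz inequality, and it remains to bound below the weighted sum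
      of the squares of the drift differences.  Divided by delta these are
      equicontinuous in x, so on a large ball the sum is governed by the numbers
      of visits to finitely many small cells.  Exponential ergodicity and the
      Markov property bring these numbers close to n times the invariant masses
      (occupation_variance), and the identifiability condition bounds the
      resulting integral below (quadratic_lower).

    The events in the definition of O_p must be measurable for these estimates
    to bound their probabilities.  The free energy is a measurable function of
    the sample point because a field that is continuous in the parameter may be
    evaluated at a random parameter (measurable_random_parameter), after which
    Tonelli's theorem applies. *)

(** * Quadratic forms and inverse scale matrices *)

Lemma cvg_rsum {R : realType} {T : Type} {F : set_system T} {FF : Filter F}
    (I : Type) (r : seq I) (P : pred I) (f : I -> T -> R) (a : I -> R) :
  (forall i, P i -> f i x @[x --> F] --> a i) ->
  \sum_(i <- r | P i) f i x @[x --> F] --> \sum_(i <- r | P i) a i.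
Proof. by move=> fa; apply: cvg_big => //; exact: add_continuous. Qed.

Section continuous_real.
Context {R : realType} {T : topologicalType}.
Implicit Types f g : T -> R.

Lemma continuous_subr f g : continuous f -> continuous g ->
  continuous (fun x => f x - g x).
Proof. by move=> cf cg x; apply: cvgB; [exact: cf|exact: cg]. Qed.

Lemma continuous_mulr f g : continuous f -> continuous g ->
  continuous (fun x => f x * g x).
Proof. by move=> cf cg x; apply: cvgM; [exact: cf|exact: cg]. Qed.

Lemma continuous_rsum (I : Type) (r : seq I) (P : pred I) (f : I -> T -> R) :
  (forall i, P i -> continuous (f i)) ->
  continuous (fun x => \sum_(i <- r | P i) f i x).
Proof. by move=> cf x; apply: cvg_rsum => i Pi; exact: cf. Qed.

End continuous_real.

Section vectors.
Context {R : realType}.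

Definition dot n (u v : 'cV[R]_n) : R := \sum_i u i 0 * v i 0.

Lemma enorm_ge0 n (v : 'cV[R]_n) : 0 <= enorm v.
Proof. exact: sqrtr_ge0. Qed.

Lemma dotvv_ge0 n (v : 'cV[R]_n) : 0 <= dot v v.
Proof. by apply: sumr_ge0 => i _; rewrite -expr2 sqr_ge0. Qed.

Lemma enorm_sqr n (v : 'cV[R]_n) : enorm v ^+ 2 = dot v v.
Proof.
rewrite sqr_sqrtr; first by apply: eq_bigr => i _; rewrite expr2.
by apply: sumr_ge0 => i _; rewrite sqr_ge0.
Qed.

Lemma coord_le_enorm n (v : 'cV[R]_n) i : `|v i 0| <= enorm v.
Proof.
rewrite -sqrtr_sqr /enorm ler_wsqrtr// (bigD1 i)//= lerDl.
by apply: sumr_ge0 => j _; rewrite sqr_ge0.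
Qed.

Lemma enorm_le_sum n (v : 'cV[R]_n) : enorm v <= \sum_i `|v i 0|.
Proof.
have s0 : 0 <= \sum_i `|v i 0| by apply: sumr_ge0.
rewrite -(ler_pXn2r (ltn0Sn 1))// ?nnegrE ?enorm_ge0//.
rewrite enorm_sqr /dot expr2 mulr_suml ler_sum// => i _.
rewrite -expr2 -real_normK ?num_real// expr2 ler_wpM2l//.
by rewrite (bigD1 i)//= lerDl sumr_ge0.
Qed.

Lemma sum_le_enorm n (v : 'cV[R]_n) : \sum_i `|v i 0| <= n%:R * enorm v.
Proof.
apply: (@le_trans _ _ (\sum_(i < n) enorm v)).
  by apply: ler_sum => i _; exact: coord_le_enorm.
by rewrite sumr_const card_ord mulr_natl.
Qed.

Lemma enorm0 n : enorm (0 : 'cV[R]_n) = 0.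
Proof.
rewrite /enorm big1 ?sqrtr0// => i _.
by rewrite mxE expr0n.
Qed.

Lemma dot_cauchy_schwarz n (u v : 'cV[R]_n) :
  dot u v ^+ 2 <= dot u u * dot v v.
Proof.
set A := dot u u; set B := dot v v; set C := dot u v.
have H0 : 0 <= \sum_i (B * u i 0 - C * v i 0) ^+ 2.
  by apply: sumr_ge0 => i _; exact: sqr_ge0.
have E : \sum_i (B * u i 0 - C * v i 0) ^+ 2 = B * (A * B - C ^+ 2).
  transitivity (\sum_i (B ^+ 2 * (u i 0 * u i 0) - 2 * B * C * (u i 0 * v i 0)
    + C ^+ 2 * (v i 0 * v i 0))); first by apply: eq_bigr => i _; ring.
  rewrite !big_split/= sumrN -!mulr_sumr -/(dot u u) -/(dot u v) -/(dot v v).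
  by rewrite -/A -/B -/C; ring.
have B0 : 0 <= B by exact: dotvv_ge0.
have [B00|Bn0] := eqVneq B 0; last first.
  have Bp : 0 < B by rewrite lt_neqAle eq_sym Bn0.
  by move: H0; rewrite E pmulr_rge0// subr_ge0.
have v0 i : v i 0 = 0.
  apply/eqP; rewrite -sqrf_eq0 eq_le sqr_ge0 andbT.
  apply: le_trans (_ : B <= _); last by rewrite B00.
  rewrite /B /dot (bigD1 i)//= -expr2 lerDl sumr_ge0// => j _.
  by rewrite -expr2 sqr_ge0.
by rewrite /C /dot big1 ?expr0n ?B00 ?mulr0// => i _; rewrite v0 mulr0.
Qed.

Lemma mxformE m n (M : 'M[R]_(m, n)) u v :
  mxform M u v = dot u (M *m v).
Proof. by rewrite /mxform -mulmxA mxE; apply: eq_bigr => i _; rewrite mxE. Qed.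

Lemma mxform_sum m n (M : 'M[R]_(m, n)) u v :
  mxform M u v = \sum_i \sum_j u i 0 * M i j * v j 0.
Proof.
rewrite mxformE /dot; apply: eq_bigr => i _; rewrite mxE mulr_sumr.
by apply: eq_bigr => j _; rewrite mulrA.
Qed.

Lemma mxpair_outer n (M : 'M[R]_n) (b : 'cV[R]_n) :
  mxpair M (outer b) = mxform M b b.
Proof.
by rewrite /mxpair /outer trmx_mul trmxK mulmxA mxtrace_mulC mulmxA /mxtrace big_ord1.
Qed.

End vectors.

Section scale_matrices.
Context {R : realType} {d r : nat}.
Variable c : 'M[R]_(d, r).
Local Notation S := (outer c).

Lemma mxform_outer u v : mxform S u v = dot (c^T *m u) (c^T *m v).
Proof.
rewrite mxformE /outer -mulmxA /dot.
under eq_bigr do rewrite mxE mulr_sumr.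
rewrite exchange_big/=; apply: eq_bigr => k _.
rewrite [X in _ = X * _]mxE mulr_suml; apply: eq_bigr => i _.
by rewrite [(c^T) _ _]mxE mulrA (mulrC (u i 0)).
Qed.

Lemma outer_sym : S^T = S.
Proof. by rewrite /outer trmx_mul trmxK. Qed.

End scale_matrices.

(** A minimiser of the quadratic form on the unit sphere is an eigenvector, so
    the minimum, being an eigenvalue, dominates the infimum of the spectrum. *)
Lemma lambda_min_le_form {R : realType} d r (c : 'M[R]_(d, r)) (v : 'cV[R]_d) :
  lambda_min (outer c) * dot v v <= mxform (outer c) v v.
Proof.
case: d c v => [c v|d c v].
  by rewrite mxformE /dot !big_ord0 mulr0.
set S := outer c.
pose f (x : 'rV[R]_d.+1) := mxform S x^T x^T.
pose A := [set x : 'rV[R]_d.+1 | \sum_i x 0 i ^+ 2 = 1].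
have ssq (x : 'rV[R]_d.+1) : \sum_i x 0 i ^+ 2 = dot x^T x^T.
  by apply: eq_bigr => i _; rewrite !mxE expr2.
have fE : f = fun x => \sum_i \sum_j x 0 i * S i j * x 0 j.
  apply/funext => x; rewrite /f mxform_sum; apply: eq_bigr => i _.
  by apply: eq_bigr => j _; rewrite !mxE.
have cco (i : 'I_d.+1) : continuous (fun x : 'rV[R]_d.+1 => x 0 i).
  exact: coord_continuous.
have fC : continuous f.
  rewrite fE; apply: continuous_rsum => i _; apply: continuous_rsum => j _.
  apply: (continuous_mulr _ (cco j)); apply: (continuous_mulr (cco i)).
  exact: cst_continuous.
have sC : continuous (fun x : 'rV[R]_d.+1 => \sum_i x 0 i ^+ 2).
  apply: continuous_rsum => i _.
  rewrite (_ : (fun y : 'rV[R]_d.+1 => y 0 i ^+ 2) =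
    (fun y => y 0 i * y 0 i)); last by apply/funext => y; rewrite expr2.
  exact: continuous_mulr.
have A0 : A !=set0.
  exists (delta_mx 0 0); rewrite /A/= (bigD1 0)//= mxE !eqxx expr1n big1 ?addr0//.
  by move=> i i0; rewrite mxE (negbTE i0) andbF expr0n.
have cA : compact A.
  apply: bounded_closed_compact; last first.
    apply: (@preimage_closed _ _ (fun x : 'rV[R]_d.+1 => \sum_i x 0 i ^+ 2) [set 1]).
      by move=> x _; exact: sC.
    exact: closed_eq.
  exists 1; split => // M M1 x /= Ax.
  rewrite [`|x|]mx_normrE; apply: bigmax_le => [|[i j] _ /=].
    exact: (le_trans ler01 (ltW M1)).
  apply: (le_trans _ (ltW M1)).
  rewrite (ord1 i) -(@ler_pXn2r _ 2)// ?nnegrE//.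
  rewrite expr1n -Ax real_normK ?num_real// (bigD1 j)//= lerDl sumr_ge0//.
  by move=> k _; exact: sqr_ge0.
have [x0 Ax0 minf] := EVT_min_rV A0 cA (continuous_subspaceT fC).
rewrite inE in Ax0.
pose mu := f x0.
pose M := S - mu%:M.
have MS : M^T = M by rewrite /M linearB/= outer_sym tr_scalar_mx.
have ME u w : mxform M u w = mxform S u w - mu * dot u w.
  rewrite !mxformE /M mulmxBl mul_scalar_mx /dot mulr_sumr -sumrB.
  by apply: eq_bigr => i _; rewrite !mxE; ring.
have Mpos w : 0 <= mxform M w w.
  rewrite ME subr_ge0.
  have [w0|w0] := eqVneq (dot w w) 0.
    rewrite w0 mulr0 mxform_outer; exact: dotvv_ge0.
  have wp : 0 < dot w w by rewrite lt_neqAle eq_sym w0 dotvv_ge0.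
  set s := Num.sqrt (dot w w).
  have sp : 0 < s by rewrite sqrtr_gt0.
  have s2 : s ^+ 2 = dot w w by rewrite sqr_sqrtr// dotvv_ge0.
  have AZ : A (s^-1 *: w^T).
    rewrite /A/=; under eq_bigr do rewrite !mxE exprMn.
    have e : \sum_i w i 0 ^+ 2 = dot w w by apply: eq_bigr => i _; rewrite expr2.
    by rewrite -mulr_sumr exprVn s2 e mulVf.
  have := minf (s^-1 *: w^T); rewrite inE => /(_ AZ).
  have -> : f (s^-1 *: w^T) = (s ^+ 2)^-1 * mxform S w w.
    rewrite /f linearZ/= trmxK !mxform_sum mulr_sumr; apply: eq_bigr => i _.
    rewrite mulr_sumr; apply: eq_bigr => j _.
    rewrite [(_ *: w) i 0]mxE [(_ *: w) j 0]mxE -exprVn; ring.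
  by rewrite -/mu mulrC -s2 ler_pdivlMr ?exprn_gt0.
have Mx0 : mxform M x0^T x0^T = 0 by rewrite ME -ssq Ax0 mulr1 /mu /f subrr.
have Msym u w : mxform M u w = mxform M w u.
  rewrite !mxform_sum exchange_big/=; apply: eq_bigr => i _; apply: eq_bigr => j _.
  by rewrite -[in LHS]MS mxE; ring.
have Mlin u w t : mxform M (u + t *: w) (u + t *: w) =
    mxform M u u + 2 * t * mxform M w u + t ^+ 2 * mxform M w w.
  have -> : 2 * t * mxform M w u = t * mxform M w u + t * mxform M u w.
    by rewrite (Msym u w); ring.
  rewrite !mxform_sum !mulr_sumr -!big_split/=; apply: eq_bigr => i _.
  rewrite !mulr_sumr -!big_split/=; apply: eq_bigr => j _; rewrite !mxE; ring.
have Mg : M *m x0^T = 0.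
  set g := M *m x0^T.
  have gg : mxform M g x0^T = dot g g by rewrite mxformE.
  have Q0 := Mpos g; set Q := mxform M g g in Q0.
  have G0 : 0 <= dot g g by exact: dotvv_ge0.
  have : 0 <= mxform M (x0^T + (- (dot g g / (Q + 1))) *: g)
                       (x0^T + (- (dot g g / (Q + 1))) *: g) by exact: Mpos.
  rewrite Mlin Mx0 gg add0r -/Q.
  have Q1 : 0 < Q + 1 by lra.
  rewrite (_ : _ + _ = - (dot g g / (Q + 1)) ^+ 2 * (Q + 2)); last first.
    by field; rewrite gt_eqF.
  rewrite mulNr oppr_ge0 => H.
  have : (dot g g / (Q + 1)) ^+ 2 = 0.
    apply/eqP; rewrite eq_le sqr_ge0 andbT.
    by move: H; rewrite pmulr_lle0//; lra.
  move/eqP; rewrite sqrf_eq0 mulf_eq0 invr_eq0 (gt_eqF Q1) orbF => /eqP g0.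
  apply/matrixP => i j; rewrite ord1 [RHS]mxE; apply/eqP.
  rewrite -sqrf_eq0 eq_le sqr_ge0 andbT -g0 /dot (bigD1 i)//= -expr2 lerDl.
  by rewrite sumr_ge0// => k _; rewrite -expr2 sqr_ge0.
have emu : eigenvalue S mu.
  apply/eigenvalueP; exists x0; last first.
    apply: contra_eq_neq Ax0 => ->; rewrite big1 1?eq_sym ?oner_eq0// => i _.
    by rewrite mxE expr0n.
  apply: trmx_inj; rewrite trmx_mul outer_sym linearZ/=.
  by apply/eqP; rewrite -subr_eq0 -mul_scalar_mx -mulmxBl; apply/eqP.
have lmu : lambda_min S <= mu.
  apply: ge_inf => //; exists 0 => l /eigenvalueP[x xS xn0].
  have : 0 <= mxform S x^T x^T by rewrite mxform_outer dotvv_ge0.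
  rewrite mxformE -[S]outer_sym -trmx_mul xS.
  have -> : dot x^T (l *: x)^T = l * dot x^T x^T.
    by rewrite /dot mulr_sumr; apply: eq_bigr => i _; rewrite !mxE; ring.
  rewrite pmulr_lge0// lt_neqAle dotvv_ge0 andbT eq_sym.
  apply: contra_neq xn0; rewrite -ssq => x20.
  apply/rowP => i; rewrite mxE; apply/eqP.
  rewrite -sqrf_eq0 eq_le sqr_ge0 andbT -x20 (bigD1 i)//= lerDl.
  by rewrite sumr_ge0// => k _; rewrite sqr_ge0.
have := Mpos v; rewrite ME subr_ge0; apply: le_trans.
by rewrite ler_wpM2r// dotvv_ge0.
Qed.

Section scale_inverse.
Context {R : realType} {d r : nat}.
Variable c : 'M[R]_(d, r).
Local Notation S := (outer c).
Hypothesis l0 : 0 < lambda_min S.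

Lemma outer_unitmx : S \in unitmx.
Proof.
rewrite unitmxE unitfE; apply/det0P => -[x xn0 xS].
have := lambda_min_le_form c x^T.
rewrite mxformE -[S]outer_sym -trmx_mul xS trmx0.
have -> : dot x^T (0 : 'cV[R]_d) = 0.
  by rewrite /dot big1// => i _; rewrite !mxE mulr0.
rewrite outer_sym pmulr_rle0// => x0.
move/negP: xn0; apply; apply/eqP/rowP => i; rewrite mxE; apply/eqP.
rewrite -sqrf_eq0 eq_le sqr_ge0 andbT (le_trans _ x0)//.
rewrite /dot (bigD1 i)//= !mxE -expr2 lerDl.
by rewrite sumr_ge0// => k _; rewrite -expr2 sqr_ge0.
Qed.

(** The j-th column u of the inverse satisfies S u = e_j, so that
    lambda |u|^2 <= u^T S u = u_j <= |u|. *)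
Lemma invmx_outer_le i j : `|invmx S i j| <= (lambda_min S)^-1.
Proof.
pose e : 'cV[R]_d := delta_mx j 0.
pose u := invmx S *m e.
have ue k : u k 0 = invmx S k j.
  rewrite mxE (bigD1 j)//= mxE !eqxx mulr1 big1 ?addr0// => l lj.
  by rewrite mxE (negbTE lj) mulr0.
have Su : S *m u = e by rewrite /u mulmxA mulmxV ?mul1mx// outer_unitmx.
have := lambda_min_le_form c u; rewrite mxformE Su.
have -> : dot u e = u j 0.
  rewrite /dot (bigD1 j)//= [e j 0]mxE !eqxx mulr1 big1 ?addr0// => l lj.
  by rewrite [e l 0]mxE (negbTE lj) mulr0.
rewrite -enorm_sqr => H.
have uj := coord_le_enorm u j.
have un0 := enorm_ge0 u.
rewrite -ue (le_trans (coord_le_enorm u i))// -div1r ler_pdivlMr//.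
have [->|un] := eqVneq (enorm u) 0; first by rewrite mul0r.
have up : 0 < enorm u by rewrite lt_neqAle eq_sym un.
rewrite -(ler_pM2l up) mulr1 mulrA -expr2 mulrC (le_trans H)//.
exact: (le_trans (ler_norm _) uj).
Qed.

(** Cauchy-Schwarz for the form S: with u the image of v under the inverse of
    S, the square of v.v = u^T S v is at most (v^T S v) (u^T S u), and
    u^T S u is the form of the inverse at v. *)
Lemma invmx_outer_ge v :
  dot v v <= (\sum_i \sum_k c i k ^+ 2) * mxform (invmx S) v v.
Proof.
set L := \sum_i \sum_k c i k ^+ 2.
pose u := invmx S *m v.
have Su : S *m u = v by rewrite /u mulmxA mulmxV ?mul1mx// outer_unitmx.
have E1 : dot (c^T *m v) (c^T *m u) = dot v v.
  by rewrite -mxform_outer mxformE Su.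
have E2 : dot (c^T *m u) (c^T *m u) = mxform (invmx S) v v.
  rewrite -mxform_outer !mxformE Su -/u.
  by apply: eq_bigr => i _; rewrite mulrC.
have B : dot (c^T *m v) (c^T *m v) <= L * dot v v.
  rewrite /L exchange_big mulr_suml; apply: ler_sum => k _.
  have := dot_cauchy_schwarz (\col_i c i k) v.
  rewrite expr2 (_ : dot (\col_i c i k) v = (c^T *m v) k 0); last first.
    by rewrite mxE; apply: eq_bigr => i _; rewrite !mxE.
  by rewrite (_ : dot _ _ = \sum_i c i k ^+ 2)//; apply: eq_bigr => i _; rewrite mxE expr2.
have := dot_cauchy_schwarz (c^T *m v) (c^T *m u); rewrite E1 E2 => H.
have F0 : 0 <= mxform (invmx S) v v by rewrite -E2 dotvv_ge0.
have [->|vn] := eqVneq (dot v v) 0.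
  rewrite mulr_ge0// sumr_ge0// => i _; rewrite sumr_ge0// => k _.
  exact: sqr_ge0.
have vp : 0 < dot v v by rewrite lt_neqAle eq_sym vn dotvv_ge0.
rewrite -(ler_pM2l vp) -expr2 (le_trans H)// mulrA ler_wpM2r// mulrC//.
Qed.

End scale_inverse.

Lemma invmxB {R : comUnitRingType} d (A B : 'M[R]_d) :
  A \in unitmx -> B \in unitmx ->
  invmx A - invmx B = invmx A *m (B - A) *m invmx B.
Proof.
move=> uA uB; rewrite mulmxBr mulmxBl -mulmxA mulmxV// mulmx1.
by rewrite mulVmx// mul1mx.
Qed.

Lemma mulmx3_le {R : numDomainType} m n p q (A : 'M[R]_(m, n))
    (B : 'M[R]_(n, p)) (C : 'M[R]_(p, q)) a b c i j :
  (forall i j, `|A i j| <= a) -> (forall i j, `|B i j| <= b) ->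
  (forall i j, `|C i j| <= c) ->
  `|(A *m B *m C) i j| <= n%:R * p%:R * (a * b * c).
Proof.
move=> Aa Bb Cc; rewrite mxE (le_trans (ler_norm_sum _ _ _))//.
apply: (@le_trans _ _ (\sum_(k < p) n%:R * (a * b * c))); last first.
  by rewrite sumr_const card_ord -[leLHS]mulr_natl mulrA (mulrC p%:R).
apply: ler_sum => k _; rewrite mxE mulr_suml (le_trans (ler_norm_sum _ _ _))//.
apply: (@le_trans _ _ (\sum_(l < n) a * b * c)); last first.
  by rewrite sumr_const card_ord -[leLHS]mulr_natl.
by apply: ler_sum => l _; rewrite !normrM !ler_pM ?mulr_ge0.
Qed.

(** * Differential calculus on the parameter space *)

Lemma nbhs_cVP {R : realType} p (x : 'cV[R]_p) (A : set 'cV[R]_p) :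
  nbhs x A <-> exists2 e : R, 0 < e &
    forall y : 'cV[R]_p, (forall i, `|y i 0 - x i 0| < e) -> A y.
Proof.
split=> [/nbhs_ballP[e /= e0 xA]|[e e0 xA]].
  exists e => // y yx; apply: xA; split => // i j.
  by rewrite (ord1 j) -ball_normE/= distrC.
apply/nbhs_ballP; exists e => //= y [_ yx]; apply: xA => i.
by have := yx i 0; rewrite -ball_normE/= distrC.
Qed.

Lemma within_closure_interior {R : realType} p (A : set 'cV[R]_p)
    (f : 'cV[R]_p -> R) x :
  open A -> {within closure A, continuous f} -> A x -> {for x, continuous f}.
Proof.
move=> oA cf Ax.
have xI : (closure A)° x.
  by apply: (filterS (@subset_closure _ A)); exact: open_nbhs_nbhs.
move: (cf x); rewrite /continuous_at => {}cf.
by rewrite /prop_for/continuous_at (nbhs_subspace_interior xI).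
Qed.

Section directional.
Context {R : realType}.

Lemma is_derive_line (V : normedModType R) (f : V -> R) (a v : V) (t D : R) :
  is_derive (a + t *: v) v f D ->
  is_derive t (1 : R) (fun s => f (a + s *: v)) D.
Proof.
move=> [df <-].
have E : (fun h : R => h^-1 *: ((f \o shift (a + t *: v)) (h *: v) -
      f (a + t *: v))) =
    (fun h : R => h^-1 *: (((fun s => f (a + s *: v)) \o shift t) (h *: 1) -
      f (a + t *: v))).
  apply/funext => h /=; do 2 f_equal; f_equal.
  by rewrite addrCA -scalerDl /GRing.scale/= mulr1.
by apply: DeriveDef; rewrite /derivable /derive -E.
Qed.

Lemma mean_value_sym (g dg : R -> R) (s : R) :
  (forall t, `|t| <= `|s| -> is_derive t (1 : R) g (dg t)) ->
  exists2 t, `|t| <= `|s| & g s - g 0 = dg t * s.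
Proof.
move=> gd.
have [s0|s0] := leP 0 s.
  have ine t : t \in `[0, s] -> `|t| <= `|s|.
    by rewrite in_itv/= => /andP[t0 ts]; rewrite !ger0_norm.
  have [t ts||c cs ->] := @MVT_segment _ g dg 0 s s0.
  - by apply: gd; apply: ine; move: ts; rewrite !in_itv/= => /andP[/ltW -> /ltW ->].
  - by apply: derivable_within_continuous => t /ine /gd[].
  by exists c; [exact: ine|rewrite subr0].
have ine t : t \in `[s, 0] -> `|t| <= `|s|.
  by rewrite in_itv/= => /andP[t0 ts]; rewrite !ler0_norm// ?lerN2// ltW.
have [t ts||c cs E] := @MVT_segment _ g dg s 0 (ltW s0).
- by apply: gd; apply: ine; move: ts; rewrite !in_itv/= => /andP[/ltW -> /ltW ->].
- by apply: derivable_within_continuous => t /ine /gd[].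
exists c; first exact: ine.
by rewrite -[LHS]opprB E sub0r mulrN opprK.
Qed.

(** Continuous partial derivatives give all directional derivatives: the
    increment along h v is telescoped into increments along the axes, each
    controlled by the one-dimensional mean value theorem. *)
Lemma is_derive_partials p (A : set 'cV[R]_p) (f : 'cV[R]_p -> R)
    (f' : 'I_p -> 'cV[R]_p -> R) :
  open A ->
  (forall x i, A x -> is_derive x (delta_mx i 0) f (f' i x)) ->
  (forall i x, A x -> {for x, continuous (f' i)}) ->
  forall x v, A x -> is_derive x v f (\sum_i v i 0 * f' i x).
Proof.
move=> oA fd fc x v Ax.
suff H : (fun h : R => h^-1 *: ((f \o shift x) (h *: v) - f x)) h @[h --> 0^'] -->
    \sum_i v i 0 * f' i x.
  by apply: DeriveDef; [apply/cvg_ex; eexists; exact: H|exact: cvg_lim H].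
apply/cvgrPdist_le => /= e e0.
pose B := 1 + \sum_i `|v i 0|.
have vB i : `|v i 0| < B.
  by rewrite /B (bigD1 i)//= addrCA ltrDl ltr_pwDl// sumr_ge0.
have B0 : 0 < B by rewrite /B ltr_pwDl// sumr_ge0.
have [del del0 Hdel] : exists2 del : R, 0 < del & forall y : 'cV[R]_p,
    (forall i, `|y i 0 - x i 0| < del) ->
    A y /\ forall i, `|f' i y - f' i x| <= e / B.
  apply: (proj1 (nbhs_cVP x [set y | A y /\ forall i, `|f' i y - f' i x| <= e / B])).
  have nA : nbhs x A by exact: open_nbhs_nbhs.
  have nf : nbhs x [set y | forall i, `|f' i y - f' i x| <= e / B].
    apply: (@filter_forall _ _ (fun i => [set y | `|f' i y - f' i x| <= e / B])
      (nbhs x) _) => i.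
    have /cvgrPdist_le/(_ (e / B)) := fc i x Ax.
    rewrite divr_gt0// => /(_ isT).
    by apply: filterS => y; rewrite distrC.
  exact: filterS2 nA nf.
have dB0 : 0 < del / B by rewrite divr_gt0.
near=> h.
have hd : `|h| * B < del.
  by rewrite -ltr_pdivlMr//; near: h; exact: dnbhs0_lt.
have h0 : h != 0 by near: h; exact: nbhs_dnbhs_neq.
pose w (k : nat) : 'cV[R]_p := \col_i (if (i < k)%N then v i 0 else 0).
have wS (k : 'I_p) : w k.+1 = w k + v k 0 *: delta_mx k 0.
  apply/colP => i; rewrite !mxE ltnS leq_eqVlt.
  case: (eqVneq i k) => [->|ik]; first by rewrite eqxx ltnn mulr1 add0r.
  by rewrite (_ : (val i == val k) = false) ?mulr0 ?addr0//; exact/negbTE.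
have tel : f (x + h *: v) - f x =
    \sum_(k < p) (f (x + h *: w k.+1) - f (x + h *: w k)).
  rewrite -(big_mkord xpredT (fun k => f (x + h *: w k.+1) - f (x + h *: w k))).
  rewrite (@telescope_sumr _ 0 p (fun k => f (x + h *: w k)))//.
  have -> : w p = v by apply/colP => i; rewrite mxE ltn_ord.
  have -> : w 0%N = 0 by apply/colP => i; rewrite !mxE ltn0.
  by rewrite scaler0 addr0.
have step (k : 'I_p) : `|h * (v k 0 * f' k x) -
    (f (x + h *: w k.+1) - f (x + h *: w k))| <= `|h| * (`|v k 0| * (e / B)).
  pose a := x + h *: w k.
  have box t : `|t| <= `|h * v k 0| ->
      forall i, `|(a + t *: delta_mx k 0 : 'cV[R]_p) i 0 - x i 0| < del.
    move=> tk i; rewrite !mxE.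
    rewrite (_ : forall u1 u2 u3 : R, u1 + u2 + u3 - u1 = u2 + u3); last first.
      by move=> *; ring.
    apply: le_lt_trans (_ : `|h| * B < del) => //.
    case: (eqVneq i k) => [->|ik].
      rewrite ltnn mulr0 add0r mulr1 (le_trans tk)// normrM ler_wpM2l//.
      exact/ltW/vB.
    rewrite mulr0 addr0 normrM ler_wpM2l//.
    by case: ifP => _; [exact/ltW/vB|rewrite normr0 ltW].
  have [t tk E] := @mean_value_sym (fun s => f (a + s *: delta_mx k 0))
    (fun s => f' k (a + s *: delta_mx k 0)) (h * v k 0) (fun t tk =>
      is_derive_line (fd _ k (proj1 (Hdel _ (box t tk))))).
  move: E; rewrite scale0r addr0 => E.
  have -> : x + h *: w k.+1 = a + (h * v k 0) *: delta_mx k 0.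
    by rewrite wS scalerDr addrA scalerA.
  rewrite E (_ : _ - _ = - ((h * v k 0) * (f' k (a + t *: delta_mx k 0) - f' k x))).
    rewrite normrN !normrM -mulrA ler_wpM2l// ler_wpM2l//.
    exact: (proj2 (Hdel _ (box t tk)) k).
  ring.
rewrite /= (addrC (h *: v)) tel (_ : \sum_i v i 0 * f' i x =
  h^-1 *: \sum_i h * (v i 0 * f' i x)); last first.
  by rewrite -mulr_sumr /GRing.scale/= mulrA mulVf// mul1r.
rewrite -scalerBr -sumrB normrZ normfV ler_pdivrMl ?normr_gt0//.
apply: (le_trans (ler_norm_sum _ _ _)).
apply: (@le_trans _ _ (\sum_(k < p) `|h| * (`|v k 0| * (e / B)))).
  by apply: ler_sum => k _; exact: step.
rewrite -mulr_sumr ler_wpM2l// -mulr_suml.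
by rewrite mulrA ler_pdivrMr// mulrC ler_pM2l// /B lerDr.
Unshelve. all: by end_near. Qed.

Lemma convex_segment p (A : set 'cV[R]_p) x y (s : R) :
  convex_set (A : set (convex_lmodType 'cV[R]_p)) -> A x -> A y ->
  0 <= s <= 1 -> A (x + s *: (y - x)).
Proof.
move=> cA Ax Ay /andP[s0 s1].
have := cA y x (Itv01 s0 s1); rewrite !inE => /(_ Ay Ax).
congr A; rewrite /conv/= /unstable.onem.
by apply/colP => i; rewrite !mxE; ring.
Qed.

Lemma mean_value_convex p (A : set 'cV[R]_p) (f df : 'cV[R]_p -> R) x y :
  convex_set (A : set (convex_lmodType 'cV[R]_p)) -> A x -> A y ->
  (forall z, A z -> is_derive z (y - x) f (df z)) ->
  exists s : R, [/\ 0 <= s <= 1, A (x + s *: (y - x)) &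
    f y - f x = df (x + s *: (y - x))].
Proof.
move=> cA Ax Ay fd.
have seg (s : R) : s \in `[0, 1]%R -> A (x + s *: (y - x)).
  by rewrite in_itv/= => s01; exact: convex_segment.
pose g (s : R) : R := f (x + s *: (y - x)).
pose dg (s : R) : R := df (x + s *: (y - x)).
have dl (s : R) : s \in `[0, 1]%R -> is_derive s (1 : R) g (dg s).
  by move=> /seg /fd /is_derive_line.
have gd (s : R) : s \in `]0, 1[%R -> is_derive s (1 : R) g (dg s).
  by rewrite in_itv/= => /andP[s0 s1]; apply: dl; rewrite in_itv/= !ltW.
have gc : {within `[0, 1], continuous g}.
  by apply: derivable_within_continuous => t /dl[].
have [c c01 E] := MVT_segment ler01 gd gc.
have g1 : g 1 = f y by rewrite /g scale1r addrC subrK.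
have g0 : g 0 = f x by rewrite /g scale0r addr0.
exists c; split; [by move: c01; rewrite in_itv|exact: seg|].
by rewrite -g1 -g0 E subr0 mulr1.
Qed.

Lemma convex_setT p :
  convex_set ([set: 'cV[R]_p] : set (convex_lmodType 'cV[R]_p)).
Proof. by move=> x y l _ _; rewrite inE. Qed.

End directional.

(** The polynomial weight against which all growth is measured: being at least
    1, its natural powers absorb sums and products of growth bounds. *)
Definition wgt {R : realType} d (x : 'cV[R]_d) : R := 1 + enorm x.

Section weight.
Context {R : realType} {d : nat}.
Implicit Types x y : 'cV[R]_d.

Lemma wgt_ge1 x : 1 <= wgt x.
Proof. by rewrite /wgt lerDl enorm_ge0. Qed.

Lemma wgt_gt0 x : 0 < wgt x.
Proof. exact: lt_le_trans (wgt_ge1 x). Qed.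

Lemma wgtX_ge1 x m : 1 <= wgt x ^+ m.
Proof. by rewrite exprn_ege1// wgt_ge1. Qed.

Lemma wgtX_ge0 x m : 0 <= wgt x ^+ m.
Proof. exact: le_trans (wgtX_ge1 x m). Qed.

Lemma wgtX_le x m n : (m <= n)%N -> wgt x ^+ m <= wgt x ^+ n.
Proof. by move=> mn; rewrite ler_weXn2l// wgt_ge1. Qed.

Lemma powR_le_wgt (C : R) : 0 <= C ->
  exists m, forall x, 1 + enorm x `^ C <= 2 * wgt x ^+ m.
Proof.
move=> C0; exists (Num.truncn C).+1 => x; rewrite mulr_natl mulr2n lerD//.
  exact: wgtX_ge1.
apply: (@le_trans _ _ (wgt x `^ C)).
  by apply: ge0_ler_powR; rewrite ?nnegrE ?enorm_ge0 ?(ltW (wgt_gt0 x))// /wgt lerDr.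
rewrite -powR_mulrn ?(ltW (wgt_gt0 x))// ler_powR ?wgt_ge1// ltW//.
exact: Num.Theory.truncnS_gt.
Qed.

Lemma wgt_segment x y (s : R) : 0 <= s <= 1 ->
  wgt (x + s *: (y - x)) <= d.+1%:R * (wgt x + wgt y).
Proof.
move=> /andP[s0 s1].
have ci i : `|(x + s *: (y - x)) i 0| <= enorm x + enorm y.
  rewrite !mxE (_ : _ + _ = (1 - s) * x i 0 + s * y i 0); last by ring.
  rewrite (le_trans (ler_normD _ _))// !normrM (ger0_norm s0) ger0_norm ?subr_ge0//.
  have := coord_le_enorm x i; have := coord_le_enorm y i.
  have := enorm_ge0 x; have := enorm_ge0 y.
  by have := normr_ge0 (x i 0); have := normr_ge0 (y i 0); nra.
rewrite /wgt (@le_trans _ _ (1 + d%:R * (enorm x + enorm y)))//.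
  rewrite lerD2l (le_trans (enorm_le_sum _))//.
  rewrite (le_trans (ler_sum _ (fun i _ => ci i)))//.
  by rewrite sumr_const card_ord mulr_natl.
rewrite -natr1 mulrDl mul1r.
have := enorm_ge0 x; have := enorm_ge0 y; have : 0 <= d%:R :> R by [].
nra.
Qed.

End weight.

(** * The smoothness class *)

Definition l1 {R : realType} n (v : 'cV[R]_n) : R := \sum_i `|v i 0|.

Section l1_norm.
Context {R : realType} {n : nat}.
Implicit Types u v : 'cV[R]_n.

Lemma l1_ge0 v : 0 <= l1 v.
Proof. exact: sumr_ge0. Qed.

Lemma l1B u v : l1 (u - v) = l1 (v - u).
Proof. by apply: eq_bigr => i _; rewrite !mxE distrC. Qed.

Lemma l1_triangle u v w : l1 (u - w) <= l1 (u - v) + l1 (v - w).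
Proof.
rewrite /l1 -big_split; apply: ler_sum => i _; rewrite !mxE.
exact: ler_distD.
Qed.

Lemma enorm_le_l1 v : enorm v <= l1 v.
Proof. exact: enorm_le_sum. Qed.

Lemma l1_le_enorm v : l1 v <= n%:R * enorm v.
Proof. exact: sum_le_enorm. Qed.

Lemma l1_wgt v : l1 v <= n%:R * wgt v.
Proof. by rewrite (le_trans (l1_le_enorm v))// ler_wpM2l// /wgt lerDr. Qed.

End l1_norm.

Lemma is_derive_le {R : realType} (V : normedModType R) (f : V -> R)
    (x v : V) (D C : R) : is_derive x v f D ->
  (\forall h \near (0 : R)^', `|f (h *: v + x) - f x| <= C * `|h|) -> `|D| <= C.
Proof.
move=> [fd <-] fC; rewrite leNgt; apply/negP => CD.
move: fd; rewrite /derivable => /cvgrPdist_lt/(_ (`|'D_v f x| - C)).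
rewrite subr_gt0 => /(_ CD) H.
have [h [[]]] := filter_ex (filterI (filterI H fC) (nbhs_dnbhs_neq (0 : R))).
rewrite -/(derive f x v) /= => {}H {}fC h0.
have : `|h^-1 *: (f (h *: v + x) - f x)| <= C.
  by rewrite normrZ normfV ler_pdivrMl ?normr_gt0// mulrC.
have := ler_distD (h^-1 *: (f (h *: v + x) - f x)) ('D_v f x) 0.
by rewrite !subr0; lra.
Qed.

(** Here f' is the gradient in theta, and one constant and one natural power of
    the weight serve all bounds.  The mixed second difference is what makes the
    slopes of f in theta equicontinuous in x. *)
Record regular_field {R : realType} d p (Theta : set 'cV[R]_p)
    (f : 'cV[R]_d -> 'cV[R]_p -> R) (f' : 'I_p -> 'cV[R]_d -> 'cV[R]_p -> R)
    (K : R) (m : nat) : Prop := RegularField {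
  rf_ge0 : 0 <= K ;
  rf_bound : forall x t, closure Theta t -> `|f x t| <= K * wgt x ^+ m ;
  rf_lip : forall x y t, closure Theta t -> `|f x t - f y t| <= K * l1 (x - y) ;
  rf_cont : forall x, {within closure Theta, continuous (f x)} ;
  rf_deriv : forall x t v, Theta t ->
    is_derive t v (f x) (\sum_j v j 0 * f' j x t) ;
  rf_dbound : forall j x t, Theta t -> `|f' j x t| <= K * wgt x ^+ m ;
  rf_dlip : forall j x t t', Theta t -> Theta t' ->
    `|f' j x t - f' j x t'| <= K * wgt x ^+ m * l1 (t - t') ;
  rf_mixed : forall x y t t', Theta t -> Theta t' ->
    `|(f x t - f x t') - (f y t - f y t')| <=
      K * (wgt x + wgt y) ^+ m * l1 (x - y) * l1 (t - t') }.

Section regular_fields.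
Context {R : realType} {d p : nat} (Theta : set 'cV[R]_p).
Hypothesis Tdom : bounded_convex_domain Theta.

Lemma regular_field_weaken f f' (K K' : R) m m' : K <= K' -> (m <= m')%N ->
  @regular_field R d p Theta f f' K m -> regular_field Theta f f' K' m'.
Proof.
move=> KK mm [K0 b lip ct der db dl mx].
have W x : K * wgt x ^+ m <= K' * wgt x ^+ m'.
  by rewrite ler_pM ?wgtX_ge0 ?wgtX_le.
have W2 x y : K * (wgt x + wgt y) ^+ m <= K' * (wgt x + wgt y) ^+ m'.
  have w1 : 1 <= wgt x + wgt y by rewrite (le_trans (wgt_ge1 x))// lerDl ltW ?wgt_gt0.
  by rewrite ler_pM// ?exprn_ge0 ?(le_trans ler01)// ler_weXn2l.
split => //.
- exact: le_trans KK.
- by move=> x t Tt; rewrite (le_trans (b _ _ Tt)).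
- by move=> x y t Tt; rewrite (le_trans (lip _ _ _ Tt))// ler_wpM2r ?l1_ge0.
- by move=> j x t Tt; rewrite (le_trans (db _ _ _ Tt)).
- by move=> j x t t' Tt Tt'; rewrite (le_trans (dl _ _ _ _ Tt Tt'))// ler_wpM2r ?l1_ge0.
- move=> x y t t' Tt Tt'; rewrite (le_trans (mx _ _ _ _ Tt Tt'))//.
  by rewrite ler_wpM2r ?l1_ge0// ler_wpM2r ?l1_ge0.
Qed.

Lemma regular_field_theta_lip f f' K m x t t' :
  @regular_field R d p Theta f f' K m -> Theta t -> Theta t' ->
  `|f x t - f x t'| <= K * wgt x ^+ m * l1 (t - t').
Proof.
move=> rf Tt Tt'; have [_ _ _ cT] := Tdom.
have [s [_ Ts ->]] := mean_value_convex cT Tt' Tt (fun z => rf_deriv rf x (t - t') (t := z)).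
rewrite (le_trans (ler_norm_sum _ _ _))// mulrC /l1 mulr_suml ler_sum// => j _.
by rewrite normrM ler_wpM2l// (rf_dbound rf).
Qed.

(** The bound on mixed differences, divided by the increment of theta, passes to
    the derivative. *)
Lemma regular_field_deriv_xlip f f' K m j x y t :
  @regular_field R d p Theta f f' K m -> Theta t ->
  `|f' j x t - f' j y t| <= K * (wgt x + wgt y) ^+ m * l1 (x - y).
Proof.
move=> rf Tt; have [oT _ _ _] := Tdom.
have Dj z : is_derive t (delta_mx j 0) (f z) (f' j z t).
  have := rf_deriv rf z (delta_mx j 0) Tt.
  rewrite (bigD1 j)//= mxE !eqxx mul1r big1 ?addr0// => i ij.
  by rewrite mxE (negbTE ij) mul0r.
have D := is_deriveB (Dj x) (Dj y).
apply: (is_derive_le D).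
have /nbhs_cVP[e e0 He] : nbhs t Theta by exact: open_nbhs_nbhs.
near=> h.
have Th : Theta (h *: delta_mx j 0 + t).
  apply: He => i; rewrite !mxE addrK normrM.
  apply: (@le_lt_trans _ _ `|h|); last by near: h; exact: dnbhs0_lt.
  by case: (i == j); rewrite ?normr1 ?mulr1//= normr0 mulr0.
have := rf_mixed rf x y Th Tt.
rewrite addrK [X in _ * X](_ : _ = `|h|); last first.
  rewrite /l1 (bigD1 j)//= !mxE !eqxx mulr1 big1 ?addr0// => i ij.
  by rewrite !mxE (negbTE ij) mulr0 normr0.
rewrite !fctE (_ : f x (h *: delta_mx j 0 + t) - f y (h *: delta_mx j 0 + t) -
  (f x t - f y t) = f x (h *: delta_mx j 0 + t) - f x t -
  (f y (h *: delta_mx j 0 + t) - f y t))//; ring.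
Unshelve. all: by end_near. Qed.

(** Each bound is one application of the mean value theorem on a segment: in the
    convex parameter set or, for the mixed difference, in x for the difference
    of two parameters, whose x-derivatives are in turn Lipschitz in theta. *)
Lemma C_sharp_regular (f : 'cV[R]_d -> 'cV[R]_p -> R) : C_sharp 2 4 Theta f ->
  exists f' K m, regular_field Theta f f' K m.
Proof.
have [oT _ _ cT] := Tdom.
have sub := @subset_closure _ Theta.
move=> [[K1 lip] [D [D0 [Dx Dt cx ct [C [K2 [C0 bD]]]]]]].
have [m wm] := powR_le_wgt (d := d) C0.
pose K0 := `|K2| * 2.
have K00 : 0 <= K0 by rewrite mulr_ge0.
have bD' I J x t : (size I <= 2)%N -> (size J <= 4)%N -> closure Theta t ->
    `|D I J x t| <= K0 * wgt x ^+ m.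
  move=> sI sJ Tt; rewrite (le_trans (bD I J x t sI sJ Tt))//.
  rewrite /K0 -mulrA; apply: (@le_trans _ _ (`|K2| * (1 + enorm x `^ C))).
    by rewrite ler_wpM2r ?ler_norm// addr_ge0// powR_ge0.
  by rewrite ler_wpM2l.
have ci I J x t : (size I <= 2)%N -> (size J <= 4)%N -> Theta t ->
    {for t, continuous (D I J x)}.
  by move=> sI sJ; exact: within_closure_interior (ct I J x sI sJ).
have dir I J x t v : (size I <= 2)%N -> (size J < 4)%N -> Theta t ->
    is_derive t v (D I J x) (\sum_j v j 0 * D I (j :: J) x t).
  move=> sI sJ Tt.
  apply: (@is_derive_partials _ _ Theta (D I J x) (fun j => D I (j :: J) x)) => //.
    by move=> z i Tz; exact: Dt.
  by move=> i z Tz; exact: ci.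
have tl I J x t t' : (size I <= 2)%N -> (size J < 4)%N -> Theta t -> Theta t' ->
    `|D I J x t - D I J x t'| <= K0 * wgt x ^+ m * l1 (t - t').
  move=> sI sJ Tt Tt'.
  have [s [_ Ts ->]] := mean_value_convex cT Tt' Tt
    (fun z Tz => @dir I J x z (t - t') sI sJ Tz).
  rewrite (le_trans (ler_norm_sum _ _ _))// mulrC /l1 mulr_suml ler_sum// => j _.
  by rewrite normrM ler_wpM2l// bD'//; exact: sub.
have fD x t : closure Theta t -> f x t = D [::] [::] x t by move=> /D0 ->.
pose K := `|K1| + K0 * d.+1%:R ^+ m.
have KK0 : K0 <= K.
  rewrite /K (@le_trans _ _ (K0 * d.+1%:R ^+ m)) ?lerDr//.
  by rewrite ler_peMr// exprn_ege1// ler1n.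
have K_ge0 : 0 <= K by rewrite addr_ge0// mulr_ge0// exprn_ge0.
have KW x : K0 * wgt x ^+ m <= K * wgt x ^+ m by rewrite ler_wpM2r// wgtX_ge0.
exists (fun j => D [::] [:: j]), K, m; split => //.
- by move=> x t Tt; rewrite fD// (le_trans (bD' _ _ _ _ _ _ Tt)).
- move=> x y t Tt; rewrite (le_trans (lip t x y Tt))//.
  apply: (@le_trans _ _ (`|K1| * enorm (x - y))).
    by rewrite ler_wpM2r ?enorm_ge0// ler_norm.
  rewrite ler_pM ?enorm_ge0 ?enorm_le_l1// /K lerDl.
  by rewrite mulr_ge0// exprn_ge0.
- move=> x; refine (@subspace_eq_continuous _ (closure Theta) _
    (D [::] [::] x) (f x) _ (ct [::] [::] x isT isT)).
  by move=> t; rewrite inE => Tt; rewrite fD.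
- move=> x t v Tt; apply: (near_eq_is_derive (f := D [::] [::] x)); last exact: dir.
  have : nbhs t Theta by exact: open_nbhs_nbhs.
  by apply: filterS => z Tz; rewrite fD//; exact: sub.
- by move=> j x t Tt; rewrite (le_trans (bD' _ _ _ _ _ _ (sub _ Tt))).
- move=> j x t t' Tt Tt'; rewrite (le_trans (tl _ _ _ _ _ _ _ Tt Tt'))//.
  by rewrite ler_wpM2r ?l1_ge0.
- move=> x y t t' Tt Tt'.
  pose G z := D [::] [::] z t - D [::] [::] z t'.
  have GD z v : is_derive z v G (\sum_i v i 0 * (D [:: i] [::] z t - D [:: i] [::] z t')).
    apply: (@is_derive_partials _ _ setT G
      (fun i z => D [:: i] [::] z t - D [:: i] [::] z t')) => //; first exact: openT.
      move=> {}z i _; apply: is_deriveB; apply: Dx => //; exact: sub.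
    move=> i {}z _; apply: (@cvgB _ _ _ (nbhs z)); apply: cx => //; exact: sub.
  have [s [s01 _ E]] := mean_value_convex (@convex_setT R d) (I : setT y) (I : setT x)
    (fun z _ => GD z (x - y)).
  rewrite !fD; try exact: sub.
  rewrite -/(G x) -/(G y) E (le_trans (ler_norm_sum _ _ _))//.
  rewrite [leRHS]mulrAC [leRHS]mulrC /l1 mulr_suml -/(l1 (t - t')) ler_sum// => i _.
  rewrite normrM ler_wpM2l// (le_trans (tl _ _ _ _ _ _ _ Tt Tt'))//.
  rewrite ler_wpM2r ?l1_ge0//.
  apply: (@le_trans _ _ (K0 * (d.+1%:R * (wgt y + wgt x)) ^+ m)).
    have W := wgt_segment y x s01; have W0 := wgt_gt0 (y + s *: (x - y)).
    by rewrite ler_wpM2l// lerXn2r// nnegrE ?(ltW W0)// (le_trans (ltW W0)).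
  have w0 : 0 <= wgt x + wgt y by rewrite addr_ge0// ltW// wgt_gt0.
  rewrite exprMn mulrA (addrC (wgt y)); apply: ler_wpM2r; first exact: exprn_ge0.
  by rewrite /K lerDr.
Qed.

Lemma C_sharp_regular_family (I : finType) (f : I -> 'cV[R]_d -> 'cV[R]_p -> R) :
  (forall i, C_sharp 2 4 Theta (f i)) ->
  exists f' K m, forall i, regular_field Theta (f i) (f' i) K m.
Proof.
move=> Cf.
have /choice[g Hg] i : exists g : ('I_p -> 'cV[R]_d -> 'cV[R]_p -> R) * R * nat,
    regular_field Theta (f i) g.1.1 g.1.2 g.2.
  by have [f' [K [m H]]] := C_sharp_regular (Cf i); exists (f', K, m).
exists (fun i => (g i).1.1), (\sum_i (g i).1.2), (\sum_i (g i).2)%N => i.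
apply: regular_field_weaken (Hg i).
  by rewrite (bigD1 i)//= lerDl sumr_ge0// => j _; exact: rf_ge0 (Hg j).
by rewrite (bigD1 i)//= leq_addr.
Qed.

End regular_fields.

(** * Measurability of fields at random parameters *)

Section cells.
Context {R : realType} {K : finType}.

(** Grid cells of side 4^-k.  Coding a point by the integer corner of its cell
    turns functions of a random point into countable case distinctions. *)
Definition cell (k : nat) (v : K -> R) : {ffun K -> int} :=
  [ffun i => Num.floor (v i * 4 ^+ k)].

Lemma cell_close k u v i : cell k u = cell k v -> `|u i - v i| <= (4 ^+ k)^-1.
Proof.
move=> /ffunP/(_ i); rewrite !ffunE => uv.
have /andP[u1 u2] := floor_itv (u i * 4 ^+ k).
have /andP[v1 v2] := floor_itv (v i * 4 ^+ k).
rewrite uv in u1 u2; move: u2 v2; rewrite intrD => u2 v2.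
have p0 : 0 < 4 ^+ k :> R by rewrite exprn_gt0.
rewrite -div1r ler_pdivlMr// -[X in _ * X](ger0_norm (ltW p0)) -normrM mulrBl.
by rewrite ler_norml; apply/andP; split; lra.
Qed.

Lemma measurable_cell d (T : measurableType d) (V : T -> K -> R) k c :
  (forall i, measurable_fun setT (fun t => V t i)) ->
  measurable [set t | cell k (V t) = c].
Proof.
move=> mV.
rewrite (_ : mkset _ = \bigcap_(i in [set: K])
    ((fun t => V t i * 4 ^+ k) @^-1` `[(c i)%:~R, (c i + 1)%:~R[)).
  apply: fin_bigcap_measurable => // i _; rewrite -[X in measurable X]setTI.
  by apply: measurable_funM => //; exact: measurable_itv.
apply/seteqP; split => t /=.
  by move=> <- i _ /=; rewrite ffunE in_itv/= floor_itv.
move=> H; apply/ffunP => i; rewrite ffunE; apply: floor_def.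
by have := H i I; rewrite /= in_itv.
Qed.

Section projection.
Context {I : choiceType}.
Variables (iota : I -> K -> R) (D : set I) (x0 : I).

(** Representatives are taken in D, since a field on a closed set of parameters
    has no values elsewhere. *)
Definition cell_point (k : nat) (c : {ffun K -> int}) : I :=
  xget x0 [set x | D x /\ cell k (iota x) = c].

Definition cell_proj k x := cell_point k (cell k (iota x)).

Lemma cell_projP k x : D x ->
  D (cell_proj k x) /\
  forall i, `|iota (cell_proj k x) i - iota x i| <= (4 ^+ k)^-1.
Proof.
move=> Dx; have [DP cP] : [set y | D y /\ cell k (iota y) = cell k (iota x)]
    (cell_proj k x).
  by apply: (xgetPex x0); exists x.
by split => // i; exact: cell_close cP.
Qed.

Hypothesis Dx0 : D x0.

Lemma cell_point_in k c : D (cell_point k c).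
Proof. by rewrite /cell_point; case: xgetP => [y _ []|]. Qed.

End projection.
End cells.

Lemma measurable_countable_code {R : realType} d (T : measurableType d)
    (C : countType) (code : T -> C) (F : C -> T -> R) :
  (forall c, measurable [set t | code t = c]) ->
  (forall c, measurable_fun setT (F c)) ->
  measurable_fun setT (fun t => F (code t) t).
Proof.
move=> mcode mF _ Y mY.
rewrite (_ : _ `&` _ = \bigcup_(c in [set: C])
    ([set t | code t = c] `&` (setT `&` F c @^-1` Y))).
  apply: countable_bigcupT_measurable; first exact: countableP.
  by move=> c; apply: measurableI => //; exact: mF.
apply/seteqP; split => t /=.
  by move=> [_ Yt]; exists (code t).
by move=> [c _ /= [<- [_ Yt]]].
Qed.

Lemma expr4_cvg0 {R : realType} (e : R) : 0 < e ->
  \forall k \near \oo, (4 ^+ k)^-1 < e.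
Proof.
move=> e0.
have : (fun k => (4^-1 : R) ^+ k) k @[k --> \oo] --> (0 : R).
  by apply: cvg_expr; rewrite ger0_norm// invf_lt1// ltr1n.
move=> /cvgrPdist_lt/(_ e e0); apply: filterS => k.
by rewrite sub0r normrN exprVn ger0_norm// invr_ge0 exprn_ge0.
Qed.

(** A field that is measurable at every fixed parameter and continuous in the
    parameter may be evaluated at a random parameter: it is the limit of its
    values at the representatives of the random cells, of which there are
    countably many. *)
Lemma measurable_random_parameter {R : realType} d (T : measurableType d)
    (K : finType) (I : choiceType) (iota : I -> K -> R) (D : set I)
    (F : I -> T -> R) (V : T -> I) (x0 : I) : D x0 ->
  (forall t, D (V t)) ->
  (forall i, measurable_fun setT (fun t => iota (V t) i)) ->
  (forall x, D x -> measurable_fun setT (F x)) ->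
  (forall t x, D x -> forall e : R, 0 < e -> exists2 del : R, 0 < del &
    forall y, D y -> (forall i, `|iota y i - iota x i| < del) ->
      `|F y t - F x t| < e) ->
  measurable_fun setT (fun t => F (V t) t).
Proof.
move=> Dx0 DV mV mF cF.
pose h k t := F (cell_point iota D x0 k (cell k (iota (V t)))) t.
apply: (@measurable_realfun.measurable_fun_cvg _ _ _ _ h).
  move=> k; apply: (@measurable_countable_code _ _ _ _ (fun t => cell k (iota (V t)))
    (fun c t => F (cell_point iota D x0 k c) t)).
    by move=> c; exact: measurable_cell.
  by move=> c; apply: mF; exact: cell_point_in.
move=> t _; apply/cvgrPdist_lt => e e0.
have [del del0 Hdel] := cF t (V t) (DV t) e e0.
near=> k; rewrite distrC; apply: Hdel.
  by have [] := cell_projP iota x0 k (DV t).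
move=> i; have [_ /(_ i)] := cell_projP iota x0 k (DV t).
by move=> /le_lt_trans; apply; near: k; exact: expr4_cvg0.
Unshelve. all: by end_near. Qed.

(** Column vectors carry no sigma-algebra of their own; tuples do. *)
Definition borel {R : realType} n (f : 'cV[R]_n -> R) :=
  measurable_fun [set: n.-tuple R] (f \o @tov R n).

Lemma totK {R : realType} n : cancel (@tot R n) (@tov R n).
Proof. by move=> v; apply/colP => i; rewrite mxE tnth_mktuple. Qed.

Section borel_functions.
Context {R : realType} {n : nat}.
Implicit Types f g : 'cV[R]_n -> R.

Lemma borel_coord i : borel (fun v : 'cV[R]_n => v i 0).
Proof.
rewrite /borel (_ : _ \o _ = (@tnth n R)^~ i); first exact: measurable_tnth.
by apply/funext => t /=; rewrite mxE.
Qed.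

Lemma borelD f g : borel f -> borel g -> borel (fun x => f x + g x).
Proof. exact: measurable_funD. Qed.

Lemma borelB f g : borel f -> borel g -> borel (fun x => f x - g x).
Proof. exact: measurable_funB. Qed.

Lemma borelM f g : borel f -> borel g -> borel (fun x => f x * g x).
Proof. exact: measurable_funM. Qed.

Lemma borel_cst (k : R) : borel (fun _ : 'cV[R]_n => k).
Proof. exact: measurable_cst. Qed.

Lemma borel_sum (J : Type) (r : seq J) (P : pred J) (f : J -> 'cV[R]_n -> R) :
  (forall j, borel (f j)) -> borel (fun x => \sum_(j <- r | P j) f j x).
Proof.
move=> bf; elim: r => [|j r IH].
  by under eq_fun do rewrite big_nil; exact: borel_cst.
under eq_fun do rewrite big_cons; case: (P j) => //.
exact: borelD.
Qed.

Lemma continuous_borel f :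
  (forall (x : 'cV[R]_n) (e : R), 0 < e -> exists2 del : R, 0 < del &
    forall y : 'cV[R]_n, (forall i, `|y i 0 - x i 0| < del) -> `|f y - f x| < e) ->
  borel f.
Proof.
move=> cf; rewrite /borel.
apply: (@measurable_random_parameter R _ _ 'I_n 'cV[R]_n (fun v i => v i 0)
  setT (fun v _ => f v) (@tov R n) 0) => //.
  by move=> i; exact: borel_coord.
move=> t x _ e e0; have [del d0 H] := cf x e e0.
by exists del => // y _; exact: H.
Qed.

Lemma lipschitz_borel f (C : 'cV[R]_n -> 'cV[R]_n -> R) :
  (forall x y, `|f y - f x| <= C y x * l1 (y - x)) ->
  (forall x, exists M : R, forall y, l1 (y - x) <= 1 -> C y x <= M) ->
  borel f.
Proof.
move=> lf bC; apply: continuous_borel => x e e0.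
have [M HM] := bC x.
pose M' := `|M| + 1.
have M'0 : 0 < M' by rewrite /M' ltr_wpDl.
pose N := n%:R + 1 : R.
have N0 : 0 < N by rewrite /N ltr_wpDl.
exists (Num.min (N^-1) (e / (2 * M' * N))).
  rewrite lt_min invr_gt0 N0/= divr_gt0// !mulr_gt0//.
move=> y yx.
have ly (b : R) : 0 < b -> (forall i, `|y i 0 - x i 0| < b / N) -> l1 (y - x) <= b.
  move=> b0 H; apply: (@le_trans _ _ (\sum_(i < n) b / N)).
    by apply: ler_sum => i _; rewrite !mxE ltW.
  rewrite sumr_const card_ord -[leLHS]mulr_natl mulrA ler_pdivrMr// mulrC.
  by rewrite ler_pM2l// /N lerDl.
have l1y : l1 (y - x) <= 1.
  apply: ly => // i; rewrite div1r; apply: (lt_le_trans (yx i)).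
  by rewrite ge_min lexx.
have l2y : l1 (y - x) <= e / (2 * M').
  apply: ly => [|i]; first by rewrite divr_gt0// mulr_gt0.
  apply: (lt_le_trans (yx i)).
  by rewrite ge_min -mulrA -invfM lexx orbT.
apply: (le_lt_trans (lf _ _)).
apply: (@le_lt_trans _ _ (M' * (e / (2 * M')))).
  apply: (@le_trans _ _ (M' * l1 (y - x))); last by rewrite ler_pM2l.
  rewrite ler_wpM2r ?l1_ge0// (le_trans (HM _ l1y))// /M'.
  by rewrite (le_trans (ler_norm M))// lerDl.
have -> : M' * (e / (2 * M')) = e / 2 by field; rewrite gt_eqF.
by rewrite ltr_pdivrMr//; lra.
Qed.

Lemma borel_enorm : borel (@enorm R n).
Proof.
have ms : measurable_fun [set: R] (@Num.sqrt R).
  by apply: continuous_measurable_fun; exact: sqrt_continuous.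
apply: (measurableT_comp ms).
have := @borel_sum _ (index_enum 'I_n) xpredT (fun j v => v j 0 * v j 0).
rewrite /borel => H; rewrite (_ : (fun v : n.-tuple R => \sum_i tov v i 0 ^+ 2) =
  (fun x => \sum_(j <- index_enum 'I_n) x j 0 * x j 0) \o @tov R n).
  by apply: H => j; apply: borelM; exact: borel_coord.
by apply/funext => t /=; apply: eq_bigr => i _; rewrite expr2.
Qed.

Lemma borel_wgt : borel (@wgt R n).
Proof. by apply: borelD; [exact: borel_cst|exact: borel_enorm]. Qed.

Lemma borelX f m : borel f -> borel (fun x => f x ^+ m).
Proof. by move=> bf; exact: measurable_funX. Qed.

End borel_functions.

Section random_vectors.
Context {R : realType} {d : measure_display} {Omega : measurableType d}.

Lemma vec_sigmaP n (U : Omega -> 'cV[R]_n) (G : set_system Omega) :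
  vec_sigma U `<=` G <->
  forall B : set (n.-tuple R), measurable B -> G [set w | B (tot (U w))].
Proof.
split=> [UG B mB|UG _ [B mB <-]]; last by rewrite setTI; exact: UG.
by apply: UG; exists B => //; rewrite setTI.
Qed.

Lemma random_vector_tot n (U : Omega -> 'cV[R]_n) : random_vector U ->
  measurable_fun setT (fun w => tot (U w)).
Proof. by move=> /vec_sigmaP mU _ B mB; rewrite setTI; exact: mU. Qed.

Lemma random_vector_coord n (U : Omega -> 'cV[R]_n) i : random_vector U ->
  measurable_fun setT (fun w => U w i 0).
Proof.
move=> /random_vector_tot mU.
rewrite (_ : (fun w => U w i 0) = (@tnth n R)^~ i \o (fun w => tot (U w))).
  exact: (measurableT_comp (measurable_tnth i) mU).
by apply/funext => w /=; rewrite tnth_mktuple.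
Qed.

Lemma borel_random_vector n (U : Omega -> 'cV[R]_n) f : random_vector U ->
  borel f -> measurable_fun setT (fun w => f (U w)).
Proof.
move=> /random_vector_tot mU bf.
rewrite (_ : (fun w => f (U w)) = (f \o @tov R n) \o (fun w => tot (U w))).
  exact: (measurableT_comp bf mU).
by apply/funext => w /=; rewrite totK.
Qed.

End random_vectors.

(** * Expectations and independence *)

Section expectation.
Context {R : realType} {d : measure_display} {Omega : measurableType d}.
Variable P : probability Omega R.
Implicit Types (f g : Omega -> R) (c : R).

Definition intgr f := P.-integrable setT (EFin \o f).
Definition expect f : R := \int[P]_w f w.

Lemma intgr_measurable f : intgr f -> measurable_fun setT f.
Proof. by move=> /integrableP[/measurable_EFinP]. Qed.

Lemma intgr_le f g : measurable_fun setT f -> (forall w, `|f w| <= g w) ->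
  intgr g -> intgr f.
Proof.
move=> mf fg; apply: le_integrable => //; first exact/measurable_EFinP.
by move=> w _ /=; rewrite lee_fin (le_trans (fg w))// ler_norm.
Qed.

Lemma intgr_cst c : intgr (fun=> c).
Proof. exact: finite_measure_integrable_cst. Qed.

Lemma intgrD f g : intgr f -> intgr g -> intgr (fun w => f w + g w).
Proof. by move=> If Ig; exact: (integrableD measurableT If Ig). Qed.

Lemma intgrB f g : intgr f -> intgr g -> intgr (fun w => f w - g w).
Proof. by move=> If Ig; exact: (integrableB measurableT If Ig). Qed.

Lemma intgrZ c f : intgr f -> intgr (fun w => c * f w).
Proof. by move=> If; exact: (integrableZl measurableT c If). Qed.

Lemma intgr_sum (I : Type) (s : seq I) (Q : pred I) (f : I -> Omega -> R) :
  (forall i, intgr (f i)) -> intgr (fun w => \sum_(i <- s | Q i) f i w).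
Proof.
move=> If; elim: s => [|i s IH].
  by under eq_fun do rewrite big_nil; exact: intgr_cst.
by under eq_fun do rewrite big_cons; case: (Q i) => //; exact: intgrD.
Qed.

Lemma intgr_norm f : intgr f -> intgr (fun w => `|f w|).
Proof. exact: integrable_norm. Qed.

Lemma expectD f g : intgr f -> intgr g ->
  expect (fun w => f w + g w) = expect f + expect g.
Proof. by move=> If Ig; exact: RintegralD. Qed.

Lemma expectB f g : intgr f -> intgr g ->
  expect (fun w => f w - g w) = expect f - expect g.
Proof. by move=> If Ig; exact: RintegralB. Qed.

Lemma expectZ c f : intgr f -> expect (fun w => c * f w) = c * expect f.
Proof. by move=> If; exact: RintegralZl. Qed.

Lemma expect_cst c : expect (fun=> c) = c.
Proof.
rewrite /expect Rintegral_cst//.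
have -> : fine (P [set: Omega]) = 1 by rewrite probability_setT.
by rewrite mulr1.
Qed.

Lemma expect_sum (I : Type) (s : seq I) (Q : pred I) (f : I -> Omega -> R) :
  (forall i, intgr (f i)) ->
  expect (fun w => \sum_(i <- s | Q i) f i w) = \sum_(i <- s | Q i) expect (f i).
Proof.
move=> If; elim: s => [|i s IH].
  rewrite big_nil -[RHS]expect_cst; congr expect.
  by apply/funext => w; rewrite big_nil.
rewrite big_cons -IH.
under [in LHS]eq_fun do rewrite big_cons.
by case: (Q i) => //; rewrite expectD//; exact: intgr_sum.
Qed.

Lemma expect_le f g : intgr f -> intgr g -> (forall w, f w <= g w) ->
  expect f <= expect g.
Proof. by move=> If Ig fg; apply: le_Rintegral. Qed.

Lemma expect_ge0 f : (forall w, 0 <= f w) -> 0 <= expect f.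
Proof. by move=> f0; apply: Rintegral_ge0. Qed.

Lemma expect_norm f : intgr f -> `|expect f| <= expect (fun w => `|f w|).
Proof. by move=> If; exact: le_normr_Rintegral. Qed.

Lemma expectE f : intgr f -> (\int[P]_w (f w)%:E = (expect f)%:E)%E.
Proof. by move=> If; rewrite /expect fineK// integrable_fin_num. Qed.

Lemma intgr_bound f (K : R) : measurable_fun setT f -> (forall w, 0 <= f w) ->
  (\int[P]_w (f w)%:E <= K%:E)%E -> intgr f /\ expect f <= K.
Proof.
move=> mf f0 fK.
have If : intgr f.
  apply/integrableP; split; first exact/measurable_EFinP.
  rewrite (eq_integral (EFin \o f)); last by move=> w _; rewrite gee0_abs// lee_fin.
  by rewrite (le_lt_trans fK)// ltry.
by split => //; rewrite -lee_fin -expectE.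
Qed.

Lemma expect_markov f c : intgr f -> (forall w, 0 <= f w) -> 0 < c ->
  (P [set w | (c <= f w)%R] <= (expect f / c)%:E)%E.
Proof.
move=> If f0 c0; have mf := intgr_measurable If.
rewrite EFinM lee_pdivlMr// muleC.
have mE : measurable [set w | (c <= f w)%R].
  rewrite (_ : mkset _ = setT `&` f @^-1` `[c, +oo[); last first.
    by rewrite setTI; apply/seteqP; split => w /=; rewrite in_itv/= andbT.
  exact: mf.
rewrite -expectE// -integral_cst//=.
have mfE : measurable_fun setT (EFin \o f) by exact/measurable_EFinP.
have H1 : (\int[P]_(w in [set w | (c <= f w)%R]) c%:E <=
    \int[P]_(w in [set w | (c <= f w)%R]) (f w)%:E)%E.
  apply: ge0_le_integral => //; first by move=> w _ /=; rewrite lee_fin ltW.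
  exact: measurable_funTS.
apply: (le_trans H1).
by apply: (ge0_subset_integral P mE measurableT mfE) => // w _; rewrite lee_fin.
Qed.

(** Random variables all of whose powers are integrable: an algebra, so that
    integrability of the products met below is automatic. *)
Definition all_moments f := measurable_fun setT f /\ forall m, intgr (fun w => f w ^+ m).

Lemma all_moments_measurable f : all_moments f -> measurable_fun setT f.
Proof. by case. Qed.

Lemma all_moments_intgr f : all_moments f -> intgr f.
Proof. by move=> [_ /(_ 1%N)]; under eq_fun do rewrite expr1. Qed.

Lemma all_moments_intgrX f m : all_moments f -> intgr (fun w => f w ^+ m).
Proof. by case. Qed.

Lemma all_moments_intgr_normX f m : all_moments f -> intgr (fun w => `|f w| ^+ m).
Proof. by move=> [_ /(_ m) /intgr_norm]; under eq_fun do rewrite normrX. Qed.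

Lemma all_moments_le f g : measurable_fun setT f -> (forall w, `|f w| <= g w) ->
  all_moments g -> all_moments f.
Proof.
move=> mf fg Lg; split => // m; apply: (intgr_le _ _ (all_moments_intgr_normX m Lg)).
  exact: measurable_funX.
by move=> w; rewrite normrX lerXn2r ?nnegrE// (le_trans (fg w))// ler_norm.
Qed.

Lemma all_moments_cst c : all_moments (fun=> c).
Proof. by split => [|m]; [exact: measurable_cst|exact: intgr_cst]. Qed.

Lemma all_momentsM f g : all_moments f -> all_moments g -> all_moments (fun w => f w * g w).
Proof.
move=> Lf Lg; have mf := all_moments_measurable Lf; have mg := all_moments_measurable Lg.
split=> [|m]; first exact: measurable_funM.
apply: (intgr_le _ _ (intgrD (all_moments_intgrX (m * 2) Lf) (all_moments_intgrX (m * 2) Lg))).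
  by apply: measurable_funX; exact: measurable_funM.
move=> w; rewrite exprMn normrM !exprM.
have := sqr_ge0 (`|f w ^+ m| - `|g w ^+ m|).
rewrite sqrrB !real_normK ?num_real// => H.
have := normr_ge0 (f w ^+ m); have := normr_ge0 (g w ^+ m).
rewrite mulr2n in H; nra.
Qed.

Lemma exprD_le (a b : R) m : 0 <= a -> 0 <= b ->
  (a + b) ^+ m <= 2 ^+ m * (a ^+ m + b ^+ m).
Proof.
move=> a0 b0; wlog ab : a b a0 b0 / a <= b.
  by have [ab|/ltW ba] := leP a b => H; [|rewrite addrC [X in _ * X]addrC]; exact: H.
apply: (@le_trans _ _ ((2 * b) ^+ m)).
  by rewrite lerXn2r ?nnegrE ?addr_ge0 ?mulr_ge0//; lra.
by rewrite exprMn ler_wpM2l ?exprn_ge0// lerDr exprn_ge0.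
Qed.

Lemma all_momentsD f g : all_moments f -> all_moments g -> all_moments (fun w => f w + g w).
Proof.
move=> Lf Lg; have mf := all_moments_measurable Lf; have mg := all_moments_measurable Lg.
split=> [|m]; first exact: measurable_funD.
apply: (intgr_le _ _ (intgrZ (2 ^+ m)
  (intgrD (all_moments_intgr_normX m Lf) (all_moments_intgr_normX m Lg)))).
  by apply: measurable_funX; exact: measurable_funD.
move=> w; rewrite normrX (le_trans _ (exprD_le _ _ _))//.
by rewrite lerXn2r ?nnegrE ?addr_ge0// ler_normD.
Qed.

Lemma all_momentsZ c f : all_moments f -> all_moments (fun w => c * f w).
Proof. by move=> Lf; apply: all_momentsM => //; exact: all_moments_cst. Qed.

Lemma all_momentsB f g : all_moments f -> all_moments g -> all_moments (fun w => f w - g w).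
Proof.
move=> Lf Lg; under eq_fun do rewrite -mulN1r.
by apply: all_momentsD => //; exact: all_momentsZ.
Qed.

Lemma all_momentsX f m : all_moments f -> all_moments (fun w => f w ^+ m).
Proof.
move=> Lf; elim: m => [|m IH].
  by under eq_fun do rewrite expr0; exact: all_moments_cst.
by under eq_fun do rewrite exprS; exact: all_momentsM.
Qed.

Lemma all_moments_norm f : all_moments f -> all_moments (fun w => `|f w|).
Proof.
move=> Lf; split; last by move=> m; exact: all_moments_intgr_normX.
exact: measurableT_comp (all_moments_measurable Lf).
Qed.

Lemma all_moments_sum (I : Type) (s : seq I) (Q : pred I) (f : I -> Omega -> R) :
  (forall i, all_moments (f i)) -> all_moments (fun w => \sum_(i <- s | Q i) f i w).
Proof.
move=> If; elim: s => [|i s IH].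
  by under eq_fun do rewrite big_nil; exact: all_moments_cst.
by under eq_fun do rewrite big_cons; case: (Q i) => //; exact: all_momentsD.
Qed.

End expectation.

Section independence.
Context {R : realType} {d : measure_display} {Omega : measurableType d}.
Variable P : probability Omega R.

(** The joint law and the product of the laws agree on rectangles, hence
    everywhere; Tonelli's theorem computes the integral against the product. *)
Lemma ge0_integral_indep (U V : Omega -> R) :
  measurable_fun setT U -> measurable_fun setT V ->
  (forall w, 0 <= U w) -> (forall w, 0 <= V w) ->
  (forall A B, measurable A -> measurable B ->
    P (U @^-1` A `&` V @^-1` B) = (P (U @^-1` A) * P (V @^-1` B))%E) ->
  (\int[P]_w (U w * V w)%:E = \int[P]_w (U w)%:E * \int[P]_w (V w)%:E)%E.
Proof.
move=> mU mV U0 V0 UV.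
pose XU : {mfun Omega >-> R} := HB.pack U (isMeasurableFun.Build _ _ _ _ _ mU).
pose XV : {mfun Omega >-> R} := HB.pack V (isMeasurableFun.Build _ _ _ _ _ mV).
have mW : measurable_fun setT (fun w => (U w, V w)).
  exact: measurable_fun_pair.
pose W : {mfun Omega >-> (R * R)%type} :=
  HB.pack (fun w => (U w, V w)) (isMeasurableFun.Build _ _ _ _ _ mW).
pose h (z : R * R) : \bar R := (`|z.1| * `|z.2|)%:E.
have mh : measurable_fun setT h.
  apply/measurable_EFinP; apply: measurable_funM.
    by apply: measurableT_comp => //; exact: measurable_fst.
  by apply: measurableT_comp => //; exact: measurable_snd.
have h0 z : (0 <= h z)%E by rewrite lee_fin mulr_ge0.
have mabs : measurable_fun [set: R] (fun y : R => (`|y|)%:E).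
  by apply/measurable_EFinP; exact: normr_measurable.
transitivity (\int[P]_w (h \o W) w)%E.
  apply: eq_integral => w _.
  have -> : (h \o W) w = (`|U w| * `|V w|)%:E by [].
  by rewrite (ger0_norm (U0 w)) (ger0_norm (V0 w)).
rewrite -ge0_integral_distribution//.
rewrite (eq_measure_integral (distribution P XU \x distribution P XV)%E); last first.
  move=> A mA _; apply/esym/product_measure_unique => [B C mB mC|].
    exact: (UV B C mB mC).
  exact: mA.
rewrite fubini_tonelli1// /fubini_F.
have Ex (x : R) : (\int[distribution P XV]_y h (x, y) =
    `|x|%:E * \int[distribution P XV]_y (`|y|)%:E)%E.
  by rewrite -ge0_integralZl.
under eq_integral do rewrite Ex.
rewrite ge0_integralZr//; last by apply: integral_ge0.
rewrite (ge0_integral_distribution XU mabs) ?(ge0_integral_distribution XV mabs)//.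
congr (_ * _)%E; apply: eq_integral => w _.
  by have -> : ((fun y : R => (`|y|)%:E) \o XU) w = `|U w|%:E by []; rewrite ger0_norm.
by have -> : ((fun y : R => (`|y|)%:E) \o XV) w = `|V w|%:E by []; rewrite ger0_norm.
Qed.

Definition indep_pair (U V : Omega -> R) := forall A B, measurable A ->
  measurable B -> P (U @^-1` A `&` V @^-1` B) = (P (U @^-1` A) * P (V @^-1` B))%E.

Lemma indep_pair_comp (U V : Omega -> R) (u v : R -> R) :
  indep_pair U V -> measurable_fun setT u -> measurable_fun setT v ->
  indep_pair (u \o U) (v \o V).
Proof.
move=> UV mu mv A B mA mB.
by apply: (UV (u @^-1` A) (v @^-1` B)); rewrite -[X in measurable X]setTI;
  [exact: mu|exact: mv].
Qed.

Lemma expect_indep (U V : Omega -> R) : intgr P U -> intgr P V ->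
  indep_pair U V ->
  intgr P (fun w => U w * V w) /\
  expect P (fun w => U w * V w) = expect P U * expect P V.
Proof.
move=> IU IV UV.
have nn (u v : R -> R) : measurable_fun setT u -> measurable_fun setT v ->
    (forall x, 0 <= u x) -> (forall x, 0 <= v x) ->
    intgr P (u \o U) -> intgr P (v \o V) ->
    intgr P (fun w => u (U w) * v (V w)) /\
    expect P (fun w => u (U w) * v (V w)) = expect P (u \o U) * expect P (v \o V).
  move=> mu mv u0 v0 Iu Iv.
  have muU := intgr_measurable Iu; have mvV := intgr_measurable Iv.
  have E : (\int[P]_w (u (U w) * v (V w))%:E =
      (expect P (u \o U) * expect P (v \o V))%:E)%E.
    rewrite EFinM -!expectE//.
    exact: (ge0_integral_indep muU mvV (fun w => u0 _) (fun w => v0 _)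
      (indep_pair_comp UV mu mv)).
  have [I _] : intgr P (fun w => u (U w) * v (V w)) /\
      expect P (fun w => u (U w) * v (V w)) <= expect P (u \o U) * expect P (v \o V).
    apply: intgr_bound; [exact: measurable_funM| |by rewrite E].
    by move=> w; exact: mulr_ge0.
  by split => //; apply: EFin_inj; rewrite -E expectE.
pose p (x : R) := `|x|; pose q (x : R) := `|x| - x.
have mp : measurable_fun [set: R] p by exact: normr_measurable.
have mq : measurable_fun [set: R] q by apply: measurable_funB.
have p0 x : 0 <= p x by exact: normr_ge0.
have q0 x : 0 <= q x by rewrite subr_ge0 ler_norm.
have Ip X : intgr P X -> intgr P (p \o X) by exact: intgr_norm.
have Iq X : intgr P X -> intgr P (q \o X).
  by move=> IX; apply: intgrB => //; exact: intgr_norm.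
have Eq X : intgr P X -> expect P X = expect P (p \o X) - expect P (q \o X).
  move=> IX; rewrite -expectB//; [|exact: Ip|exact: Iq].
  by congr expect; apply/funext => w /=; rewrite /p /q; ring.
have [I1 E1] := nn p p mp mp p0 p0 (Ip _ IU) (Ip _ IV).
have [I2 E2] := nn p q mp mq p0 q0 (Ip _ IU) (Iq _ IV).
have [I3 E3] := nn q p mq mp q0 p0 (Iq _ IU) (Ip _ IV).
have [I4 E4] := nn q q mq mq q0 q0 (Iq _ IU) (Iq _ IV).
have -> : (fun w => U w * V w) = (fun w => (p (U w) * p (V w) - p (U w) * q (V w)) -
    (q (U w) * p (V w) - q (U w) * q (V w))).
  by apply/funext => w; rewrite /p /q; ring.
split; first by apply: intgrB; apply: intgrB.
rewrite !expectB ?E1 ?E2 ?E3 ?E4//; try exact: intgrB.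
by rewrite (Eq U)// (Eq V)//; ring.
Qed.

End independence.

(** * Measurability with respect to a sub-sigma-algebra *)

Section sub_sigma_algebra.
Context {R : realType} {d : measure_display} {Omega : measurableType d}.
Implicit Types (G : set_system Omega) (f g : Omega -> R).

Definition measurable_wrt G f := forall B : set R, measurable B -> G (f @^-1` B).

Section closure.
Variable G : set_system Omega.
Hypothesis sG : sigma_algebra setT G.

Lemma measurable_wrtP f :
  measurable_wrt G f <-> measurable_fun (setT : set (g_sigma_algebraType G)) f.
Proof.
have E := measurable_g_measurableTypeE sG.
split=> [Gf _ B mB|mf B mB].
  by rewrite E setTI; exact: Gf.
by have := mf measurableT B mB; rewrite E setTI.
Qed.

Lemma measurable_wrt_cst (c : R) : measurable_wrt G (fun=> c).
Proof. by apply/measurable_wrtP; exact: measurable_cst. Qed.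

Lemma measurable_wrtD f g : measurable_wrt G f -> measurable_wrt G g -> measurable_wrt G (fun w => f w + g w).
Proof. by move=> /measurable_wrtP mf /measurable_wrtP mg; apply/measurable_wrtP; exact: measurable_funD. Qed.

Lemma measurable_wrtM f g : measurable_wrt G f -> measurable_wrt G g -> measurable_wrt G (fun w => f w * g w).
Proof. by move=> /measurable_wrtP mf /measurable_wrtP mg; apply/measurable_wrtP; exact: measurable_funM. Qed.

Lemma measurable_wrtX f m : measurable_wrt G f -> measurable_wrt G (fun w => f w ^+ m).
Proof.
move=> mf; elim: m => [|m IH]; first by under eq_fun do rewrite expr0; exact: measurable_wrt_cst.
by under eq_fun do rewrite exprS; exact: measurable_wrtM.
Qed.

Lemma measurable_wrt_sum (I : Type) (s : seq I) (Q : pred I) (f : I -> Omega -> R) :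
  (forall i, measurable_wrt G (f i)) -> measurable_wrt G (fun w => \sum_(i <- s | Q i) f i w).
Proof.
move=> If; elim: s => [|i s IH].
  by under eq_fun do rewrite big_nil; exact: measurable_wrt_cst.
by under eq_fun do rewrite big_cons; case: (Q i) => //; exact: measurable_wrtD.
Qed.

End closure.

Lemma measurable_wrt_sub G G' f : G `<=` G' -> measurable_wrt G f -> measurable_wrt G' f.
Proof. by move=> GG Gf B mB; exact/GG/Gf. Qed.

Lemma measurable_wrt_measurable G f : G `<=` measurable -> measurable_wrt G f ->
  measurable_fun setT f.
Proof. by move=> GG Gf _ B mB; rewrite setTI; exact/GG/Gf. Qed.

Lemma measurable_wrt_borel n (U : Omega -> 'cV[R]_n) (h : 'cV[R]_n -> R) G : vec_sigma U `<=` G ->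
  borel h -> measurable_wrt G (fun w => h (U w)).
Proof.
move=> /vec_sigmaP UG bf B mB.
have -> : (fun w => h (U w)) @^-1` B =
    [set w | ((h \o @tov R n) @^-1` B) (tot (U w))].
  by apply/seteqP; split => w /=; rewrite totK.
by apply: UG; rewrite -[X in measurable X]setTI; exact: bf.
Qed.

Lemma indep_sigma_pair (P : probability Omega R) G G' (U V : Omega -> R) :
  indep_sigma P G G' -> measurable_wrt G U -> measurable_wrt G' V -> indep_pair P U V.
Proof. by move=> GG GU GV A B mA mB; apply: GG; [exact: GU|exact: GV]. Qed.

Lemma expect_same_law (P : probability Omega R) (U V : Omega -> R) :
  measurable_fun setT V ->
  (forall B : set R, measurable B -> P (U @^-1` B) = P (V @^-1` B)) ->
  intgr P U -> intgr P V /\ expect P U = expect P V.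
Proof.
move=> mV UV IU; have mU := intgr_measurable IU.
pose XU : {mfun Omega >-> R} := HB.pack U (isMeasurableFun.Build _ _ _ _ _ mU).
pose XV : {mfun Omega >-> R} := HB.pack V (isMeasurableFun.Build _ _ _ _ _ mV).
have mE : measurable_fun [set: R] (@EFin R).
  by apply/measurable_EFinP; exact: measurable_id.
have mabs : measurable_fun [set: R] (fun y : R => (`|y|)%:E).
  by apply/measurable_EFinP; exact: normr_measurable.
have E (f : R -> \bar R) : (\int[distribution P XU]_y f y = \int[distribution P XV]_y f y)%E.
  by apply: eq_measure_integral => B mB _; exact: UV.
have IV : intgr P V.
  apply/integrableP; split; first exact/measurable_EFinP.
  have := integrableP _ _ _ IU => -[_].
  have EU := ge0_integral_distribution XU mabs (fun y => abse_ge0 y%:E).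
  have EV := ge0_integral_distribution XV mabs (fun y => abse_ge0 y%:E).
  have -> : (\int[P]_x `|(EFin \o U) x| = \int[P]_x `|(EFin \o V) x|)%E.
    by rewrite -[LHS]EU -[RHS]EV E.
  by [].
split => //; apply: EFin_inj; rewrite -!expectE//.
have EU := integral_distribution (X := XU) mE IU.
have EV := integral_distribution (X := XV) mE IV.
by rewrite -[LHS]EU -[RHS]EV E.
Qed.

End sub_sigma_algebra.

(** Superadditivity up to a product error makes a nonnegative function at most
    linear near 0: about 1/t copies of [0, t] fit into [0, 1]. *)
Lemma superadditive_linear {R : realType} (m : R -> R) (B : R) :
  0 <= B -> (forall t, 0 <= t <= 1 -> 0 <= m t) ->
  (forall s t, 0 <= s -> 0 <= t -> s + t <= 1 ->
    m s + m t - B * (s * t) <= m (s + t)) ->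
  forall t, 0 <= t <= 1 -> m t <= 2 * (m 1 + 2 * B) * t.
Proof.
move=> B0 m0 sup t /andP[t0 t1].
have [->|tn0] := eqVneq t 0.
  by have := sup 0 0 (lexx _) (lexx _); rewrite addr0 !mulr0; lra.
have tp : 0 < t by rewrite lt_neqAle eq_sym tn0.
have mul k : k%:R * t <= 1 -> k%:R * m t - B * (k%:R * t) ^+ 2 <= m (k%:R * t).
  elim: k => [|k IH]; first by rewrite !mul0r expr0n/= mulr0 subr0 m0// lexx ler01.
  rewrite -natr1 mulrDl mul1r => kt.
  have k0 : 0 <= k%:R * t by rewrite mulr_ge0.
  have := IH _; have := sup _ _ k0 t0 kt.
  have : k%:R * t <= 1 by lra.
  move=> h1 h2 /(_ h1) h3.
  have : 0 <= B * (k%:R * t * t + t * t) by rewrite mulr_ge0// addr_ge0// mulr_ge0.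
  by move: h2 h3; rewrite !expr2 => h2 h3 h4; lra.
set k := Num.truncn t^-1.
have t1' : 0 <= t^-1 by rewrite invr_ge0.
have /andP[k1 k2] := Num.Theory.truncn_itv t1'.
rewrite -/k in k1 k2.
have kt1 : k%:R * t <= 1 by rewrite -ler_pdivlMr// div1r.
have kt2 : 1 < k%:R * t + t.
  by rewrite -(ltr_pM2r tp) mulVf// -natr1 mulrDl mul1r in k2.
have k0 : 0 <= k%:R * t by rewrite mulr_ge0.
have S : k%:R * m t <= m 1 + 2 * B.
  have r0 : 0 <= 1 - k%:R * t by lra.
  have := sup _ _ k0 r0; rewrite addrC subrK lexx => /(_ isT).
  have := mul k kt1; have := m0 (1 - k%:R * t); rewrite r0/= => /(_ _) m0'.
  have : 0 <= m (1 - k%:R * t) by apply: m0'; lra.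
  by nra.
have kge1 : (1 <= k)%N.
  rewrite /k Num.Theory.truncn_ge_nat// ?invr_ge0//.
  by rewrite -[1%:R]invr1 lef_pV2// posrE.
have kR : 1 <= k%:R :> R by rewrite ler1n.
have k2t : 1 <= 2 * (k%:R * t) by nra.
have mt : 0 <= m t by apply: m0; rewrite t0.
apply: (@le_trans _ _ (2 * (k%:R * t) * m t)); first by rewrite ler_peMl.
rewrite (_ : 2 * (k%:R * t) * m t = 2 * (k%:R * m t) * t); last by ring.
by rewrite ler_wpM2r// ler_wpM2l.
Qed.

(** * Moments of Levy increments *)

Section bounded_in_probability.
Context {R : realType} {d : measure_display} {Omega : measurableType d}.
Variable P : probability Omega R.

Lemma measurable_le_set (f : Omega -> R) (c : R) : measurable_fun setT f ->
  measurable [set w | f w <= c].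
Proof.
move=> mf; rewrite (_ : mkset _ = setT `&` f @^-1` `]-oo, c]); first exact: mf.
by rewrite setTI; apply/seteqP; split => w /=; rewrite in_itv.
Qed.

Lemma measurable_gt_set (f : Omega -> R) (c : R) : measurable_fun setT f ->
  measurable [set w | c < f w].
Proof.
move=> mf; rewrite (_ : mkset _ = setT `&` f @^-1` `]c, +oo[); first exact: mf.
by rewrite setTI; apply/seteqP; split => w /=; rewrite in_itv/= andbT.
Qed.

Lemma measurable_ge_set (f : Omega -> R) (c : R) : measurable_fun setT f ->
  measurable [set w | c <= f w].
Proof.
move=> mf; rewrite (_ : mkset _ = setT `&` f @^-1` `[c, +oo[); first exact: mf.
by rewrite setTI; apply/seteqP; split => w /=; rewrite in_itv/= andbT.
Qed.

Lemma prob_nondecreasing_half (A : nat -> set Omega) :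
  (forall n, measurable (A n)) -> nondecreasing_seq A -> \bigcup_n A n = setT ->
  exists n, (2^-1%:E < P (A n))%E.
Proof.
move=> mA ndA UA; apply: contrapT => H.
have : P (A n) @[n --> \oo] --> P (\bigcup_n A n).
  apply: nondecreasing_cvg_mu => //; first exact: bigcup_measurable.
rewrite UA probability_setT => cv.
have : (1 <= 2^-1%:E :> \bar R)%E.
  apply: (closed_cvg (fun y : \bar R => (y <= 2^-1%:E)%E)) cv.
    exact: closed_ereal_ge_ereal.
  by apply: nearW => n; rewrite leNgt; apply/negP => Hn; apply: H; exists n.
by rewrite lee_fin leNgt invf_lt1// ltr1n.
Qed.

Lemma bounded_prob_half (f : Omega -> R) : measurable_fun setT f ->
  exists N : nat, (2^-1%:E < P [set w | (`|f w| <= N%:R)%R])%E.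
Proof.
move=> mf.
have mn : measurable_fun setT (fun w => `|f w|) by exact: measurableT_comp.
apply: (@prob_nondecreasing_half (fun N => [set w | `|f w| <= N%:R])).
- by move=> n; exact: measurable_le_set.
- move=> m n mn'; apply/subsetPset => w /= H; rewrite (le_trans H)//.
  by rewrite ler_nat.
- apply/seteqP; split => // w _; exists (Num.truncn `|f w|).+1 => //=.
  by rewrite ltW// Num.Theory.truncnS_gt.
Qed.

End bounded_in_probability.

Section levy_moments.
Context {R : realType} {disp : measure_display} {Omega : measurableType disp}.
Variables (P : probability Omega R) (F : R -> set_system Omega) (r : nat).
Variables (Z : R -> Omega -> 'cV[R]_r) (a : 'I_r).
Hypotheses (HF : filtration F) (HZ : levy_process P F Z).

Let x t w := Z t w a 0.
Let inc s t w := Z t w a 0 - Z s w a 0.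

Let sF t : 0 <= t -> sigma_algebra setT (F t).
Proof. by have [+ _ _] := HF; exact. Qed.

Let F_meas t : 0 <= t -> F t `<=` measurable.
Proof. by have [_ + _] := HF; exact. Qed.

Let adapt t : 0 <= t -> measurable_wrt (F t) (x t).
Proof.
move=> t0; apply: (measurable_wrt_borel (h := fun v => v a 0)); last exact: borel_coord.
by have [+ _ _ _ _] := HZ; exact.
Qed.

Let mx t : 0 <= t -> measurable_fun setT (x t).
Proof. by move=> t0; apply: measurable_wrt_measurable (F_meas t0) (adapt t0). Qed.

Lemma levy_inc_measurable_wrt s t : 0 <= s -> s <= t -> measurable_wrt (F t) (inc s t).
Proof.
move=> s0 st; have t0 := le_trans s0 st; have [_ _ mono] := HF.
have As : measurable_wrt (F t) (x s) by exact: measurable_wrt_sub (mono _ _ s0 st) (adapt s0).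
rewrite (_ : inc s t = fun w => x t w + (-1) * x s w); last first.
  by apply/funext => w; rewrite /inc mulN1r.
apply: (measurable_wrtD (sF t0) (adapt t0)); apply: (measurable_wrtM (sF t0) _ As).
exact: measurable_wrt_cst (sF t0) _.
Qed.

Lemma levy_inc_measurable s t : 0 <= s -> s <= t -> measurable_fun setT (inc s t).
Proof.
by move=> s0 st; apply: measurable_wrt_measurable (F_meas (le_trans s0 st)) (levy_inc_measurable_wrt s0 st).
Qed.

Lemma levy_inc_indep s t (U : Omega -> R) : 0 <= s -> s <= t ->
  measurable_wrt (F s) U -> indep_pair P U (inc s t).
Proof.
move=> s0 st GU; have [_ _ _ ind _] := HZ.
apply: (indep_sigma_pair (ind s t s0 st) GU).
have := @measurable_wrt_borel R _ Omega r (fun w => Z t w - Z s w) (fun v => v a 0) _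
  (@subset_refl _ _) (borel_coord a).
by move=> H B mB; have := H B mB; congr (vec_sigma _ _);
  apply/seteqP; split => w /=; rewrite !mxE.
Qed.

Let inc_law s t (B : set R) : 0 <= s -> s <= t -> measurable B ->
  P (inc s t @^-1` B) = P (x (t - s) @^-1` B).
Proof.
move=> s0 st mB; have [_ _ _ _ law] := HZ.
have mB' : measurable ((@tnth r R)^~ a @^-1` B).
  by rewrite -[X in measurable X]setTI; exact: measurable_tnth.
have := law s t s0 st _ mB'.
have -> : [set w | ((@tnth r R)^~ a @^-1` B) (tot (Z t w - Z s w))] = inc s t @^-1` B.
  by apply/seteqP; split => w /=; rewrite tnth_mktuple !mxE.
have -> // : [set w | ((@tnth r R)^~ a @^-1` B) (tot (Z (t - s) w))] =
    x (t - s) @^-1` B.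
by apply/seteqP; split => w /=; rewrite tnth_mktuple.
Qed.

Let to_inc s t (f : R -> R) : 0 <= s -> s <= t -> measurable_fun setT f ->
  intgr P (f \o x (t - s)) ->
  intgr P (f \o inc s t) /\ expect P (f \o x (t - s)) = expect P (f \o inc s t).
Proof.
move=> s0 st mf; apply: expect_same_law.
  exact: measurableT_comp mf (levy_inc_measurable s0 st).
move=> B mB; have mfB : measurable (f @^-1` B).
  by rewrite -[X in measurable X]setTI; exact: mf.
exact/esym/(inc_law s0 st mfB).
Qed.

Let of_inc s t (f : R -> R) : 0 <= s -> s <= t -> measurable_fun setT f ->
  intgr P (f \o inc s t) ->
  intgr P (f \o x (t - s)) /\ expect P (f \o inc s t) = expect P (f \o x (t - s)).
Proof.
move=> s0 st mf; apply: expect_same_law.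
  by apply: measurableT_comp mf _; apply: mx; rewrite subr_ge0.
move=> B mB; have mfB : measurable (f @^-1` B).
  by rewrite -[X in measurable X]setTI; exact: mf.
exact: (inc_law s0 st mfB).
Qed.

Let mpow m : measurable_fun [set: R] (fun y : R => y ^+ m).
Proof. by apply: measurable_funX. Qed.

Hypothesis HM : moments_Z P Z.

Let all_moments_x1 : all_moments P (x 1).
Proof.
have [_ _ qm] := HM.
split=> [|m]; first exact: mx.
have RZ : random_vector (Z 1).
  have [ad _ _ _ _] := HZ.
  exact: subset_trans (ad 1 ler01) (F_meas ler01).
have men : measurable_fun setT (fun w => enorm (Z 1 w)).
  exact: borel_random_vector RZ borel_enorm.
case: m => [|m]; first by under eq_fun do rewrite expr0; exact: intgr_cst.
have Ie : intgr P (fun w => enorm (Z 1 w) ^+ m.+1).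
  apply/integrableP; split.
    by apply/measurable_EFinP; exact: measurable_funX.
  have := qm m.+1%:R; rewrite ltr0n => /(_ isT); congr (_ < _)%E.
  apply: eq_integral => w _ /=.
  by rewrite powR_mulrn ?enorm_ge0// ger0_norm// exprn_ge0// enorm_ge0.
apply: (intgr_le _ _ Ie); first by apply: measurable_funX; exact: mx.
move=> w; rewrite normrX lerXn2r ?nnegrE ?enorm_ge0//.
exact: coord_le_enorm.
Qed.

Let inc_split s t u w : inc s u w = inc s t w + inc t u w.
Proof. by rewrite /inc; ring. Qed.

(** Of two independent increments adding up to a variable with all moments,
    each has all moments: the other one is bounded by a constant N with
    probability at least one half. *)
Let all_moments_inc0 t : 0 <= t <= 1 -> all_moments P (inc 0 t).
Proof.
move=> /andP[t0 t1].
have all_moments01 : all_moments P (inc 0 1).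
  split=> [|m]; first exact: levy_inc_measurable.
  have I1 : intgr P ((fun y : R => y ^+ m) \o x (1 - 0)).
    by rewrite subr0; exact: all_moments_intgrX all_moments_x1.
  by have [] := to_inc (lexx 0) ler01 (mpow m) I1.
have mU := levy_inc_measurable (lexx 0) t0.
have mV := levy_inc_measurable t0 t1.
split=> // m.
have [N pN] := bounded_prob_half P mV.
pose A := [set y : R | `|y| <= N%:R].
have mA : measurable A.
  rewrite (_ : A = setT `&` [set y : R | `|y| <= N%:R]); last by rewrite setTI.
  by rewrite setTI; apply: measurable_le_set; exact: normr_measurable.
have mAV : measurable (inc t 1 @^-1` A).
  by rewrite -[X in measurable X]setTI; exact: mV.
pose u (y : R) := `|y| ^+ m.
have mu : measurable_fun setT u by apply: measurable_funX; exact: normr_measurable.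
have mi : measurable_fun [set: R] (\1_A : R -> R) by exact: measurable_indic.
pose I := (\int[P]_w (u (inc 0 t w))%:E)%E.
pose K := 2 ^+ m * (expect P (fun w => `|inc 0 1 w| ^+ m) + N%:R ^+ m).
have IV : (\int[P]_w (\1_A (inc t 1 w) : R)%:E = P (inc t 1 @^-1` A))%E.
  by rewrite -[in RHS](setIT (_ @^-1` _)) -integral_indic.
have I0 : (0 <= I)%E by apply: integral_ge0 => w _; rewrite lee_fin exprn_ge0.
have IK : (I * P (inc t 1 @^-1` A) <= K%:E)%E.
  rewrite -IV -(ge0_integral_indep (U := u \o inc 0 t) (V := \1_A \o inc t 1)).
  - have IntK : intgr P (fun w => 2 ^+ m * (`|inc 0 1 w| ^+ m + N%:R ^+ m)).
      by apply: intgrZ; apply: intgrD (intgr_cst _ _); exact: all_moments_intgr_normX.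
    have -> : K = expect P (fun w => 2 ^+ m * (`|inc 0 1 w| ^+ m + N%:R ^+ m)).
      rewrite expectZ ?expectD ?expect_cst//; first exact: all_moments_intgr_normX.
        exact: intgr_cst.
      by apply: intgrD (intgr_cst _ _); exact: all_moments_intgr_normX.
    rewrite -expectE//; apply: ge0_le_integral => //.
    + by move=> w _; rewrite lee_fin mulr_ge0 ?exprn_ge0.
    + apply/measurable_EFinP; apply: measurable_funM.
        exact: measurableT_comp mu mU.
      exact: measurableT_comp mi mV.
    + by apply/measurable_EFinP; exact: intgr_measurable IntK.
    + move=> w _; rewrite lee_fin /= indicE.
      case: (boolP (inc t 1 w \in A)) => [|_]; last first.
        by rewrite mulr0 mulr_ge0 ?exprn_ge0// addr_ge0 ?exprn_ge0.
      rewrite inE /A /= mulr1 => VN; rewrite /u.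
      rewrite (le_trans _ (exprD_le _ _ _))// lerXn2r ?nnegrE ?addr_ge0//.
      have := ler_normB (inc 0 1 w) (inc t 1 w).
      by rewrite (inc_split 0 t 1) addrK; lra.
  - exact: measurableT_comp mu mU.
  - exact: measurableT_comp mi mV.
  - by move=> w; rewrite /= /u exprn_ge0.
  - by move=> w; rewrite /= indicE.
  - apply: indep_pair_comp mu mi.
    exact: levy_inc_indep t0 t1 (levy_inc_measurable_wrt (lexx 0) t0).
have IK2 : (I <= (K * 2)%:E)%E.
  rewrite EFinM -lee_pdivrMr//; apply: le_trans IK.
  by apply: lee_wpmul2l => //; rewrite ltW.
have [I1 _] := intgr_bound (measurableT_comp mu mU)
  (fun w => exprn_ge0 m (normr_ge0 (inc 0 t w))) IK2.
apply: (intgr_le _ _ I1); first by apply: measurable_funX.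
by move=> w; rewrite normrX.
Qed.

Let all_moments_x t : 0 <= t <= 1 -> all_moments P (x t).
Proof.
move=> t01; have /andP[t0 t1] := t01.
split=> [|m]; first exact: mx.
have [] := @of_inc 0 t _ (lexx 0) t0 (mpow m) (all_moments_intgrX m (all_moments_inc0 t01)).
by rewrite subr0.
Qed.

Let mom i t := expect P (fun w => x t w ^+ i).

Let inc_mom s t : 0 <= s -> s <= t <= s + 1 ->
  all_moments P (inc s t) /\ forall i, expect P (fun w => inc s t w ^+ i) = mom i (t - s).
Proof.
move=> s0 /andP[st t1].
have ts : 0 <= t - s <= 1 by apply/andP; split; lra.
split=> [|i].
  split=> [|m]; first exact: levy_inc_measurable.
  by have [] := @to_inc s t _ s0 st (mpow m) (all_moments_intgrX m (all_moments_x ts)).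
by have [_ <-] := @to_inc s t _ s0 st (mpow i) (all_moments_intgrX i (all_moments_x ts)).
Qed.

Let mom_add q s t : 0 <= s -> 0 <= t -> s + t <= 1 ->
  mom q (s + t) = \sum_(i < q.+1) (mom (q - i) s * mom i t) *+ 'C(q, i).
Proof.
move=> s0 t0 st1.
have [L1 E1] : all_moments P (inc 0 s) /\ forall i, expect P (fun w => inc 0 s w ^+ i) = mom i s.
  by have := @inc_mom 0 s (lexx 0); rewrite subr0; apply; apply/andP; split; lra.
have [L2 E2] : all_moments P (inc s (s + t)) /\
    forall i, expect P (fun w => inc s (s + t) w ^+ i) = mom i t.
  have := @inc_mom s (s + t) s0; rewrite (addrC s) addrK addrC; apply.
  by apply/andP; split; lra.
have [_ E3] : all_moments P (inc 0 (s + t)) /\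
    forall i, expect P (fun w => inc 0 (s + t) w ^+ i) = mom i (s + t).
  by have := @inc_mom 0 (s + t) (lexx 0); rewrite subr0; apply; apply/andP; split; lra.
have ind i j : indep_pair P (fun w => inc 0 s w ^+ i) (fun w => inc s (s + t) w ^+ j).
  apply: (indep_pair_comp _ (mpow i) (mpow j)).
  by apply: levy_inc_indep => //; [lra|exact: levy_inc_measurable_wrt].
rewrite -E3.
under eq_fun do rewrite (inc_split 0 s) exprDn.
have IP i : intgr P (fun w => inc 0 s w ^+ (q - i) * inc s (s + t) w ^+ i).
  by have [] := expect_indep (all_moments_intgrX (q - i) L1) (all_moments_intgrX i L2) (@ind _ _).
rewrite expect_sum; last first.
  by move=> i; under eq_fun do rewrite -mulr_natl; exact: intgrZ.
apply: eq_bigr => i _.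
under eq_fun do rewrite -mulr_natl.
rewrite expectZ// mulr_natl; congr (_ *+ _).
have [_ ->] := expect_indep (all_moments_intgrX (q - i) L1) (all_moments_intgrX i L2) (@ind _ _).
by rewrite E1 E2.
Qed.

Let mom0 t : mom 0 t = 1.
Proof. by rewrite /mom; under eq_fun do rewrite expr0; exact: expect_cst. Qed.

Let mean_add s t : 0 <= s -> 0 <= t -> s + t <= 1 -> mom 1 (s + t) = mom 1 s + mom 1 t.
Proof.
move=> s0 t0 st; rewrite mom_add// 2!big_ord_recr big_ord0/=.
by rewrite subn0 subnn !mom0 bin0 binn !mulr1n; ring.
Qed.

Let mean1 : mom 1 1 = 0.
Proof.
have [m1 _ _] := HM.
apply: EFin_inj; rewrite -expectE; last exact: all_moments_intgrX.
rewrite -[RHS](m1 a).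
by apply: eq_integral => w _; rewrite expr1.
Qed.

Let var t := mom 2 t - mom 1 t ^+ 2.

Let var_add s t : 0 <= s -> 0 <= t -> s + t <= 1 -> var (s + t) = var s + var t.
Proof.
move=> s0 t0 st; rewrite /var mean_add// mom_add// 3!big_ord_recr big_ord0/=.
rewrite subn0 subnn (_ : 2 - 1 = 1)%N// !mom0 bin0 binn bin1 !mulr1n mulr2n; ring.
Qed.

Let varE t : 0 <= t <= 1 -> var t = expect P (fun w => (x t w - mom 1 t) ^+ 2).
Proof.
move=> t01; have L := all_moments_x t01.
have -> : (fun w => (x t w - mom 1 t) ^+ 2) =
    (fun w => (x t w ^+ 2 - (2 * mom 1 t) * x t w ^+ 1) + mom 1 t ^+ 2).
  by apply/funext => w; ring.
have I1 := all_moments_intgrX 1 L; have I2 := all_moments_intgrX 2 L.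
rewrite (expectD (intgrB I2 (intgrZ _ I1)) (intgr_cst _ _)).
rewrite (expectB I2 (intgrZ _ I1)) (expectZ _ I1) expect_cst.
by rewrite /var -/(mom 1 t) -/(mom 2 t); ring.
Qed.

Let var_ge0 t : 0 <= t <= 1 -> 0 <= var t.
Proof. by move=> t01; rewrite varE//; apply: expect_ge0 => w; exact: sqr_ge0. Qed.

Let var_le t : 0 <= t <= 1 -> var t <= 2 * var 1 * t.
Proof.
move=> t01; have := @superadditive_linear R var 0 (lexx _) var_ge0.
rewrite mulr0 addr0; apply=> // s u s0 u0 su.
by rewrite mul0r subr0 var_add.
Qed.

(** Right-continuity at 0 forces the law of a short increment to charge a
    neighbourhood of 0, and as its variance is small, its mean must be close to
    0 as well. *)
Let mean_small e : 0 < e -> exists2 del, 0 < del &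
  forall t, 0 <= t < del -> `|mom 1 t| <= e.
Proof.
move=> e0; apply: contrapT => H.
have /choice[tn Htn] (n : nat) : exists t : R,
    [/\ 0 <= t, t < n.+1%:R^-1 & e < `|mom 1 t|].
  apply: contrapT => Hn; apply: H; exists n.+1%:R^-1; first by rewrite invr_gt0.
  move=> t /andP[t0 tn]; rewrite leNgt; apply/negP => et.
  by apply: Hn; exists t.
pose A n := [set w | forall k, (n <= k)%N -> `|inc 0 (tn k) w| <= e / 2].
have tn0 k : 0 <= tn k by have [] := Htn k.
have tn1 k : tn k <= 1.
  by have [_ /ltW/le_trans + _] := Htn k; apply; rewrite invf_le1// ler1n.
have mle k : measurable [set w | `|inc 0 (tn k) w| <= e / 2].
  apply: measurable_le_set; apply: measurableT_comp => //.
  exact: levy_inc_measurable.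
have mA n : measurable (A n).
  rewrite (_ : A n = \bigcap_(k in [set k | (n <= k)%N]) [set w | `|inc 0 (tn k) w| <= e / 2]).
    by apply: bigcap_measurable => [|k _ //]; exists n => /=.
  by apply/seteqP; split => w /= Aw k; exact: Aw.
have ndA : nondecreasing_seq A.
  move=> m n mn; apply/subsetPset => w /= Aw k nk; apply: Aw.
  exact: leq_trans nk.
have UA : \bigcup_n A n = setT.
  apply/seteqP; split => // w _.
  have [_ cad _ _ _] := HZ.
  have [rc _] := cad w; have := rc 0 (lexx 0).
  move=> /cvgrPdist_le/(_ (e / 2)); rewrite divr_gt0// => /(_ isT).
  rewrite /at_right near_withinE => /nbhs_ballP[del /= del0 Hdel].
  have [n Hn] : exists n : nat, n.+1%:R^-1 < del.
    exists (Num.truncn del^-1); rewrite -[ltRHS]invrK ltf_pV2 ?posrE ?invr_gt0//.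
    exact: Num.Theory.truncnS_gt.
  exists n => // k nk.
  have [k0 k1 _] := Htn k.
  have [->|kn0] := eqVneq (tn k) 0; first by rewrite /inc subrr normr0 divr_ge0// ltW.
  have kp : 0 < tn k by rewrite lt_neqAle eq_sym kn0.
  have := Hdel (tn k); rewrite -ball_normE /= sub0r normrN ger0_norm// => /(_ _ kp) HH.
  have {}HH : `|Z 0 w - Z (tn k) w| <= e / 2.
    apply: HH; apply: (lt_trans k1); apply: le_lt_trans Hn.
    by rewrite lef_pV2 ?posrE// ler_nat ltnS.
  rewrite /inc distrC; apply: le_trans HH.
  rewrite [leRHS]mx_normrE -[X in `|X|]opprB.
  have -> : `|- (Z (tn k) w a 0 - Z 0 w a 0)| = `|(Z 0 w - Z (tn k) w) (a, 0 : 'I_1).1 (a, 0 : 'I_1).2|.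
    by rewrite /= !mxE opprB.
  exact: (le_bigmax _ (fun ij : 'I_r * 'I_1 => `|(Z 0 w - Z (tn k) w) ij.1 ij.2|)).
have [n0 Pn0] := prob_nondecreasing_half P mA ndA UA.
have v1 : 0 <= var 1 by apply: var_ge0; rewrite ler01 lexx.
have [n nn0 small] : exists2 n, (n0 <= n)%N & 4 * (2 * var 1 * tn n) / e ^+ 2 <= 2^-1.
  pose c := 16 * var 1 / e ^+ 2.
  have c0 : 0 <= c by rewrite divr_ge0 ?sqr_ge0// mulr_ge0.
  exists (n0 + (Num.truncn c).+1)%N; first exact: leq_addr.
  set n := (n0 + _)%N.
  have cn : c * n.+1%:R^-1 <= 1.
    rewrite ler_pdivrMr// mul1r (le_trans (ltW (Num.Theory.truncnS_gt c)))// ler_nat.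
    by rewrite /n -addnS; exact: leq_trans (leq_addl _ _).
  have [_ /ltW tnn _] := Htn n.
  rewrite (_ : _ / e ^+ 2 = c * tn n / 2); last by rewrite /c; field; rewrite gt_eqF.
  rewrite -[leRHS]mul1r ler_wpM2r// (le_trans _ cn)// ler_wpM2l//.
have t01 : 0 <= tn n <= 1 by rewrite tn0 tn1.
have L := all_moments_x t01.
have [_ _ eM] := Htn n.
have LB : all_moments P (fun w => x (tn n) w - mom 1 (tn n)) by apply: all_momentsB => //; exact: all_moments_cst.
have := expect_markov (all_moments_intgrX 2 LB) (fun w => sqr_ge0 _) (c := (e / 2) ^+ 2).
rewrite exprn_gt0 ?divr_gt0// -varE// => /(_ isT) cheb.
have : (P (A n0) <= P [set w | ((e / 2) ^+ 2 <= (x (tn n) w - mom 1 (tn n)) ^+ 2)%R])%E.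
  apply: (@le_trans _ _ (P (inc 0 (tn n) @^-1` [set y | `|y| <= e / 2]))).
    apply: le_measure; rewrite ?inE; [exact: mA|exact: mle|].
    by move=> w /= /(_ _ nn0).
  rewrite inc_law//; last by apply: measurable_le_set; exact: normr_measurable.
  rewrite subr0; apply: le_measure; rewrite ?inE.
  - by rewrite -[X in measurable X]setTI; apply: mx => //; apply: measurable_le_set;
      exact: normr_measurable.
  - by apply: measurable_ge_set; apply: measurable_funX; exact: all_moments_measurable LB.
  move=> w /= xe; rewrite -[leRHS]real_normK ?num_real// lerXn2r ?nnegrE//.
    by rewrite ltW// divr_gt0.
  have := lerB_normD (mom 1 (tn n)) (- x (tn n) w); rewrite normrN distrC; lra.
move=> /le_trans/(_ cheb); rewrite leNgt => /negP; apply.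
apply: le_lt_trans Pn0; rewrite lee_fin; apply: le_trans small.
rewrite (_ : var _ / _ = 4 * var (tn n) / e ^+ 2); last by field; rewrite gt_eqF.
rewrite ler_wpM2r ?invr_ge0 ?sqr_ge0// ler_wpM2l//.
exact: var_le.
Qed.

Let mean_mul k t : 0 <= t -> k%:R * t <= 1 -> mom 1 (k%:R * t) = k%:R * mom 1 t.
Proof.
move=> t0; elim: k => [|k IH].
  move=> _; rewrite !mul0r; have := @mean_add 0 0 (lexx 0) (lexx 0).
  by rewrite addr0 => /(_ ler01); lra.
rewrite -[k.+1]addn1 natrD !mulrDl !mul1r => kt.
have k0 : 0 <= k%:R * t by rewrite mulr_ge0.
by rewrite mean_add// IH//; lra.
Qed.

(** The mean is additive in time and vanishes at 1, hence at all multiples of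
    1 / k; the remainder of t modulo 1 / k contributes a small mean. *)
Let mean_zero t : 0 <= t <= 1 -> mom 1 t = 0.
Proof.
move=> /andP[t0 t1]; apply/eqP; rewrite -normr_le0.
apply/ler_addgt0Pl => e e0; rewrite addr0.
have [del del0 Hdel] := mean_small e0.
pose k := (Num.truncn del^-1).+1.
have kd : k%:R^-1 < del.
  rewrite -[ltRHS]invrK ltf_pV2 ?posrE ?invr_gt0//.
  exact: Num.Theory.truncnS_gt.
have k0 : 0 < k%:R :> R by rewrite ltr0n.
have mk : mom 1 (k%:R^-1) = 0.
  have := @mean_mul k (k%:R^-1); rewrite invr_ge0 ler0n mulfV ?gt_eqF// lexx mean1.
  move=> /(_ isT isT)/esym/eqP; rewrite mulf_eq0 gt_eqF//= => /eqP//.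
pose j := Num.truncn (k%:R * t).
have /andP[j1 j2] := Num.Theory.truncn_itv (mulr_ge0 (ltW k0) t0).
rewrite -/j in j1 j2.
have jk : j%:R / k%:R <= t by rewrite ler_pdivrMr// mulrC.
have jk2 : t - j%:R / k%:R < k%:R^-1.
  by rewrite ltrBlDr -[X in X + _]mul1r -mulrDl ltr_pdivlMr// mulrC addrC natr1.
have jk0 : 0 <= j%:R / k%:R :> R by rewrite divr_ge0.
rewrite (_ : t = j%:R / k%:R + (t - j%:R / k%:R)); last by ring.
rewrite mean_add//; [|lra|lra].
have jk1 : j%:R / k%:R <= 1 :> R by lra.
have ki : 0 <= k%:R^-1 :> R by rewrite invr_ge0.
rewrite (mean_mul ki jk1) mk mulr0 add0r; apply: Hdel; apply/andP; split; first lra.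
exact: lt_trans kd.
Qed.

Let amom i t := expect P (fun w => `|x t w| ^+ i).

Let amom_even q t : mom q.*2 t = amom q.*2 t.
Proof.
congr expect; apply/funext => w.
by rewrite -mul2n !exprM real_normK ?num_real.
Qed.

Let amom_ge0 i t : 0 <= amom i t.
Proof. by apply: expect_ge0 => w; rewrite exprn_ge0. Qed.


Let mom_le_amom i t : 0 <= t <= 1 -> `|mom i t| <= amom i t.
Proof.
move=> t01; apply: le_trans (expect_norm _) _; first exact: (all_moments_intgrX i (all_moments_x t01)).
by under eq_fun do rewrite normrX.
Qed.

Let amom_odd q t : 0 <= t <= 1 -> amom q.*2.+3 t <= amom q.+1.*2 t + amom q.+2.*2 t.
Proof.
move=> t01; have L := all_moments_x t01.
rewrite /amom -expectD; [|exact: all_moments_intgr_normX|exact: all_moments_intgr_normX].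
apply: expect_le; first exact: all_moments_intgr_normX.
  by apply: intgrD; exact: all_moments_intgr_normX.
move=> w; rewrite !doubleS.
have y0 := normr_ge0 (x t w); set y := `|x t w| in y0 *.
have yq : 0 <= y ^+ q.*2.+2 by rewrite exprn_ge0.
rewrite [in leLHS]exprS [X in _ <= _ + X]exprS [X in _ <= _ + _ * X]exprS.
have := mulr_ge0 yq (addr_ge0 (sqr_ge0 (1 - y)) y0).
set Y := y ^+ _; lra.
Qed.

(** Even moments are superadditive in time up to a product error: the extreme
    terms of the binomial expansion of an increment over s + t are the moments
    over s and over t, the linear ones vanish, and the others are products of
    two moments that are linear by induction.  Odd absolute moments lie between
    even ones. *)
Let mom_linear q : exists C : nat -> R, forall i, (2 <= i <= q.+1.*2)%N ->
  0 <= C i /\ forall t, 0 <= t <= 1 -> amom i t <= C i * t.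
Proof.
elim: q => [|q [C HC]].
  exists (fun=> 2 * var 1) => i; rewrite -[(0.+1).*2]/2%N -eqn_leq => /eqP <-.
  split; first by rewrite mulr_ge0// var_ge0// ler01 lexx.
  move=> t t01; rewrite -[2%N]/(1.*2) -amom_even.
  by have := var_le t01; rewrite /var mean_zero// expr0n subr0.
pose Q := q.+2.*2.
have Cge0 i : (2 <= i <= q.+1.*2)%N -> 0 <= C i by move=> /HC[].
pose B := \sum_(i < Q.+1) 'C(Q, i)%:R * (`|C (Q - i)%N| * `|C i|).
have B0 : 0 <= B by apply: sumr_ge0 => i _; rewrite !mulr_ge0.
have sup s t : 0 <= s -> 0 <= t -> s + t <= 1 ->
    mom Q s + mom Q t - B * (s * t) <= mom Q (s + t).
  move=> s0 t0 st.
  have s01 : 0 <= s <= 1 by apply/andP; split; lra.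
  have t01 : 0 <= t <= 1 by apply/andP; split; lra.
  have Q2 : (2 <= Q)%N by rewrite /Q doubleS.
  have QQ : (Q = Q.-2.+2)%N by rewrite -(subnKC Q2).
  have -> : mom Q (s + t) = mom Q s + mom Q t +
      \sum_(i < Q.+1 | (0 < i < Q)%N) (mom (Q - i) s * mom i t) *+ 'C(Q, i).
    rewrite mom_add// (bigD1 ord0)//= subn0 mom0 bin0 mulr1 mulr1n -addrA; congr (_ + _).
    have Qn0 : (Q > 0)%N by rewrite (leq_trans _ Q2).
    rewrite (bigD1 ord_max)/=; last by [].
    rewrite subnn mom0 binn mul1r mulr1n; congr (_ + _).
    apply: eq_bigl => i; rewrite -!(inj_eq val_inj)/= lt0n; congr (_ && _).
    by rewrite ltn_neqAle -ltnS ltn_ord andbT.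
  rewrite lerD2l -mulNr -[leLHS]opprK lerNl -sumrN.
  rewrite mulNr opprK; apply: (@le_trans _ _ (\sum_(i < Q.+1 | (0 < i < Q)%N)
      'C(Q, i)%:R * (`|C (Q - i)%N| * `|C i|) * (s * t))); last first.
    rewrite /B mulr_suml [leRHS](bigID (fun i : 'I_Q.+1 => (0 < i < Q)%N))/= lerDl.
    by apply: sumr_ge0 => i _; rewrite !mulr_ge0.
  apply: ler_sum => i /andP[i0 iQ].
  rewrite -mulr_natl -mulrN -mulrA ler_wpM2l//.
  have [i1|i1] := eqVneq (i : nat) 1%N.
    by rewrite i1 (mean_zero t01) mulr0 oppr0 !mulr_ge0.
  have [i2|i2] := eqVneq (Q - i)%N 1%N.
    by rewrite i2 (mean_zero s01) mul0r oppr0 !mulr_ge0.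
  have ir : (2 <= i <= q.+1.*2)%N.
    have QE : Q = q.+1.*2.+2 by rewrite /Q doubleS.
    by move: iQ i0 i1 i2; move: (nat_of_ord i) => k; rewrite QE; lia.
  have jr : (2 <= Q - i <= q.+1.*2)%N.
    have QE : Q = q.+1.*2.+2 by rewrite /Q doubleS.
    by move: iQ i0 i1 i2; move: (nat_of_ord i) => k; rewrite QE; lia.
  have [Ci Hi] := HC _ ir; have [Cj Hj] := HC _ jr.
  rewrite (ger0_norm Ci) (ger0_norm Cj) mulrACA.
  apply: le_trans (ler_norm _) _; rewrite normrN normrM ler_pM//.
    exact: le_trans (mom_le_amom _ s01) (Hj _ s01).
  exact: le_trans (mom_le_amom _ t01) (Hi _ t01).
have pos t : 0 <= t <= 1 -> 0 <= mom Q t by move=> _; rewrite /Q amom_even; exact: amom_ge0.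
have lin := superadditive_linear B0 pos sup.
pose D := 2 * (mom Q 1 + 2 * B).
have D0 : 0 <= D.
  by rewrite /D mulr_ge0// addr_ge0 ?mulr_ge0// pos// ler01 lexx.
exists (fun i => if (i <= q.+1.*2)%N then C i else if i == Q then D else C q.+1.*2 + D) => i.
move=> /andP[i2 iQ]; case: ifPn => [iq|]; first by apply: HC; rewrite i2.
rewrite -ltnNge => qi; case: eqVneq => [->|iQ'].
  by split => // t t01; rewrite /Q -amom_even; exact: lin.
have -> : i = q.*2.+3 by move: iQ qi iQ'; rewrite /Q !doubleS; lia.
have CQ := HC q.+1.*2; have [|C0 HQ] := CQ; first by rewrite leqnn doubleS.
split=> [|t t01]; first by rewrite addr_ge0.
apply: le_trans (amom_odd q t01) _; rewrite mulrDl lerD//; first exact: HQ.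
by rewrite -amom_even; exact: lin.
Qed.

(** Linearity in the length of the interval, for every order from 2 on, is where
    jumps differ from a Brownian driver; it is exactly what the moment bounds
    for martingale transforms consume at each step. *)
Lemma levy_increment_moments : exists C : nat -> R, (forall i, 0 <= C i) /\
  forall s t, 0 <= s -> s <= t <= s + 1 ->
    [/\ all_moments P (inc s t), expect P (inc s t) = 0 &
      forall i, (2 <= i)%N -> `|expect P (fun w => inc s t w ^+ i)| <= C i * (t - s)].
Proof.
have /choice[C HC] i : exists c : R, 0 <= c /\ ((2 <= i)%N ->
    forall t, 0 <= t <= 1 -> amom i t <= c * t).
  have [C HC] := mom_linear i.
  have [i2|i2] := leqP 2 i; last by exists 0.
  have [|C0 H] := HC i; first by rewrite i2 -addnn addSn leqW// leq_addr.
  by exists (C i).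
exists C; split=> [i|s t s0 st]; first by have [] := HC i.
have [L E] := inc_mom s0 st; split => //.
  have := E 1%N; under eq_fun do rewrite expr1; move=> ->.
  by rewrite mean_zero//; move: st => /andP[? ?]; apply/andP; split; lra.
move=> i i2; rewrite E.
have ts : 0 <= t - s <= 1 by move: st => /andP[? ?]; apply/andP; split; lra.
have [_ /(_ i2 _ ts)] := HC i; apply: le_trans.
exact: mom_le_amom.
Qed.

End levy_moments.

(** * Martingale transforms and convergence in probability *)

(** Young's inequality, with weights that make the first term summable over a
    horizon of length s ^+ 2. *)
Lemma young_weighted {R : realFieldType} (u v s : R) (q i : nat) :
  0 <= u -> 0 <= v -> 1 <= s -> (2 <= i <= q.+1.*2)%N ->
  u ^+ (q.+1.*2 - i) * v ^+ i <=
    (s ^+ 2)^-1 * u ^+ q.+1.*2 + s ^+ q.*2 * v ^+ q.+1.*2.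
Proof.
move=> u0 v0 s1 /andP[i2 iq].
set Q := q.+1.*2 in iq *.
have s0 : 0 < s by exact: lt_le_trans ltr01 s1.
have y (x z : R) : 0 <= x -> 0 <= z -> x ^+ (Q - i) * z ^+ i <= x ^+ Q + z ^+ Q.
  move=> x0 z0; have [xz|zx] := leP x z.
    apply: (@le_trans _ _ (z ^+ (Q - i) * z ^+ i)).
      by rewrite ler_wpM2r ?exprn_ge0// lerXn2r.
    by rewrite -exprD subnK// lerDr exprn_ge0.
  apply: (@le_trans _ _ (x ^+ (Q - i) * x ^+ i)).
    by rewrite ler_wpM2l ?exprn_ge0// lerXn2r ?nnegrE// ltW.
  by rewrite -exprD subnK// lerDl exprn_ge0.
have sv0 : 0 <= s * v by rewrite mulr_ge0// ltW.
have := y u (s * v) u0 sv0.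
rewrite exprMn mulrCA => H.
have si : s ^+ 2 <= s ^+ i by rewrite ler_weXn2l.
have X0 : 0 <= u ^+ (Q - i) * v ^+ i by rewrite mulr_ge0 ?exprn_ge0.
have {}H : s ^+ 2 * (u ^+ (Q - i) * v ^+ i) <= u ^+ Q + (s * v) ^+ Q.
  by apply: le_trans H; rewrite ler_wpM2r.
have -> : s ^+ q.*2 * v ^+ Q = (s ^+ 2)^-1 * (s * v) ^+ Q.
  have e : (s ^+ 2)^-1 * s ^+ Q = s ^+ q.*2.
    by rewrite /Q doubleS -[q.*2.+2]addn2 exprD mulrCA mulVf ?mulr1// gt_eqF// exprn_gt0.
  by rewrite exprMn (mulrA _ (s ^+ Q)) e.
by rewrite -mulrDr ler_pdivlMl ?exprn_gt0.
Qed.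

Section martingale.
Context {R : realType} {disp : measure_display} {Omega : measurableType disp}.
Variable P : probability Omega R.

(** Expanding the next partial sum binomially, the linear term vanishes by
    centring and independence, and the terms of order i >= 2 cost the length
    of the step: a discrete Gronwall inequality.  The scale s splits the mixed
    moments so that the Gronwall factor stays bounded on horizons of length
    s ^+ 2. *)
Lemma martingale_moment (C : nat -> R) (q : nat) : (forall i, 0 <= C i) ->
  exists A : R, 0 <= A /\
  forall (G : nat -> set_system Omega) (H D : nat -> Omega -> R) (t : nat -> R)
    (s B : R) (K : nat),
  (forall k, sigma_algebra setT (G k)) -> (forall k, G k `<=` measurable) ->
  (forall k, G k `<=` G k.+1) -> (forall k, t k <= t k.+1) ->
  (forall k, measurable_wrt (G k) (H k)) -> (forall k, measurable_wrt (G k.+1) (D k)) ->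
  (forall k, all_moments P (H k)) -> (forall k, all_moments P (D k)) ->
  (forall k, expect P (D k) = 0) ->
  (forall k i, (2 <= i)%N ->
     `|expect P (fun w => D k w ^+ i)| <= C i * (t k.+1 - t k)) ->
  (forall k U, measurable_wrt (G k) U -> indep_pair P U (D k)) ->
  (forall k, expect P (fun w => `|H k w| ^+ q.+1.*2) <= B) ->
  1 <= s -> t K - t 0 <= s ^+ 2 ->
  expect P (fun w => (\sum_(k < K) H k w * D k w) ^+ q.+1.*2) <=
    A * B * (t K - t 0) * s ^+ q.*2.
Proof.
move=> C0; set Q := q.+1.*2.
pose Ac := \sum_(i < Q.+1) 'C(Q, i)%:R * C i.
have Ac0 : 0 <= Ac by apply: sumr_ge0 => i _; rewrite mulr_ge0.
exists (expR Ac * Ac); split; first by rewrite mulr_ge0// expR_ge0.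
move=> G H D t s B K sG mG GG tt GH GD LH LD ED MD ind HB s1 tK.
have s0 : 0 < s by exact: lt_le_trans ltr01 s1.
have s20 : 0 < s ^+ 2 by rewrite exprn_gt0.
pose M k w := \sum_(j < k) H j w * D j w.
have MS k w : M k.+1 w = M k w + H k w * D k w by rewrite /M big_ord_recr.
have M0 w : M 0%N w = 0 by rewrite /M big_ord0.
have GM k : measurable_wrt (G k) (M k).
  elim: k => [|k IH]; first by rewrite (_ : M 0%N = fun=> 0); [exact: measurable_wrt_cst|exact/funext].
  rewrite (_ : M k.+1 = fun w => M k w + H k w * D k w); last exact/funext.
  apply: measurable_wrtD => //; first exact: measurable_wrt_sub (GG k) IH.
  by apply: measurable_wrtM => //; exact: measurable_wrt_sub (GG k) (GH k).
have LM k : all_moments P (M k) by apply: all_moments_sum => j; exact: all_momentsM.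
have B0 : 0 <= B by apply: le_trans (HB 0%N); apply: expect_ge0 => w; rewrite exprn_ge0.
have sq0 : 0 <= s ^+ q.*2 by rewrite exprn_ge0// ltW.
pose e k := expect P (fun w => M k w ^+ Q).
have e0 k : 0 <= e k.
  by apply: expect_ge0 => w; rewrite /Q -mul2n exprM exprn_ge0// sqr_ge0.
have abs (y : R) : `|y| ^+ Q = y ^+ Q.
  by rewrite /Q -mul2n !exprM real_normK ?num_real.
have step k : e k.+1 <= (1 + Ac * (t k.+1 - t k) / s ^+ 2) * e k +
    Ac * (t k.+1 - t k) * (s ^+ q.*2 * B).
  have d0 : 0 <= t k.+1 - t k by rewrite subr_ge0.
  pose T i w := (M k w ^+ (Q - i) * H k w ^+ i) * D k w ^+ i.
  have LU i : all_moments P (fun w => M k w ^+ (Q - i) * H k w ^+ i).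
    by apply: all_momentsM; exact: all_momentsX.
  have indU i : indep_pair P (fun w => M k w ^+ (Q - i) * H k w ^+ i) (fun w => D k w ^+ i).
    apply: (indep_pair_comp (u := id) (v := fun y => y ^+ i)) => //.
      apply: ind; apply: measurable_wrtM => //; exact: measurable_wrtX.
  have [IT ET] : (forall i, intgr P (T i)) /\ (forall i, expect P (T i) =
      expect P (fun w => M k w ^+ (Q - i) * H k w ^+ i) * expect P (fun w => D k w ^+ i)).
    split=> i; have [] // := expect_indep (all_moments_intgr (LU i)) (all_moments_intgrX i (LD k)) (@indU i).
  have -> : e k.+1 = \sum_(i < Q.+1) 'C(Q, i)%:R * expect P (T i).
    rewrite /e (_ : (fun w => M k.+1 w ^+ Q) =
        fun w => \sum_(i < Q.+1) 'C(Q, i)%:R * T i w).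
      rewrite expect_sum; last by move=> i; exact: intgrZ.
      by apply: eq_bigr => i _; rewrite expectZ.
    apply/funext => w; rewrite MS exprDn; apply: eq_bigr => i _.
    by rewrite mulr_natl /T exprMn mulrA.
  have E0 : expect P (T 0%N) = e k.
    by rewrite /e; congr expect; apply/funext => w; rewrite /T subn0 !expr0 !mulr1.
  have E1 : expect P (T 1%N) = 0.
    by rewrite ET; under [X in _ * expect P X]eq_fun do rewrite expr1; rewrite ED mulr0.
  have Ei i : (2 <= i <= Q)%N -> expect P (T i) <=
      C i * (t k.+1 - t k) * ((s ^+ 2)^-1 * e k + s ^+ q.*2 * B).
    move=> /andP[i2 iQ]; rewrite ET mulrC.
    apply: le_trans (ler_norm _) _; rewrite normrM ler_pM//; first exact: MD.
    apply: le_trans (expect_norm _) _; first exact: all_moments_intgr.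
    apply: (@le_trans _ _ (expect P (fun w => (s ^+ 2)^-1 * M k w ^+ Q +
        s ^+ q.*2 * `|H k w| ^+ Q))).
      apply: expect_le.
      - exact: intgr_norm (all_moments_intgr (LU i)).
      - apply: intgrD; apply: intgrZ; first exact: all_moments_intgrX.
        exact: all_moments_intgr_normX.
      move=> w; rewrite normrM !normrX -[M k w ^+ Q]abs.
      by apply: young_weighted => //; rewrite i2.
    have I1 := all_moments_intgrX Q (LM k); have I2 := all_moments_intgr_normX Q (LH k).
    rewrite (expectD (intgrZ _ I1) (intgrZ _ I2)) (expectZ _ I1) (expectZ _ I2).
    by rewrite lerD2l ler_wpM2l.
  have X0 : 0 <= (s ^+ 2)^-1 * e k + s ^+ q.*2 * B.
    by rewrite addr_ge0// mulr_ge0// invr_ge0 ltW.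
  rewrite [leRHS](_ : _ = e k + Ac * (t k.+1 - t k) * ((s ^+ 2)^-1 * e k + s ^+ q.*2 * B)); last by ring.
  rewrite big_ord_recl/= E0 bin0 mul1r lerD2l.
  pose Ac' := \sum_(i < Q) 'C(Q, bump 0 i)%:R * C (bump 0 i).
  have AcA : Ac' <= Ac by rewrite /Ac big_ord_recl/= lerDr mulr_ge0.
  apply: (@le_trans _ _ (Ac' * (t k.+1 - t k) * ((s ^+ 2)^-1 * e k + s ^+ q.*2 * B))); last first.
    by rewrite !ler_wpM2r.
  rewrite -mulrA mulr_suml; apply: ler_sum => i _.
  rewrite -mulrA ler_wpM2l// /bump/= add1n mulrA.
  case: (eqVneq (i : nat) 0%N) => [->|i0]; first by rewrite E1 !mulr_ge0.
  by apply: Ei; rewrite ltnS lt0n i0 ltn_ord.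
have main k : e k <= expR (Ac * (t k - t 0) / s ^+ 2) * (Ac * (t k - t 0) * (s ^+ q.*2 * B)).
  elim: k => [|k IH].
    rewrite /e (_ : (fun w => M 0%N w ^+ Q) = fun=> 0).
      by rewrite expect_cst subrr !mulr0 !mul0r mulr0.
    by apply/funext => w; rewrite M0 expr0n.
  apply: le_trans (step k) _.
  have tk0 : 0 <= t k - t 0.
    rewrite subr_ge0; elim: k {IH} => // k IHk; exact: le_trans IHk (tt k).
  have d0 : 0 <= t k.+1 - t k by rewrite subr_ge0.
  set x := Ac * (t k.+1 - t k) / s ^+ 2; set y := Ac * (t k - t 0) / s ^+ 2 in IH *.
  have x0 : 0 <= x by rewrite !mulr_ge0// invr_ge0 ltW.
  have y0 : 0 <= y by rewrite !mulr_ge0// invr_ge0 ltW.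
  have -> : Ac * (t k.+1 - t 0) / s ^+ 2 = x + y by rewrite /x /y; ring.
  set W := s ^+ q.*2 * B; have W0 : 0 <= W by rewrite mulr_ge0.
  have -> : Ac * (t k.+1 - t 0) * W = Ac * (t k.+1 - t k) * W + Ac * (t k - t 0) * W by ring.
  rewrite [leRHS]mulrDr [leLHS]addrC lerD//.
    by rewrite ler_peMl// ?mulr_ge0//; rewrite -expR0 ler_expR addr_ge0.
  rewrite expRD -mulrA ler_pM// ?addr_ge0// expR_ge1Dx//.
apply: le_trans (main K) _.
have tK0 : 0 <= t K - t 0.
  by rewrite subr_ge0; elim: (K) => // k IHk; exact: le_trans IHk (tt k).
rewrite (_ : _ * B * _ * _ = expR Ac * (Ac * (t K - t 0) * (s ^+ q.*2 * B))); last by ring.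
rewrite ler_wpM2r ?mulr_ge0// ler_expR -mulrA ler_piMr// ler_pdivrMr// mul1r//.
Qed.

(** Convergence in probability, with the measurability that makes the
    probabilities meaningful. *)
Definition cvg_prob (Y : nat -> Omega -> R) (X : Omega -> R) :=
  [/\ forall k, measurable_fun setT (Y k), measurable_fun setT X &
    forall e : R, 0 < e -> exists k0, forall k, (k0 <= k)%N ->
      (P [set w | (e < `|Y k w - X w|)%R] <= e%:E)%E].

Lemma measurable_gt_norm (f : Omega -> R) (c : R) : measurable_fun setT f ->
  measurable [set w | c < `|f w|].
Proof. by move=> mf; apply: measurable_gt_set; exact: measurableT_comp. Qed.

Lemma prob_le2 (A B S : set Omega) (a b : R) : measurable A -> measurable B ->
  measurable S -> S `<=` A `|` B -> (P A <= a%:E)%E -> (P B <= b%:E)%E ->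
  (P S <= (a + b)%:E)%E.
Proof.
move=> mA mB mS SAB Aa Bb.
apply: (@le_trans _ _ (P (A `|` B))).
  by apply: le_measure; rewrite ?inE//; exact: measurableU.
by apply: (le_trans (measureU2 P mA mB)); rewrite EFinD leeD.
Qed.

Lemma prob_mono (A B : set Omega) : measurable A -> measurable B -> A `<=` B ->
  (P A <= P B)%E.
Proof. by move=> mA mB AB; apply: le_measure; rewrite ?inE. Qed.

Lemma cvg_probD Y Y' X X' : cvg_prob Y X -> cvg_prob Y' X' ->
  cvg_prob (fun k w => Y k w + Y' k w) (fun w => X w + X' w).
Proof.
move=> [mY mX cY] [mY' mX' cY']; split => [k||e e0]; try exact: measurable_funD.
have e2 : 0 < e / 2 by rewrite divr_gt0.
have [k1 H1] := cY _ e2; have [k2 H2] := cY' _ e2.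
exists (maxn k1 k2) => k; rewrite geq_max => /andP[kk1 kk2].
rewrite [X in X%:E]splitr.
apply: prob_le2 (H1 k kk1) (H2 k kk2).
- by apply: measurable_gt_norm; exact: measurable_funB.
- by apply: measurable_gt_norm; exact: measurable_funB.
- by apply: measurable_gt_norm; apply: measurable_funB; exact: measurable_funD.
move=> w /= H; apply: contrapT => /not_orP[/negP + /negP]; rewrite -!leNgt => h1 h2.
move: H; rewrite ltNge => /negP; apply.
rewrite [X in `|X|](_ : _ = (Y k w - X w) + (Y' k w - X' w)); last by ring.
by apply: le_trans (ler_normD _ _) _; lra.
Qed.

Lemma prob_bounded (f : Omega -> R) (e : R) : measurable_fun setT f -> 0 < e ->
  exists2 N : R, 0 < N & (P [set w | (N < `|f w|)%R] <= e%:E)%E.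
Proof.
move=> mf e0.
pose A n := [set w | n.+1%:R < `|f w|].
have mA n : measurable (A n) by exact: measurable_gt_norm.
have cv : P (A n) @[n --> \oo] --> P (\bigcap_n A n).
  apply: nonincreasing_cvg_mu => //.
  - by rewrite (le_lt_trans (probability_le1 P (mA 0%N)))// ltry.
  - exact: bigcap_measurable.
  - move=> m n mn; apply/subsetPset => w; apply: le_lt_trans.
    by rewrite ler_nat ltnS.
have A0 : \bigcap_n A n = set0.
  apply/seteqP; split => // w /(_ (Num.truncn `|f w|) I) /=.
  by rewrite /A/= ltNge => /negP; apply; rewrite ltW// Num.Theory.truncnS_gt.
rewrite A0 measure0 in cv.
have [n Hn] : exists n, (P (A n) <= e%:E)%E; last by exists n.+1%:R.
apply: contrapT => H.
have : (e%:E <= 0)%E.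
  apply: (closed_cvg (fun y : \bar R => (e%:E <= y)%E)) cv.
    exact: closed_ereal_le_ereal.
  apply: nearW => n; rewrite leNgt; apply/negP => /ltW Hn; apply: H.
  by exists n.
by rewrite lee_fin leNgt e0.
Qed.

Lemma cvg_probM (U : Omega -> R) Y X : measurable_fun setT U -> cvg_prob Y X ->
  cvg_prob (fun k w => U w * Y k w) (fun w => U w * X w).
Proof.
move=> mU [mY mX cY]; split => [k||e e0]; try exact: measurable_funM.
have e2 : 0 < e / 2 by rewrite divr_gt0.
have [N N0 HN] := prob_bounded mU e2.
pose e' := Num.min (e / 2) (e / N).
have e'0 : 0 < e' by rewrite lt_min e2 divr_gt0.
have [k0 H] := cY _ e'0.
exists k0 => k kk; rewrite [X in X%:E]splitr.
apply: (prob_le2 _ _ _ _ HN (le_trans (H k kk) _)).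
- exact: measurable_gt_norm.
- by apply: measurable_gt_norm; exact: measurable_funB.
- by apply: measurable_gt_norm; apply: measurable_funB; exact: measurable_funM.
- move=> w /= Hw; apply: contrapT => /not_orP[/negP + /negP]; rewrite -!leNgt => h1 h2.
  move: Hw; rewrite ltNge => /negP; apply.
  rewrite -mulrBr normrM; apply: (@le_trans _ _ (N * (e / N))).
    by rewrite ler_pM// (le_trans h2)// ge_min lexx orbT.
  by rewrite mulrCA mulfV ?gt_eqF// mulr1.
by rewrite lee_fin ge_min lexx.
Qed.

Lemma cvg_prob0 : cvg_prob (fun _ _ => 0) (fun=> 0).
Proof.
split=> [k||e e0]; try exact: measurable_cst.
exists 0%N => k _; rewrite (_ : mkset _ = set0) ?measure0 ?lee_fin ?ltW//.
by apply/seteqP; split => // w /=; rewrite subrr normr0 ltNge ltW.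
Qed.

Lemma cvg_prob_sum (I : Type) (r : seq I) (Y : I -> nat -> Omega -> R) X :
  (forall i, cvg_prob (Y i) (X i)) ->
  cvg_prob (fun k w => \sum_(i <- r) Y i k w) (fun w => \sum_(i <- r) X i w).
Proof.
move=> cY; elim: r => [|i r IH].
  rewrite (_ : (fun k w => _) = (fun _ _ => 0)); last first.
    by apply/funext => k; apply/funext => w; rewrite big_nil.
  rewrite (_ : (fun w => _) = (fun=> 0)); first exact: cvg_prob0.
  by apply/funext => w; rewrite big_nil.
rewrite (_ : (fun k w => _) = (fun k w => Y i k w + \sum_(i <- r) Y i k w)); last first.
  by apply/funext => k; apply/funext => w; rewrite big_cons.
rewrite (_ : (fun w => _) = (fun w => X i w + \sum_(i <- r) X i w)); first exact: cvg_probD.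
by apply/funext => w; rewrite big_cons.
Qed.

(** Truncate the limit at N: close to some Y k it is at most |Y k| + 1, and the
    exceptional event costs N ^+ q times a small probability.  Monotone
    convergence then removes N. *)
Lemma cvg_prob_moment Y X q (B : R) : cvg_prob Y X ->
  (forall k, intgr P (fun w => `|Y k w| ^+ q)) ->
  (forall k, expect P (fun w => `|Y k w| ^+ q) <= B) -> (0 < q)%N ->
  intgr P (fun w => `|X w| ^+ q) /\ expect P (fun w => `|X w| ^+ q) <= 2 ^+ q * B.
Proof.
move=> [mY mX cY] IY YB q0.
have mnX : measurable_fun setT (fun w => `|X w|) by exact: measurableT_comp.
apply: intgr_bound.
- exact: measurable_funX.
- by move=> w; rewrite exprn_ge0.
pose g (N : nat) w := Num.min `|X w| N%:R ^+ q.
have mg N : measurable_fun setT (g N).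
  by apply: measurable_funX; apply: measurable_minr => //; exact: measurable_cst.
have g0 N w : 0 <= g N w by rewrite exprn_ge0// le_min normr_ge0 ler0n.
have gK N : (\int[P]_w (g N w)%:E <= (2 ^+ q * B)%:E)%E.
  have Ig : intgr P (g N).
    apply: (intgr_le _ _ (intgr_cst P (N%:R ^+ q))) => // w.
    by rewrite ger0_norm// lerXn2r ?nnegrE ?le_min ?normr_ge0 ?ler0n// ge_min lexx orbT.
  rewrite expectE// lee_fin; apply/ler_addgt0Pr => eta eta0.
  pose c : R := 2 ^+ q + N%:R ^+ q.
  have c0 : 0 < c by rewrite ltr_pwDl ?exprn_gt0// exprn_ge0.
  pose e := Num.min 1 (eta / c).
  have e0 : 0 < e by rewrite lt_min ltr01 divr_gt0.
  have e1 : e <= 1 by rewrite ge_min lexx.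
  have [k0 Hk] := cY e e0; have {}Hk := Hk k0 (leqnn _).
  set E := [set w | (e < `|Y k0 w - X w|)%R] in Hk.
  have mE : measurable E by apply: measurable_gt_norm; exact: measurable_funB.
  have IE : intgr P (\1_E : Omega -> R).
    apply: (intgr_le _ _ (intgr_cst P 1)); first exact: measurable_indic.
    by move=> w; rewrite indicE; case: (w \in E); rewrite ?normr1 ?normr0.
  have EE : expect P (\1_E : Omega -> R) <= e.
    by rewrite -lee_fin -expectE// integral_indic// setIT.
  apply: (@le_trans _ _ (expect P (fun w => 2 ^+ q * (`|Y k0 w| ^+ q + e ^+ q) +
      N%:R ^+ q * (\1_E w : R)))).
    apply: expect_le => //.
      apply: intgrD; apply: intgrZ => //; apply: intgrD => //; exact: intgr_cst.
    move=> w; rewrite indicE; case: (boolP (w \in E)) => [_|/negP].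
      rewrite mulr1 (@le_trans _ _ (N%:R ^+ q))//.
        by rewrite lerXn2r ?nnegrE ?le_min ?normr_ge0 ?ler0n// ge_min lexx orbT.
      by rewrite lerDr mulr_ge0 ?exprn_ge0// addr_ge0 ?exprn_ge0// ltW.
    rewrite inE /E/= => /negP; rewrite -leNgt => YX.
    rewrite mulr0 addr0; apply: le_trans (exprD_le _ _ _) => //; last exact: ltW.
    rewrite lerXn2r ?nnegrE ?le_min ?normr_ge0 ?ler0n ?addr_ge0// ?(ltW e0)// ge_min.
    apply/orP; left; have := ler_distD (Y k0 w) (X w) 0; rewrite !subr0 distrC; lra.
  have I1 : intgr P (fun w => `|Y k0 w| ^+ q + e ^+ q) := intgrD (IY k0) (intgr_cst _ _).
  rewrite (expectD (intgrZ _ I1) (intgrZ _ IE)) (expectZ _ I1) (expectZ _ IE).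
  rewrite (expectD (IY k0) (intgr_cst _ _)) expect_cst.
  rewrite mulrDr -addrA lerD//; first by rewrite ler_wpM2l ?exprn_ge0.
  apply: (@le_trans _ _ (c * e)).
    rewrite /c mulrDl lerD//; last by rewrite ler_wpM2l// exprn_ge0.
    rewrite ler_wpM2l ?exprn_ge0// -[leRHS]expr1.
    by rewrite ler_wiXn2l// ltW.
  by rewrite mulrC -ler_pdivlMr// ge_min lexx orbT.
have cvint : (\int[P]_w (g N w)%:E)%E @[N --> \oo] --> (\int[P]_w (`|X w| ^+ q)%:E)%E.
  rewrite (_ : (fun w => (`|X w| ^+ q)%:E) = (fun w => limn (fun N => (g N w)%:E))).
    apply: cvg_monotone_convergence => //.
    - by move=> N; exact/measurable_EFinP.
    - by move=> N w _; rewrite lee_fin.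
    - move=> w _ m n mn; rewrite lee_fin lerXn2r ?nnegrE ?le_min ?normr_ge0 ?ler0n//.
      by rewrite ge_min lexx/= ge_min ler_nat mn orbT.
  apply/funext => w; apply/esym/cvg_lim => //; apply: cvg_near_cst.
  exists (Num.truncn `|X w|).+1 => // N /= XN.
  rewrite /g min_l// ltW// (lt_le_trans (Num.Theory.truncnS_gt _))// ler_nat//.
apply: (closed_cvg (fun y : \bar R => (y <= (2 ^+ q * B)%:E)%E)) cvint.
  exact: closed_ereal_ge_ereal.
exact: nearW.
Qed.

End martingale.

(** * Cadlag paths *)

Section cadlag_paths.
Context {R : realType} {n : nat}.
Variable f : R -> 'cV[R]_n.
Hypothesis cf : cadlag f.

Lemma cadlag_right t (e : R) : 0 <= t -> 0 < e -> exists2 del : R, 0 < del &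
  forall s, t <= s < t + del -> forall i, `|f s i 0 - f t i 0| < e.
Proof.
move=> t0 e0; have [rc _] := cf; have := rc t t0.
move=> /cvgrPdist_lt/(_ e e0).
rewrite /at_right near_withinE => /nbhs_ballP[del /= del0 Hdel].
exists del => // s /andP[]; rewrite le_eqVlt => /predU1P[<- _ i|ts sd i].
  by rewrite subrr normr0.
have := Hdel s; rewrite -ball_normE /= distrC ger0_norm ?subr_ge0 ?ltW//.
rewrite ltrBlDl => /(_ sd ts); apply: le_lt_trans.
rewrite distrC [leRHS]mx_normrE.
have -> : `|f t i 0 - f s i 0| = `|(f t - f s) (i, 0 : 'I_1).1 (i, 0 : 'I_1).2|.
  by rewrite /= !mxE.
exact: (le_bigmax _ (fun ij : 'I_n * 'I_1 => `|(f t - f s) ij.1 ij.2|)).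
Qed.

Lemma cadlag_left_bounded t : 0 < t -> exists2 del : R, 0 < del &
  exists M : R, forall s, t - del < s < t -> forall i, `|f s i 0| <= M.
Proof.
move=> t0; have [_ lc] := cf; have /cvg_ex[l /cvgrPdist_lt/(_ 1 ltr01)] := lc t t0.
rewrite /at_left near_withinE => /nbhs_ballP[del /= del0 Hdel].
exists del => //; exists (1 + `|l|) => s /andP[s1 s2] i.
have := Hdel s; rewrite -ball_normE /= gtr0_norm ?subr_gt0//.
rewrite ltrBlDl addrC -ltrBlDl addrC => HH; have {}HH := HH _ s2.
have {}HH : `|l - f s| < 1 by apply: HH; lra.
have : `|f s i 0| <= `|f s|.
  rewrite [leRHS]mx_normrE.
  exact: (le_bigmax _ (fun ij : 'I_n * 'I_1 => `|(f s) ij.1 ij.2|) (i, 0)).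
have := ler_distD l (f s) 0; rewrite !subr0 distrC => h1 h2.
by apply: (le_trans h2); apply: (le_trans h1); rewrite lerD2r ltW.
Qed.

(** One-sided limits bound the path near every point of a compact interval. *)
Lemma cadlag_bounded t : exists M : R, forall s, 0 <= s <= t ->
  forall i, `|f s i 0| <= M.
Proof.
have cK : near_covering `[0, t].
  by apply/compact_near_coveringP; exact: segment_compact.
have /near_covering_withinP cW := cK.
have := cW R (pinfty_nbhs R) (fun M s => forall i, `|f s i 0| <= M) _.
move=> [|M0 [_ H]].
- move=> s; rewrite /= in_itv/= => /andP[s0 st].
  have [del1 d10 H1] := cadlag_right s0 (@ltr01 R).
  have [del2 d20 [M2 H2]] : exists2 del : R, 0 < del & exists M : R,
      forall u, 0 <= u -> s - del < u < s -> forall i, `|f u i 0| <= M.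
    have [s00|sn0] := eqVneq s 0.
      by exists 1 => //; exists 0 => u u0 /andP[_]; rewrite s00 ltNge u0.
    have [|del d0 [M HM]] := @cadlag_left_bounded s; first by rewrite lt_neqAle eq_sym sn0.
    by exists del => //; exists M => u _; exact: HM.
  pose M1 := 1 + `|f s|.
  exists (ball s (Num.min del1 del2), [set M | Num.max M1 M2 < M]).
    split => /=; first by apply: nbhsx_ballx; rewrite lt_min d10.
    by exists (Num.max M1 M2); split => //; exact: num_real.
  move=> [u M] /= [su MM]; rewrite in_itv/= => /andP[u0 ut] i.
  move: su; rewrite -ball_normE /= lt_min => /andP[su1 su2].
  move: MM; rewrite gt_max => /andP[MM1 MM2].
  have [us|us] := ltP u s.
    apply: le_trans (ltW MM2); apply: H2 => //; rewrite us andbT.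
    by move: su2; rewrite gtr0_norm ?subr_gt0//; lra.
  apply: le_trans (ltW MM1).
  have fi : `|f s i 0| <= `|f s|.
    rewrite [leRHS]mx_normrE.
    exact: (le_bigmax _ (fun ij : 'I_n * 'I_1 => `|(f s) ij.1 ij.2|) (i, 0)).
  have : `|f u i 0 - f s i 0| < 1.
    apply: H1; rewrite us/=; move: su1.
    by rewrite ler0_norm ?subr_le0//; lra.
  have := ler_distD (f s i 0) (f u i 0) 0; rewrite !subr0 /M1; lra.
exists (`|M0| + 1) => s st; apply: (H (`|M0| + 1)).
  by rewrite (le_lt_trans (ler_norm _))// ltrDl.
by rewrite /= in_itv.
Qed.

End cadlag_paths.

Section joint_measurability.
Context {R : realType} {disp : measure_display} {Omega : measurableType disp}.
Context {n : nat}.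
Variable X : R -> Omega -> 'cV[R]_n.
Hypothesis rX : forall t, 0 <= t -> random_vector (X t).
Hypothesis cX : forall w, cadlag (X ^~ w).

Let pos (s : R) := Num.max s 0.

(** A right-continuous process is the limit of its values at the right
    endpoints of dyadic intervals, hence jointly measurable in (w, s). *)
Lemma process_joint_measurable i : measurable_fun setT
  (fun z : Omega * measurableTypeR R => X (Num.max z.2 0) z.1 i 0).
Proof.
pose code k (z : Omega * measurableTypeR R) : int := Num.floor (pos z.2 * 4 ^+ k).
pose Fc k (c : int) (z : Omega * measurableTypeR R) : R :=
  if 0 <= c then X ((c%:~R + 1) / 4 ^+ k) z.1 i 0 else 0.
have mpos : measurable_fun setT (fun z : Omega * measurableTypeR R => pos z.2).
  apply: measurable_maxr; last exact: measurable_cst.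
  exact: (@measurable_snd _ _ Omega (measurableTypeR R)).
apply: (@measurable_realfun.measurable_fun_cvg _ _ _ _ (fun k z => Fc k (code k z) z)).
  move=> k; apply: (measurable_countable_code (code := code k) (F := Fc k)).
    move=> c; rewrite (_ : mkset _ = setT `&`
        (fun z : Omega * measurableTypeR R => pos z.2 * 4 ^+ k) @^-1` `[c%:~R, (c + 1)%:~R[).
      have : measurable_fun setT (fun z : Omega * measurableTypeR R => pos z.2 * 4 ^+ k).
        by apply: measurable_funM => //; exact: measurable_cst.
      by apply => //; exact: measurable_itv.
    rewrite setTI; apply/seteqP; split => z /=; rewrite in_itv/=.
      by move=> <-; exact: floor_itv.
    exact: floor_def.
  move=> c; rewrite /Fc; case: (boolP (0 <= c)) => c0; last exact: measurable_cst.
  have p0 : 0 <= (c%:~R + 1) / 4 ^+ k :> R.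
    by rewrite divr_ge0 ?exprn_ge0// addr_ge0// ler0z.
  have := random_vector_coord i (rX p0).
  move=> H; exact: (measurableT_comp H measurable_fst).
move=> [w s] _ /=; set u := Num.max s 0.
have u0 : 0 <= u by rewrite /u le_max lexx orbT.
apply/cvgrPdist_lt => e e0.
have [del del0 Hdel] := cadlag_right (cX w) u0 e0.
near=> k; rewrite distrC /Fc /code /pos/= -/u.
have /andP[f1 f2] := floor_itv (u * 4 ^+ k).
have p4 : 0 < 4 ^+ k :> R by rewrite exprn_gt0.
have -> : 0 <= Num.floor (u * 4 ^+ k) by rewrite floor_ge0 mulr_ge0// ltW.
apply: Hdel; apply/andP; split.
  by rewrite ler_pdivlMr// ltW// (lt_le_trans f2)// intrD.
rewrite mulrDl div1r ler_ltD//; first by rewrite ler_pdivrMr.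
by near: k; exact: expr4_cvg0.
Unshelve. all: by end_near. Qed.

Lemma process_joint_tuple : measurable_fun setT
  (fun z : Omega * measurableTypeR R => tot (X (Num.max z.2 0) z.1)).
Proof.
apply/measurable_fun_tnthP => i.
rewrite (_ : _ \o _ = (fun z : Omega * measurableTypeR R => X (Num.max z.2 0) z.1 i 0)).
  exact: process_joint_measurable.
by apply/funext => z /=; rewrite tnth_mktuple.
Qed.

Lemma borel_process_joint (g : 'cV[R]_n -> R) : borel g -> measurable_fun setT
  (fun z : Omega * measurableTypeR R => g (X (Num.max z.2 0) z.1)).
Proof.
move=> bg; have := measurableT_comp bg process_joint_tuple.
by congr measurable_fun; apply/funext => z /=; rewrite totK.
Qed.

End joint_measurability.

Section time_integrals.
Context {R : realType} {disp : measure_display} {Omega : measurableType disp}.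
Variable P : probability Omega R.
Local Notation leb := (@lebesgue_measure R).

Lemma itv_indic_joint (u v : R) : measurable_fun setT
  (fun z : Omega * measurableTypeR R => (\1_(`[u, v] : set R) z.2 : R)).
Proof.
have m1 : measurable_fun [set: measurableTypeR R] (\1_(`[u, v] : set R) : R -> R).
  by apply: measurable_indic; exact: measurable_itv.
exact: (measurableT_comp m1 (@measurable_snd _ _ Omega (measurableTypeR R))).
Qed.

Lemma integral_itvE (f : R -> R) (u v : R) :
  (\int[leb]_(s in `[u, v]) (f s)%:E =
   \int[leb]_s (f s * (\1_(`[u, v] : set R) s : R))%:E)%E.
Proof.
rewrite integral_mkcond; apply: eq_integral => s _.
by have := congr1 (fun g => g s) (restrict_EFin f `[u, v]) => /= ->; rewrite patch_indic.
Qed.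

Lemma expect_time_integral_le (f : Omega -> R -> R) (u v B : R) : u <= v ->
  measurable_fun setT (fun z : Omega * measurableTypeR R => f z.1 z.2) ->
  (forall w s, 0 <= f w s) ->
  (forall s, u <= s <= v -> (\int[P]_w (f w s)%:E <= B%:E)%E) ->
  measurable_fun setT (fun w => (\int[leb]_(s in `[u, v]) (f w s)%:E)%E) /\
  (\int[P]_w (\int[leb]_(s in `[u, v]) (f w s)%:E) <= (B * (v - u))%:E)%E.
Proof.
move=> uv mf f0 fB.
pose h (z : Omega * measurableTypeR R) : \bar R :=
  (f z.1 z.2 * (\1_(`[u, v] : set R) z.2 : R))%:E.
have mh : measurable_fun setT h.
  by apply/measurable_EFinP; apply: measurable_funM => //; exact: itv_indic_joint.
have h0 z : (0 <= h z)%E by rewrite lee_fin mulr_ge0// indicE.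
have E w : (\int[leb]_(s in `[u, v]) (f w s)%:E = fubini_F leb h w)%E.
  exact: integral_itvE.
have -> : (fun w => (\int[leb]_(s in `[u, v]) (f w s)%:E)%E) = fubini_F leb h.
  exact/funext.
split; first exact: measurable_fun_fubini_tonelli_F.
rewrite -fubini_tonelli1// fubini_tonelli2//.
apply: (@le_trans _ _ (\int[leb]_(s in `[u, v]) B%:E)%E); last first.
  rewrite integral_cst; last exact: measurable_itv.
  rewrite /= lebesgue_measure_itv/= lte_fin; case: ltP => [_|vu].
    by rewrite -EFinB -EFinM.
  by rewrite (le_anti (introT andP (conj uv vu))) subrr mulr0 mule0.
rewrite integral_itvE; apply: ge0_le_integral => //.
- by move=> s _; apply: integral_ge0 => w _; exact: h0.
- exact: measurable_fun_fubini_tonelli_G.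
- apply/measurable_EFinP; apply: measurable_funM; first exact: measurable_cst.
  by apply: measurable_indic; exact: measurable_itv.
move=> s _; rewrite /fubini_G /h /=.
rewrite indicE; case: (boolP (s \in [set` `[u, v]])) => [|_].
  rewrite inE/= in_itv/= => suv.
  under eq_integral do rewrite mulr1.
  by rewrite mulr1; exact: fB.
under eq_integral do rewrite mulr0.
by rewrite integral0 mulr0.
Qed.

End time_integrals.

(** * The stochastic differential equation *)

(** The model at the true parameter: b and sg are the coefficients frozen there,
    K and m0 their constants of Lipschitz continuity and growth. *)
Record sde_setting {R : realType} {disp : measure_display}
    {Omega : measurableType disp} (P : probability Omega R)
    (F : R -> set_system Omega) (d r : nat) (b : 'cV[R]_d -> 'cV[R]_d)
    (sg : 'cV[R]_d -> 'M[R]_(d, r)) (Z : R -> Omega -> 'cV[R]_r)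
    (X : R -> Omega -> 'cV[R]_d) (K : R) (m0 : nat) : Prop := SdeSetting {
  ss_filtration : filtration F ;
  ss_levy : levy_process P F Z ;
  ss_momentsZ : moments_Z P Z ;
  ss_sde : sde_solution P F b sg Z X ;
  ss_momentsX : bounded_moments P X ;
  ss_K : 0 <= K ;
  ss_blip : forall i x y, `|b x i 0 - b y i 0| <= K * l1 (x - y) ;
  ss_slip : forall i k x y, `|sg x i k - sg y i k| <= K * l1 (x - y) ;
  ss_bbound : forall i x, `|b x i 0| <= K * wgt x ^+ m0 ;
  ss_sbound : forall i k x, `|sg x i k| <= K * wgt x ^+ m0 }.

Lemma exprM_le {R : realFieldType} (a b : R) : a * b <= a ^+ 2 + b ^+ 2.
Proof.
have := sqr_ge0 (a - b); have := sqr_ge0 a; have := sqr_ge0 b.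
by rewrite sqrrB mulr2n; lra.
Qed.

Lemma expr_sum_le {R : realType} (I : Type) (s : seq I) (x : I -> R) q :
  (forall i, 0 <= x i) ->
  (\sum_(i <- s) x i) ^+ q.+1 <= (2 ^+ q.+1) ^+ size s * \sum_(i <- s) x i ^+ q.+1.
Proof.
move=> x0; elim: s => [|i s IH]; first by rewrite !big_nil mulr0 expr0n.
have s0 : 0 <= \sum_(j <- s) x j by exact: sumr_ge0.
rewrite !big_cons/= [in leRHS]exprS -mulrA.
apply: le_trans (exprD_le _ _ _) _ => //; rewrite ler_wpM2l ?exprn_ge0//.
rewrite mulrDr lerD// ler_peMl ?exprn_ge0// exprn_ege1// exprn_ege1//.
by rewrite ler1n.
Qed.

Lemma sum_mul_ord {V : nmodType} (n m : nat) (f : nat -> nat -> V) : (0 < m)%N ->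
  \sum_(k < n * m) f (k %/ m)%N (k %% m)%N = \sum_(j < n) \sum_(l < m) f j l.
Proof.
move=> m0; elim: n => [|n IH]; first by rewrite mul0n !big_ord0.
rewrite mulSnr big_split_ord/= IH big_ord_recr/=; congr (_ + _).
apply: eq_bigr => l _; rewrite divnMDl// divn_small ?ltn_ord// addn0.
by rewrite modnMDl modn_small ?ltn_ord.
Qed.

Section grids.
Context {R : realType}.
Implicit Types g : nat -> R.

Lemma nth_grid g K k : g 0%N = 0 -> (k <= K)%N ->
  (0 :: mkseq (fun j => g j.+1) K)`_k = g k.
Proof. by move=> g0; case: k => [|k] kK //=; rewrite nth_mkseq. Qed.

Lemma grid_partition g K : g 0%N = 0 -> (forall k, (k < K)%N -> g k < g k.+1) ->
  itv_partition 0 (g K) (mkseq (fun j => g j.+1) K).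
Proof.
move=> g0 gg; split.
  apply/(pathP 0) => k; rewrite size_mkseq => kK.
  by rewrite nth_grid// ?nth_mkseq//; [exact: gg|exact: ltnW].
rewrite -[X in last X]g0; case: K gg => [|K] gg; first by rewrite /= g0.
by rewrite -nth_last size_mkseq nth_mkseq.
Qed.

Lemma grid_mesh g K del : g 0%N = 0 -> 0 < del ->
  (forall k, (k < K)%N -> g k.+1 - g k < del) ->
  mesh (mkseq (fun j => g j.+1) K) < del.
Proof.
move=> g0 del0 gg; apply: bigmax_lt => // k _.
have kK : (k < K)%N by rewrite -{2}(size_mkseq (fun j => g j.+1) K).
by rewrite nth_grid ?nth_mkseq//; [exact: gg|exact: ltnW].
Qed.

Lemma riemann_sum_grid {disp : measure_display} {Omega : measurableType disp}
    d r (H : R -> Omega -> 'M[R]_(d, r)) (Z : R -> Omega -> 'cV[R]_r) g K w :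
  g 0%N = 0 ->
  riemann_sum H Z (mkseq (fun j => g j.+1) K) w =
  \sum_(k < K) H (g k) w *m (Z (g k.+1) w - Z (g k) w).
Proof.
move=> g0; rewrite /riemann_sum.
set s := mkseq _ _.
rewrite -(big_mkord xpredT (fun k => H (0 :: s)`_k w *m (Z s`_k w - Z (0 :: s)`_k w))).
rewrite size_mkseq big_mkord; apply: eq_bigr => k _.
by rewrite /s nth_grid ?nth_mkseq// ltnW.
Qed.

End grids.

Section sde.
Context {R : realType} {disp : measure_display} {Omega : measurableType disp}.
Variables (P : probability Omega R) (F : R -> set_system Omega) (d r : nat).
Variables (b : 'cV[R]_d -> 'cV[R]_d) (sg : 'cV[R]_d -> 'M[R]_(d, r)).
Variables (Z : R -> Omega -> 'cV[R]_r) (X : R -> Omega -> 'cV[R]_d).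
Variables (K : R) (m0 : nat).
Hypothesis SS : sde_setting P F b sg Z X K m0.
Local Notation leb := (@lebesgue_measure R).

Lemma sde_sub_sigma t : 0 <= t -> F t `<=` measurable.
Proof. by have [_ + _] := ss_filtration SS; exact. Qed.

Lemma sde_sigma t : 0 <= t -> sigma_algebra setT (F t).
Proof. by have [+ _ _] := ss_filtration SS; exact. Qed.

Lemma sde_adapted t : 0 <= t -> vec_sigma (X t) `<=` F t.
Proof. by have [+ _ _] := ss_sde SS; exact. Qed.

Lemma sde_random_vector t : 0 <= t -> random_vector (X t).
Proof. by move=> t0; exact: subset_trans (sde_adapted t0) (sde_sub_sigma t0). Qed.

Lemma sde_cadlag w : cadlag (X ^~ w).
Proof. by have [_ + _] := ss_sde SS; exact. Qed.

Lemma sde_measurable_wrt s t f : 0 <= s -> s <= t -> borel f -> measurable_wrt (F t) (fun w => f (X s w)).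
Proof.
move=> s0 st bf; have [_ _ mono] := ss_filtration SS.
by apply: measurable_wrt_sub (mono _ _ s0 st) _; apply: measurable_wrt_borel bf; exact: sde_adapted.
Qed.

Lemma sde_measurable t f : 0 <= t -> borel f -> measurable_fun setT (fun w => f (X t w)).
Proof. by move=> t0; apply: borel_random_vector; exact: sde_random_vector. Qed.

Let lip_borel (f : 'cV[R]_d -> R) : (forall x y, `|f x - f y| <= K * l1 (x - y)) -> borel f.
Proof.
move=> lf; apply: (lipschitz_borel (C := fun _ _ => K)) => [x y|x]; first exact: lf.
by exists K.
Qed.

Lemma drift_borel i : borel (fun x => b x i 0).
Proof. by apply: lip_borel => x y; exact: (ss_blip SS). Qed.

Lemma coef_borel i k : borel (fun x => sg x i k).
Proof. by apply: lip_borel => x y; exact: (ss_slip SS). Qed.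

Lemma wgt_moment m : exists C : R, 0 <= C /\ forall t, 0 <= t ->
  intgr P (fun w => wgt (X t w) ^+ m) /\ expect P (fun w => wgt (X t w) ^+ m) <= C.
Proof.
case: m => [|m].
  exists 1; split=> // t t0; under eq_fun do rewrite expr0.
  by split; [exact: intgr_cst|rewrite expect_cst].
have /(_ m.+1%:R) := ss_momentsX SS; rewrite ltr0n => /(_ isT)[C HC].
have HE t : 0 <= t -> intgr P (fun w => enorm (X t w) ^+ m.+1) /\
    expect P (fun w => enorm (X t w) ^+ m.+1) <= C.
  move=> t0; apply: intgr_bound.
  - by apply: measurable_funX; apply: sde_measurable t0 _; exact: borel_enorm.
  - by move=> w; rewrite exprn_ge0// enorm_ge0.
  apply: le_trans (HC t t0); rewrite le_eqVlt; apply/orP; left; apply/eqP.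
  by apply: eq_integral => w _; rewrite powR_mulrn ?enorm_ge0.
have C0 : 0 <= C.
  have [_] := HE 0 (lexx 0); apply: le_trans; apply: expect_ge0 => w.
  by rewrite exprn_ge0// enorm_ge0.
exists (2 ^+ m.+1 * (1 + C)); split=> [|t t0]; first by rewrite mulr_ge0 ?exprn_ge0// addr_ge0.
have [IE EE] := HE t t0.
have le w : wgt (X t w) ^+ m.+1 <= 2 ^+ m.+1 * (1 + enorm (X t w) ^+ m.+1).
  by rewrite -[X in _ * (X + _)](expr1n _ m.+1); apply: exprD_le => //; exact: enorm_ge0.
have I2 : intgr P (fun w => 2 ^+ m.+1 * (1 + enorm (X t w) ^+ m.+1)).
  by apply: intgrZ; apply: intgrD IE; exact: intgr_cst.
have I1 : intgr P (fun w => wgt (X t w) ^+ m.+1).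
  apply: intgr_le I2.
    by apply: measurable_funX; apply: sde_measurable t0 _; exact: borel_wgt.
  by move=> w; rewrite ger0_norm ?wgtX_ge0.
split => //; apply: le_trans (expect_le I1 I2 le) _.
rewrite (expectZ _ (intgrD (intgr_cst _ _) IE)) (expectD (intgr_cst _ _) IE) expect_cst.
by rewrite ler_wpM2l ?exprn_ge0// lerD2l.
Qed.

Lemma all_moments_wgt t : 0 <= t -> all_moments P (fun w => wgt (X t w)).
Proof.
move=> t0; split=> [|m]; first by apply: sde_measurable t0 _; exact: borel_wgt.
by have [C [_ /(_ t t0)[]]] := wgt_moment m.
Qed.

Lemma all_moments_growth t f (L : R) m : 0 <= t -> borel f ->
  (forall x, `|f x| <= L * wgt x ^+ m) -> all_moments P (fun w => f (X t w)).
Proof.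
move=> t0 bf fL; apply: (all_moments_le (g := fun w => L * wgt (X t w) ^+ m)) => //.
  exact: sde_measurable.
by apply: all_momentsZ; apply: all_momentsX; exact: all_moments_wgt.
Qed.

Lemma path_integrable f (L : R) m u v w : 0 <= u -> borel f ->
  (forall x, `|f x| <= L * wgt x ^+ m) ->
  leb.-integrable `[u, v] (EFin \o (fun s => f (X s w))).
Proof.
move=> u0 bf fL.
have J := borel_process_joint sde_random_vector sde_cadlag bf.
have mf : measurable_fun `[u, v] (fun s => f (X s w)).
  apply: (eq_measurable_fun (fun s : measurableTypeR R => f (X (Num.max s 0) w))).
    move=> s; rewrite inE/= in_itv/= => /andP[us _].
    by rewrite max_l// (le_trans u0).
  apply: measurable_funTS.
  exact: (@measurable_fun_pair2 _ _ _ Omega (measurableTypeR R) _ _ w J).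
apply: measurable_bounded_integrable => //.
  by rewrite /= lebesgue_measure_itv/=; case: ifP => // _; rewrite -EFinB ltry.
have [M HM] := cadlag_bounded (sde_cadlag w) v.
have M0 : 0 <= `|M| by [].
pose N := `|L| * (1 + d%:R * `|M|) ^+ m.
exists N; split; first exact: num_real.
move=> y Ny s /=; rewrite in_itv/= => /andP[us sv].
apply: le_trans (fL _) _; apply: le_trans (ltW Ny).
apply: (@le_trans _ _ (`|L| * wgt (X s w) ^+ m)).
  by rewrite ler_wpM2r ?wgtX_ge0// ler_norm.
rewrite /N ler_wpM2l//; apply: lerXn2r.
- by rewrite nnegrE ltW// wgt_gt0.
- by rewrite nnegrE addr_ge0// mulr_ge0.
rewrite /wgt lerD2l (le_trans (enorm_le_l1 _))// /l1.
apply: (@le_trans _ _ (\sum_(i < d) `|M|)); last by rewrite sumr_const card_ord mulr_natl.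
apply: ler_sum => i _; apply: le_trans (ler_norm M).
by apply: HM; rewrite sv (le_trans u0).
Qed.

Lemma time_integral_measurable f (L : R) m t : 0 <= t -> borel f ->
  (forall x, `|f x| <= L * wgt x ^+ m) ->
  measurable_fun setT (fun w => \int[leb]_(s in `[0, t]) f (X s w)).
Proof.
move=> t0 bf fL.
have pos (g : 'cV[R]_d -> R) : borel g -> (forall x, 0 <= g x) ->
    measurable_fun setT (fun w => \int[leb]_(s in `[0, t]) g (X s w)).
  move=> bg g0.
  have mg := borel_process_joint sde_random_vector sde_cadlag bg.
  pose h (w : Omega) (s : R) := g (X (Num.max s 0) w).
  pose hE (z : Omega * measurableTypeR R) : \bar R :=
    (h z.1 z.2 * (\1_(`[0, t] : set R) z.2 : R))%:E.
  have mh : measurable_fun setT hE.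
    by apply/measurable_EFinP; apply: measurable_funM mg _; exact: itv_indic_joint.
  have mF : measurable_fun setT (fubini_F leb hE).
    by apply: measurable_fun_fubini_tonelli_F => // z; rewrite lee_fin mulr_ge0 ?g0// indicE.
  have := measurableT_comp (@fine_measurable R setT measurableT) mF.
  congr measurable_fun; apply/funext => w /=; rewrite /Rintegral; congr fine.
  rewrite -[LHS](integral_itvE (h w)); apply: eq_integral => s.
  by rewrite inE/= in_itv/= /h => /andP[s0 _]; rewrite max_l.
have mabs : borel (fun x => `|f x|) by exact: measurableT_comp bf.
have m1 := pos _ mabs (fun x => normr_ge0 _).
have m2 : measurable_fun setT (fun w => \int[leb]_(s in `[0, t]) (`|f (X s w)| - f (X s w))).
  by apply: (pos (fun x => `|f x| - f x)) => [|x]; [exact: borelB|rewrite subr_ge0 ler_norm].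
have := measurable_funB m1 m2.
congr measurable_fun; apply/funext => w /=.
have If := path_integrable t w (lexx 0) bf fL.
have Ia : leb.-integrable `[0, t] (EFin \o (fun s => `|f (X s w)|)) by exact: integrable_norm.
by rewrite RintegralB//; ring.
Qed.

Definition drift_int i t w : R := \int[leb]_(s in `[0, t]) b (X s w) i 0.

(** By the equation this is a coordinate of the stochastic integral. *)
Definition mart_part i t w : R := X t w i 0 - X 0 w i 0 - drift_int i t w.

Lemma mart_part_measurable i t : 0 <= t -> measurable_fun setT (mart_part i t).
Proof.
move=> t0; apply: measurable_funB.
  apply: measurable_funB; apply: random_vector_coord; exact: sde_random_vector.
by apply: time_integral_measurable t0 (drift_borel i) _ => x; exact: (ss_bbound SS).
Qed.

Lemma drift_shift_growth i (y : 'cV[R]_d) x :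
  `|b x i 0 - b y i 0| <= (K + `|b y i 0|) * wgt x ^+ m0.
Proof.
apply: le_trans (ler_normB _ _) _; rewrite mulrDl lerD//.
  exact: (ss_bbound SS).
by rewrite ler_peMr// wgtX_ge1.
Qed.

Lemma drift_increment i (k : R) u s w : 0 <= u -> u <= s ->
  `|drift_int i s w - drift_int i u w - (s - u) * k| <=
  \int[leb]_(v in `[u, s]) `|b (X v w) i 0 - k|.
Proof.
move=> u0 us.
have bd x : `|b x i 0| <= K * wgt x ^+ m0 := ss_bbound SS i x.
have I0s := path_integrable s w (lexx 0) (drift_borel i) bd.
have Ius := path_integrable s w u0 (drift_borel i) bd.
have mI : measurable (`[u, s] : set R) by exact: measurable_itv.
have E1 : drift_int i s w - drift_int i u w = \int[leb]_(v in `[u, s]) b (X v w) i 0.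
  rewrite /drift_int (Rintegral_itvB I0s) ?bnd_simp//.
  rewrite Rintegral_itv_obnd_cbnd//; apply: integrableS I0s => //.
  by move=> v /=; rewrite !in_itv/= => /andP[uv ->]; rewrite (le_trans u0 (ltW uv)).
have Ik : leb.-integrable `[u, s] (EFin \o (fun=> k)).
  apply: measurable_bounded_integrable => //.
    by rewrite /= lebesgue_measure_itv/=; case: ifP => // _; rewrite -EFinB ltry.
  by exists `|k|; split; [exact: num_real|move=> y /ltW ky v _].
have E2 : (s - u) * k = \int[leb]_(v in `[u, s]) k.
  rewrite Rintegral_cst//= lebesgue_measure_itv/= lte_fin mulrC; congr (_ * _).
  by case: ltP => [_|su]//=; rewrite (le_anti (introT andP (conj us su))) subrr.
rewrite E1 E2 -RintegralB//; apply: le_normr_Rintegral => //.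
by apply: (integrableB _ Ius Ik).
Qed.

(** Tonelli reduces the drift accumulated over [u, s], weighted by a variable W,
    to estimates at single times. *)
Lemma expect_drift_increment_le (W : Omega -> R) (f : 'cV[R]_d -> 'cV[R]_d -> R)
    u s (B : R) : 0 <= u -> u <= s ->
  measurable_fun setT W -> (forall w, 0 <= W w) ->
  (forall x y, 0 <= f x y) ->
  measurable_fun setT (fun z : Omega * measurableTypeR R => f (X (Num.max z.2 0) z.1) (X u z.1)) ->
  (forall w, leb.-integrable `[u, s] (EFin \o (fun v => f (X v w) (X u w)))) ->
  (forall v, u <= v <= s -> intgr P (fun w => W w * f (X v w) (X u w)) /\
     expect P (fun w => W w * f (X v w) (X u w)) <= B) ->
  intgr P (fun w => W w * \int[leb]_(v in `[u, s]) f (X v w) (X u w)) /\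
  expect P (fun w => W w * \int[leb]_(v in `[u, s]) f (X v w) (X u w)) <= B * (s - u).
Proof.
move=> u0 us mW W0 f0 mf If fB.
pose h (w : Omega) (v : R) := W w * f (X (Num.max v 0) w) (X u w).
have mh : measurable_fun setT (fun z : Omega * measurableTypeR R => h z.1 z.2).
  apply: measurable_funM mf.
  exact: (measurableT_comp mW (@measurable_fst _ _ Omega (measurableTypeR R))).
have h0 w v : 0 <= h w v by rewrite mulr_ge0.
have hE v w : u <= v -> h w v = W w * f (X v w) (X u w).
  by move=> uv; rewrite /h max_l// (le_trans u0).
have hB v : u <= v <= s -> (\int[P]_w (h w v)%:E <= B%:E)%E.
  move=> /andP[uv vs]; under eq_integral do rewrite hE//.
  by have [I E] := fB v (introT andP (conj uv vs)); rewrite expectE// lee_fin.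
have [m1 m2] := expect_time_integral_le us mh h0 hB.
have E w : (\int[leb]_(v in `[u, s]) (h w v)%:E =
    (W w * \int[leb]_(v in `[u, s]) f (X v w) (X u w))%:E)%E.
  transitivity (\int[leb]_(v in `[u, s]) ((W w)%:E * (f (X v w) (X u w))%:E))%E.
    by apply: eq_integral => v; rewrite inE/= in_itv/= => /andP[uv _]; rewrite hE// EFinM.
  have mI : measurable (`[u, s] : set R) by exact: measurable_itv.
  rewrite integralZl//; last exact: If.
  by rewrite EFinM /Rintegral fineK//; apply: integrable_fin_num => //; exact: If.
have E' : (fun w => (\int[leb]_(v in `[u, s]) (h w v)%:E)%E) = EFin \o
    (fun w => W w * \int[leb]_(v in `[u, s]) f (X v w) (X u w)) by exact/funext.
apply: intgr_bound.
- by apply/measurable_EFinP; rewrite -E'.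
- by move=> w; rewrite mulr_ge0// Rintegral_ge0.
- by apply: le_trans m2; rewrite le_eqVlt; apply/orP; left; apply/eqP;
    apply: eq_integral => w _; rewrite E.
Qed.

Let incZ a s t w : R := Z t w a 0 - Z s w a 0.

Definition riemann i u del m w : R :=
  \sum_(l < m) \sum_a sg (X (u + l%:R * del) w) i a *
    incZ a (u + l%:R * del) (u + l.+1%:R * del) w.

Lemma riemann_measurable i u del m : 0 <= u -> 0 <= del ->
  measurable_fun setT (riemann i u del m).
Proof.
move=> u0 del0; apply: measurable_sum => l; apply: measurable_sum => a.
have t0 k : 0 <= u + k%:R * del by rewrite addr_ge0// mulr_ge0.
apply: measurable_funM; first exact: (sde_measurable (t0 _) (coef_borel i a)).
apply: (levy_inc_measurable a (ss_filtration SS) (ss_levy SS)) => //.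
by rewrite lerD2l ler_wpM2r// ler_nat.
Qed.

(** The integrals up to u and up to u + h are limits of sums along partitions
    that coincide on [0, u]; the difference is a sum over [u, u + h] only. *)
Lemma riemann_cvg_prob i u h : 0 <= u -> 0 < h ->
  cvg_prob P (fun m w => riemann i u (h / m.+1%:R) m.+1 w)
    (fun w => mart_part i (u + h) w - mart_part i u w).
Proof.
move=> u0 h0; split=> [m||e e0].
- by apply: riemann_measurable => //; rewrite divr_ge0// ltW.
- apply: measurable_funB; apply: mart_part_measurable => //.
  by rewrite addr_ge0// ltW.
have e2 : 0 < e / 2 by rewrite divr_gt0.
have uh0 : 0 <= u + h by rewrite addr_ge0// ltW.
have [_ _ SI] := ss_sde SS.
have [d1 d10 H1] := SI u u0 (e / 2) e2.
have [d2 d20 H2] := SI (u + h) uh0 (e / 2) e2.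
pose del := Num.min d1 d2; have del0 : 0 < del by rewrite lt_min d10.
pose N := if u == 0 then 0%N else (Num.truncn (u / del)).+1.
have uN : u != 0 -> 0 < N%:R :> R /\ u / N%:R < del.
  move=> un; rewrite /N (negbTE un); split=> //.
  by rewrite ltr_pdivrMr// mulrC -ltr_pdivrMr// Num.Theory.truncnS_gt.
exists (Num.truncn (h / del)) => m mm.
have dm0 : 0 < h / m.+1%:R by rewrite divr_gt0.
have dm : h / m.+1%:R < del.
  rewrite ltr_pdivrMr// mulrC -ltr_pdivrMr//.
  by rewrite (lt_le_trans (Num.Theory.truncnS_gt _))// ler_nat.
pose g k : R := if (k <= N)%N then k%:R * (u / N%:R) else u + (k - N)%:R * (h / m.+1%:R).
have g0 : g 0%N = 0 by rewrite /g leq0n mul0r.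
have gN : g N = u.
  rewrite /g leqnn; have [u00|un] := eqVneq u 0; first by rewrite u00 mul0r mulr0.
  by have [Np _] := uN un; rewrite mulrCA mulfV ?gt_eqF// mulr1.
have gR l : g (N + l)%N = u + l%:R * (h / m.+1%:R).
  case: l => [|l]; first by rewrite addn0 gN mul0r addr0.
  by rewrite /g leqNgt -addn1 leq_add2l/= addKn.
have gL k : (k <= N)%N -> g k = k%:R * (u / N%:R) by rewrite /g => ->.
have gd k : g k.+1 - g k = if (k < N)%N then u / N%:R else h / m.+1%:R.
  case: ltnP => kN.
    by rewrite !gL// 1?ltnW// -mulrBl -natrB// subSnn mul1r.
  by rewrite -(subnKC kN) -addnS !gR -natr1; ring.
have stepN k : (k < N)%N -> 0 < u / N%:R < del.
  move=> kN; have un : u != 0 by apply: contraTneq kN => u00; rewrite /N u00 eqxx.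
  have [Np ->] := uN un; rewrite andbT divr_gt0// lt_neqAle eq_sym un//.
have gpos k : 0 < g k.+1 - g k.
  by rewrite gd; case: ifP => [/stepN/andP[]|].
have gdel k : g k.+1 - g k < del.
  by rewrite gd; case: ifP => [/stepN/andP[]|].
have part k : itv_partition 0 (g k) (mkseq (fun j => g j.+1) k).
  by apply: grid_partition => // j _; rewrite -subr_gt0.
have meshk k : mesh (mkseq (fun j => g j.+1) k) < del by apply: grid_mesh.
have md1 : mesh (mkseq (fun j => g j.+1) N) < d1.
  by rewrite (lt_le_trans (meshk _))// ge_min lexx.
have md2 : mesh (mkseq (fun j => g j.+1) (N + m.+1)) < d2.
  by rewrite (lt_le_trans (meshk _))// ge_min lexx orbT.
have p1 := part N; rewrite gN in p1.
have p2 := part (N + m.+1)%N; rewrite gR mulrCA mulfV ?gt_eqF// mulr1 in p2.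
have {}H1 := H1 _ p1 md1; have {}H2 := H2 _ p2 md2.
have gge k : 0 <= g k.
  by have := itv_partition_le (part k).
pose Rs k w := riemann_sum (fun t w => sg (X t w)) Z (mkseq (fun j => g j.+1) k) w.
have RsE k w j : Rs k w j 0 = \sum_(l < k) \sum_a sg (X (g l) w) j a * incZ a (g l) (g l.+1) w.
  rewrite /Rs riemann_sum_grid// summxE; apply: eq_bigr => l _; rewrite mxE.
  by apply: eq_bigr => a _; rewrite !mxE.
have mRs k j : measurable_fun setT (fun w => Rs k w j 0).
  under eq_fun do rewrite RsE.
  apply: measurable_sum => l; apply: measurable_sum => a; apply: measurable_funM.
    exact: (sde_measurable (gge l) (coef_borel j a)).
  by apply: (levy_inc_measurable a (ss_filtration SS) (ss_levy SS)) => //; rewrite -subr_ge0 ltW.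
pose Iv t w : 'cV[R]_d := X t w - X 0 w - \col_j \int[leb]_(s in `[0, t]) b (X s w) j 0.
have IvE t w j : Iv t w j 0 = mart_part j t w by rewrite /Iv !mxE.
have mdiff k t : 0 <= t -> measurable_fun setT (fun w => enorm (Rs k w - Iv t w)).
  move=> t0; apply: borel_random_vector borel_enorm.
  apply/vec_sigmaP => B mB.
  have : measurable_fun setT (fun w => tot (Rs k w - Iv t w)).
    apply/measurable_fun_tnthP => j.
    rewrite (_ : _ \o _ = fun w => Rs k w j 0 - mart_part j t w).
      by apply: measurable_funB => //; exact: mart_part_measurable.
    by apply/funext => w /=; rewrite tnth_mktuple mxE [(- _ : 'cV__) j 0]mxE IvE.
  by move=> /(_ measurableT B mB); rewrite setTI.
pose A1 := [set w | e / 2 < enorm (Rs N w - Iv u w)].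
pose A2 := [set w | e / 2 < enorm (Rs (N + m.+1)%N w - Iv (u + h) w)].
have {}H1 : (P A1 <= (e / 2)%:E)%E := H1.
have {}H2 : (P A2 <= (e / 2)%:E)%E := H2.
have mA1 : measurable A1 by apply: measurable_gt_set; exact: mdiff.
have mA2 : measurable A2 by apply: measurable_gt_set; exact: mdiff.
rewrite [X in X%:E]splitr.
apply: (prob_le2 mA1 mA2 _ _ H1 H2).
  apply: measurable_gt_norm; apply: measurable_funB.
    by apply: riemann_measurable => //; exact: ltW.
  by apply: measurable_funB; exact: mart_part_measurable.
move=> w He.
have [h1|h1] := ltP (e / 2) (enorm (Rs N w - Iv u w)).
  exact: (or_introl (h1 : A1 w)).
have [h2|h2] := ltP (e / 2) (enorm (Rs (N + m.+1)%N w - Iv (u + h) w)).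
  exact: (or_intror (h2 : A2 w)).
exfalso; move: He; apply/negP; rewrite -leNgt.
have dE k t : (Rs k w - Iv t w) i 0 = Rs k w i 0 - mart_part i t w.
  by rewrite mxE [(- _ : 'cV__) i 0]mxE IvE.
have := le_trans (coord_le_enorm _ i) h1; rewrite dE => c1.
have := le_trans (coord_le_enorm _ i) h2; rewrite dE => c2.
have -> : riemann i u (h / m.+1%:R) m.+1 w = Rs (N + m.+1)%N w i 0 - Rs N w i 0.
  rewrite !RsE big_split_ord/= [X in _ = X - _]addrC addrK; apply: eq_bigr => l _.
  by apply: eq_bigr => a _; rewrite -addnS !gR.
rewrite (_ : _ - _ = (Rs (N + m.+1)%N w i 0 - mart_part i (u + h) w) - (Rs N w i 0 - mart_part i u w)); last by ring.
apply: (le_trans (ler_normB _ _)); apply: (le_trans (lerD c2 c1)).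
by rewrite -splitr.
Qed.

End sde.

(** * Moments of the residuals *)

Section increments.
Context {R : realType} {disp : measure_display} {Omega : measurableType disp}.
Variables (P : probability Omega R) (F : R -> set_system Omega) (d r : nat).
Variables (b : 'cV[R]_d -> 'cV[R]_d) (sg : 'cV[R]_d -> 'M[R]_(d, r)).
Variables (Z : R -> Omega -> 'cV[R]_r) (X : R -> Omega -> 'cV[R]_d).
Variables (K : R) (m0 : nat).
Hypothesis SS : sde_setting P F b sg Z X K m0.
Local Notation leb := (@lebesgue_measure R).
Local Notation mart_part := (mart_part b X).
Local Notation drift_int := (drift_int b X).

Let incZ a s t w : R := Z t w a 0 - Z s w a 0.

Let even_abs q (y : R) : `|y| ^+ q.*2 = y ^+ q.*2.
Proof. by rewrite -mul2n !exprM real_normK ?num_real. Qed.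

Lemma expect_weight_product m m' q : exists C : R, 0 <= C /\ forall s t (L : R)
    (f : Omega -> R), 0 <= s -> 0 <= t -> 0 <= L -> all_moments P f ->
  (forall w, `|f w| <= L * (wgt (X s w) ^+ m * wgt (X t w) ^+ m')) ->
  expect P (fun w => `|f w| ^+ q) <= L ^+ q * C.
Proof.
have [C1 [C10 H1]] := wgt_moment SS (m * 2 * q).
have [C2 [C20 H2]] := wgt_moment SS (m' * 2 * q).
exists (2 ^+ q * (C1 + C2)); split; first by rewrite mulr_ge0 ?exprn_ge0// addr_ge0.
move=> s t L f s0 t0 L0 Lf fL.
have [I1 E1] := H1 s s0; have [I2 E2] := H2 t t0.
have I3 := intgrZ (L ^+ q) (intgrZ (2 ^+ q) (intgrD I1 I2)).
apply: (le_trans (expect_le (all_moments_intgr_normX q Lf) I3 _)).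
  move=> w; apply: (@le_trans _ _ ((L * (wgt (X s w) ^+ (m * 2) + wgt (X t w) ^+ (m' * 2))) ^+ q)).
    apply: lerXn2r; rewrite ?nnegrE//.
      by rewrite mulr_ge0// addr_ge0 ?wgtX_ge0.
    apply: (le_trans (fL w)); rewrite ler_wpM2l// [in leRHS]exprM [X in _ + X]exprM.
    exact: exprM_le.
  rewrite exprMn ler_wpM2l ?exprn_ge0//.
  apply: le_trans (exprD_le _ _ _) _; rewrite ?wgtX_ge0//.
  by rewrite -!exprM.
rewrite (expectZ _ (intgrZ _ (intgrD I1 I2))) (expectZ _ (intgrD I1 I2)) (expectD I1 I2).
by rewrite ler_wpM2l ?exprn_ge0// ler_wpM2l ?exprn_ge0// lerD.
Qed.

(** Moments of order Q = 2 (q + 1) of weighted sums of increments of the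
    stochastic integral.  The bound is proved for left-point sums on finer and
    finer grids, which are discrete martingale transforms of the driving
    process, and survives the limit in probability. *)
Lemma integral_moment q m : exists A : R, 0 <= A /\
  forall (u h L s : R) (n : nat) (g : nat -> 'I_d -> 'cV[R]_d -> R),
  0 <= u -> 0 < h <= 1 -> 0 <= L -> (forall j i, borel (g j i)) ->
  (forall j i x, `|g j i x| <= L * wgt x ^+ m) -> 1 <= s -> n%:R * h <= s ^+ 2 ->
  let Y w := \sum_(j < n) \sum_i g j i (X (u + j%:R * h) w) *
    (mart_part i (u + j.+1%:R * h) w - mart_part i (u + j%:R * h) w) in
  intgr P (fun w => `|Y w| ^+ q.+1.*2) /\
  expect P (fun w => `|Y w| ^+ q.+1.*2) <= A * L ^+ q.+1.*2 * (n%:R * h) * s ^+ q.*2.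
Proof.
set Q := q.+1.*2.
have /choice[Am HAm] a : exists A : R, 0 <= A /\
  forall (G : nat -> set_system Omega) (H D : nat -> Omega -> R) (t : nat -> R)
    (s B : R) (N : nat),
  (forall k, sigma_algebra setT (G k)) -> (forall k, G k `<=` measurable) ->
  (forall k, G k `<=` G k.+1) -> (forall k, t k <= t k.+1) ->
  (forall k, measurable_wrt (G k) (H k)) -> (forall k, all_moments P (H k)) ->
  (forall k, 0 <= t k) -> (forall k, G k = F (t k)) ->
  (forall k, t k.+1 <= t k + 1) -> (forall k, D k = incZ a (t k) (t k.+1)) ->
  (forall k, expect P (fun w => `|H k w| ^+ Q) <= B) ->
  1 <= s -> t N - t 0%N <= s ^+ 2 ->
  expect P (fun w => (\sum_(k < N) H k w * D k w) ^+ Q) <=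
    A * B * (t N - t 0%N) * s ^+ q.*2.
  have [C [C0 HC]] := levy_increment_moments a (ss_filtration SS) (ss_levy SS) (ss_momentsZ SS).
  have [A [A0 HA]] := martingale_moment P q C0.
  exists A; split => // G H D t s B N sG mG GG tt GH LH t0 GE t1 DE.
  have W k : t k <= t k.+1 <= t k + 1 by rewrite tt t1.
  apply: HA => // k.
  - rewrite DE GE; exact: (levy_inc_measurable_wrt a (ss_filtration SS) (ss_levy SS)).
  - by rewrite DE; have [] := HC _ _ (t0 k) (W k).
  - by rewrite DE; have [] := HC _ _ (t0 k) (W k).
  - by move=> i i2; rewrite DE; have [_ _] := HC _ _ (t0 k) (W k); apply.
  - move=> U; rewrite GE DE.
    apply: (levy_inc_indep a (ss_levy SS) (t0 k) (tt k)).
have [CB [CB0 HCB]] := expect_weight_product m m0 Q.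
pose A := 2 ^+ Q * ((2 ^+ Q) ^+ r * (\sum_a Am a) * ((d%:R * K) ^+ Q * CB)).
have Am0 a : 0 <= Am a by have [] := HAm a.
have K0 := ss_K SS.
exists A; split.
  have S0 : 0 <= \sum_a Am a by exact: sumr_ge0.
  by rewrite /A; apply: mulr_ge0; rewrite ?exprn_ge0//; apply: mulr_ge0; apply: mulr_ge0;
    rewrite // ?exprn_ge0// ?exprn_ge0// mulr_ge0.
move=> u h L s n g u0 /andP[h0 h1] L0 bg gL s1 nh Y.
have nh0 : 0 <= n%:R * h by rewrite mulr_ge0// ltW.
have t0 (k : nat) (e : R) : 0 <= e -> 0 <= u + k%:R * e by move=> e0; rewrite addr_ge0// mulr_ge0.
pose Rk k w := \sum_(j < n) \sum_i g j i (X (u + j%:R * h) w) *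
  riemann sg Z X i (u + j%:R * h) (h / k.+1%:R) k.+1 w.
have cR : cvg_prob P Rk Y.
  apply: cvg_prob_sum => j; apply: cvg_prob_sum => i; apply: cvg_probM.
    exact: (sde_measurable SS (t0 _ _ (ltW h0)) (bg j i)).
  have -> : u + j.+1%:R * h = u + j%:R * h + h by rewrite -natr1; ring.
  exact: (riemann_cvg_prob SS i (t0 j _ (ltW h0)) h0).
have gLall j i k : all_moments P (fun w => g j i (X (u + k%:R * h) w)).
  exact: (all_moments_growth SS (t0 _ _ (ltW h0)) (bg j i) (gL j i)).
pose B := L ^+ Q * ((d%:R * K) ^+ Q * CB).
have main k : all_moments P (Rk k) /\ expect P (fun w => `|Rk k w| ^+ Q) <=
    (2 ^+ Q) ^+ r * (\sum_a Am a) * B * (n%:R * h) * s ^+ q.*2.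
  pose N := k.+1; pose del := h / N%:R.
  have N0 : 0 < N%:R :> R by [].
  have del0 : 0 < del by rewrite divr_gt0.
  have del1 : del <= 1.
    by rewrite ler_pdivrMr// mul1r (le_trans h1)// ler1n.
  pose t (j : nat) := u + j%:R * del.
  have tS j : t j.+1 = t j + del by rewrite /t -natr1; ring.
  have tge j : 0 <= t j by exact: t0 (ltW del0).
  have Ndel : N%:R * del = h by rewrite /del mulrCA mulfV ?mulr1// gt_eqF.
  have tE j l : u + j%:R * h + l%:R * del = t (j * N + l)%N.
    by rewrite /t natrD natrM -Ndel; ring.
  pose H a j w := \sum_i g (j %/ N)%N i (X (u + (j %/ N)%N%:R * h) w) * sg (X (t j) w) i a.
  pose D a j w := incZ a (t j) (t j.+1) w.
  have LH a j : all_moments P (H a j).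
    apply: all_moments_sum => i; apply: all_momentsM => //.
    exact: (all_moments_growth SS (tge j) (coef_borel SS i a) (ss_sbound SS i a)).
  have RE w : Rk k w = \sum_a \sum_(j < n * N) H a j w * D a j w.
    rewrite exchange_big/=.
    pose f j l := \sum_a (\sum_i g j i (X (u + j%:R * h) w) *
      sg (X (t (j * N + l)%N) w) i a) * D a (j * N + l)%N w.
    transitivity (\sum_(j < n) \sum_(l < N) f j l); last first.
      rewrite -sum_mul_ord//; apply: eq_bigr => j _; rewrite /f /H -divn_eq.
      by [].
    apply: eq_bigr => j _; rewrite /f.
    under eq_bigr do rewrite /riemann mulr_sumr.
    rewrite exchange_big/=; apply: eq_bigr => l _.
    under eq_bigr do rewrite mulr_sumr.
    rewrite exchange_big/=; apply: eq_bigr => a _.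
    rewrite mulr_suml; apply: eq_bigr => i _.
    by rewrite mulrA /D /incZ -addnS -!tE.
  have dN j : (j %/ N)%N%:R * h <= j%:R * del.
    by rewrite -Ndel mulrA -natrM; apply: ler_wpM2r; rewrite ?(ltW del0)// ler_nat leq_divM.
  have HB a j : expect P (fun w => `|H a j w| ^+ Q) <= B.
    have -> : B = (L * (d%:R * K)) ^+ Q * CB by rewrite /B (exprMn _ L) mulrA.
    apply: (HCB (u + (j %/ N)%N%:R * h) (t j)) => //.
    - exact: t0 (ltW h0).
    - by rewrite !mulr_ge0.
    move=> w; rewrite /H; apply: le_trans (ler_norm_sum _ _ _) _.
    apply: (@le_trans _ _ (\sum_(i < d) L * K * (wgt (X (u + (j %/ N)%N%:R * h) w) ^+ m *
        wgt (X (t j) w) ^+ m0))); last first.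
      by rewrite sumr_const card_ord -mulr_natl; rewrite le_eqVlt; apply/orP; left; apply/eqP; ring.
    apply: ler_sum => i _; rewrite normrM mulrACA ler_pM//; exact: (ss_sbound SS).
  have EM a : expect P (fun w => (\sum_(j < n * N) H a j w * D a j w) ^+ Q) <=
      Am a * B * (n%:R * h) * s ^+ q.*2.
    have [_ HA] := HAm a.
    have tT : t (n * N)%N - t 0%N = n%:R * h.
      by rewrite /t natrM -mulrA Ndel mul0r addr0 addrC addKr.
    rewrite -tT; apply: (HA (fun j => F (t j))) => //; last by rewrite tT.
    - by move=> j; exact: (sde_sigma SS).
    - by move=> j; exact: (sde_sub_sigma SS).
    - move=> j; have [_ _ mono] := ss_filtration SS; apply: mono => //.
      by rewrite tS lerDl ltW.
    - by move=> j; rewrite tS lerDl ltW.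
    - move=> j; apply: measurable_wrt_sum; first exact: (sde_sigma SS).
      move=> i; apply: measurable_wrtM; first exact: (sde_sigma SS).
        apply: (sde_measurable_wrt SS _ _ (bg _ _)); first exact: t0 (ltW h0).
        by rewrite lerD2l.
      exact: (sde_measurable_wrt SS (tge j) (lexx _) (coef_borel SS i a)).
    - by move=> j; rewrite tS lerD2l.
  have LD a j : all_moments P (D a j).
    have [C [C0 HC]] := levy_increment_moments a (ss_filtration SS) (ss_levy SS) (ss_momentsZ SS).
    have [] // := HC (t j) (t j.+1) (tge j).
    by rewrite tS lerDl (ltW del0) lerD2l.
  have LM a : all_moments P (fun w => \sum_(j < n * N) H a j w * D a j w).
    by apply: all_moments_sum => j; exact: all_momentsM.
  have LR : all_moments P (Rk k).
    by rewrite (_ : Rk k = fun w => \sum_a \sum_(j < n * N) H a j w * D a j w);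
      [exact: all_moments_sum|exact/funext].
  split => //.
  apply: (@le_trans _ _ (expect P (fun w => (2 ^+ Q) ^+ r *
      \sum_a (\sum_(j < n * N) H a j w * D a j w) ^+ Q))).
    apply: expect_le.
    - exact: all_moments_intgr_normX.
    - by apply: intgrZ; apply: intgr_sum => a; exact: all_moments_intgrX.
    move=> w; rewrite RE.
    apply: (@le_trans _ _ ((\sum_a `|\sum_(j < n * N) H a j w * D a j w|) ^+ Q)).
      by apply: lerXn2r; rewrite ?nnegrE ?sumr_ge0// ler_norm_sum.
    apply: le_trans (expr_sum_le _ _ _) _ => //.
    have sr : size (index_enum 'I_r) = r by rewrite -[RHS]card_ord cardT enumT.
    rewrite sr ler_wpM2l ?exprn_ge0//.
    by apply: ler_sum => a _; rewrite le_eqVlt; apply/orP; left; apply/eqP; exact: (even_abs q.+1).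
  have IS : intgr P (fun w => \sum_a (\sum_(j < n * N) H a j w * D a j w) ^+ Q).
    by apply: intgr_sum => a; exact: all_moments_intgrX.
  rewrite (expectZ _ IS) expect_sum; last by move=> a; exact: all_moments_intgrX.
  apply: (@le_trans _ _ ((2 ^+ Q) ^+ r * \sum_a Am a * B * (n%:R * h) * s ^+ q.*2)).
    by rewrite ler_wpM2l ?exprn_ge0//; apply: ler_sum => a _; exact: EM.
  by rewrite -!mulr_suml !mulrA.
have [||] := cvg_prob_moment cR _ (fun k => proj2 (main k)).
- by move=> k; apply: all_moments_intgr_normX; exact: (proj1 (main k)).
- by [].
move=> IY EY; split => //; apply: le_trans EY _.
by rewrite /A /B; rewrite le_eqVlt; apply/orP; left; apply/eqP; ring.
Qed.

Let intB i u v w : R := \int[leb]_(s in `[u, v]) `|b (X s w) i 0 - 0|.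

Let drift_gap_borel i k : borel (fun x : 'cV[R]_d => `|b x i 0 - k|).
Proof.
have H := borelB (drift_borel SS i) (borel_cst (n := d) k).
exact: (measurableT_comp (@normr_measurable R setT) H).
Qed.

Lemma weighted_drift_le m : exists C : R, 0 <= C /\ forall i u v, 0 <= u -> u <= v ->
  intgr P (fun w => wgt (X u w) ^+ m * intB i u v w) /\
  expect P (fun w => wgt (X u w) ^+ m * intB i u v w) <= C * (v - u).
Proof.
have K0 := ss_K SS.
have [C [C0 HC]] := expect_weight_product m m0 1.
exists (K * C); split; first exact: mulr_ge0.
move=> i u v u0 uv.
have H := expect_drift_increment_le (W := fun w => wgt (X u w) ^+ m)
  (f := fun x _ => `|b x i 0 - 0|) (B := K * C) u0 uv.
apply: H.
- by apply: measurable_funX; apply: (sde_measurable SS) => //; exact: borel_wgt.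
- by move=> w; rewrite wgtX_ge0.
- by [].
- apply: (borel_process_joint (sde_random_vector SS) (sde_cadlag SS)
    (g := fun x => `|b x i 0 - 0|)).
  exact: drift_gap_borel.
- move=> w; apply: (path_integrable SS (L := K) (m := m0) (f := fun x => `|b x i 0 - 0|)) => //.
  by move=> x; rewrite normr_id subr0; exact: (ss_bbound SS).
move=> s /andP[us sv]; have s0 := le_trans u0 us.
have L : all_moments P (fun w => wgt (X u w) ^+ m * `|b (X s w) i 0 - 0|).
  apply: all_momentsM; first by apply: all_momentsX; exact: (all_moments_wgt SS).
  apply: all_moments_norm; apply: (all_moments_growth SS (L := K) (m := m0) (f := fun x => b x i 0 - 0)) => //.
    exact: (borelB (drift_borel SS i) (borel_cst (n := d) 0)).
  by move=> x; rewrite subr0; exact: (ss_bbound SS).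
split; first exact: all_moments_intgr.
have := HC u s K _ u0 s0 K0 L; rewrite expr1 => H.
apply: le_trans (H _).
  rewrite le_eqVlt; apply/orP; left; apply/eqP; congr expect; apply/funext => w.
  by rewrite expr1 normrM normr_id (ger0_norm (wgtX_ge0 _ _)).
move=> w; rewrite normrM normr_id (ger0_norm (wgtX_ge0 _ _)) subr0 mulrCA ler_wpM2l ?wgtX_ge0//.
exact: (ss_bbound SS).
Qed.

(** The second moment of an increment over a time h is of order h, whence the
    rate h^(1/2); Young's inequality with weight h^(1/2) separates the
    polynomial factor. *)
Lemma weighted_mart_le m : exists C : R, 0 <= C /\ forall i u h, 0 <= u -> 0 < h <= 1 ->
  let f w := wgt (X u w) ^+ m * `|mart_part i (u + h) w - mart_part i u w| in
  intgr P f /\ expect P f <= C * Num.sqrt h.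
Proof.
have [A [A0 HA]] := integral_moment 0 0.
have [C [C0 HC]] := wgt_moment SS (m * 2).
exists (C + A); split; first exact: addr_ge0.
move=> i u h u0 h01 f; have /andP[h0 h1] := h01.
pose g (j : nat) (k : 'I_d) (x : 'cV[R]_d) : R := (k == i)%:R.
have := HA u h 1 1 1%N g u0 h01 ler01.
rewrite !mul1r expr1n => /(_ _ _ (lexx _) h1) [||IY EY].
- by move=> j k; exact: borel_cst.
- by move=> j k x; rewrite expr0 mulr1 /g; case: eqP => _; rewrite ?normr0 ?normr1.
have YE w : \sum_(j < 1) \sum_k g j k (X (u + j%:R * h) w) *
    (mart_part k (u + j.+1%:R * h) w - mart_part k (u + j%:R * h) w) =
    mart_part i (u + h) w - mart_part i u w.
  rewrite big_ord1/= (bigD1 i)//= big1 => [|k ki]; last by rewrite /g (negPf ki) mul0r.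
  by rewrite /g eqxx mul1r mul0r mul1r !addr0.
have E2 : (fun w => `|\sum_(j < 1) \sum_k g j k (X (u + j%:R * h) w) *
    (mart_part k (u + j.+1%:R * h) w - mart_part k (u + j%:R * h) w)| ^+ 2) =
    (fun w => (mart_part i (u + h) w - mart_part i u w) ^+ 2).
  by apply/funext => w; rewrite YE real_normK ?num_real.
rewrite [X in intgr P X]E2 in IY; rewrite [X in expect P X]E2 in EY.
have [IW EW] := HC u u0.
set rho := Num.sqrt h; have rho0 : 0 < rho by rewrite sqrtr_gt0.
have rr : rho * rho = h by rewrite -expr2 sqr_sqrtr// ltW.
have ID := intgrD (intgrZ rho IW) (intgrZ rho^-1 IY).
have fle w : `|f w| <= rho * wgt (X u w) ^+ (m * 2) + rho^-1 * (mart_part i (u + h) w - mart_part i u w) ^+ 2.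
  rewrite ger0_norm; last by rewrite mulr_ge0 ?wgtX_ge0.
  rewrite /f; set y := mart_part i (u + h) w - mart_part i u w; rewrite exprM.
  set W := wgt _ ^+ m; rewrite -[y ^+ 2]real_normK ?num_real//.
  have W0 : 0 <= W by exact: wgtX_ge0.
  have := exprM_le (rho * W) `|y| => H.
  rewrite -(ler_pM2l rho0) mulrDr !mulrA mulfV ?gt_eqF// mul1r.
  by move: H; rewrite exprMn expr2 -!mulrA.
have mf : measurable_fun setT f.
  apply: measurable_funM.
    by apply: measurable_funX; apply: (sde_measurable SS) => //; exact: borel_wgt.
  apply: (measurableT_comp (@normr_measurable R setT)).
  by apply: measurable_funB; apply: (mart_part_measurable SS) => //; rewrite addr_ge0// ltW.
have If := intgr_le mf fle ID.
split => //.
apply: (le_trans (expect_le If ID (fun w => le_trans (ler_norm _) (fle w)))).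
rewrite (expectD (intgrZ rho IW) (intgrZ rho^-1 IY)) (expectZ _ IW) (expectZ _ IY).
rewrite mulrDl lerD//; first by rewrite mulrC ler_wpM2r// ltW.
rewrite ler_pdivrMl// mulrCA rr; by move: EY; rewrite /= !mulr1.
Qed.

Lemma weighted_coord_le m : exists C : R, 0 <= C /\ forall i u h, 0 <= u -> 0 < h <= 1 ->
  let f w := wgt (X u w) ^+ m * `|X (u + h) w i 0 - X u w i 0| in
  intgr P f /\ expect P f <= C * Num.sqrt h.
Proof.
have [C1 [C10 H1]] := weighted_mart_le m.
have [C2 [C20 H2]] := weighted_drift_le m.
exists (C1 + C2); split; first exact: addr_ge0.
move=> i u h u0 h01 f; have /andP[h0 h1] := h01.
have uh : u <= u + h by rewrite lerDl ltW.
have [I1 E1] := H1 i u h u0 h01; have [I2 E2] := H2 i u (u + h) u0 uh.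
have fle w : `|f w| <= wgt (X u w) ^+ m * `|mart_part i (u + h) w - mart_part i u w| +
    wgt (X u w) ^+ m * intB i u (u + h) w.
  rewrite ger0_norm; last by rewrite mulr_ge0 ?wgtX_ge0.
  rewrite -mulrDr ler_wpM2l ?wgtX_ge0//.
  have -> : X (u + h) w i 0 - X u w i 0 = (mart_part i (u + h) w - mart_part i u w) +
      (drift_int i (u + h) w - drift_int i u w).
    by rewrite /mart_part; ring.
  apply: le_trans (ler_normD _ _) _; rewrite lerD2l.
  by have := drift_increment SS i 0 w u0 uh; rewrite mulr0 subr0.
have mf : measurable_fun setT f.
  apply: measurable_funM.
    by apply: measurable_funX; apply: (sde_measurable SS) => //; exact: borel_wgt.
  apply: (measurableT_comp (@normr_measurable R setT)).
  apply: measurable_funB; apply: (sde_measurable SS (f := fun x : 'cV[R]_d => x i 0));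
    rewrite ?borel_coord//; last exact: borel_coord.
    by rewrite addr_ge0// ltW.
  exact: borel_coord.
have ID := intgrD I1 I2.
have If := intgr_le mf fle ID.
split => //.
apply: (le_trans (expect_le If ID (fun w => le_trans (ler_norm _) (fle w)))).
rewrite (expectD I1 I2) mulrDl lerD//; apply: (le_trans E2).
rewrite addrAC subrr add0r ler_wpM2l//.
have s1 : Num.sqrt h <= 1 by rewrite -sqrtr1 ler_sqrt.
by rewrite -[leLHS]sqr_sqrtr ?(ltW h0)// expr2 ler_piMl.
Qed.

(** The drift is Lipschitz, so its error over one step is a time integral of path
    increments, each of order h^(1/2). *)
Lemma drift_remainder m : exists C : R, 0 <= C /\ forall i u h, 0 <= u -> 0 < h <= 1 ->
  let f w := wgt (X u w) ^+ m *
    \int[leb]_(v in `[u, u + h]) `|b (X v w) i 0 - b (X u w) i 0| in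
  intgr P f /\ expect P f <= C * (h * Num.sqrt h).
Proof.
have K0 := ss_K SS.
have [C [C0 HC]] := weighted_coord_le m.
exists (K * (d%:R * C)); split; first by rewrite !mulr_ge0.
move=> i u h u0 h01; have /andP[h0 h1] := h01.
have uh : u <= u + h by rewrite lerDl ltW.
have -> : K * (d%:R * C) * (h * Num.sqrt h) =
    K * (d%:R * (C * Num.sqrt h)) * (u + h - u) by ring.
have bb (y : 'cV[R]_d) : borel (fun x : 'cV[R]_d => `|b x i 0 - b y i 0|).
  exact: drift_gap_borel.
have H := expect_drift_increment_le (W := fun w => wgt (X u w) ^+ m)
  (f := fun x y => `|b x i 0 - b y i 0|) (B := K * (d%:R * (C * Num.sqrt h))) u0 uh.
apply: H.
- by apply: measurable_funX; apply: (sde_measurable SS) => //; exact: borel_wgt.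
- by move=> w; rewrite wgtX_ge0.
- by [].
- apply: (measurableT_comp (@normr_measurable R setT)); apply: measurable_funB.
    exact: (borel_process_joint (sde_random_vector SS) (sde_cadlag SS) (drift_borel SS i)).
  exact: (measurableT_comp (sde_measurable SS u0 (drift_borel SS i)) measurable_fst).
- move=> w; apply: (path_integrable SS (L := K + `|b (X u w) i 0|) (m := m0)
    (f := fun x => `|b x i 0 - b (X u w) i 0|)) => //.
  by move=> x; rewrite normr_id; exact: (drift_shift_growth SS).
move=> v /andP[uv vh].
pose f w := wgt (X u w) ^+ m * `|b (X v w) i 0 - b (X u w) i 0|.
pose G w := \sum_(k < d) wgt (X u w) ^+ m * `|X v w k 0 - X u w k 0|.
have HG k : intgr P (fun w => wgt (X u w) ^+ m * `|X v w k 0 - X u w k 0|) /\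
    expect P (fun w => wgt (X u w) ^+ m * `|X v w k 0 - X u w k 0|) <= C * Num.sqrt h.
  have [vu|vu] := eqVneq v u.
    rewrite vu; rewrite (_ : (fun w => _) = cst 0); last first.
      by apply/funext => w; rewrite subrr normr0 mulr0.
    by split; [exact: intgr_cst|rewrite expect_cst mulr_ge0// sqrtr_ge0].
  have vu0 : 0 < v - u by rewrite subr_gt0 lt_neqAle eq_sym vu.
  have vuh : v - u <= h by rewrite lerBlDl.
  have [|I E] := HC k u (v - u) u0; first by rewrite vu0 (le_trans vuh).
  rewrite addrC subrK in I E; split => //; apply: (le_trans E).
  by rewrite ler_wpM2l// ler_wsqrtr.
have IG : intgr P G by apply: intgr_sum => k; exact: (proj1 (HG k)).
have fle w : `|f w| <= K * G w.
  rewrite ger0_norm; last by rewrite mulr_ge0 ?wgtX_ge0.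
  rewrite /f /G -mulr_sumr mulrCA ler_wpM2l ?wgtX_ge0//.
  apply: le_trans (ss_blip SS _ _ _) _; rewrite ler_wpM2l// /l1.
  by apply: ler_sum => k _; rewrite !mxE.
have v0 := le_trans u0 uv.
have mf : measurable_fun setT f.
  apply: measurable_funM.
    by apply: measurable_funX; apply: (sde_measurable SS) => //; exact: borel_wgt.
  apply: (measurableT_comp (@normr_measurable R setT)).
  apply: measurable_funB; apply: (sde_measurable SS _ (drift_borel SS i)) => //.
have If := intgr_le mf fle (intgrZ K IG).
split => //.
apply: (le_trans (expect_le If (intgrZ K IG) (fun w => le_trans (ler_norm _) (fle w)))).
rewrite (expectZ _ IG) ler_wpM2l// expect_sum; last by move=> k; exact: (proj1 (HG k)).
apply: (@le_trans _ _ (\sum_(k < d) C * Num.sqrt h)).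
  by apply: ler_sum => k _; exact: (proj2 (HG k)).
by rewrite sumr_const card_ord -[leLHS]mulr_natl.
Qed.

End increments.

(** * Uniform bounds over the parameter set *)

(** Points are grouped by the integer parts of their coordinates scaled by 4^k,
    and one point of D is chosen in every group that meets D: the net stays
    inside D, where the processes to be chained are defined. *)
Lemma finite_net {R : realType} p (D : set 'cV[R]_p) (B : R) :
  (forall t, D t -> forall l, `|t l 0| <= B) -> D !=set0 ->
  exists N : nat, forall k, exists net : {ffun 'I_p -> 'I_(N * 4 ^ k)} -> 'cV[R]_p,
    (forall i, D (net i)) /\
    forall t, D t -> exists i, l1 (t - net i) <= p%:R / 4 ^+ k.
Proof.
move=> DB [d0 Dd0].
pose b := (Num.truncn B).+1; pose N := (b + b)%N.
exists N => k.
have k0 : 0 < 4 ^+ k :> R by rewrite exprn_gt0.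
pose code (t : 'cV[R]_p) l := Num.truncn ((t l 0 + b%:R) * 4 ^+ k).
have Bb : B < b%:R by exact: truncnS_gt.
have pos t l : D t -> 0 <= (t l 0 + b%:R) * 4 ^+ k.
  move=> Dt; apply: mulr_ge0; last exact: ltW.
  by have := DB _ Dt l; rewrite ler_norml => /andP[+ _]; move: Bb; lra.
have codeN t l : D t -> (code t l < N * 4 ^ k)%N.
  move=> Dt; rewrite -(ltr_nat R); apply: le_lt_trans (_ : (t l 0 + b%:R) * 4 ^+ k < _).
    by rewrite truncn_le pos.
  rewrite natrM natrX ltr_pM2r// /N natrD ltrD2r.
  by apply: le_lt_trans Bb; apply: le_trans (DB _ Dt l); exact: ler_norm.
pose Q (i : {ffun 'I_p -> 'I_(N * 4 ^ k)}) := [set t | D t /\ forall l, code t l = i l].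
have /choice[net Hnet] i : exists t, D t /\ ((exists t', Q i t') -> Q i t).
  have [[t Qt]|nQ] := pselect (exists t', Q i t'); last by exists d0.
  by exists t; split=> //; case: Qt.
exists net; split => [i|t Dt]; first by have [] := Hnet i.
exists [ffun l => Ordinal (codeN t l Dt)].
set i := finfun _.
have [Dn Qn] : Q i (net i).
  have [_] := Hnet i; apply; exists t; split => // l; by rewrite ffunE.
rewrite /l1; apply: (@le_trans _ _ (\sum_(l < p) (4 ^+ k)^-1)); last first.
  by rewrite sumr_const card_ord -[leLHS]mulr_natl.
apply: ler_sum => l _; rewrite !mxE.
have E : code (net i) l = code t l by rewrite Qn ffunE.
have c1 := truncn_itv (pos t l Dt); have c2 := truncn_itv (pos (net i) l Dn).
move: c2; rewrite -/(code (net i) l) E => /andP[c2 c2'].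
move: c1; rewrite -/(code t l) => /andP[c1 c1'].
have e1 : (code t l).+1%:R = (code t l)%:R + 1 :> R by rewrite natr1.
rewrite e1 in c1' c2'.
rewrite -[leRHS]mul1r ler_pdivlMr// -[X in _ * X]gtr0_norm// -normrM ler_norml.
move: c1 c1' c2 c2'; move: (4 ^+ k) (t l 0) (net i l 0) (code t l)%:R b%:R => z x y u v.
by move=> *; apply/andP; split; lra.
Qed.

Section chaining.
Context {R : realType} {disp : measure_display} {Omega : measurableType disp}.
Variable P : probability Omega R.

Lemma prob_exists_le (I : finType) (A : I -> set Omega) (c : R) :
  (forall i, measurable (A i)) -> (forall i, (P (A i) <= c%:E)%E) ->
  measurable [set w | exists i, A i w] /\
  (P [set w | exists i, A i w] <= (#|I|%:R * c)%:E)%E.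
Proof.
move=> mA Ac.
suff H (s : seq I) : measurable [set w | exists2 i, i \in s & A i w] /\
    (P [set w | exists2 i, i \in s & A i w] <= ((size s)%:R * c)%:E)%E.
  have := H (enum I); rewrite -cardE.
  rewrite (_ : [set w | _] = [set w | exists i, A i w])//.
  by apply/seteqP; split => w [i]; [exists i|exists i; rewrite ?mem_enum].
elim: s => [|i s [mS IH]].
  rewrite (_ : [set w | _] = set0); first by rewrite measure0 mul0r.
  by apply/seteqP; split => w // [].
have E : [set w | exists2 j, j \in i :: s & A j w] =
    A i `|` [set w | exists2 j, j \in s & A j w].
  apply/seteqP; split => w.
    by move=> [j]; rewrite inE => /orP[/eqP->|js Aj]; [left|right; exists j].
  by case=> [Aw|[j js Aj]]; [exists i|exists j]; rewrite ?inE ?eqxx// js orbT.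
rewrite E; split; first exact: measurableU.
have -> : (size (i :: s))%:R * c = c + (size s)%:R * c by rewrite /= -natr1; ring.
exact: (prob_le2 (mA i) mS (measurableU _ _ (mA i) mS) (@subset_refl _ _) (Ac i) IH).
Qed.

(** Kolmogorov's chaining.  At scale 4^-k the net has at most C 4^(kp) points, so
    the scales k and k + 1 produce C 16^(kp) increments, each of which exceeds
    M tau 2^-k with probability at most C (2^-k / M)^Q by Markov's inequality;
    Q = 4 p + 2 makes the sum over k converge.  The pathwise Lipschitz bound
    serves to pass to the limit along the chain. *)
Lemma chaining p (D : set 'cV[R]_p) (B A eps : R) :
  (forall t, D t -> forall l, `|t l 0| <= B) -> D !=set0 -> 0 <= A -> 0 < eps ->
  let Q := (2 * p).+1.*2 in
  exists M, 0 < M /\ forall (G : 'cV[R]_p -> Omega -> R) (tau : R), 0 < tau ->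
    (forall t, D t -> measurable_fun setT (G t)) ->
    (forall w, exists Lam, forall t t', D t -> D t' ->
      `|G t w - G t' w| <= Lam * l1 (t - t')) ->
    (forall t, D t -> intgr P (fun w => `|G t w| ^+ Q) /\
      expect P (fun w => `|G t w| ^+ Q) <= A * tau ^+ Q) ->
    (forall t t', D t -> D t' -> intgr P (fun w => `|G t w - G t' w| ^+ Q) /\
      expect P (fun w => `|G t w - G t' w| ^+ Q) <= A * (l1 (t - t') * tau) ^+ Q) ->
    exists E, [/\ measurable E, (P E <= eps%:E)%E &
      forall w, ~ E w -> forall t, D t -> `|G t w| <= M * tau].
Proof.
move=> DB D0 A0 e0 Q.
have [N HN] := finite_net DB D0.
pose net k := sval (cid (HN k)).
have Hnet k : (forall i, D (net k i)) /\
    forall t, D t -> exists i, l1 (t - net k i) <= p%:R / 4 ^+ k := svalP (cid (HN k)).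
have Q0 : (0 < Q)%N by [].
pose np := (N ^ p)%N.
pose A1 : R := np%:R * A.
pose A2 : R := np%:R * np%:R * 4 ^+ p * A * (2 * p%:R) ^+ Q.
have A10 : 0 <= A1 by rewrite mulr_ge0.
have A20 : 0 <= A2 by rewrite /A2; do ![by [] | apply: exprn_ge0 | apply: mulr_ge0].
pose M : R := 1 + 4 * (A1 + A2) / eps.
have M1 : 1 <= M by rewrite lerDl divr_ge0 ?mulr_ge0 ?addr_ge0// ltW.
have M0 : 0 < M by exact: lt_le_trans M1.
have MQ x : 0 <= x -> x <= A1 + A2 -> x / M ^+ Q <= eps / 4.
  move=> x0 xA; rewrite ler_pdivrMr ?exprn_gt0//.
  apply: (@le_trans _ _ (eps / 4 * M)); last first.
    by rewrite ler_pM2l ?divr_gt0// -[leLHS]expr1 ler_weXn2l.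
  rewrite /M mulrDr mulr1 -[leLHS]add0r lerD ?divr_ge0 ?(ltW e0)//.
  rewrite (_ : _ * _ = A1 + A2)//; field; exact: lt0r_neq0.
exists (3 * M); split; first by rewrite mulr_gt0.
move=> G tau tau0 mG LG G1 G2.
pose F0 (i : {ffun 'I_p -> 'I_(N * 4 ^ 0)}) : set Omega :=
  [set w | (M * tau) ^+ Q <= `|G (net 0%N i) w| ^+ Q].
pose near k (ij : {ffun 'I_p -> 'I_(N * 4 ^ k)} * {ffun 'I_p -> 'I_(N * 4 ^ k.+1)}) :=
  l1 (net k ij.1 - net k.+1 ij.2) <= 2 * p%:R / 4 ^+ k.
pose F k ij : set Omega := if near k ij then
  [set w | (M * tau / 2 ^+ k) ^+ Q <= `|G (net k ij.1) w - G (net k.+1 ij.2) w| ^+ Q]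
  else set0.
pose E (k : nat) : set Omega := match k with
  | 0%N => [set w | exists i, F0 i w] | k.+1 => [set w | exists ij, F k ij w] end.
have Dnet k i : D (net k i) by exact: (proj1 (Hnet k)).
have HE k : measurable (E k) /\ (P (E k) <= (eps / (2 ^ k.+1)%:R)%:E)%E.
  case: k => [|k].
    have H i : measurable (F0 i) /\ (P (F0 i) <= (A / M ^+ Q)%:E)%E.
      have [I1 E1] := G1 _ (Dnet 0%N i).
      split; first by apply: measurable_ge_set; exact: intgr_measurable I1.
      have c0 : 0 < (M * tau) ^+ Q by rewrite exprn_gt0// mulr_gt0.
      apply: (le_trans (expect_markov I1 (fun w => exprn_ge0 _ (normr_ge0 _)) c0)).
      rewrite lee_fin ler_pdivrMr// exprMn [leRHS]mulrA divfK// ?gt_eqF ?exprn_gt0//.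
    have [m1 p1] := prob_exists_le (fun i => proj1 (H i)) (fun i => proj2 (H i)).
    split => //; apply: (le_trans p1).
    rewrite card_ffun !card_ord muln1 lee_fin mulrA -/np -/A1.
    apply: (le_trans (MQ A1 A10 _)); first by rewrite lerDl.
    by rewrite ler_pM2l// lef_pV2 ?posrE// ler_nat.
  pose ck := A * (2 * p%:R) ^+ Q / M ^+ Q * (2 ^+ k / 4 ^+ k) ^+ Q.
  have H ij : measurable (F k ij) /\ (P (F k ij) <= ck%:E)%E.
    rewrite /F; case: ifPn => nr; last first.
      split => //; rewrite measure0 lee_fin /ck.
      have M0' := ltW M0.
      by do ![by [] | apply: exprn_ge0 | apply: mulr_ge0 | rewrite invr_ge0].
    have [I1 E1] := G2 _ _ (Dnet k ij.1) (Dnet k.+1 ij.2).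
    split; first by apply: measurable_ge_set; exact: intgr_measurable I1.
    have c0 : 0 < (M * tau / 2 ^+ k) ^+ Q.
      by rewrite exprn_gt0// divr_gt0 ?mulr_gt0// exprn_gt0.
    apply: (le_trans (expect_markov I1 (fun w => exprn_ge0 _ (normr_ge0 _)) c0)).
    rewrite lee_fin ler_pdivrMr//; apply: (le_trans E1).
    apply: (@le_trans _ _ (A * (2 * p%:R / 4 ^+ k * tau) ^+ Q)).
      have le1 : l1 (net k ij.1 - net k.+1 ij.2) * tau <= 2 * p%:R / 4 ^+ k * tau.
        by rewrite ler_pM2r.
      have le0 : 0 <= l1 (net k ij.1 - net k.+1 ij.2) * tau.
        by rewrite mulr_ge0 ?l1_ge0// ltW.
      rewrite ler_wpM2l//; apply: lerXn2r; rewrite ?nnegrE//.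
      exact: le_trans le1.
    rewrite le_eqVlt; apply/orP; left; apply/eqP; rewrite /ck.
    rewrite !exprMn !exprVn.
    have k2 : (2 ^+ k) ^+ Q != 0 :> R by rewrite !expf_neq0// pnatr_eq0.
    have k4 : (4 ^+ k) ^+ Q != 0 :> R by rewrite !expf_neq0// pnatr_eq0.
    have kM : M ^+ Q != 0 by rewrite expf_neq0// gt_eqF.
    move: k2 k4 kM; move: ((2 ^+ k) ^+ Q) ((4 ^+ k) ^+ Q) (M ^+ Q) (2 ^+ Q) (p%:R ^+ Q) (tau ^+ Q).
    by move=> x y z u v s x0 y0 z0; field; rewrite x0 y0 z0.
  have [m1 p1] := prob_exists_le (fun i => proj1 (H i)) (fun i => proj2 (H i)).
  split => //; apply: (le_trans p1); rewrite lee_fin card_prod !card_ffun !card_ord.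
  apply: (@le_trans _ _ (A2 / M ^+ Q * (4 ^+ k)^-1)).
    rewrite le_eqVlt; apply/orP; left; apply/eqP; rewrite /ck /A2.
    have k2 : (2 ^+ k) != 0 :> R by rewrite expf_neq0// pnatr_eq0.
    have k44 : 4 ^+ k = 2 ^+ k * 2 ^+ k :> R by rewrite -exprMn -natrM.
    have -> : (2 ^+ k / 4 ^+ k) ^+ Q = ((4 ^+ k) ^+ (2 * p).+1)^-1 :> R.
      rewrite k44 invfM mulrA mulfV// mul1r exprVn -(expr2 (2 ^+ k)) -(exprM (2 ^+ k)); congr (_ ^-1).
      by congr (_ ^+ _); rewrite /Q; lia.
    rewrite !expnMn expnS !natrM !natrX -/np.
    have k4 : 4 ^+ k != 0 :> R by rewrite expf_neq0// pnatr_eq0.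
    have kM : M ^+ Q != 0 by rewrite expf_neq0// gt_eqF.
    rewrite [((4 ^+ k) ^+ _.+1)]exprSr [(2 * p)%N]mulnC exprM expr2.
    have k4p : (4 ^+ k) ^+ p != 0 :> R by rewrite expf_neq0.
    move: k4 kM k4p; rewrite exprMn -!natrX.
    rewrite (expnMn 4) natrM.
    move: (4 ^ k)%:R (M ^+ Q) ((4 ^ k) ^ p)%:R (N ^ p)%:R (4 ^ p)%:R ((2 ^ Q)%:R * (p ^ Q)%:R).
    by move=> x y z u v s x0 y0 z0; field; rewrite x0 y0 z0.
  apply: (@le_trans _ _ (eps / 4 * (4 ^+ k)^-1)).
    rewrite ler_pM2r ?invr_gt0 ?exprn_gt0//; apply: MQ => //.
    by rewrite lerDr.
  rewrite -mulrA ler_pM2l// -invfM.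
  have le24 : (2 ^ k.+2)%:R <= 4 * 4 ^+ k :> R.
    rewrite -natrX -natrM ler_nat -expnS -[4%N]/(2 ^ 2)%N -expnM leq_exp2l//.
    by lia.
  by rewrite lef_pV2// posrE ?mulr_gt0 ?exprn_gt0// ltr0n expn_gt0.
exists (\bigcup_k E k); split.
- by apply: bigcup_measurable => k _; have [] := HE k.
- apply: (le_trans (measure_sigma_subadditive P (fun k => proj1 (HE k)) _ (@subset_refl _ _))).
    by apply: bigcup_measurable => k _; have [] := HE k.
  apply: le_trans (epsilon_trick0 xpredT (ltW e0)).
  by apply: lee_nneseries => // k _; exact: (proj2 (HE k)).
move=> w nE t Dt.
pose i k := sval (cid (proj2 (Hnet k) t Dt)).
have Hi k : l1 (t - net k (i k)) <= p%:R / 4 ^+ k := svalP (cid (proj2 (Hnet k) t Dt)).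
have S k : `|G (net k (i k)) w - G (net k.+1 (i k.+1)) w| <= M * tau / 2 ^+ k.
  have nr : near k (i k, i k.+1).
    rewrite /near/=; apply: (le_trans (l1_triangle _ t _)).
    rewrite (l1B _ t); apply: (le_trans (lerD (Hi k) (Hi k.+1))).
    have -> : 2 * p%:R / 4 ^+ k = p%:R / 4 ^+ k + p%:R / 4 ^+ k :> R by ring.
    rewrite lerD2l ler_wpM2l//.
    by rewrite lef_pV2 ?posrE ?exprn_gt0// ler_weXn2l// ler1n.
  rewrite leNgt; apply/negP => H; apply: nE; exists k.+1 => //=.
  exists (i k, i k.+1); rewrite /F nr/=.
  apply: lerXn2r; rewrite ?nnegrE// ?(ltW H)//.
  by rewrite divr_ge0 ?exprn_ge0 ?mulr_ge0 ?ltW.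
have S0 : `|G (net 0%N (i 0%N)) w| <= M * tau.
  rewrite leNgt; apply/negP => H; apply: nE; exists 0%N => //=.
  exists (i 0%N); rewrite /F0/=.
  by apply: lerXn2r; rewrite ?nnegrE// ?(ltW H)// mulr_ge0 ?ltW.
have T k : `|G (net k (i k)) w| <= M * tau * (3 - 2 / 2 ^+ k).
  elim: k => [|k IH].
    by rewrite expr0 divr1 (_ : 3 - 2 = 1) ?mulr1//; ring.
  have -> : M * tau * (3 - 2 / 2 ^+ k.+1) = M * tau * (3 - 2 / 2 ^+ k) + M * tau / 2 ^+ k.
    by rewrite exprS; field; rewrite expf_neq0// pnatr_eq0.
  rewrite -[G (net k.+1 _) w](subKr (G (net k (i k)) w)).
  by apply: le_trans (ler_normB _ _) _; rewrite lerD.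
have [Lam HL] := LG w.
have Mt0 : 0 < M * tau by exact: mulr_gt0.
have U k : `|G t w| <= 3 * M * tau + `|Lam| * p%:R * (4 ^+ k)^-1.
  rewrite -[G t w](subrK (G (net k (i k)) w)) [leRHS]addrC.
  apply: le_trans (ler_normD _ _) _; apply: lerD.
    apply: (le_trans (HL _ _ Dt (Dnet _ _))).
    apply: (@le_trans _ _ (`|Lam| * l1 (t - net k (i k)))).
      by rewrite ler_wpM2r ?l1_ge0// ler_norm.
    by rewrite -mulrA ler_wpM2l.
  apply: (le_trans (T k)); rewrite -(mulrA 3) [leRHS]mulrC ler_pM2l//.
  by rewrite gerBl divr_ge0// exprn_ge0.
apply/ler_addgt0Pr => e ep.
have L1 : 0 < `|Lam| * p%:R + 1 by rewrite ltr_wpDl// mulr_ge0.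
have [k _ /(_ k (leqnn k)) Hk] := expr4_cvg0 (divr_gt0 ep L1).
apply: (le_trans (U k)); rewrite lerD2l.
apply: (@le_trans _ _ ((`|Lam| * p%:R + 1) * (4 ^+ k)^-1)).
  by rewrite ler_wpM2r ?invr_ge0 ?exprn_ge0// lerDl.
by rewrite mulrC -ler_pdivlMr// ltW.
Qed.

End chaining.

Section score_bound.
Context {R : realType} {disp : measure_display} {Omega : measurableType disp}.
Variables (P : probability Omega R) (F : R -> set_system Omega) (d r : nat).
Variables (b : 'cV[R]_d -> 'cV[R]_d) (sg : 'cV[R]_d -> 'M[R]_(d, r)).
Variables (Z : R -> Omega -> 'cV[R]_r) (X : R -> Omega -> 'cV[R]_d).
Variables (K : R) (m0 : nat).
Hypothesis SS : sde_setting P F b sg Z X K m0.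
Local Notation leb := (@lebesgue_measure R).
Local Notation mart_part := (mart_part b X).
Local Notation drift_int := (drift_int b X).

Variables (p : nat) (D : set 'cV[R]_p) (B : R).
Hypotheses (DB : forall t, D t -> forall l, `|t l 0| <= B) (D0 : D !=set0).
Variables (phi : 'I_d -> 'cV[R]_d -> 'cV[R]_p -> R) (Kp : R) (mp : nat).
Hypotheses (Kp0 : 0 <= Kp) (phi_borel : forall i t, D t -> borel (phi i ^~ t)).
Hypothesis phi_bound : forall i x t, D t -> `|phi i x t| <= Kp * wgt x ^+ mp.
Hypothesis phi_lip : forall i x t t', D t -> D t' ->
  `|phi i x t - phi i x t'| <= Kp * wgt x ^+ mp * l1 (t - t').

Definition residual h j i w : R := X (j.+1%:R * h) w i 0 - X (j%:R * h) w i 0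
  - h * b (X (j%:R * h) w) i 0.

Definition score n h t w : R :=
  \sum_(j < n) \sum_i phi i (X (j%:R * h) w) t * residual h j i w.

Let minc h j i w := mart_part i (0 + j.+1%:R * h) w - mart_part i (0 + j%:R * h) w.

Let mscore n h t w : R :=
  \sum_(j < n) \sum_i phi i (X (0 + j%:R * h) w) t * minc h j i w.

Let gap h j i w := \int[leb]_(v in `[j%:R * h, j%:R * h + h])
  `|b (X v w) i 0 - b (X (j%:R * h) w) i 0|.

Let score_split n h t w : 0 <= h -> D t ->
  `|score n h t w - mscore n h t w| <=
  \sum_(j < n) \sum_i Kp * (wgt (X (j%:R * h) w) ^+ mp * gap h j i w).
Proof.
move=> h0 Dt; rewrite /score /mscore -sumrB.
apply: le_trans (ler_norm_sum _ _ _) _; apply: ler_sum => j _.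
rewrite -sumrB; apply: le_trans (ler_norm_sum _ _ _) _; apply: ler_sum => i _.
rewrite !add0r -mulrBr normrM mulrA; apply: ler_pM => //; first exact: phi_bound.
have jh : 0 <= j%:R * h by rewrite mulr_ge0.
have jE : j.+1%:R * h = j%:R * h + h by rewrite -natr1 mulrDl mul1r.
have jhh : j%:R * h <= j%:R * h + h by rewrite lerDl.
apply: le_trans (drift_increment SS i (b (X (j%:R * h) w) i 0) w jh jhh).
rewrite /residual /minc !add0r jE /mart_part; rewrite le_eqVlt; apply/orP; left; apply/eqP.
by congr `|_|; ring.
Qed.

(** A residual is an increment of the martingale part plus a drift error.  The
    drift errors sum to at most n h^(3/2) in expectation, which is the square
    root of n h times that of n h^2; the martingale part is chained. *)
Lemma score_bound eps : 0 < eps -> exists M, 0 < M /\ forall n h,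
  0 < h <= 1 -> 1 <= n%:R * h -> n%:R * h ^+ 2 <= 1 ->
  exists E, [/\ measurable E, (P E <= eps%:E)%E & forall w, ~ E w ->
    forall t, D t -> `|score n h t w| <= M * Num.sqrt (n%:R * h)].
Proof.
move=> e0; have e2 : 0 < eps / 2 by rewrite divr_gt0.
have [A [A0 HA]] := integral_moment SS (2 * p) mp.
set Q := (2 * p).+1.*2 in HA.
have KQ0 : 0 <= A * Kp ^+ Q by rewrite mulr_ge0// exprn_ge0.
have [M1 [M10 H1]] := chaining P DB D0 KQ0 e2.
have [C [C0 HC]] := drift_remainder SS mp.
pose M2 := Kp * d%:R * C / (eps / 2) + 1.
have M20 : 0 < M2 by rewrite ltr_wpDl// divr_ge0 ?mulr_ge0// ltW.
exists (M1 + M2); split; first exact: addr_gt0.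
move=> n h h01 T1 nh2; have /andP[h0 h1] := h01.
set tau := Num.sqrt (n%:R * h).
have T0 : 0 < n%:R * h by exact: lt_le_trans T1.
have tau0 : 0 < tau by rewrite sqrtr_gt0.
have tau2 : tau ^+ 2 = n%:R * h by rewrite sqr_sqrtr// ltW.
have tau1 : 1 <= tau by rewrite -sqrtr1 ler_sqrt// ltW.
have tauQ : (n%:R * h) * tau ^+ (2 * p).*2 = tau ^+ Q.
  by rewrite -tau2 -exprD /Q; congr (_ ^+ _); lia.
have G0 : 0 <= n%:R * h <= tau ^+ 2 by rewrite tau2 lexx ltW.
have mm j i w : minc h j i w = mart_part i (0 + j.+1%:R * h) w - mart_part i (0 + j%:R * h) w by [].
have moment (g : 'I_d -> 'cV[R]_d -> R) L : 0 <= L -> (forall i, borel (g i)) ->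
    (forall i x, `|g i x| <= L * wgt x ^+ mp) ->
    intgr P (fun w => `|\sum_(j < n) \sum_i g i (X (0 + j%:R * h) w) * minc h j i w| ^+ Q) /\
    expect P (fun w => `|\sum_(j < n) \sum_i g i (X (0 + j%:R * h) w) * minc h j i w| ^+ Q) <=
      A * (L * tau) ^+ Q.
  move=> L0 bg gL.
  have [//|I E] := HA 0 h L tau n (fun _ => g) (lexx 0) h01 L0 (fun _ => bg) (fun _ => gL) tau1.
    by rewrite tau2.
  split; first exact: I.
  by apply: (le_trans E); rewrite exprMn -tauQ !mulrA.
have [||t Dt|t t' Dt Dt'|E1 [mE1 PE1 HE1]] := H1 (mscore n h) tau tau0.
- move=> t Dt; apply: measurable_sum => j; apply: measurable_sum => i.
  have j0 : 0 <= 0 + j%:R * h by rewrite add0r mulr_ge0// ltW.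
  have j1 : 0 <= 0 + j.+1%:R * h by rewrite add0r mulr_ge0// ltW.
  apply: measurable_funM; first exact: (sde_measurable SS j0 (phi_borel i Dt)).
  by apply: measurable_funB; exact: (mart_part_measurable SS).
- move=> w; exists (\sum_(j < n) \sum_i Kp * wgt (X (0 + j%:R * h) w) ^+ mp * `|minc h j i w|).
  move=> t t' Dt Dt'; rewrite /mscore -sumrB mulr_suml.
  apply: le_trans (ler_norm_sum _ _ _) _; apply: ler_sum => j _.
  rewrite -sumrB mulr_suml.
  apply: le_trans (ler_norm_sum _ _ _) _; apply: ler_sum => i _.
  by rewrite -mulrBl normrM mulrAC ler_wpM2r//; exact: phi_lip.
- have [I E] := moment (fun i => phi i ^~ t) Kp Kp0 (fun i => phi_borel i Dt) (fun i x => phi_bound i x Dt).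
  by split => //; rewrite exprMn mulrA in E.
- have L0 : 0 <= Kp * l1 (t - t') by rewrite mulr_ge0 ?l1_ge0.
  have [] := moment (fun i x => phi i x t - phi i x t') _ L0.
  + by move=> i; apply: borelB; exact: phi_borel.
  + by move=> i x; rewrite mulrAC; exact: phi_lip.
  rewrite (_ : (fun w => _) = (fun w => `|mscore n h t w - mscore n h t' w| ^+ Q)).
    by move=> I E; split => //; rewrite -mulrA (exprMn _ Kp) mulrA in E.
  apply/funext => w; congr (`|_| ^+ _); rewrite /mscore -sumrB; apply: eq_bigr => j _.
  by rewrite -sumrB; apply: eq_bigr => i _; rewrite mulrBl.
pose rem w := \sum_(j < n) \sum_i Kp * (wgt (X (j%:R * h) w) ^+ mp * gap h j i w).
have HR (j : nat) i : intgr P (fun w => Kp * (wgt (X (j%:R * h) w) ^+ mp * gap h j i w)) /\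
    expect P (fun w => Kp * (wgt (X (j%:R * h) w) ^+ mp * gap h j i w)) <= Kp * (C * (h * Num.sqrt h)).
  have jh : 0 <= j%:R * h by rewrite mulr_ge0// ltW.
  have [I E] := HC i _ _ jh h01.
  split; first exact: intgrZ.
  by rewrite (expectZ _ I) ler_wpM2l.
have IR : intgr P rem.
  by apply: intgr_sum => j; apply: intgr_sum => i; exact: (proj1 (HR j i)).
have gap0 j i w : 0 <= gap h j i w by apply: Rintegral_ge0.
have rem0 w : 0 <= rem w.
  by apply: sumr_ge0 => j _; apply: sumr_ge0 => i _; rewrite !mulr_ge0 ?wgtX_ge0.
have ER : expect P rem <= Kp * d%:R * C * tau.
  rewrite expect_sum; last by move=> j; apply: intgr_sum => i; exact: (proj1 (HR j i)).
  apply: (@le_trans _ _ (\sum_(j < n) \sum_(i < d) Kp * (C * (h * Num.sqrt h)))).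
    apply: ler_sum => j _; rewrite expect_sum; last by move=> i; exact: (proj1 (HR j i)).
    by apply: ler_sum => i _; exact: (proj2 (HR j i)).
  rewrite !sumr_const !card_ord -[leLHS]mulr_natl -[X in _ * X]mulr_natl.
  have hs : n%:R * (h * Num.sqrt h) <= tau.
    rewrite -[leLHS]ger0_norm ?mulr_ge0 ?sqrtr_ge0 ?(ltW h0)// -sqrtr_sqr ler_wsqrtr//.
    have -> : (n%:R * (h * Num.sqrt h)) ^+ 2 = n%:R * h * (n%:R * h * Num.sqrt h ^+ 2) by ring.
    by rewrite sqr_sqrtr ?(ltW h0)// ler_piMr ?(ltW T0)// -mulrA -expr2.
  have -> : n%:R * (d%:R * (Kp * (C * (h * Num.sqrt h)))) = Kp * d%:R * C * (n%:R * (h * Num.sqrt h)) by ring.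
  by rewrite ler_wpM2l// !mulr_ge0.
have c0 : 0 < M2 * tau by rewrite mulr_gt0.
pose E2 : set Omega := [set w | M2 * tau <= rem w].
have mE2 : measurable E2 by apply: measurable_ge_set; exact: intgr_measurable IR.
have PE2 : (P E2 <= (eps / 2)%:E)%E.
  apply: (le_trans (expect_markov IR rem0 c0)).
  rewrite lee_fin ler_pdivrMr//; apply: (le_trans ER); rewrite mulrA ler_wpM2r ?(ltW tau0)//.
  by rewrite /M2 mulrDr mulr1 [X in X + _]mulrC divfK ?gt_eqF// lerDl ltW.
exists (E1 `|` E2); split; first exact: measurableU.
  rewrite (splitr eps).
  exact: (prob_le2 mE1 mE2 (measurableU _ _ mE1 mE2) (@subset_refl _ _) PE1 PE2).
move=> w nE t Dt; rewrite -[score n h t w](subrK (mscore n h t w)) addrC.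
apply: le_trans (ler_normD _ _) _; rewrite mulrDl; apply: lerD.
  by apply: HE1 => // ?; apply: nE; left.
apply: (le_trans (score_split n w (ltW h0) Dt)).
by rewrite leNgt; apply/negP => H; apply: nE; right; exact: ltW H.
Qed.

End score_bound.

(** * Ergodic averages *)

Section ergodic.
Context {R : realType} {disp : measure_display} {Omega : measurableType disp}.
Variables (P : probability Omega R) (F : R -> set_system Omega) (d r : nat).
Variables (b : 'cV[R]_d -> 'cV[R]_d) (sg : 'cV[R]_d -> 'M[R]_(d, r)).
Variables (Z : R -> Omega -> 'cV[R]_r) (X : R -> Omega -> 'cV[R]_d).
Variables (K : R) (m0 : nat).
Hypothesis SS : sde_setting P F b sg Z X K m0.
Variables (kappa : R -> R.-pker (d.-tuple R) ~> (d.-tuple R)).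
Variable mu : probability (d.-tuple R) R.
Hypothesis TF : transition_function P F b sg Z kappa.
Hypothesis EE : exponentially_ergodic kappa mu.

(** The distance at time 0 between the transition law and mu, tested on g, is
    finite; in extended reals this excludes infinite integrals. *)
Lemma invariant_wgt_integrable m : intgr mu (fun x => wgt (tov x) ^+ m).
Proof.
case: m => [|m]; first by under eq_fun do rewrite expr0; exact: intgr_cst.
have q0 : 0 < m.+1%:R :> R by [].
have [rate rate0 [C HC]] := EE q0.
have gE x : 1 + enorm (tov x) `^ m.+1%:R = 1 + enorm (tov x) ^+ m.+1 :> R.
  by rewrite powR_mulrn ?enorm_ge0.
pose g (x : d.-tuple R) : R := 1 + enorm (tov x) ^+ m.+1.
have mg : measurable_fun setT g.
  exact: (borelD (borel_cst (n := d) 1) (borelX m.+1 (borel_enorm (n := d)))).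
have g0 x : 0 <= g x by rewrite addr_ge0// exprn_ge0 ?enorm_ge0.
have gg y : `|g y| <= 1 + enorm (tov y) `^ m.+1%:R by rewrite gE ger0_norm.
have := HC [tuple 0 | i < d] 0 g (lexx 0) mg gg.
rewrite mulr0 expR0 mul1e => H.
have I0 : (0 <= \int[mu]_y (g y)%:E)%E by apply: integral_ge0 => y _; rewrite lee_fin.
have Ig : intgr mu g.
  apply/integrableP; split; first exact/measurable_EFinP.
  rewrite (eq_integral (EFin \o g)); last by move=> w _; rewrite gee0_abs// lee_fin.
  move: H I0; move: (\int[kappa 0 _]_y _)%E => J.
  change ((\int[mu]_x (EFin \o g) x)%E) with (\int[mu]_x (g x)%:E)%E.
  case: (\int[mu]_y _)%E => [s|+ _|//]; first by rewrite ltry.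
  by case: J => [s| |].
apply: (intgr_le _ _ (intgrZ (2 ^+ m.+1) Ig)).
  exact: (borelX m.+1 (borel_wgt (n := d))).
move=> x; rewrite ger0_norm ?wgtX_ge0//.
by apply: le_trans (exprD_le _ _ _) _; rewrite ?enorm_ge0// expr1n.
Qed.

Local Notation obsin A s := (fun w => \1_A (tot (X s w)) : R).

Let indic_intgr (D : set Omega) : measurable D -> intgr P (fun w => \1_D w).
Proof.
move=> mD; apply: (intgr_le _ _ (intgr_cst P 1)); first exact: measurable_indic.
by move=> w; rewrite indicE; case: (_ \in _); rewrite ?normr1 ?normr0.
Qed.

Let expect_indic (D : set Omega) : measurable D -> expect P (fun w => \1_D w) = fine (P D).
Proof. by move=> mD; rewrite /expect /Rintegral integral_indic// setIT. Qed.

Let obsin_measurable A s : measurable A -> 0 <= s -> measurable_fun setT (obsin A s).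
Proof.
move=> mA s0; have mI : measurable_fun setT (\1_A : d.-tuple R -> R) by exact: measurable_indic.
exact: (measurableT_comp mI (random_vector_tot (sde_random_vector SS s0))).
Qed.

Lemma event_adapted A s : measurable A -> 0 <= s -> F s [set w | A (tot (X s w))].
Proof. by move=> mA s0; have /vec_sigmaP := sde_adapted SS s0; apply. Qed.

(** By the Markov property the indicator of A at time s + t may be replaced by
    its transition probability from time s, which is exponentially close to
    mu(A) up to an integrable factor. *)
Lemma transition_bound : exists rate : R, 0 < rate /\ exists2 C : R, 0 <= C &
  forall A s t B, measurable A -> 0 <= s -> 0 <= t -> F s B ->
  `|expect P (fun w => \1_B w * (\1_A (tot (X (s + t) w)) - fine (mu A)))| <=
  C * expR (- (rate * t)).
Proof.
have [rate rate0 [K0 HK]] := EE ltr01.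
have [C1 [C10 HC1]] := wgt_moment SS 1.
exists rate; split => //.
exists (`|K0| * C1); first by rewrite mulr_ge0.
move=> A s t B mA s0 t0 FB.
have mB : measurable B by exact: (sde_sub_sigma SS s0).
have st0 : 0 <= s + t by exact: addr_ge0.
pose D := [set w | A (tot (X (s + t) w))].
have mD : measurable D.
  have /vec_sigmaP := sde_random_vector SS st0; exact.
pose k w := fine (kappa t (tot (X s w)) A).
pose m := fine (mu A).
have kE w : kappa t (tot (X s w)) A = (k w)%:E.
  rewrite /k fineK// ge0_fin_numE//.
  have : (kappa t (tot (X s w)) A <= kappa t (tot (X s w)) setT)%E.
    by apply: le_measure; rewrite ?inE.
  by rewrite prob_kernel => /le_lt_trans; apply; rewrite ltry.
have mE : mu A = m%:E by rewrite /m fineK// fin_num_measure.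
have k01 w : 0 <= k w <= 1.
  rewrite -!lee_fin -kE measure_ge0/=.
  by rewrite -(@prob_kernel _ _ _ _ _ (kappa t) (tot (X s w))); apply: le_measure; rewrite ?inE.
have mk : measurable_fun setT k.
  have mkap := measurable_kernel (kappa t) A mA.
  have mX := random_vector_tot (sde_random_vector SS s0).
  apply/measurable_EFinP; have := measurableT_comp mkap mX.
  by congr measurable_fun; apply/funext => w /=; rewrite kE.
have Ik : intgr P k.
  apply: (intgr_le mk _ (intgr_cst P 1)) => w.
  by have /andP[k0 k1] := k01 w; rewrite ger0_norm.
have IB : intgr P (fun w => \1_B w) by exact: indic_intgr.
have indM (f : Omega -> R) (E : set Omega) : measurable E -> intgr P f ->
    intgr P (fun w => \1_E w * f w).
  move=> mE' If; apply: (intgr_le _ _ (intgr_norm If)).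
    by apply: measurable_funM (intgr_measurable If); exact: measurable_indic.
  move=> w; rewrite normrM indicE; case: (_ \in _); first by rewrite normr1 mul1r.
  by rewrite normr0 mul0r.
have transE : expect P (fun w => \1_B w * \1_D w) = expect P (fun w => \1_B w * k w).
  have -> : (fun w => \1_B w * \1_D w) = (\1_(B `&` D) : Omega -> R).
    by apply/funext => w; rewrite indicI.
  rewrite expect_indic; last exact: measurableI.
  rewrite (TF (ss_sde SS) s0 t0 FB mA) /expect /Rintegral; congr fine.
  rewrite [LHS]integral_mkcond; apply: eq_integral => w _.
  rewrite /patch indicE kE; case: (_ \in _); first by rewrite mul1r.
  by rewrite mul0r.
have E1 : expect P (fun w => \1_B w * (\1_A (tot (X (s + t) w)) - m)) =
    expect P (fun w => \1_B w * (k w - m)).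
  have -> : (fun w => \1_B w * (\1_A (tot (X (s + t) w)) - m)) =
      (fun w => \1_B w * \1_D w - m * \1_B w).
    by apply/funext => w; rewrite mulrBr [m * _]mulrC.
  have -> : (fun w => \1_B w * (k w - m)) = (fun w => \1_B w * k w - m * \1_B w).
    by apply/funext => w; rewrite mulrBr [m * _]mulrC.
  rewrite (expectB (indM _ _ mB (indic_intgr mD)) (intgrZ m IB)) transE.
  by rewrite (expectB (indM _ _ mB Ik) (intgrZ m IB)).
rewrite E1.
have Ikm : intgr P (fun w => k w - m) by apply: intgrB => //; exact: intgr_cst.
apply: (le_trans (expect_norm (indM _ _ mB Ikm))).
have [IW EW] := HC1 s s0.
pose c := `|K0| * expR (- (rate * t)).
have c0 : 0 <= c by rewrite mulr_ge0// expR_ge0.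
apply: (@le_trans _ _ (expect P (fun w => c * wgt (X s w) ^+ 1))); last first.
  by rewrite (expectZ _ IW) /c mulrAC ler_wpM2r ?expR_ge0// ler_wpM2l.
apply: expect_le; [exact: intgr_norm (indM _ _ mB Ikm)|exact: intgrZ|move=> w].
apply: (@le_trans _ _ `|k w - m|).
  by rewrite normrM indicE; case: (_ \in _); rewrite ?normr1 ?mul1r// normr0 mul0r.
have mA1 : measurable_fun setT (\1_A : d.-tuple R -> R) by exact: measurable_indic.
have A1 y : `|\1_A y : R| <= 1 + enorm (tov y) `^ 1.
  apply: (@le_trans _ _ 1); last by rewrite lerDl powR_ge0.
  by rewrite indicE; case: (_ \in _); rewrite ?normr1 ?normr0.
have := HK (tot (X s w)) t (\1_A) t0 mA1 A1.
rewrite !integral_indic// !setIT kE; set muA := (X in (_ - X)%E).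
have -> : muA = m%:E by exact: mE.
rewrite -EFinB abse_EFin -EFinM lee_fin totK.
rewrite powRr1 ?enorm_ge0// -/(wgt _) expr1 => H.
rewrite -(ler_pM2l (expR_gt0 (rate * t))); apply: (le_trans H).
have -> : expR (rate * t) * (c * wgt (X s w)) =
    `|K0| * wgt (X s w) * (expR (rate * t) * expR (- (rate * t))) by rewrite /c; ring.
rewrite -expRD subrr expR0 mulr1 ler_wpM2r ?ler_norm//.
exact: ltW (wgt_gt0 _).
Qed.

Definition occupation A n h w : R :=
  \sum_(j < n) (\1_A (tot (X (j%:R * h) w)) - fine (mu A)).

Lemma occupation_measurable A n h : measurable A -> 0 <= h ->
  measurable_fun setT (occupation A n h).
Proof.
move=> mA h0; apply: measurable_sum => j; apply: measurable_funB; last exact: measurable_cst.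
by apply: obsin_measurable; rewrite ?mulr_ge0.
Qed.

(** Exponential mixing makes the covariances along the grid geometric of ratio
    exp(- rate h), so the variance of a time average is of order 1 / (n h). *)
Lemma occupation_variance : exists2 C : R, 0 <= C & forall A n h,
  measurable A -> 0 < h <= 1 ->
  intgr P (fun w => occupation A n h w ^+ 2) /\
  expect P (fun w => occupation A n h w ^+ 2) <= C * n%:R / h.
Proof.
have [rate [rate0 [C C0 HC]]] := transition_bound.
exists (4 * C * (1 + rate) / rate); first by rewrite divr_ge0 ?mulr_ge0 ?addr_ge0 ?(ltW rate0).
move=> A n h mA /andP[h0 h1].
pose m := fine (mu A).
have m01 : 0 <= m <= 1.
  rewrite -!lee_fin /m fineK ?fin_num_measure// measure_ge0/=.
  exact: probability_le1.
pose V j w : R := \1_A (tot (X (j%:R * h) w)) - m.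
have jh (j : nat) : 0 <= j%:R * h by rewrite mulr_ge0// ltW.
have LV j : all_moments P (V j).
  apply: (all_moments_le (g := fun=> 1)); last exact: all_moments_cst.
    apply: measurable_funB; last exact: measurable_cst.
    exact: obsin_measurable.
  move=> w; rewrite /V indicE ler_norml; move: m01 => /andP[? ?].
  by case: (_ \in _) => /=; apply/andP; split; lra.
pose q := expR (- (rate * h)).
have q0 : 0 <= q by exact: expR_ge0.
have q1 : q < 1 by rewrite expR_lt1 oppr_lt0 mulr_gt0.
have cov i j : (i <= j)%N -> expect P (fun w => V i w * V j w) <= 2 * C * q ^+ (j - i).
  move=> ij.
  pose B := [set w | A (tot (X (i%:R * h) w))].
  have ji0 : 0 <= (j - i)%:R * h by rewrite mulr_ge0// ltW.
  have jE : i%:R * h + (j - i)%:R * h = j%:R * h by rewrite -mulrDl -natrD subnKC.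
  have H1 := HC A _ _ B mA (jh i) ji0 (event_adapted mA (jh i)).
  have FT : F (i%:R * h) setT.
    have sF := sde_sigma SS (jh i).
    by have [F0 FC _] := sF; rewrite -(setD0 setT); exact: FC.
  have H2 := HC A _ _ setT mA (jh i) ji0 FT.
  rewrite jE in H1 H2.
  have qE : expR (- (rate * ((j - i)%:R * h))) = q ^+ (j - i).
    by rewrite /q -expRM_natl; congr expR; ring.
  rewrite qE in H1 H2.
  have L2 (D : set Omega) : measurable D -> all_moments P (fun w => \1_D w * V j w).
    move=> mD; apply: all_momentsM => //; apply: (all_moments_le (g := fun=> 1)); last exact: all_moments_cst.
      exact: measurable_indic.
    by move=> w; rewrite indicE; case: (_ \in _); rewrite ?normr1 ?normr0.
  have mB : measurable B by have /vec_sigmaP := sde_random_vector SS (jh i); apply.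
  have -> : (fun w => V i w * V j w) = (fun w => \1_B w * V j w - m * (\1_setT w * V j w)).
    apply/funext => w; rewrite [\1_setT w]indicE in_setT mul1r -mulrBl.
    by rewrite /V.
  have I1 := all_moments_intgr (L2 B mB); have I2 := all_moments_intgr (L2 setT measurableT).
  rewrite (expectB I1 (intgrZ m I2)) (expectZ _ I2).
  apply: (le_trans (ler_norm _)); apply: le_trans (ler_normB _ _) _.
  have -> : 2 * C * q ^+ (j - i) = C * q ^+ (j - i) + 1 * (C * q ^+ (j - i)) by ring.
  have /andP[m_0 m_1] := m01.
  apply: lerD; first exact: H1.
  by rewrite normrM (ger0_norm m_0); apply: ler_pM.
have geo k : \sum_(i < k.+1) q ^+ (k - i) <= (1 + rate) / (rate * h).
  have -> : \sum_(i < k.+1) q ^+ (k - i) = \sum_(i < k.+1) q ^+ i.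
    rewrite [RHS](reindex_inj rev_ord_inj)/=.
    by apply: eq_bigr => i _; rewrite subSS.
  have q1' : 0 < 1 - q by rewrite subr_gt0.
  have -> : \sum_(i < k.+1) q ^+ i = (1 - q ^+ k.+1) / (1 - q).
    apply: (mulIf (lt0r_neq0 q1')); rewrite divfK ?gt_eqF//.
    elim: (k.+1) => [|l IH]; first by rewrite big_ord0 mul0r expr0 subrr.
    by rewrite big_ord_recr/= mulrDl IH exprSr; ring.
  rewrite ler_pdivrMr//.
  apply: (@le_trans _ _ 1); first by rewrite gerBl exprn_ge0.
  have rh : 0 < rate * h by rewrite mulr_gt0.
  rewrite mulrAC ler_pdivlMr// mul1r.
  have qle : q * (1 + rate * h) <= 1.
    have := expR_ge1Dx (rate * h) => H.
    apply: (@le_trans _ _ (q * expR (rate * h))); first by rewrite ler_wpM2l.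
    by rewrite /q -expRD addNr expR0.
  have rh1 : rate * h <= rate by rewrite ler_piMr// ltW.
  have H2 : 0 <= (1 - q) * (rate - rate * h) by rewrite mulr_ge0 ?subr_ge0// ltW.
  by move: qle H2; move: (rate * h) q1' => x q1' H3 H4; nra.
pose S n w := \sum_(j < n) V j w.
have LS k : all_moments P (S k) by exact: all_moments_sum.
suff H k : expect P (fun w => S k w ^+ 2) <= k%:R * (4 * C * ((1 + rate) / (rate * h))).
  split; first exact: (all_moments_intgrX 2 (LS n)).
  apply: le_trans (H n) _; rewrite le_eqVlt; apply/orP; left; apply/eqP.
  by field; rewrite !gt_eqF.
elim: k => [|k IH].
  rewrite mul0r (_ : (fun w => _) = cst 0) ?expect_cst//.
  by apply/funext => w; rewrite /S big_ord0 expr0n.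
pose cr w := \sum_(i < k.+1) V i w * V k w.
have Lcr : all_moments P cr by apply: all_moments_sum => i; exact: all_momentsM.
have Icr := intgrZ 2 (all_moments_intgr Lcr).
have SE w : S k.+1 w ^+ 2 <= S k w ^+ 2 + 2 * cr w.
  rewrite /S /cr big_ord_recr/= [in leRHS]big_ord_recr/= -mulr_suml.
  set a := \sum_(i < k) _; set v := V k w.
  by have := sqr_ge0 v; rewrite !expr2; lra.
apply: (le_trans (expect_le (all_moments_intgrX 2 (LS k.+1)) (intgrD (all_moments_intgrX 2 (LS k)) Icr) SE)).
rewrite (expectD (all_moments_intgrX 2 (LS k)) Icr) (expectZ _ (all_moments_intgr Lcr)).
have kS (y : R) : k.+1%:R * y = k%:R * y + y by rewrite -natr1 mulrDl mul1r.
rewrite kS; apply: lerD; first exact: IH.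
rewrite expect_sum; last by move=> i; apply: all_moments_intgr; exact: all_momentsM.
have -> : 4 * C * ((1 + rate) / (rate * h)) = 2 * (2 * C * ((1 + rate) / (rate * h))) by ring.
rewrite ler_pM2l//; apply: le_trans (ler_wpM2l _ (geo k)); last by rewrite mulr_ge0.
rewrite mulr_sumr; apply: ler_sum => i _; apply: cov.
by rewrite -ltnS ltn_ord.
Qed.

Lemma occupation_prob A (rho eps : R) : measurable A -> 0 < rho -> 0 < eps ->
  exists T0, forall n h, 0 < h <= 1 -> T0 <= n%:R * h ->
  (P [set w | (rho * n%:R < `|occupation A n h w|)%R] <= eps%:E)%E.
Proof.
move=> mA rho0 e0; have [C C0 HC] := occupation_variance.
exists (C / (rho ^+ 2 * eps) + 1) => n h h01 T1; have /andP[h0 h1] := h01.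
have [I E] := HC A n h mA h01.
have T0 : 0 < n%:R * h.
  by apply: lt_le_trans T1; rewrite ltr_wpDl// divr_ge0// mulr_ge0 ?exprn_ge0 ?ltW.
have n0 : 0 < n%:R :> R by move: T0; rewrite pmulr_lgt0.
have c0 : 0 < (rho * n%:R) ^+ 2 by rewrite exprn_gt0// mulr_gt0.
have M := expect_markov I (fun w => sqr_ge0 _) c0.
apply: (@le_trans _ _ (P [set w | ((rho * n%:R) ^+ 2 <= occupation A n h w ^+ 2)%R])).
  have mO := occupation_measurable n mA (ltW h0).
  apply: prob_mono; [exact: measurable_gt_norm| |].
    by apply: measurable_ge_set; apply: measurable_funX.
  move=> w /= H; rewrite -[leRHS]real_normK ?num_real//.
  by apply: lerXn2r; rewrite ?nnegrE ?(ltW H)// mulr_ge0 ?ltW.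
apply: (le_trans M); rewrite lee_fin ler_pdivrMr//; apply: (le_trans E).
rewrite ler_pdivrMr//.
have H : C <= rho ^+ 2 * eps * (n%:R * h).
  rewrite mulrC -ler_pdivrMr ?mulr_gt0 ?exprn_gt0//; apply: le_trans T1.
  by rewrite lerDl.
have -> : eps * (rho * n%:R) ^+ 2 * h = rho ^+ 2 * eps * (n%:R * h) * n%:R by ring.
by rewrite ler_wpM2r// ltW.
Qed.

End ergodic.

(** * The quadratic term *)


(** Pieces are level sets of an integer code clipped to a finite range, so they
    are disjoint by construction; on the ball no clipping occurs and equal codes
    mean equal cells. *)
Lemma small_partition {R : realType} d (L eta : R) : 1 <= L -> 0 < eta ->
  exists (I : finType) (A : I -> set (d.-tuple R)) (z : I -> 'cV[R]_d),
  [/\ forall i, measurable (A i),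
      forall i y, A i y -> wgt (tov y) <= L /\ l1 (tov y - z i) <= eta,
      forall i, wgt (z i) <= L &
      forall y, \sum_i (\1_(A i) y : R) = (wgt (tov y) <= L)%R%:R].
Proof.
move=> L1 eta0.
have d0 : 0 < d.+1%:R :> R by [].
have [k _ /(_ k (leqnn k)) Hk] := expr4_cvg0 (divr_gt0 eta0 d0).
pose c (y : d.-tuple R) := cell k (fun l => tnth y l).
pose m := absz (Num.floor (- L * 4 ^+ k)).
pose N := absz (Num.floor (L * 4 ^+ k) + m%:Z).
pose phi (q : {ffun 'I_d -> int}) : {ffun 'I_d -> 'I_N.+1} :=
  [ffun l => inord (absz (q l + m%:Z))].
pose A i : set (d.-tuple R) := [set y | wgt (tov y) <= L /\ phi (c y) = i].
have tovE (y : d.-tuple R) l : tov y l 0 = tnth y l by rewrite mxE.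
have Lk0 : 0 <= L * 4 ^+ k by rewrite mulr_ge0 ?exprn_ge0// (le_trans ler01).
have mL : Num.floor (- L * 4 ^+ k) = - m%:Z.
  rewrite /m; have : (Num.floor (- L * 4 ^+ k) <= 0)%R.
    by rewrite -(floor0 R) le_floor// mulNr oppr_le0.
  by lia.
have cb y l : wgt (tov y) <= L -> (- m%:Z <= c y l <= Num.floor (L * 4 ^+ k))%R.
  move=> yL; rewrite /c ffunE -mL.
  have : `|tnth y l| <= L.
    by rewrite -tovE (le_trans (coord_le_enorm _ _))// (le_trans _ yL)// /wgt lerDr.
  rewrite ler_norml => /andP[y1 y2].
  by rewrite !le_floor// ler_wpM2r ?exprn_ge0.
have cE y y' : wgt (tov y) <= L -> wgt (tov y') <= L -> phi (c y) = phi (c y') -> c y = c y'.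
  move=> yL yL' /ffunP E; apply/ffunP => l.
  move: (cb y l yL) (cb y' l yL') (E l); move: (c y) (c y') => u v.
  move=> /andP[a1 a2] /andP[b1 b2]; rewrite !ffunE => /(congr1 val)/=.
  move: (u l) (v l) a1 a2 b1 b2 => u1 v1 a1 a2 b1 b2.
  by rewrite !inordK; rewrite /N; move: (Num.floor (L * 4 ^+ k)) a2 b2; lia.
have /choice[z Hz] i : exists z : 'cV[R]_d, wgt z <= L /\
    forall y, A i y -> exists2 y', A i y' & z = tov y'.
  have [[y Ay]|nA] := pselect (exists y, A i y).
    by exists (tov y); split; [case: Ay|exists y].
  exists 0; split; first by rewrite /wgt enorm0 addr0.
  by move=> y Ay; exfalso; apply: nA; exists y.
exists {ffun 'I_d -> 'I_N.+1}, A, z; split.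
- move=> i; apply: measurableI.
    by apply: measurable_le_set; exact: (borel_wgt (n := d)).
  pose f (y : d.-tuple R) : R := (phi (c y) == i)%:R.
  have mf : measurable_fun setT f.
    apply: (measurable_countable_code (code := c) (F := fun q _ => (phi q == i)%:R)) => q.
      by apply: measurable_cell => l; exact: measurable_tnth.
    exact: measurable_cst.
  have := measurable_ge_set 1 mf; congr measurable; apply/seteqP; split => y /=.
    by rewrite /f; case: eqP => //; rewrite ler10.
  by rewrite /f => ->; rewrite eqxx.
- move=> i y Ay; have [yL yi] := Ay; split => //.
  have [_ /(_ y Ay)[y' [yL' yi'] ->]] := Hz i.
  have E : c y = c y' by apply: cE => //; rewrite yi yi'.
  apply: (@le_trans _ _ (\sum_(l < d) (4 ^+ k)^-1)).
    apply: ler_sum => l _; rewrite !mxE; exact: (cell_close _ E).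
  rewrite sumr_const card_ord -[leLHS]mulr_natl.
  apply: (@le_trans _ _ (d.+1%:R * (4 ^+ k)^-1)).
    by rewrite ler_wpM2r ?invr_ge0 ?exprn_ge0// ler_nat.
  by rewrite mulrC -ler_pdivlMr// ltW.
- by move=> i; have [] := Hz i.
move=> y; rewrite (bigD1 (phi (c y)))//= big1 => [|i ni]; last first.
  rewrite indicE memNset// => -[_ E]; by rewrite E eqxx in ni.
rewrite addr0 indicE; case: (leP (wgt (tov y)) L) => yL.
  by rewrite mem_set.
by rewrite memNset// => -[]; rewrite leNgt yL.
Qed.

Section quadratic.
Context {R : realType} {disp : measure_display} {Omega : measurableType disp}.
Variables (P : probability Omega R) (F : R -> set_system Omega) (d r : nat).
Variables (b : 'cV[R]_d -> 'cV[R]_d) (sg : 'cV[R]_d -> 'M[R]_(d, r)).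
Variables (Z : R -> Omega -> 'cV[R]_r) (X : R -> Omega -> 'cV[R]_d).
Variables (K : R) (m0 : nat).
Hypothesis SS : sde_setting P F b sg Z X K m0.
Variables (kappa : R -> R.-pker (d.-tuple R) ~> (d.-tuple R)).
Variable mu : probability (d.-tuple R) R.
Hypothesis TF : transition_function P F b sg Z kappa.
Hypothesis EE : exponentially_ergodic kappa mu.

Variables (p : nat) (Theta : set 'cV[R]_p) (t0 : 'cV[R]_p).
Variables (e : 'I_d -> 'cV[R]_d -> 'cV[R]_p -> R) (Ke : R) (me m1 mc : nat) (chi : R).
Hypotheses (Ke0 : 0 <= Ke) (chi0 : 0 < chi).
Hypothesis e_borel : forall i t, Theta t -> borel (e i ^~ t).
Hypothesis e_bound : forall i x t, Theta t ->
  `|e i x t| <= Ke * wgt x ^+ me * l1 (t - t0).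
Hypothesis e_mixed : forall i x y t, Theta t ->
  `|e i x t - e i y t| <= Ke * (wgt x + wgt y) ^+ me * l1 (x - y) * l1 (t - t0).
Hypothesis e_ident : forall t, Theta t -> chi * l1 (t - t0) ^+ 2 <=
  expect mu (fun x => (\sum_i e i (tov x) t ^+ 2) * wgt (tov x) ^+ m1).

Let G t x := \sum_i e i x t ^+ 2.

Let G_ge0 t x : 0 <= G t x.
Proof. by apply: sumr_ge0 => i _; exact: sqr_ge0. Qed.

Let G_bound t x : Theta t -> G t x <= d%:R * Ke ^+ 2 * wgt x ^+ (me * 2) * l1 (t - t0) ^+ 2.
Proof.
move=> Tt; apply: (@le_trans _ _ (\sum_(i < d) (Ke * wgt x ^+ me * l1 (t - t0)) ^+ 2)).
  apply: ler_sum => i _; rewrite -[leLHS]real_normK ?num_real//.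
  by apply: lerXn2r; rewrite ?nnegrE ?mulr_ge0 ?wgtX_ge0 ?l1_ge0//; exact: e_bound.
rewrite sumr_const card_ord -[leLHS]mulr_natl !exprMn -exprM le_eqVlt.
by apply/orP; left; apply/eqP; ring.
Qed.

Let G_borel t : Theta t -> borel (G t).
Proof. by move=> Tt; apply: borel_sum => i; apply: borelX; exact: e_borel. Qed.

Let box L (y : d.-tuple R) : R := (wgt (tov y) <= L)%R%:R.

Let box_measurable L : measurable_fun setT (box L).
Proof.
have mB : measurable [set y : d.-tuple R | wgt (tov y) <= L].
  by apply: measurable_le_set; exact: (borel_wgt (n := d)).
rewrite (_ : box L = \1_[set y : d.-tuple R | wgt (tov y) <= L]).
  exact: measurable_indic.
by apply/funext => y; rewrite indicE mem_setE.
Qed.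

Let mu_wgt := invariant_wgt_integrable (kappa := kappa) (mu := mu) EE.

(** Outside the ball of radius L the integrand is at most a moment of mu over
    L. *)
Let truncated_identifiability : exists L c, [/\ 1 <= L, 0 < c & forall t, Theta t ->
  c * l1 (t - t0) ^+ 2 <= expect mu (fun y => box L y * G t (tov y))].
Proof.
pose M := (me * 2 + m1).+1.
pose M3 := expect mu (fun x => wgt (tov x) ^+ M).
have M30 : 0 <= M3 by apply: expect_ge0 => x; exact: wgtX_ge0.
pose C := d%:R * Ke ^+ 2 * M3.
have C0 : 0 <= C by rewrite !mulr_ge0// exprn_ge0.
pose L := 1 + 2 * C / chi.
have L1 : 1 <= L by rewrite lerDl divr_ge0 ?mulr_ge0// ltW.
have L0 : 0 < L by exact: lt_le_trans L1.
have Lm0 : 0 < L ^+ m1 by rewrite exprn_gt0.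
have c0 : 0 < chi / 2 / L ^+ m1 by rewrite divr_gt0// divr_gt0.
exists L, (chi / 2 / L ^+ m1); split => //.
move=> t Tt; set D := l1 (t - t0) ^+ 2.
have D0 : 0 <= D by rewrite exprn_ge0 ?l1_ge0.
have W0 (x : d.-tuple R) : 0 < wgt (tov x) := wgt_gt0 _.
have b01 y : 0 <= box L y <= 1 by rewrite /box ler0n lern1 leq_b1.
have I1 : intgr mu (fun y => box L y * G t (tov y)).
  apply: (intgr_le _ _ (intgrZ (d%:R * Ke ^+ 2 * D) (mu_wgt (me * 2)))).
    by apply: measurable_funM; [exact: box_measurable|exact: G_borel].
  move=> y; have /andP[b0 b1] := b01 y.
  rewrite ger0_norm ?mulr_ge0//; apply: (@le_trans _ _ (G t (tov y))).
    by rewrite ler_piMl.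
  by apply: (le_trans (G_bound _ Tt)); rewrite mulrAC.
have I2 := mu_wgt M.
have I3 := intgrD (intgrZ (L ^+ m1) I1) (intgrZ (d%:R * Ke ^+ 2 * D / L) I2).
have := e_ident Tt; rewrite -/D => H0.
have H : chi * D <= L ^+ m1 * expect mu (fun y => box L y * G t (tov y)) +
    d%:R * Ke ^+ 2 * D / L * M3.
  apply: (le_trans H0).
  rewrite -(expectZ _ I2) -(expectZ _ I1) -(expectD (intgrZ _ I1) (intgrZ _ I2)).
  have le1 (y : d.-tuple R) : G t (tov y) * wgt (tov y) ^+ m1 <=
      L ^+ m1 * (box L y * G t (tov y)) + d%:R * Ke ^+ 2 * D / L * wgt (tov y) ^+ M.
    rewrite /box; case: (leP (wgt (tov y)) L) => yL.
      rewrite mul1r mulrC -[leLHS]addr0; apply: lerD.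
        by rewrite ler_wpM2r// lerXn2r ?nnegrE// ltW.
      have Li : 0 <= L^-1 by rewrite invr_ge0 ltW.
      by do ![by [] | apply: wgtX_ge0 | apply: exprn_ge0 | apply: mulr_ge0].
    rewrite mul0r mulr0 add0r.
    apply: (@le_trans _ _ (d%:R * Ke ^+ 2 * wgt (tov y) ^+ (me * 2) * D * wgt (tov y) ^+ m1)).
      by rewrite ler_wpM2r ?wgtX_ge0//; exact: G_bound.
    have -> : d%:R * Ke ^+ 2 * wgt (tov y) ^+ (me * 2) * D * wgt (tov y) ^+ m1 =
        d%:R * Ke ^+ 2 * D * wgt (tov y) ^+ (me * 2 + m1) * 1 by rewrite exprD; ring.
    have -> : d%:R * Ke ^+ 2 * D / L * wgt (tov y) ^+ M =
        d%:R * Ke ^+ 2 * D * wgt (tov y) ^+ (me * 2 + m1) * (wgt (tov y) / L).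
      by rewrite /M (exprS _ (me * 2 + m1)); ring.
    apply: ler_wpM2l; last by rewrite ler_pdivlMr// mul1r ltW.
    by do ![by [] | apply: wgtX_ge0 | apply: exprn_ge0 | apply: mulr_ge0].
  apply: expect_le => //.
  apply: (intgr_le _ _ I3).
    apply: measurable_funM; first exact: G_borel.
    exact: (borelX m1 (borel_wgt (n := d))).
  move=> y; rewrite ger0_norm; first exact: le1.
  by apply: mulr_ge0; [exact: G_ge0|exact: wgtX_ge0].
have H2 : d%:R * Ke ^+ 2 * D / L * M3 <= chi / 2 * D.
  have -> : d%:R * Ke ^+ 2 * D / L * M3 = C / L * D by rewrite /C; ring.
  rewrite ler_wpM2r// ler_pdivrMr// /L mulrDr mulr1.
  have -> : chi / 2 * (2 * C / chi) = C by field; rewrite gt_eqF.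
  by rewrite lerDr divr_ge0// ltW.
rewrite mulrAC ler_pdivrMr// [leLHS]mulrC [leRHS]mulrC.
have H3 : chi * D = chi / 2 * D + chi / 2 * D by field.
rewrite [X in X <= _]mulrC.
move: H H2; rewrite H3; move: (chi / 2 * D) (expect _ _) (d%:R * Ke ^+ 2 * D / L * M3).
by move=> x y v; move: (L ^+ m1 * y) => u; lra.
Qed.

(** Relative to the distance between t and t0 the fields are equicontinuous in
    x.  On a fine partition of a ball both the sum along the path and the
    integral against mu are thus computed, up to a small error and uniformly in
    t, from the values at the centres of finitely many cells, and the numbers of
    visits to these cells are close to their masses. *)
Lemma quadratic_lower : exists2 c : R, 0 < c & forall eps, 0 < eps ->
  exists T0 : R, forall n h, 0 < h <= 1 -> T0 <= n%:R * h ->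
  exists E, [/\ measurable E, (P E <= eps%:E)%E & forall w, ~ E w ->
    forall t, Theta t -> c * n%:R * l1 (t - t0) ^+ 2 <=
      \sum_(j < n) G t (X (j%:R * h) w) / wgt (X (j%:R * h) w) ^+ mc].
Proof.
have [L [c [L1 c0 Hc]]] := truncated_identifiability.
have L0 : 0 < L by exact: lt_le_trans L1.
have Lmc : 0 < L ^+ mc by rewrite exprn_gt0.
exists (c / 2 / L ^+ mc); first by rewrite divr_gt0// divr_gt0.
move=> eps eps0.
pose kap := d%:R * (Ke * (L + L) ^+ me) * (2 * (Ke * L ^+ me)).
have kap0 : 0 <= kap by rewrite !mulr_ge0 ?exprn_ge0 ?addr_ge0// ltW.
pose eta := c / 8 / (kap + 1).
have k1 : 0 < kap + 1 by rewrite ltr_wpDl.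
have eta0 : 0 < eta by rewrite divr_gt0// divr_gt0.
have keta : kap * eta <= c / 8.
  rewrite /eta mulrCA -[leRHS]mulr1 ler_wpM2l ?divr_ge0 ?(ltW c0)//.
  by rewrite ler_pdivrMr// mul1r lerDl.
have [I [A [z [mA Az zL A1]]]] := small_partition d L1 eta0.
pose B := d%:R * Ke ^+ 2 * L ^+ (me * 2).
have B0 : 0 <= B by rewrite !mulr_ge0// ?exprn_ge0// ltW.
pose rho := c / 4 / (#|I|%:R * B + 1).
have r1 : 0 < #|I|%:R * B + 1 by rewrite ltr_wpDl// mulr_ge0.
have rho0 : 0 < rho by rewrite divr_gt0// divr_gt0.
have rhoB : #|I|%:R * (rho * B) <= c / 4.
  have -> : #|I|%:R * (rho * B) = c / 4 * (#|I|%:R * B / (#|I|%:R * B + 1)).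
    by rewrite /rho; ring.
  rewrite -[leRHS]mulr1; apply: ler_wpM2l; first by rewrite divr_ge0// ltW.
  by rewrite ler_pdivrMr// mul1r lerDl.
have I1 : 0 < #|I|%:R + 1 :> R by rewrite ltr_wpDl.
have eI : 0 < eps / (#|I|%:R + 1) by rewrite divr_gt0.
have /choice[T0 HT0] i : exists T0 : R, forall n h, 0 < h <= 1 -> T0 <= n%:R * h ->
    (P [set w | (rho * n%:R < `|occupation X mu (A i) n h w|)%R] <= (eps / (#|I|%:R + 1))%:E)%E.
  exact: (occupation_prob SS TF EE (mA i) rho0 eI).
exists (\sum_i `|T0 i|) => n h h01 Tn; have /andP[h0 h1] := h01.
pose Ei i : set Omega := [set w | rho * n%:R < `|occupation X mu (A i) n h w|].
have mEi i : measurable (Ei i).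
  apply: measurable_gt_norm; exact: (occupation_measurable SS mu _ (mA i) (ltW h0)).
have pEi i : (P (Ei i) <= (eps / (#|I|%:R + 1))%:E)%E.
  apply: HT0 => //; apply: le_trans Tn; apply: (le_trans (ler_norm _)).
  by rewrite (bigD1 i)//= lerDl sumr_ge0.
have [mE pE] := prob_exists_le mEi pEi.
exists [set w | exists i, Ei i w]; split => //.
  apply: (le_trans pE); rewrite lee_fin mulrCA -[leRHS]mulr1 ler_wpM2l ?(ltW eps0)//.
  by rewrite ler_pdivrMr// mul1r lerDl.
move=> w nE t Tt; set D := l1 (t - t0) ^+ 2.
have D0 : 0 <= D by rewrite exprn_ge0 ?l1_ge0.
have l0 := l1_ge0 (t - t0).
have eL i x : wgt x <= L -> `|e i x t| <= Ke * L ^+ me * l1 (t - t0).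
  move=> xL; apply: (le_trans (e_bound _ _ Tt)); rewrite ler_wpM2r// ler_wpM2l//.
  by rewrite lerXn2r ?nnegrE ?(ltW L0)// ltW ?wgt_gt0.
have wgt0 (x : 'cV[R]_d) : 0 <= wgt x := ltW (wgt_gt0 x).
have osc x y : wgt x <= L -> wgt y <= L -> l1 (x - y) <= eta ->
    `|G t x - G t y| <= kap * eta * D.
  move=> xL yL xy; rewrite /G -sumrB; apply: le_trans (ler_norm_sum _ _ _) _.
  have -> : kap * eta * D = \sum_(i < d) (Ke * (L + L) ^+ me * eta * l1 (t - t0)) *
      (2 * (Ke * L ^+ me) * l1 (t - t0)).
    rewrite sumr_const card_ord -[RHS]mulr_natl /kap /D; ring.
  apply: ler_sum => i _; rewrite subr_sqr normrM; apply: ler_pM => //.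
    apply: (le_trans (e_mixed _ _ _ Tt)); rewrite ler_wpM2r//; apply: ler_pM; rewrite ?l1_ge0//.
      by apply: mulr_ge0 => //; apply: exprn_ge0; apply: addr_ge0.
    apply: ler_wpM2l => //; apply: lerXn2r; rewrite ?nnegrE; last exact: lerD.
      exact: addr_ge0.
    by apply: addr_ge0; exact: ltW.
  apply: (le_trans (ler_normD _ _)).
  have -> : 2 * (Ke * L ^+ me) * l1 (t - t0) = Ke * L ^+ me * l1 (t - t0) + Ke * L ^+ me * l1 (t - t0) by ring.
  by apply: lerD; exact: eL.
have GB x : wgt x <= L -> G t x <= B * D.
  move=> xL; apply: (le_trans (G_bound _ Tt)); rewrite ler_wpM2r// ler_wpM2l//.
    by rewrite mulr_ge0// exprn_ge0.
  by rewrite lerXn2r ?nnegrE ?(ltW L0)// ltW ?wgt_gt0.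
have ind01 i y : 0 <= (\1_(A i) y : R) by rewrite indicE; case: (_ \in _).
have indI i : intgr mu (fun y => \1_(A i) y).
  apply: (intgr_le _ _ (intgr_cst mu 1)); first exact: measurable_indic.
  by move=> y; rewrite indicE; case: (_ \in _); rewrite ?normr1 ?normr0.
pose ku := kap * eta * D.
have ku0 : 0 <= ku by apply: mulr_ge0 => //; apply: mulr_ge0 => //; exact: ltW.
have cmp i y : `|\1_(A i) y * G t (tov y) - \1_(A i) y * G t (z i)| <= \1_(A i) y * ku.
  rewrite -mulrBr normrM (ger0_norm (ind01 i y)) indicE.
  have [yA|_] := boolP (y \in A i); last by rewrite !mul0r.
  by rewrite !mul1r; move: yA; rewrite inE => /Az[yL yz]; exact: osc.
(* Under mu, replacing each point by the centre of its cell costs at most ku. *)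
have inv : c * D <= \sum_i fine (mu (A i)) * G t (z i) + ku.
  apply: (le_trans (Hc t Tt)).
  have EI i : expect mu (fun y => \1_(A i) y) = fine (mu (A i)).
    by rewrite /expect /Rintegral integral_indic// setIT.
  have IS : intgr mu (fun y => \sum_i \1_(A i) y * G t (z i)).
    by apply: intgr_sum => i; under eq_fun do rewrite mulrC; exact: intgrZ.
  have IB : intgr mu (fun y => \sum_i \1_(A i) y * G t (z i) + ku).
    by apply: intgrD => //; exact: intgr_cst.
  have -> : \sum_i fine (mu (A i)) * G t (z i) + ku =
      expect mu (fun y => \sum_i \1_(A i) y * G t (z i) + ku).
    rewrite (expectD IS (intgr_cst mu ku)) expect_cst; congr (_ + _).
    rewrite expect_sum; last by move=> i; under eq_fun do rewrite mulrC; exact: intgrZ.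
    apply: eq_bigr => i _; under [in RHS]eq_fun do rewrite mulrC.
    by rewrite expectZ// EI mulrC.
  have le1 (y : d.-tuple R) : box L y * G t (tov y) <= \sum_i \1_(A i) y * G t (z i) + ku.
    apply: (@le_trans _ _ (\sum_i (\1_(A i) y * G t (z i) + \1_(A i) y * ku))).
      rewrite /box -A1 mulr_suml; apply: ler_sum => i _.
      by have := cmp i y; rewrite ler_norml => /andP[_]; rewrite lerBlDl.
    rewrite big_split/= lerD2l -mulr_suml A1; by rewrite ler_piMl// lern1 leq_b1.
  apply: expect_le => //; apply: (intgr_le _ _ IB).
    by apply: measurable_funM; [exact: box_measurable|exact: G_borel].
  by move=> y; rewrite ger0_norm// mulr_ge0// /box; case: (_ <= _).
(* Off the exceptional event every cell is visited almost as often as mu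
   predicts. *)
pose x j := tot (X (j%:R * h) w).
have xE j : tov (x j) = X (j%:R * h) w by rewrite /x totK.
have occ i : n%:R * fine (mu (A i)) - rho * n%:R <= \sum_(j < n) (\1_(A i) (x j) : R).
  have : `|occupation X mu (A i) n h w| <= rho * n%:R.
    by rewrite leNgt; apply/negP => H; apply: nE; exists i.
  rewrite ler_norml => /andP[+ _]; rewrite /occupation sumrB sumr_const card_ord.
  by rewrite -[X in _ - X]mulr_natl -/(x _); lra.
apply: (@le_trans _ _ ((L ^+ mc)^-1 * \sum_(j < n) \sum_i \1_(A i) (x j) * G t (tov (x j)))); last first.
  rewrite mulr_sumr; apply: ler_sum => j _; rewrite -mulr_suml A1 xE.
  case: (leP (wgt _) L) => xL; last by rewrite mul0r mulr0 divr_ge0// wgtX_ge0.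
  rewrite mul1r mulrC ler_wpM2l// lef_pV2 ?posrE// ?exprn_gt0 ?wgt_gt0//.
  by rewrite lerXn2r ?nnegrE ?(ltW L0)// ltW ?wgt_gt0.
have -> : c / 2 / L ^+ mc * n%:R * D = (L ^+ mc)^-1 * (c / 2 * n%:R * D) by ring.
rewrite ler_wpM2l ?invr_ge0 ?(ltW Lmc)//.
apply: (@le_trans _ _ (\sum_i (n%:R * fine (mu (A i)) - rho * n%:R) * G t (z i) - n%:R * ku)).
  under eq_bigr do rewrite mulrBl -mulrA.
  rewrite sumrB -mulr_sumr.
  have H2 : \sum_i rho * n%:R * G t (z i) <= n%:R * (c / 4 * D).
    apply: (@le_trans _ _ (\sum_(i : I) rho * n%:R * (B * D))).
      apply: ler_sum => i _; apply: ler_wpM2l; first by rewrite mulr_ge0// ltW.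
      exact: GB (zL i).
    rewrite sumr_const -[leLHS]mulr_natl.
    have -> : #|I|%:R * (rho * n%:R * (B * D)) = n%:R * (#|I|%:R * (rho * B) * D) by ring.
    by rewrite ler_wpM2l// ler_wpM2r.
  have H3 : n%:R * ku <= n%:R * (c / 8 * D) by rewrite ler_wpM2l// ler_wpM2r.
  have H4 : n%:R * (c * D - ku) <= n%:R * \sum_i fine (mu (A i)) * G t (z i).
    by rewrite ler_wpM2l// lerBlDr.
  have -> : c / 2 * n%:R * D = n%:R * (c * D) - n%:R * (c / 4 * D) - (n%:R * (c / 8 * D)) - n%:R * (c / 8 * D).
    by field.
  by move: H2 H3 H4; rewrite mulrBr; lra.
rewrite exchange_big/=.
apply: (@le_trans _ _ (\sum_i (\sum_(j < n) \1_(A i) (x j) * G t (z i) - \sum_(j < n) \1_(A i) (x j) * ku))).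
  rewrite sumrB; apply: lerB.
    by apply: ler_sum => i _; rewrite -mulr_suml ler_wpM2r//.
  rewrite exchange_big/=; apply: (@le_trans _ _ (\sum_(j < n) ku)).
    apply: ler_sum => j _; rewrite -mulr_suml A1; by rewrite ler_piMl// lern1 leq_b1.
  by rewrite sumr_const card_ord -[leLHS]mulr_natl.
apply: ler_sum => i _; rewrite -sumrB; apply: ler_sum => j _.
by have := cmp i (x j); rewrite ler_norml => /andP[+ _]; lra.
Qed.

End quadratic.

(** * Laplace's method *)

Section laplace.
Context {R : realType}.

(** An open set is a countable union of grid cells. *)
Lemma open_tuple_measurable p (Theta : set 'cV[R]_p) : open Theta ->
  measurable [set t : p.-tuple R | Theta (tov t)].
Proof.
move=> oT.
pose cellv k (t : p.-tuple R) := cell k (fun l => tnth t l).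
pose D (kc : nat * {ffun 'I_p -> int}) : set (p.-tuple R) :=
  [set t | cellv kc.1 t = kc.2 /\ (forall t', cellv kc.1 t' = kc.2 -> Theta (tov t'))].
have -> : [set t : p.-tuple R | Theta (tov t)] = \bigcup_kc D kc.
  apply/seteqP; split => [t /= Tt|t [[k c] _ [/= ck]]]; last exact.
  have /nbhs_cVP[e e0 He] : nbhs (tov t) Theta by exact: open_nbhs_nbhs.
  have [k _ /(_ k (leqnn k)) Hk] := expr4_cvg0 e0.
  exists (k, cellv k t) => //; split => //= t' Et; apply: He => i.
  by rewrite !mxE; apply: le_lt_trans Hk; exact: (cell_close _ Et).
apply: countable_bigcupT_measurable => [|[k c]]; first exact: countableP.
have [H|nH] := pselect (forall t', cellv k t' = c -> Theta (tov t')).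
  rewrite (_ : D _ = [set t | cellv k t = c]).
    by apply: measurable_cell => l; exact: measurable_tnth.
  by apply/seteqP; split => t /=; [case|].
rewrite (_ : D _ = set0)//.
by apply/seteqP; split => t // [].
Qed.

Lemma integral_lebesgue_vec_prod p (f : 'I_p -> R -> R) (c : 'I_p -> R) :
  (forall i, measurable_fun setT (f i)) -> (forall i x, 0 <= f i x) ->
  (forall i, \int[lebesgue_measure]_x (f i x)%:E = (c i)%:E)%E ->
  (\int[lebesgue_vec p]_t (\prod_i f i (tnth t i))%:E = (\prod_i c i)%:E)%E.
Proof.
elim: p f c => [|p IH] f c mf f0 fc.
  under eq_integral do rewrite big_ord0.
  rewrite big_ord0 integral_cst//=.
  by rewrite diracT mul1e.
have mprod q (g : 'I_q -> R -> R) : (forall i, measurable_fun setT (g i)) ->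
    measurable_fun setT (fun t : q.-tuple R => \prod_i g i (tnth t i)).
  move=> mg; apply: measurable_prod => i _.
  exact: (measurableT_comp (mg i) (measurable_tnth i)).
rewrite /= /lebesgue_succ ge0_integral_pushforward//=; first last.
- by move=> t _; rewrite lee_fin prodr_ge0.
- by apply/measurable_EFinP; exact: mprod.
- exact: measurable_tcons.
rewrite preimage_setT.
pose F (z : measurableTypeR R * p.-tuple R) : \bar R :=
  (f ord0 z.1 * \prod_i f (lift ord0 i) (tnth z.2 i))%:E.
rewrite (eq_integral F); last first.
  move=> [x t] _ /=; rewrite /F/= big_ord_recl tnth0; congr (_ * _)%:E.
  by apply: eq_bigr => i _; rewrite tnthS.
have mF : measurable_fun setT F.
  apply/measurable_EFinP; apply: measurable_funM.
    exact: (measurableT_comp (mf ord0) (@measurable_fst _ _ (measurableTypeR R) _)).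
  exact: (measurableT_comp (mprod _ _ (fun i => mf (lift ord0 i))) measurable_snd).
have F0 z : (0 <= F z)%E by rewrite lee_fin mulr_ge0// prodr_ge0.
rewrite fubini_tonelli1// /fubini_F.
have H x : (\int[lebesgue_vec p]_t F (x, t) =
    (\prod_i c (lift ord0 i))%:E * (f ord0 x)%:E)%E.
  rewrite /F/=.
  under eq_integral do rewrite EFinM.
  rewrite ge0_integralZl//; last 3 first.
  - by apply/measurable_EFinP; exact: (mprod _ (fun i => f (lift ord0 i)) (fun i => mf (lift ord0 i))).
  - by move=> t _; rewrite lee_fin prodr_ge0.
  - by rewrite lee_fin.
  by rewrite (IH (fun i => f (lift ord0 i)) (fun i => c (lift ord0 i)))// muleC.
under eq_integral do rewrite H.
have c0 i : 0 <= c i.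
  by rewrite -lee_fin -fc; apply: integral_ge0 => x _; rewrite lee_fin.
rewrite ge0_integralZl//; last 3 first.
- by apply/measurable_EFinP; exact: mf.
- by move=> x _; rewrite lee_fin.
- by rewrite lee_fin prodr_ge0.
by rewrite fc -EFinM big_ord_recl mulrC.
Qed.

Lemma gauss_integral_scaled (m k : R) : 0 < k ->
  (\int[lebesgue_measure]_x (expR (- (k / 2 * (x - m) ^+ 2)))%:E =
    (Num.sqrt (2 * pi) / Num.sqrt k)%:E)%E.
Proof.
move=> k0; pose s := (Num.sqrt k)^-1.
have sk0 : 0 < Num.sqrt k by rewrite sqrtr_gt0.
have s0 : s != 0 by rewrite invr_neq0// gt_eqF.
have s2 : s ^+ 2 = k^-1 by rewrite /s exprVn sqr_sqrtr// ltW.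
pose pk := normal_peak s.
have pkE : pk = (Num.sqrt (2 * pi) / Num.sqrt k)^-1.
  rewrite /pk /normal_peak s2; congr (_ ^-1); rewrite -sqrtrV ?ltW//.
  rewrite -sqrtrM ?mulr_ge0 ?pi_ge0//; congr Num.sqrt.
  by rewrite -mulr_natl; ring.
have pi2 : 0 < Num.sqrt (2 * pi) :> R by rewrite sqrtr_gt0 mulr_gt0// pi_gt0.
have pk0 : 0 < pk by rewrite pkE invr_gt0 divr_gt0.
have E x : expR (- (k / 2 * (x - m) ^+ 2)) = pk^-1 * normal_pdf m s x.
  rewrite normal_pdfE// -/pk mulrA mulVf ?gt_eqF// mul1r /normal_fun s2.
  by congr expR; rewrite -mulr_natl; field; rewrite gt_eqF.
under eq_integral do rewrite E EFinM.
rewrite ge0_integralZl//; last 3 first.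
- by apply/measurable_EFinP; exact: measurable_normal_pdf.
- by move=> x _; rewrite lee_fin normal_pdf_ge0.
- by rewrite lee_fin invr_ge0 ltW.
by rewrite integral_normal_pdf mule1 pkE invrK.
Qed.

Section free_energy.
Variables (p : nat) (Theta : set 'cV[R]_p) (prior : 'cV[R]_p -> R) (t0 : 'cV[R]_p).
Variables (M c Kp p0 rho : R).
Hypotheses (M0 : 0 <= M) (c0 : 0 < c) (p00 : 0 < p0) (rho0 : 0 < rho).
Hypothesis oTheta : open Theta.
Hypothesis prior_ge0 : forall t, Theta t -> 0 <= prior t.
Hypothesis prior_le : forall t, Theta t -> prior t <= Kp.
Hypothesis near_t0 : forall t : 'cV[R]_p, (forall i, `|t i 0 - t0 i 0| <= rho) ->
  Theta t /\ p0 <= prior t.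

Let S := [set t : p.-tuple R | Theta (tov t)].
Let mS : measurable S. Proof. exact: open_tuple_measurable. Qed.

(** Half of the quadratic term absorbs the linear one. *)
Lemma quadratic_envelope (tau u : R) : 0 < tau ->
  M * tau * u - c * tau ^+ 2 * u ^+ 2 <= M ^+ 2 / (2 * c) - c / 2 * tau ^+ 2 * u ^+ 2.
Proof.
move=> tau0; rewrite -subr_ge0.
have -> : M ^+ 2 / (2 * c) - c / 2 * tau ^+ 2 * u ^+ 2 - (M * tau * u - c * tau ^+ 2 * u ^+ 2) =
  (M - c * tau * u) ^+ 2 / (2 * c) by field; rewrite gt_eqF.
by rewrite divr_ge0 ?sqr_ge0// mulr_ge0// ltW.
Qed.

(** After the change of variables by the square root of T, the integrand lies
    between a Gaussian and the indicator of a box. *)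
Lemma laplace : exists C : R, forall (T : R) (H : 'cV[R]_p -> R) (that : 'cV[R]_p),
  1 <= T -> (Num.sqrt T)^-1 <= rho ->
  measurable_fun S (fun t => expR (H (tov t)) * prior (tov t)) ->
  H t0 <= H that ->
  (forall e, 0 < e -> exists2 t, Theta t & H that <= H t + e) ->
  (forall t, Theta t -> - (M * Num.sqrt T * l1 (t - t0)) - M * T * l1 (t - t0) ^+ 2
     <= H t - H t0 <= M * Num.sqrt T * l1 (t - t0) - c * T * l1 (t - t0) ^+ 2) ->
  `|free_energy T Theta prior H - (- T^-1 * H that + p%:R / (2 * T) * ln T)| <= C * T^-1.
Proof.
pose Cu := Kp * expR (M ^+ 2 / (2 * c)) * (Num.sqrt (2 * pi) / Num.sqrt c) ^+ p.
pose Cl := expR (- (M * p%:R) - M * p%:R ^+ 2) * p0 * 2 ^+ p.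
exists (`|ln Cu| + `|ln Cl| + M ^+ 2 / (2 * c)) => T H that T1 Trho mE H0that Hthat HH.
set tau := Num.sqrt T in Trho HH.
have T0 : 0 < T by exact: lt_le_trans T1.
have tau0 : 0 < tau by rewrite sqrtr_gt0.
have tau2 : tau ^+ 2 = T by rewrite sqr_sqrtr// ltW.
have Tt0 : Theta t0.
  by apply: (proj1 (near_t0 _)) => i; rewrite subrr normr0 ltW.
have p0K : p0 <= Kp.
  apply: le_trans (prior_le Tt0); apply: (proj2 (near_t0 _)) => i.
  by rewrite subrr normr0 ltW.
have Kp0 : 0 < Kp by exact: lt_le_trans p0K.
pose E t := expR (H (tov t)) * prior (tov t).
have E0 t : S t -> 0 <= E t by move=> St; rewrite mulr_ge0 ?expR_ge0// prior_ge0.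
pose I := (\int[lebesgue_vec p]_(t in S) (E t)%:E)%E.
have pi2 : 0 < Num.sqrt (2 * pi) :> R by rewrite sqrtr_gt0 mulr_gt0// pi_gt0.
have sc0 : 0 < Num.sqrt c by rewrite sqrtr_gt0.
have Cu0 : 0 < Cu by rewrite !mulr_gt0 ?expR_gt0// exprn_gt0// divr_gt0.
have Cl0 : 0 < Cl by rewrite !mulr_gt0 ?expR_gt0// exprn_gt0.
pose r := tau^-1.
have r0 : 0 < r by rewrite invr_gt0.
have rp0 : 0 < r ^+ p by rewrite exprn_gt0.
have taur : tau * r = 1 by rewrite mulfV// gt_eqF.
have Iup : (I <= (expR (H t0) * (Cu * r ^+ p))%:E)%E.
  pose f (i : 'I_p) x := expR (- (c * T / 2 * (x - t0 i 0) ^+ 2)).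
  have mf i : measurable_fun setT (f i).
    apply: measurableT_comp => //; apply: measurable_funN; apply: measurable_funM => //.
    by apply: measurable_funX; apply: measurable_funB.
  have cT : 0 < c * T by rewrite mulr_gt0.
  have fI i := gauss_integral_scaled (t0 i 0) cT.
  have IF := integral_lebesgue_vec_prod mf (fun i x => expR_ge0 _) fI.
  pose k := Kp * expR (M ^+ 2 / (2 * c)) * expR (H t0).
  have k0 : 0 < k by rewrite !mulr_gt0 ?expR_gt0.
  have mprod : measurable_fun setT (fun t : p.-tuple R => \prod_i f i (tnth t i)).
    apply: measurable_prod => i _.
    exact: (measurableT_comp (mf i) (measurable_tnth i)).
  have prod0 (t : p.-tuple R) : 0 <= \prod_i f i (tnth t i).
    by apply: prodr_ge0 => i _; exact: expR_ge0.
  apply: (@le_trans _ _ (\int[lebesgue_vec p]_(t in S) (k * \prod_i f i (tnth t i))%:E)%E).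
    apply: ge0_le_integral => //.
    - exact/measurable_EFinP.
    - by apply/measurable_EFinP; apply: measurable_funM => //; apply: measurable_funTS.
    move=> t St; rewrite lee_fin /E.
    have /andP[_ Hu] := HH _ St; set u := l1 (tov t - t0) in Hu.
    have q1 := quadratic_envelope u tau0; rewrite tau2 in q1.
    have u2 : \sum_i (tnth t i - t0 i 0) ^+ 2 <= u ^+ 2.
      apply: (@le_trans _ _ (enorm (tov t - t0) ^+ 2)).
        by rewrite enorm_sqr; apply: ler_sum => i _; rewrite !mxE.
      by apply: lerXn2r; rewrite ?nnegrE ?enorm_ge0 ?l1_ge0 ?enorm_le_l1.
    rewrite mulrC; apply: (@le_trans _ _ (Kp * expR (M ^+ 2 / (2 * c) +
        (H t0 - c * T / 2 * \sum_i (tnth t i - t0 i 0) ^+ 2)))).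
      apply: ler_pM; rewrite ?expR_ge0 ?prior_ge0 ?prior_le// ler_expR.
      have u3 : c * T / 2 * \sum_i (tnth t i - t0 i 0) ^+ 2 <= c / 2 * T * u ^+ 2.
        rewrite (mulrAC c T); apply: ler_wpM2l => //.
        by apply: mulr_ge0; [rewrite divr_ge0// ltW|exact: ltW].
      move: Hu q1 u3; move: (c * T / 2 * _) (c / 2 * T * u ^+ 2) (c * T * u ^+ 2).
      by move=> x y z; lra.
    rewrite !expRD mulr_sumr -sumrN expR_sum /k; rewrite !mulrA.
    by rewrite ler_wpM2l// !mulr_ge0 ?expR_ge0 ?(ltW Kp0).
  apply: (@le_trans _ _ (\int[lebesgue_vec p]_t (k * \prod_i f i (tnth t i))%:E)%E).
    apply: ge0_subset_integral => //.
      by apply/measurable_EFinP; apply: measurable_funM.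
    by move=> t _; rewrite lee_fin mulr_ge0// ltW.
  under eq_integral do rewrite EFinM.
  rewrite ge0_integralZl//; last 3 first.
  - exact/measurable_EFinP.
  - by move=> t _; rewrite lee_fin.
  - by rewrite lee_fin ltW.
  rewrite IF prodr_const card_ord -EFinM lee_fin le_eqVlt; apply/orP; left; apply/eqP.
  have -> : Num.sqrt (2 * pi) / Num.sqrt (c * T) = Num.sqrt (2 * pi) / Num.sqrt c * r.
    by rewrite (sqrtrM _ (ltW c0)) -/tau invfM mulrA.
  rewrite /k /Cu (exprMn _ (Num.sqrt (2 * pi) / Num.sqrt c) r).
  by move: ((Num.sqrt (2 * pi) / Num.sqrt c) ^+ p) (r ^+ p) => x y; ring.
have Ilow : ((expR (H t0) * (Cl * r ^+ p))%:E <= I)%E.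
  pose A (i : 'I_p) : set R := `[t0 i 0 - r, t0 i 0 + r]%classic.
  pose bx := [set t : p.-tuple R | forall i, A i (tnth t i)].
  have mA i : measurable (A i) by exact: measurable_itv.
  have lbx : lebesgue_vec p bx = ((2 * r) ^+ p)%:E.
    rewrite /bx lebesgue_vec_box//.
    rewrite (eq_bigr (fun=> (2 * r)%:E)).
      by rewrite prodEFin prodr_const card_ord.
    move=> i _; rewrite /A lebesgue_measure_itv/= lte_fin.
    rewrite ifT; last by rewrite ltrBlDr -addrA ltrDl addr_gt0.
    by rewrite -EFinB; congr (_%:E); ring.
  have mbx : measurable bx.
    rewrite (_ : bx = \bigcap_(i in [set: 'I_p]) ((fun t : p.-tuple R => tnth t i) @^-1` A i)).
      apply: fin_bigcap_measurable => // i _.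
      by rewrite -[X in measurable X]setTI; apply: measurable_tnth => //; exact: mA.
    by apply/seteqP; split => [t /= At i _|t At i]; exact: At.
  have bxP t : bx t -> forall i, `|tov t i 0 - t0 i 0| <= r.
    move=> bt i; have := bt i; rewrite /A/= in_itv/= mxE ler_norml => /andP[b1 b2].
    by apply/andP; split; move: b1 b2; lra.
  have bxN t : bx t -> Theta (tov t) /\ p0 <= prior (tov t).
    by move=> bt; apply: near_t0 => i; exact: le_trans (bxP t bt i) Trho.
  pose k := expR (H t0) * expR (- (M * p%:R) - M * p%:R ^+ 2) * p0.
  have k0 : 0 < k by rewrite !mulr_gt0 ?expR_gt0.
  have -> : expR (H t0) * (Cl * r ^+ p) = k * (2 * r) ^+ p by rewrite /k /Cl exprMn; ring.
  rewrite EFinM -lbx -integral_cst//.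
  apply: (@le_trans _ _ (\int[lebesgue_vec p]_(t in bx) (E t)%:E)%E).
    apply: ge0_le_integral => //.
    - by move=> t _; rewrite lee_fin ltW.
    - apply/measurable_EFinP; apply: measurable_funS mE => //.
      by move=> t /bxN[].
    move=> t bt; have [St pt] := bxN t bt; rewrite lee_fin /E /k -expRD.
    apply: ler_pM; rewrite ?expR_ge0 ?(ltW p00)// ler_expR.
    have /andP[Hl _] := HH _ St; set u := l1 (tov t - t0) in Hl.
    have ur : u <= p%:R * r.
      apply: (@le_trans _ _ (\sum_(i < p) r)).
        by apply: ler_sum => i _; rewrite !mxE; have := bxP t bt i; rewrite mxE.
      by rewrite sumr_const card_ord -[leLHS]mulr_natl.
    have u0 : 0 <= u by exact: l1_ge0.
    have tu : tau * u <= p%:R.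
      apply: (@le_trans _ _ (tau * (p%:R * r))); first by rewrite ler_wpM2l// ltW.
      by rewrite mulrCA taur mulr1.
    have tu0 : 0 <= tau * u by rewrite mulr_ge0// ltW.
    have h1 : M * tau * u <= M * p%:R by rewrite -mulrA ler_wpM2l.
    have h2 : M * T * u ^+ 2 <= M * p%:R ^+ 2.
      rewrite -tau2 -mulrA -exprMn ler_wpM2l//.
      by apply: lerXn2r; rewrite ?nnegrE.
    by move: Hl h1 h2; move: (M * tau * u) (M * T * u ^+ 2) (M * p%:R) (M * p%:R ^+ 2) => x y z v; lra.
  apply: ge0_subset_integral => //.
    exact/measurable_EFinP.
  by move=> t /bxN[].
have Ifin : I \is a fin_num.
  rewrite ge0_fin_numE; first by rewrite (le_lt_trans Iup)// ltry.
  by apply: integral_ge0 => t St; rewrite lee_fin E0.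
have IE : (fine I)%:E = I by rewrite fineK.
move: Iup Ilow; rewrite -IE !lee_fin => Iup Ilow.
have I0 : 0 < fine I by apply: lt_le_trans Ilow; rewrite !mulr_gt0 ?expR_gt0.
have lnr : ln (r ^+ p) = - (p%:R / 2 * ln T).
  rewrite lnXn// /r lnV ?posrE// -mulr_natl.
  have -> : ln T = 2 * ln tau by rewrite -{1}tau2 lnXn// mulr_natl.
  by field.
have posk k : 0 < k -> 0 < expR (H t0) * (k * r ^+ p).
  by move=> k0; apply: mulr_gt0; [exact: expR_gt0|exact: mulr_gt0].
have lnk k : 0 < k -> ln (expR (H t0) * (k * r ^+ p)) = H t0 + ln k - p%:R / 2 * ln T.
  move=> k0; rewrite lnM ?posrE ?expR_gt0 ?mulr_gt0// expRK lnM ?posrE// lnr addrA//.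
have L1 : ln (fine I) <= H t0 + ln Cu - p%:R / 2 * ln T.
  by rewrite -(lnk _ Cu0) ler_ln ?posrE// posk.
have L2 : H t0 + ln Cl - p%:R / 2 * ln T <= ln (fine I).
  by rewrite -(lnk _ Cl0) ler_ln ?posrE// posk.
have Hup : H that <= H t0 + M ^+ 2 / (2 * c).
  apply/ler_addgt0Pr => e e0; have [t Tt Ht] := Hthat e e0.
  have /andP[_ Hu] := HH _ Tt; set u := l1 (t - t0) in Hu.
  have q1 := quadratic_envelope u tau0; rewrite tau2 in q1.
  have q2 : 0 <= c / 2 * T * u ^+ 2.
    by apply: mulr_ge0; [apply: mulr_ge0; [rewrite divr_ge0// ltW|exact: ltW]|exact: sqr_ge0].
  apply: (le_trans Ht); move: Hu q1 q2.
  by move: (c / 2 * T * u ^+ 2) (c * T * u ^+ 2) (M * tau * u) => x y z; lra.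
have -> : free_energy T Theta prior H - (- T^-1 * H that + p%:R / (2 * T) * ln T) =
    T^-1 * (H that - p%:R / 2 * ln T - ln (fine I)).
  rewrite /free_energy /Rintegral -/S -/I.
  have -> : p%:R / (2 * T) = T^-1 * (p%:R / 2) by rewrite invfM; ring.
  by ring.
rewrite normrM (gtr0_norm (_ : 0 < T^-1)) ?invr_gt0// mulrC ler_pM2r ?invr_gt0//.
have a1 := ler_norm (ln Cu); have a2 := ler_norm (- ln Cl); rewrite normrN in a2.
have a3 := normr_ge0 (ln Cu); have a4 := normr_ge0 (ln Cl).
have a5 := ler_norm (- ln Cu); rewrite normrN in a5. have a6 := ler_norm (ln Cl).
have a7 : 0 <= M ^+ 2 / (2 * c) by rewrite divr_ge0 ?sqr_ge0// mulr_ge0// ltW.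
move: L1 L2 Hup H0that a1 a2 a3 a4 a5 a6 a7.
move: (ln Cu) (ln Cl) (p%:R / 2 * ln T) (M ^+ 2 / (2 * c)) (ln (fine I)) (H that) (H t0).
by move=> x y z v l s q *; rewrite ler_norml; apply/andP; split; lra.
Qed.

End free_energy.

End laplace.

(** * The coefficients on the closed parameter sets *)

Lemma closure_approx {R : realType} p (Theta : set 'cV[R]_p) (f : 'cV[R]_p -> R) t (e : R) :
  {within closure Theta, continuous f} -> closure Theta t -> 0 < e ->
  exists2 s, Theta s & `|f s - f t| < e /\ l1 (s - t) < e.
Proof.
move=> cf Ct e0.
have [del del0 Hdel] : exists2 del : R, 0 < del & forall y : 'cV[R]_p,
    closure Theta y -> (forall i, `|y i 0 - t i 0| < del) -> `|f y - f t| < e.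
  have /cvgrPdist_lt/(_ e e0) := proj1 (subspace_continuousP _ _) cf t Ct.
  rewrite near_withinE => /nbhs_cVP[del del0 H]; exists del => // y Cy yt.
  by rewrite distrC; exact: H.
pose q := Num.min del (e / p.+1%:R).
have q0 : 0 < q by rewrite lt_min del0 divr_gt0.
have B : nbhs t [set y : 'cV[R]_p | forall i, `|y i 0 - t i 0| < q].
  by apply/nbhs_cVP; exists q.
have [s [Ts sq]] := Ct _ B.
exists s => //; split.
  apply: Hdel; first exact: subset_closure.
  by move=> i; apply: (lt_le_trans (sq i)); rewrite ge_min lexx.
apply: (@le_lt_trans _ _ (\sum_(i < p) e / p.+1%:R)).
  apply: ler_sum => i _; rewrite !mxE; apply: ltW; apply: lt_le_trans (sq i) _.
  by rewrite ge_min lexx orbT.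
rewrite sumr_const card_ord -[X in X < _]mulr_natl mulrCA -[X in _ < X]mulr1.
by rewrite ltr_pM2l// ltr_pdivrMr// mul1r ltr_nat.
Qed.

Lemma within_closure_dist {R : realType} p (C : set 'cV[R]_p) (f : 'cV[R]_p -> R) t (e : R) :
  {within C, continuous f} -> C t -> 0 < e ->
  exists2 del : R, 0 < del & forall y : 'cV[R]_p,
    C y -> (forall i, `|y i 0 - t i 0| < del) -> `|f y - f t| < e.
Proof.
move=> cf Ct e0.
have /cvgrPdist_lt/(_ e e0) := proj1 (subspace_continuousP _ _) cf t Ct.
rewrite near_withinE => /nbhs_cVP[del del0 H]; exists del => // y Cy yt.
by rewrite distrC; exact: H.
Qed.

Lemma closure_coord_bounded {R : realType} p (Theta : set 'cV[R]_p) : bounded_set Theta ->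
  exists B : R, forall t, closure Theta t -> forall l, `|t l 0| <= B.
Proof.
move=> [N [_ HN]]; pose B := `|N| + 1.
have NB : N < B by rewrite /B (le_lt_trans (ler_norm _))// ltrDl.
have B0 : 0 < B by rewrite ltr_wpDl.
exists (B + 1 + 1) => t Ct l.
have nb : nbhs t [set y : 'cV[R]_p | forall i, `|y i 0 - t i 0| < 1].
  by apply/nbhs_cVP; exists 1.
have [s [Ts st]] := Ct _ nb.
have sB : `|s| < B + 1 by apply: (le_lt_trans (HN B NB s Ts)); rewrite ltrDl.
have : ball (0 : 'cV[R]_p) (B + 1) s by rewrite -ball_normE/= sub0r normrN.
move=> [_ /(_ l 0)]; rewrite -ball_normE/= mxE sub0r normrN => sl.
rewrite -[t l 0](subKr (s l 0)); apply: le_trans (ler_normB _ _) _.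
by apply: lerD; apply: ltW => //; exact: st.
Qed.

Lemma regular_field_closure_lip {R : realType} d p (Theta : set 'cV[R]_p)
    f f' (K : R) m (x : 'cV[R]_d) t t' :
  bounded_convex_domain Theta -> regular_field Theta f f' K m ->
  closure Theta t -> closure Theta t' ->
  `|f x t - f x t'| <= K * wgt x ^+ m * l1 (t - t').
Proof.
move=> Tdom rf Ct Ct'; have K0 := rf_ge0 rf.
apply/ler_addgt0Pr => e e0.
set C := K * wgt x ^+ m.
have C0 : 0 <= C by rewrite mulr_ge0 ?wgtX_ge0.
pose q := e / (2 * (1 + C)).
have q0 : 0 < q by rewrite divr_gt0// mulr_gt0// ltr_wpDr.
have [s Ts [fs ls]] := closure_approx (rf_cont rf (x := x)) Ct q0.
have [s' Ts' [fs' ls']] := closure_approx (rf_cont rf (x := x)) Ct' q0.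
have H := regular_field_theta_lip Tdom x rf Ts Ts'.
have lss : l1 (s - s') <= l1 (t - t') + (q + q).
  have -> : l1 (t - t') + (q + q) = q + (l1 (t - t') + q) by ring.
  apply: (le_trans (l1_triangle _ t _)); apply: lerD; first exact: ltW.
  apply: (le_trans (l1_triangle _ t' _)); rewrite lerD2l l1B; exact: ltW.
have H2 : `|f x s - f x s'| <= C * l1 (t - t') + C * (q + q).
  by apply: (le_trans H); rewrite -mulrDr ler_wpM2l.
have -> : e = (q + q) + C * (q + q).
  by rewrite /q; field; rewrite gt_eqF// ltr_wpDr.
have -> : f x t - f x t' = (f x s - f x s') - (f x s - f x t) + (f x s' - f x t') by ring.
apply: (le_trans (ler_normD _ _)).
have -> : C * l1 (t - t') + (q + q + C * (q + q)) = C * l1 (t - t') + C * (q + q) + q + q by ring.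
apply: lerD; last exact: ltW.
apply: (le_trans (ler_normB _ _)); apply: lerD => //; exact: ltW.
Qed.

Section measurable_matrices.
Context {R : realType} {disp : measure_display} {T : measurableType disp}.

(** The inverse of y is y exp(- ln (y^2)). *)
Lemma measurable_inv_neq0 (f : T -> R) : measurable_fun setT f ->
  (forall w, f w != 0) -> measurable_fun setT (fun w => (f w)^-1).
Proof.
move=> mf f0.
rewrite (_ : (fun w => (f w)^-1) = (fun w => f w * expR (- ln (f w ^+ 2)))).
  apply: measurable_funM => //; apply: measurableT_comp => //; apply: measurable_funN.
  by apply: (measurableT_comp (@measurable_ln R)); exact: measurable_funX.
apply/funext => w; have f2 : 0 < f w ^+ 2 by rewrite exprn_even_gt0//= f0.
by rewrite expRN lnK ?posrE// expr2 invfM mulrA mulfV// mul1r.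
Qed.

Lemma measurable_det n (A : T -> 'M[R]_n) :
  (forall i j, measurable_fun setT (fun w => A w i j)) ->
  measurable_fun setT (fun w => \det (A w)).
Proof.
move=> mA; rewrite /determinant; apply: measurable_sum => s.
by apply: measurable_funM => //; apply: measurable_prod => i _; exact: mA.
Qed.

(** Cramer's rule. *)
Lemma measurable_invmx n (A : T -> 'M[R]_n) i j :
  (forall i j, measurable_fun setT (fun w => A w i j)) ->
  (forall w, A w \in unitmx) ->
  measurable_fun setT (fun w => invmx (A w) i j).
Proof.
move=> mA uA.
rewrite (_ : (fun w => _) = (fun w => (\det (A w))^-1 *
    ((-1) ^+ (j + i) * \det (row' j (col' i (A w)))))).
  apply: measurable_funM.
    apply: measurable_inv_neq0; first exact: measurable_det.
    by move=> w; have := uA w; rewrite unitmxE unitfE.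
  apply: measurable_funM => //; apply: measurable_det => k l.
  by under eq_fun do rewrite !mxE; exact: mA.
by apply/funext => w; rewrite /invmx uA !mxE.
Qed.

Lemma measurable_parameter d p (C : set 'cV[R]_p) (f : 'cV[R]_d -> 'cV[R]_p -> R)
    (U : T -> 'cV[R]_d) (V : T -> 'cV[R]_p) (t0 : 'cV[R]_p) : C t0 ->
  (forall g, borel g -> measurable_fun setT (fun w => g (U w))) ->
  (forall i, measurable_fun setT (fun w => V w i 0)) -> (forall w, C (V w)) ->
  (forall t, C t -> borel (f ^~ t)) ->
  (forall x, exists L : R, forall t t', C t -> C t' -> `|f x t - f x t'| <= L * l1 (t - t')) ->
  measurable_fun setT (fun w => f (U w) (V w)).
Proof.
move=> Ct0 mU mV CV bf lf.
apply: (@measurable_random_parameter R _ _ 'I_p 'cV[R]_p (fun v i => v i 0) C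
  (fun t w => f (U w) t) V t0) => //.
  by move=> t Ct; exact: (mU _ (bf t Ct)).
move=> w t Ct e e0; have [L HL] := lf (U w).
pose L' := (`|L| + 1) * p.+1%:R.
have L0 : 0 < L' by rewrite mulr_gt0// ltr_wpDl.
exists (e / L'); first by rewrite divr_gt0.
move=> y Cy yt; apply: (le_lt_trans (HL _ _ Cy Ct)).
apply: (@le_lt_trans _ _ (`|L| * (p%:R * (e / L')))).
  apply: (@le_trans _ _ (`|L| * l1 (y - t))); first by rewrite ler_wpM2r ?l1_ge0// ler_norm.
  rewrite ler_wpM2l//; apply: (@le_trans _ _ (\sum_(i < p) e / L')).
    by apply: ler_sum => i _; rewrite !mxE ltW.
  by rewrite sumr_const card_ord -[leLHS]mulr_natl.
have -> : `|L| * (p%:R * (e / L')) = e * (`|L| * p%:R / L') by ring.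
rewrite -[X in _ < X]mulr1 ltr_pM2l// ltr_pdivrMr// mul1r /L'.
apply: (@le_lt_trans _ _ (`|L| * p.+1%:R)); first by rewrite ler_wpM2l// ler_nat.
by rewrite ltr_pM2r// ltrDl.
Qed.

End measurable_matrices.

Section coefficients.
Context {R : realType} {d r pa pg : nat}.
Variables (a : 'cV[R]_d -> 'cV[R]_pa -> 'cV[R]_d)
          (c : 'cV[R]_d -> 'cV[R]_pg -> 'M[R]_(d, r)).
Variables (Theta_a : set 'cV[R]_pa) (Theta_g : set 'cV[R]_pg).
Variables (a' : 'I_d -> 'I_pa -> 'cV[R]_d -> 'cV[R]_pa -> R)
  (c' : 'I_d * 'I_r -> 'I_pg -> 'cV[R]_d -> 'cV[R]_pg -> R) (K : R) (m : nat).
Hypotheses (Ta : bounded_convex_domain Theta_a) (Tg : bounded_convex_domain Theta_g).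
Hypothesis Ra : forall i, regular_field Theta_a (fun x t => a x t i 0) (a' i) K m.
Hypothesis Rc : forall ij, regular_field Theta_g (fun x t => c x t ij.1 ij.2) (c' ij) K m.
Hypothesis K0 : 0 <= K.
Hypothesis lmin : forall x g, closure Theta_g g ->
  0 < lambda_min (scale_mx c x g) /\ (lambda_min (scale_mx c x g))^-1 <= K * wgt x ^+ m.

Definition precision x g : 'M[R]_d := invmx (scale_mx c x g).

Lemma precision_unit x g : closure Theta_g g -> scale_mx c x g \in unitmx.
Proof. by move=> Cg; apply: outer_unitmx; exact: (proj1 (lmin x Cg)). Qed.

Lemma precision_sym x g i j : precision x g i j = precision x g j i.
Proof.
have E : (precision x g)^T = precision x g by rewrite /precision trmx_inv outer_sym.
by rewrite -[in LHS]E mxE.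
Qed.

Lemma precision_bound x g i j : closure Theta_g g -> `|precision x g i j| <= K * wgt x ^+ m.
Proof.
move=> Cg; have [l0 l1] := lmin x Cg.
by apply: le_trans l1; exact: invmx_outer_le.
Qed.

(** The resolvent identity transfers the Lipschitz bound from S to its inverse. *)
Lemma precision_lip : exists2 Kn : R, 0 <= Kn & forall x g g' i j,
  closure Theta_g g -> closure Theta_g g' ->
  `|precision x g i j - precision x g' i j| <= Kn * wgt x ^+ (4 * m) * l1 (g - g').
Proof.
exists (d%:R * d%:R * (K * (r%:R * (2 * (K * K))) * K)); first by rewrite !mulr_ge0.
move=> x g g' i j Cg Cg'.
have -> : precision x g i j - precision x g' i j = (precision x g - precision x g') i j.
  by rewrite !mxE.
rewrite /precision invmxB ?precision_unit//.
have W0 := wgtX_ge0 x m.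
have S i' j' : `|(scale_mx c x g' - scale_mx c x g) i' j'| <=
    r%:R * (2 * (K * K)) * (wgt x ^+ m * wgt x ^+ m) * l1 (g - g').
  rewrite !mxE -sumrB; apply: le_trans (ler_norm_sum _ _ _) _.
  apply: (@le_trans _ _ (\sum_(k < r) (2 * (K * K)) * (wgt x ^+ m * wgt x ^+ m) * l1 (g - g'))); last first.
    by rewrite sumr_const card_ord -[leLHS]mulr_natl !mulrA.
  apply: ler_sum => k _; rewrite !mxE.
  have b1 := rf_bound (Rc (i', k)) x Cg'; have b2 := rf_bound (Rc (j', k)) x Cg.
  have b3 := regular_field_closure_lip x Tg (Rc (i', k)) Cg' Cg.
  have b4 := regular_field_closure_lip x Tg (Rc (j', k)) Cg' Cg.
  rewrite /= in b1 b2 b3 b4; rewrite (l1B g' g) in b3 b4.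
  have -> : c x g' i' k * c x g' j' k - c x g i' k * c x g j' k =
    c x g' i' k * (c x g' j' k - c x g j' k) + (c x g' i' k - c x g i' k) * c x g j' k by ring.
  apply: (le_trans (ler_normD _ _)); rewrite !normrM.
  have -> : 2 * (K * K) * (wgt x ^+ m * wgt x ^+ m) * l1 (g - g') =
    (K * wgt x ^+ m) * (K * wgt x ^+ m * l1 (g - g')) +
    (K * wgt x ^+ m * l1 (g - g')) * (K * wgt x ^+ m) by ring.
  by apply: lerD; apply: ler_pM.
apply: (le_trans (mulmx3_le _ _ (fun i j => precision_bound x i j Cg) S
  (fun i j => precision_bound x i j Cg'))).
have -> : (4 * m = m + m + m + m)%N by lia.
rewrite !exprD le_eqVlt; apply/orP; left; apply/eqP.
by move: (wgt x ^+ m) => W; ring.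
Qed.

Lemma precision_measurable disp (T : measurableType disp) (U : T -> 'cV[R]_d)
    (V : T -> 'cV[R]_pg) i j :
  (forall f, borel f -> measurable_fun setT (fun w => f (U w))) ->
  (forall i, measurable_fun setT (fun w => V w i 0)) ->
  (forall w, closure Theta_g (V w)) ->
  measurable_fun setT (fun w => precision (U w) (V w) i j).
Proof.
move=> mU mV CV; apply: measurable_invmx => [i' j'|w]; last exact: precision_unit.
have mc k l : measurable_fun setT (fun w => c (U w) (V w) k l).
  have [_ [g0 Tg0] _ _] := Tg.
  apply: (measurable_parameter (C := closure Theta_g) (f := fun x t => c x t k l)
    (t0 := g0)) => //.
  - exact: subset_closure.
  - move=> t Ct; apply: (lipschitz_borel (C := fun _ _ => K)) => [x y|x]; last by exists K.
    exact: (rf_lip (Rc (k, l)) _ _ Ct).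
  by move=> x; exists (K * wgt x ^+ m) => t t'; exact: (regular_field_closure_lip x Tg (Rc (k, l))).
under eq_fun do rewrite !mxE.
apply: measurable_sum => k; apply: measurable_funM => //.
by under eq_fun do rewrite mxE; exact: mc.
Qed.

Lemma drift_measurable disp (T : measurableType disp) (U : T -> 'cV[R]_d)
    (V : T -> 'cV[R]_pa) i :
  (forall f, borel f -> measurable_fun setT (fun w => f (U w))) ->
  (forall i, measurable_fun setT (fun w => V w i 0)) ->
  (forall w, closure Theta_a (V w)) ->
  measurable_fun setT (fun w => a (U w) (V w) i 0).
Proof.
move=> mU mV CV; have [_ [g0 Tg0] _ _] := Ta.
apply: (measurable_parameter (C := closure Theta_a) (f := fun x t => a x t i 0)
  (t0 := g0)) => //.
- exact: subset_closure.
- move=> t Ct; apply: (lipschitz_borel (C := fun _ _ => K)) => [x y|x]; last by exists K.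
  exact: (rf_lip (Ra i) _ _ Ct).
by move=> x; exists (K * wgt x ^+ m) => t t'; exact: (regular_field_closure_lip x Ta (Ra i)).
Qed.

Lemma precision_borel g i j : closure Theta_g g -> borel (fun x => precision x g i j).
Proof.
move=> Cg; apply: (precision_measurable (U := @tov R d) (V := fun=> g)) => //.
Qed.

Lemma drift_deriv_borel t l k : Theta_a t -> borel (fun x => a' l k x t).
Proof.
move=> Tt; apply: (lipschitz_borel (C := fun y x => K * (wgt y + wgt x) ^+ m)) => [x y|x].
  exact: (regular_field_deriv_xlip Ta k y x (Ra l) Tt).
exists (K * (2 + d%:R * wgt x + wgt x) ^+ m) => y yx.
have W0 := wgt_gt0 x; have W1 := wgt_gt0 y.
have yb : wgt y <= 2 + d%:R * wgt x.
  have T := l1_triangle y x 0; rewrite !subr0 in T.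
  rewrite /wgt; have := le_trans (enorm_le_l1 y) T; have := l1_wgt x.
  by move: yx; rewrite /wgt; move: (d%:R * _) => u; lra.
rewrite ler_wpM2l//; apply: lerXn2r; rewrite ?nnegrE.
- by rewrite addr_ge0// ltW.
- by apply: addr_ge0; [apply: addr_ge0 => //; apply: mulr_ge0 => //|]; exact: ltW.
by rewrite lerD2r.
Qed.

(** The drift parameter stays in the open set, where derivatives exist; the
    diffusion parameter ranges over the closed set, in which its estimator
    takes its values. *)
Definition joint_domain : set 'cV[R]_(pa + pg) :=
  [set t | Theta_a (usubmx t) /\ closure Theta_g (dsubmx t)].

Lemma l1_split (t : 'cV[R]_(pa + pg)) : l1 t = l1 (usubmx t) + l1 (dsubmx t).
Proof.
rewrite /l1 big_split_ord/=; congr (_ + _); apply: eq_bigr => i _; by rewrite mxE.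
Qed.

(** The coefficient of the i-th residual in the derivative of the
    quasi-likelihood along the k-th drift parameter. *)
Definition score_weight k i x (t : 'cV[R]_(pa + pg)) : R :=
  \sum_l precision x (dsubmx t) i l * a' l k x (usubmx t).

Lemma score_weight_regular : exists2 Kp : R, 0 <= Kp & exists mp : nat,
  [/\ forall k i t, joint_domain t -> borel (score_weight k i ^~ t),
      forall k i x t, joint_domain t -> `|score_weight k i x t| <= Kp * wgt x ^+ mp &
      forall k i x t t', joint_domain t -> joint_domain t' ->
        `|score_weight k i x t - score_weight k i x t'| <= Kp * wgt x ^+ mp * l1 (t - t')].
Proof.
have [Kn Kn0 Hn] := precision_lip.
exists (d%:R * (Kn * K + K * K)); first by rewrite mulr_ge0// addr_ge0// mulr_ge0.
exists (5 * m)%N; split.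
- move=> k i t [Tt Ct]; apply: borel_sum => l; apply: borelM; first exact: precision_borel.
  exact: drift_deriv_borel.
- move=> k i x t [Tt Ct]; apply: le_trans (ler_norm_sum _ _ _) _.
  apply: (@le_trans _ _ (\sum_(l < d) (Kn * K + K * K) * wgt x ^+ (5 * m))).
    apply: ler_sum => l _; rewrite normrM.
    apply: (@le_trans _ _ ((K * wgt x ^+ m) * (K * wgt x ^+ m))).
      by apply: ler_pM => //; [exact: precision_bound|exact: (rf_dbound (Ra l) k x Tt)].
    have -> : K * wgt x ^+ m * (K * wgt x ^+ m) = K * K * wgt x ^+ (m + m) by rewrite exprD; ring.
    apply: ler_pM; rewrite ?mulr_ge0 ?wgtX_ge0//; first by rewrite lerDr mulr_ge0.
    by apply: wgtX_le; lia.
  by rewrite sumr_const card_ord -[leLHS]mulr_natl mulrA.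
move=> k i x t t' [Tt Ct] [Tt' Ct'].
have lu : l1 (usubmx t - usubmx t') <= l1 (t - t').
  by rewrite (l1_split (t - t')) linearB/= lerDl l1_ge0.
have ld : l1 (dsubmx t - dsubmx t') <= l1 (t - t').
  have e : dsubmx (t - t') = dsubmx t - dsubmx t' by rewrite linearB.
  by rewrite (l1_split (t - t')) e lerDr l1_ge0.
rewrite /score_weight -sumrB; apply: le_trans (ler_norm_sum _ _ _) _.
apply: (@le_trans _ _ (\sum_(l < d) (Kn * K + K * K) * wgt x ^+ (5 * m) * l1 (t - t'))); last first.
  by rewrite sumr_const card_ord -[leLHS]mulr_natl !mulrA.
apply: ler_sum => l _.
set p1 := precision _ _ _ _; set p2 := precision _ _ _ _; set d1 := a' _ _ _ _; set d2 := a' _ _ _ _.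
have -> : p1 * d1 - p2 * d2 = (p1 - p2) * d1 + p2 * (d1 - d2) by ring.
apply: (le_trans (ler_normD _ _)); rewrite !normrM !mulrDl; apply: lerD.
  apply: (@le_trans _ _ ((Kn * wgt x ^+ (4 * m) * l1 (t - t')) * (K * wgt x ^+ m))).
    apply: ler_pM => //; last exact: (rf_dbound (Ra l) k x Tt).
    apply: (le_trans (Hn x _ _ i l Ct Ct')); rewrite ler_wpM2l// mulr_ge0// wgtX_ge0//.
  have -> : (5 * m = 4 * m + m)%N by lia.
  by rewrite exprD; move: (wgt x ^+ (4 * m)) (wgt x ^+ m) => u v;
    rewrite le_eqVlt; apply/orP; left; apply/eqP; ring.
apply: (@le_trans _ _ ((K * wgt x ^+ m) * (K * wgt x ^+ m * l1 (t - t')))).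
  apply: ler_pM => //; first exact: precision_bound.
  apply: (le_trans (rf_dlip (Ra l) k x Tt Tt')); rewrite ler_wpM2l// mulr_ge0// wgtX_ge0//.
have -> : K * wgt x ^+ m * (K * wgt x ^+ m * l1 (t - t')) = K * K * wgt x ^+ (m + m) * l1 (t - t').
  by rewrite exprD; ring.
rewrite ler_wpM2r ?l1_ge0// ler_wpM2l ?mulr_ge0//; apply: wgtX_le; lia.
Qed.

Lemma precision_form_ge0 x g v : closure Theta_g g -> 0 <= mxform (precision x g) v v.
Proof.
move=> Cg; pose u := precision x g *m v.
have E : scale_mx c x g *m u = v.
  by rewrite /u mulmxA mulmxV ?mul1mx// precision_unit.
rewrite mxformE -/u -[v in dot v u]E.
have -> : dot (scale_mx c x g *m u) u = mxform (scale_mx c x g) u u.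
  by rewrite mxformE; apply: eq_bigr => i _; rewrite mulrC.
by rewrite mxform_outer dotvv_ge0.
Qed.

Lemma precision_form_lower x g v : closure Theta_g g ->
  dot v v <= (d%:R * r%:R * K ^+ 2) * wgt x ^+ (m * 2) * mxform (precision x g) v v.
Proof.
move=> Cg; have [l0 _] := lmin x Cg.
have H := invmx_outer_ge l0 v.
have pos := precision_form_ge0 x v Cg.
apply: (le_trans H); apply: ler_wpM2r => //.
apply: (@le_trans _ _ (\sum_(i < d) \sum_(k < r) (K * wgt x ^+ m) ^+ 2)).
  apply: ler_sum => i _; apply: ler_sum => k _.
  rewrite -[leLHS]real_normK ?num_real//; apply: lerXn2r; rewrite ?nnegrE ?mulr_ge0 ?wgtX_ge0//.
  exact: (rf_bound (Rc (i, k)) x Cg).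
rewrite !sumr_const !card_ord -[leLHS]mulr_natl -[X in _ * X]mulr_natl exprMn -exprM.
by rewrite !mulrA.
Qed.

Lemma precision_form_upper x g v : closure Theta_g g ->
  `|mxform (precision x g) v v| <= K * wgt x ^+ m * l1 v ^+ 2.
Proof.
move=> Cg; rewrite mxform_sum; apply: le_trans (ler_norm_sum _ _ _) _.
rewrite expr2 /l1 mulrCA mulr_suml; apply: ler_sum => i _.
apply: le_trans (ler_norm_sum _ _ _) _; rewrite mulrA mulr_sumr; apply: ler_sum => j _.
by rewrite !normrM ler_wpM2r// ler_wpM2l//; exact: precision_bound.
Qed.

End coefficients.

(** * Expansion of the quasi-likelihood *)

Section bilinear.
Context {R : realType} {n : nat} (A : 'M[R]_n).

Lemma mxformBr u v w : mxform A u (v - w) = mxform A u v - mxform A u w.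
Proof. by rewrite /mxform mulmxBr !mxE. Qed.

Lemma mxformBl u v w : mxform A (u - v) w = mxform A u w - mxform A v w.
Proof. by rewrite /mxform linearB/= !mulmxBl !mxE. Qed.

Lemma mxformZl k u w : mxform A (k *: u) w = k * mxform A u w.
Proof. by rewrite /mxform linearZ/= -!scalemxAl !mxE. Qed.

Lemma mxform_sym u v : (forall i j, A i j = A j i) -> mxform A u v = mxform A v u.
Proof.
move=> sA; rewrite !mxform_sum exchange_big/=; apply: eq_bigr => i _; apply: eq_bigr => j _.
by rewrite sA; ring.
Qed.

End bilinear.

Section expansion.
Context {R : realType} {d r pa pg : nat}.
Variables (a : 'cV[R]_d -> 'cV[R]_pa -> 'cV[R]_d)
          (c : 'cV[R]_d -> 'cV[R]_pg -> 'M[R]_(d, r)).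
Local Notation precision := (precision c).

(** Expansion at alpha0: the inverse of S being symmetric, the cross terms turn
    the increment of X into the residual. *)
Lemma GQL2_increment n h x alpha alpha0 g :
  GQL2 a c n h x alpha g - GQL2 a c n h x alpha0 g =
  \sum_(j < n) mxform (precision (x j) g) (x j.+1 - x j - h *: a (x j) alpha0)
     (a (x j) alpha - a (x j) alpha0) -
  h / 2 * \sum_(j < n) mxform (precision (x j) g) (a (x j) alpha - a (x j) alpha0)
     (a (x j) alpha - a (x j) alpha0).
Proof.
rewrite /GQL2 !big_add1 !big_mkord /= mulr_sumr -!sumrB; apply: eq_bigr => j _.
rewrite !mxpair_outer -/(precision (x j) g) !mxformBr !mxformBl !mxformZl.
have -> : mxform (precision (x j) g) (a (x j) alpha) (a (x j) alpha0) =
    mxform (precision (x j) g) (a (x j) alpha0) (a (x j) alpha).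
  by apply: mxform_sym => i l; exact: precision_sym.
by field.
Qed.

Variables (Theta_a : set 'cV[R]_pa).
Variables (a' : 'I_d -> 'I_pa -> 'cV[R]_d -> 'cV[R]_pa -> R) (K : R) (m : nat).
Hypothesis Ta : bounded_convex_domain Theta_a.
Hypothesis Ra : forall i, regular_field Theta_a (fun x t => a x t i 0) (a' i) K m.

(** Mean value theorem on the segment from alpha0 to alpha, where the directional
    derivative is a combination of the coordinates of the score. *)
Lemma linear_part n (x : nat -> 'cV[R]_d) (xi : nat -> 'cV[R]_d) alpha alpha0 g (B : R) :
  Theta_a alpha -> Theta_a alpha0 ->
  (forall k al, Theta_a al -> `|\sum_(j < n) \sum_i
     score_weight c a' k i (x j) (col_mx al g) * xi j i 0| <= B) ->
  `|\sum_(j < n) mxform (precision (x j) g) (xi j) (a (x j) alpha - a (x j) alpha0)| <=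
    B * l1 (alpha - alpha0).
Proof.
move=> Tal Tal0 HB; have [_ _ _ cT] := Ta.
pose W (j : 'I_n) l : R := \sum_i xi j i 0 * precision (x j) g i l.
pose f (al : 'cV[R]_pa) : R := \sum_(j < n) \sum_l W j l * a (x j) al l 0.
pose df (z : 'cV[R]_pa) : R :=
  \sum_(j < n) \sum_l W j l * (\sum_k (alpha - alpha0) k 0 * a' l k (x j) z).
have D z : Theta_a z -> is_derive z (alpha - alpha0) f (df z).
  move=> Tz.
  have Dj (j : 'I_n) : is_derive z (alpha - alpha0)
      (\sum_l (W j l \*: (fun al => a (x j) al l 0)))
      (\sum_l W j l * (\sum_k (alpha - alpha0) k 0 * a' l k (x j) z)).
    apply: is_derive_sum => l.
    exact: (is_deriveZ (W j l) (rf_deriv (Ra l) (x j) (alpha - alpha0) Tz)).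
  have := is_derive_sum (fun j => Dj j).
  congr is_derive; apply/funext => al; rewrite /f fct_sumE; apply: eq_bigr => j _.
  by rewrite fct_sumE.
have [s [_ Ts E]] := mean_value_convex cT Tal0 Tal D.
have -> : \sum_(j < n) mxform (precision (x j) g) (xi j) (a (x j) alpha - a (x j) alpha0) =
    f alpha - f alpha0.
  rewrite /f -sumrB; apply: eq_bigr => j _; rewrite mxform_sum exchange_big/= -sumrB.
  apply: eq_bigr => l _; rewrite /W -mulrBr mulr_suml; apply: eq_bigr => i _.
  by rewrite !mxE.
rewrite E; set z := alpha0 + _ in Ts *.
have -> : df z = \sum_k (alpha - alpha0) k 0 *
    \sum_(j < n) \sum_i score_weight c a' k i (x j) (col_mx z g) * xi j i 0.
  rewrite /df; under eq_bigr do under eq_bigr do rewrite mulr_sumr.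
  under eq_bigr do rewrite exchange_big/=.
  rewrite exchange_big/=; apply: eq_bigr => k _; rewrite mulr_sumr; apply: eq_bigr => j _.
  rewrite mulr_sumr /W.
  under eq_bigr do rewrite mulr_suml.
  rewrite exchange_big/=; apply: eq_bigr => i _.
  rewrite /score_weight col_mxKd col_mxKu mulr_suml mulr_sumr; apply: eq_bigr => l _.
  by ring.
apply: le_trans (ler_norm_sum _ _ _) _; rewrite /l1 mulr_sumr; apply: ler_sum => k _.
by rewrite normrM mulrC ler_wpM2r//; exact: HB.
Qed.

End expansion.

(** * The two parabolas *)


Section key_inequality.
Context {R : realType} {disp : measure_display} {Omega : measurableType disp}.
Variables (P : probability Omega R) (F : R -> set_system Omega) (d r pa pg : nat).
Variables (a : 'cV[R]_d -> 'cV[R]_pa -> 'cV[R]_d)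
          (c : 'cV[R]_d -> 'cV[R]_pg -> 'M[R]_(d, r)).
Variables (Theta_a : set 'cV[R]_pa) (Theta_g : set 'cV[R]_pg).
Variables (alpha0 : 'cV[R]_pa) (gamma0 : 'cV[R]_pg).
Variables (Z : R -> Omega -> 'cV[R]_r) (X : R -> Omega -> 'cV[R]_d).
Variables (kappa : R -> R.-pker (d.-tuple R) ~> (d.-tuple R)).
Variable mu : probability (d.-tuple R) R.
Variables (a' : 'I_d -> 'I_pa -> 'cV[R]_d -> 'cV[R]_pa -> R)
  (c' : 'I_d * 'I_r -> 'I_pg -> 'cV[R]_d -> 'cV[R]_pg -> R) (K : R) (m : nat).
Hypotheses (Ta : bounded_convex_domain Theta_a) (Tg : bounded_convex_domain Theta_g).
Hypotheses (Ta0 : Theta_a alpha0) (Tg0 : Theta_g gamma0).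
Hypothesis Ra : forall i, regular_field Theta_a (fun x t => a x t i 0) (a' i) K m.
Hypothesis Rc : forall ij, regular_field Theta_g (fun x t => c x t ij.1 ij.2) (c' ij) K m.
Hypothesis K0 : 0 <= K.
Hypothesis lmin : forall x g, closure Theta_g g ->
  0 < lambda_min (scale_mx c x g) /\ (lambda_min (scale_mx c x g))^-1 <= K * wgt x ^+ m.
Hypothesis SS : sde_setting P F (a ^~ alpha0) (c ^~ gamma0) Z X K m.
Hypothesis TF : transition_function P F (a ^~ alpha0) (c ^~ gamma0) Z kappa.
Hypothesis EE : exponentially_ergodic kappa mu.
Hypothesis IA : identifiable_alpha a c mu Theta_a alpha0 gamma0.

Let shift i x t : R := a x t i 0 - a x alpha0 i 0.

Let shift_bound i x t : closure Theta_a t ->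
  `|shift i x t| <= K * wgt x ^+ m * l1 (t - alpha0).
Proof.
by move=> Ct; apply: (regular_field_closure_lip x Ta (Ra i)) => //; exact: subset_closure.
Qed.

Let drift_borel t i : closure Theta_a t -> borel (fun x => a x t i 0).
Proof.
move=> Ct; apply: (lipschitz_borel (C := fun _ _ => K)) => [x y|x]; last by exists K.
exact: (rf_lip (Ra i) _ _ Ct).
Qed.

Let shift_borel i t : closure Theta_a t -> borel (shift i ^~ t).
Proof.
by move=> Ct; apply: borelB; apply: drift_borel => //; exact: subset_closure.
Qed.

Let shift_sqr x t : dot (a x t - a x alpha0) (a x t - a x alpha0) = \sum_i shift i x t ^+ 2.
Proof. by apply: eq_bigr => i _; rewrite !mxE expr2. Qed.

(** Weighting by a power of wgt turns the identifiability condition into one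
    on the drift alone. *)
Let drift_identifiability : exists2 chi : R, 0 < chi & forall t, Theta_a t ->
  chi * l1 (t - alpha0) ^+ 2 <=
  expect mu (fun x => (\sum_i shift i (tov x) t ^+ 2) * wgt (tov x) ^+ m).
Proof.
have [chi chi0 H] := IA.
pose A : R := pa%:R ^+ 2 + 1; pose B : R := K * d%:R ^+ 2 + 1.
have A0 : 0 < A by rewrite ltr_wpDl// exprn_ge0.
have B0 : 0 < B by rewrite ltr_wpDl// mulr_ge0// exprn_ge0.
exists (2 * chi / A / B); first by rewrite !divr_gt0// mulr_gt0.
move=> t Tt; have Ct := subset_closure Tt.
have Cg0 : closure Theta_g gamma0 by exact: subset_closure.
set D := l1 (t - alpha0).
pose q x := mxform (precision c x gamma0) (a x t - a x alpha0) (a x t - a x alpha0).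
pose s x := (\sum_i shift i x t ^+ 2) * wgt x ^+ m.
have H1 : 2 * chi * enorm (t - alpha0) ^+ 2 <= expect mu (fun x => q (tov x)).
  have := H t Ct.
  rewrite (_ : \int[mu]_x _ = expect mu (fun x => q (tov x))); last first.
    by congr Rintegral; apply/funext => x; rewrite mxpair_outer.
  by move: (expect _ _) (enorm _ ^+ 2) => u v; lra.
have s0 x : 0 <= s x.
  by rewrite mulr_ge0 ?wgtX_ge0// sumr_ge0// => i _; exact: sqr_ge0.
have qs x : `|q x| <= B * s x.
  apply: (le_trans (precision_form_upper lmin x _ Cg0)).
  apply: (@le_trans _ _ (K * d%:R ^+ 2 * s x)); last first.
    by rewrite ler_wpM2r// lerDl.
  have -> : K * d%:R ^+ 2 * s x = K * wgt x ^+ m * (d%:R ^+ 2 * \sum_i shift i x t ^+ 2).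
    by rewrite /s; ring.
  rewrite ler_wpM2l ?mulr_ge0 ?wgtX_ge0// -shift_sqr.
  have -> : dot (a x t - a x alpha0) (a x t - a x alpha0) = enorm (a x t - a x alpha0) ^+ 2.
    by rewrite enorm_sqr.
  by rewrite -exprMn; apply: lerXn2r; rewrite ?nnegrE ?l1_ge0 ?mulr_ge0 ?enorm_ge0 ?l1_le_enorm.
have Is : intgr mu (fun x => s (tov x)).
  apply: (intgr_le _ _ (intgrZ (d%:R * (K * D) ^+ 2)
    (invariant_wgt_integrable EE (m * 2 + m)))).
    have b1 : borel (fun x => \sum_i shift i x t ^+ 2).
      by apply: borel_sum => i; apply: borelX; exact: shift_borel.
    exact: (borelM b1 (borelX m (borel_wgt (n := d)))).
  move=> x; rewrite ger0_norm// /s exprD mulrA; apply: ler_wpM2r; first exact: wgtX_ge0.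
  apply: (@le_trans _ _ (\sum_(i < d) (K * wgt (tov x) ^+ m * D) ^+ 2)).
    apply: ler_sum => i _; rewrite -[leLHS]real_normK ?num_real//.
    by apply: lerXn2r; rewrite ?nnegrE ?mulr_ge0 ?wgtX_ge0 ?l1_ge0//; exact: shift_bound.
  rewrite sumr_const card_ord -[leLHS]mulr_natl !exprMn -exprM le_eqVlt.
  by apply/orP; left; apply/eqP; ring.
have Iq : intgr mu (fun x => q (tov x)).
  apply: (intgr_le _ (fun x => qs (tov x)) (intgrZ B Is)).
  apply: (eq_measurable_fun (fun x : d.-tuple R => \sum_i \sum_j shift i (tov x) t *
      precision c (tov x) gamma0 i j * shift j (tov x) t)).
    move=> x _; rewrite /q mxform_sum; apply: eq_bigr => i _; apply: eq_bigr => j _.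
    by rewrite !mxE.
  have b1 i j : borel (fun x => shift i x t * precision c x gamma0 i j * shift j x t).
    apply: borelM; last exact: shift_borel.
    by apply: borelM; [exact: shift_borel|exact: (precision_borel Tg Rc lmin)].
  exact: (borel_sum _ _ (fun i => borel_sum _ _ (fun j => b1 i j))).
have H2 : 2 * chi * enorm (t - alpha0) ^+ 2 <= B * expect mu (fun x => s (tov x)).
  rewrite -(expectZ _ Is); apply: (le_trans H1); apply: expect_le => //.
    exact: intgrZ.
  by move=> x; apply: le_trans (qs (tov x)); exact: ler_norm.
have H3 : D ^+ 2 <= A * enorm (t - alpha0) ^+ 2.
  apply: (@le_trans _ _ (pa%:R ^+ 2 * enorm (t - alpha0) ^+ 2)).
    rewrite -exprMn; apply: lerXn2r; rewrite ?nnegrE ?l1_ge0 ?l1_le_enorm//.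
    by rewrite mulr_ge0// enorm_ge0.
  by rewrite ler_wpM2r ?sqr_ge0// lerDl.
have -> : 2 * chi / A / B * D ^+ 2 = 2 * chi * (D ^+ 2 / A) / B by ring.
rewrite ler_pdivrMr// [leRHS]mulrC; apply: le_trans H2.
by rewrite ler_wpM2l ?mulr_ge0 ?(ltW chi0)// ler_pdivrMr// mulrC.
Qed.

Let moment_sum_bound q eps : 0 < eps -> exists2 M : R, 0 < M & forall n h, (0 < n)%N -> 0 <= h ->
  exists E, [/\ measurable E, (P E <= eps%:E)%E & forall w, ~ E w ->
    \sum_(j < n) wgt (X (j%:R * h) w) ^+ q <= M * n%:R].
Proof.
move=> e0; have [C [C0 HC]] := wgt_moment SS q.
pose M := C / eps + 1; have M0 : 0 < M by rewrite ltr_wpDl// divr_ge0// ltW.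
exists M => // n h n0 h0.
have jh (j : nat) : 0 <= j%:R * h by rewrite mulr_ge0.
pose f w := \sum_(j < n) wgt (X (j%:R * h) w) ^+ q.
have If : intgr P f by apply: intgr_sum => j; exact: (proj1 (HC _ (jh j))).
have Ef : expect P f <= C * n%:R.
  rewrite expect_sum; last by move=> j; exact: (proj1 (HC _ (jh j))).
  apply: (@le_trans _ _ (\sum_(j < n) C)); first by apply: ler_sum => j _; exact: (proj2 (HC _ (jh j))).
  by rewrite sumr_const card_ord -[leLHS]mulr_natl mulrC.
have f0 w : 0 <= f w by apply: sumr_ge0 => j _; exact: wgtX_ge0.
have n0' : 0 < n%:R :> R by rewrite ltr0n.
have c0 : 0 < M * n%:R by rewrite mulr_gt0.
exists [set w | M * n%:R <= f w]; split.
- by apply: measurable_ge_set; exact: intgr_measurable If.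
- apply: (le_trans (expect_markov If f0 c0)); rewrite lee_fin ler_pdivrMr//.
  apply: (le_trans Ef); rewrite mulrA ler_wpM2r//.
  by rewrite /M mulrDr mulr1 [eps * _]mulrC divfK ?gt_eqF// lerDl ltW.
by move=> w; rewrite /mkset => /negP; rewrite -ltNge => /ltW.
Qed.

(** With probability close to one the increments of the quasi-likelihood are
    squeezed between two parabolas at the scale given by the square root of T.
    The bounds are uniform over the closed set of diffusion parameters, so that
    any estimator with values there may be substituted. *)
Lemma key_inequality : exists2 q : R, 0 < q & forall eps, 0 < eps ->
  exists M T0 : R, 0 <= M /\ forall n h, 0 < h <= 1 -> n%:R * h ^+ 2 <= 1 ->
  1 <= n%:R * h -> T0 <= n%:R * h ->
  exists E, [/\ measurable E, (P E <= eps%:E)%E & forall w, ~ E w ->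
    forall g t, closure Theta_g g -> Theta_a t ->
    - (M * Num.sqrt (n%:R * h) * l1 (t - alpha0)) - M * (n%:R * h) * l1 (t - alpha0) ^+ 2
    <= GQL2 a c n h (fun j => X (j%:R * h) w) t g - GQL2 a c n h (fun j => X (j%:R * h) w) alpha0 g
    <= M * Num.sqrt (n%:R * h) * l1 (t - alpha0) - q * (n%:R * h) * l1 (t - alpha0) ^+ 2].
Proof.
have [chi chi0 Hchi] := drift_identifiability.
have [|q1 q10 Hq1] := quadratic_lower SS TF EE (Theta := Theta_a) (t0 := alpha0)
  (e := shift) (me := m) (m1 := m) (m * 2) K0 chi0 (fun i t Tt => shift_borel i (subset_closure Tt))
  (fun i x t Tt => shift_bound i x (subset_closure Tt)) _ Hchi.
  move=> i x y t Tt; apply: le_trans (rf_mixed (Ra i) x y Tt Ta0).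
  by rewrite /shift le_eqVlt; apply/orP; left; apply/eqP; congr `|_|.
pose B : R := d%:R * r%:R * K ^+ 2 + 1.
have B0 : 0 < B by rewrite ltr_wpDl// !mulr_ge0// exprn_ge0.
exists (q1 / B / 2); first by rewrite !divr_gt0.
move=> eps e0; have e2 : 0 < eps / 2 by rewrite divr_gt0.
have e4 : 0 < eps / 2 / 2 by rewrite divr_gt0.
have [T1 HT1] := Hq1 _ e4.
have [M2 M20 HM2] := moment_sum_bound (m * 3) e4.
have [Kp Kp0 [mp [wb wB wl]]] := score_weight_regular Ta Tg Ra Rc K0 lmin.
have [_ _ bTa _] := Ta; have [_ _ bTg _] := Tg.
have [Ba HBa] := closure_coord_bounded bTa; have [Bg HBg] := closure_coord_bounded bTg.
pose D := joint_domain Theta_a Theta_g.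
have DB t : D t -> forall l, `|t l 0| <= `|Ba| + `|Bg|.
  move=> [Tu Cd] l; rewrite -(vsubmxK t) mxE; case: (fintype.split l) => i.
    apply: (le_trans (HBa _ (subset_closure Tu) i)); apply: (le_trans (ler_norm _)).
    by rewrite lerDl.
  by apply: (le_trans (HBg _ Cd i)); apply: (le_trans (ler_norm _)); rewrite lerDr.
have D0 : D !=set0.
  by exists (col_mx alpha0 gamma0); split; rewrite ?col_mxKu ?col_mxKd//; exact: subset_closure.
have p10 : 0 < pa%:R + 1 :> R by rewrite ltr_wpDl.
have ek : 0 < eps / 2 / (pa%:R + 1) by rewrite divr_gt0.
pose HS (k : 'I_pa) := score_bound SS DB D0 Kp0 (wb k) (wB k) (wl k) ek.
have /choice[Mk HMk] := HS.
pose M1 := \sum_k `|Mk k|; have M10 : 0 <= M1 by exact: sumr_ge0.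
pose M3 := K * (d%:R * K) ^+ 2 * M2.
have M30 : 0 <= M3 by apply: mulr_ge0; [apply: mulr_ge0 => //; exact: sqr_ge0|exact: ltW].
exists (M1 + M3), T1; split; first exact: addr_ge0.
move=> n h h01 nh2 nh1 nhT; have /andP[h0 h1] := h01.
have T0 : 0 < n%:R * h by exact: lt_le_trans nh1.
have n0 : (0 < n)%N by move: T0; rewrite pmulr_lgt0// ltr0n.
set tau := Num.sqrt (n%:R * h).
have tau0 : 0 <= tau by exact: sqrtr_ge0.
have /choice[Ek HEk] k : exists E, [/\ measurable E, (P E <= (eps / 2 / (pa%:R + 1))%:E)%E &
    forall w, ~ E w -> forall t, D t ->
    `|score (a ^~ alpha0) X (score_weight c a' k) n h t w| <= Mk k * tau].
  by have [_ H] := HMk k; have [E [mE pE HE]] := H n h h01 nh1 nh2; exists E.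
have [mE1 pE1] := prob_exists_le (fun k => let: And3 x _ _ := HEk k in x)
  (fun k => let: And3 _ x _ := HEk k in x).
set E1 := [set w | _] in mE1 pE1.
have [E2 [mE2 pE2 HE2]] := HT1 n h h01 nhT.
have [E3 [mE3 pE3 HE3]] := HM2 n h n0 (ltW h0).
have mE23 : measurable (E2 `|` E3) by exact: measurableU.
have mE : measurable (E1 `|` (E2 `|` E3)) by exact: measurableU.
exists (E1 `|` (E2 `|` E3)); split => //.
  rewrite [in leRHS](splitr eps).
  apply: (prob_le2 mE1 mE23 mE (@subset_refl _ _)).
    apply: (le_trans pE1); rewrite lee_fin card_ord mulrCA -[leRHS]mulr1.
    apply: ler_wpM2l; first exact: ltW.
    by rewrite ler_pdivrMr// mul1r lerDl.
  rewrite [in leRHS](splitr (eps / 2)).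
  exact: (prob_le2 mE2 mE3 mE23 (@subset_refl _ _) pE2 pE3).
move=> w nE g t Cg Tt; set u := l1 (t - alpha0).
set H := fun s => GQL2 a c n h (fun j => X (j%:R * h) w) s g.
rewrite -/(H t) -/(H alpha0).
have u0 : 0 <= u by exact: l1_ge0.
pose x j := X (j%:R * h) w.
pose xi (j : nat) := x j.+1 - x j - h *: a (x j) alpha0.
pose form j := mxform (precision c (x j) g) (a (x j) t - a (x j) alpha0) (a (x j) t - a (x j) alpha0).
have HD : H t - H alpha0 = \sum_(j < n) mxform (precision c (x j) g) (xi j)
    (a (x j) t - a (x j) alpha0) - h / 2 * \sum_(j < n) form j.
  exact: GQL2_increment.
have lin : `|\sum_(j < n) mxform (precision c (x j) g) (xi j)
    (a (x j) t - a (x j) alpha0)| <= M1 * tau * u.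
  apply: (linear_part (K := K) (m := m) Ta Ra) => // k al Tal.
  have nEk : ~ Ek k w by move=> Ekw; apply: nE; left; exists k.
  have [_ _ /(_ w nEk (col_mx al g)) Hs] := HEk k.
  apply: (le_trans _ (_ : Mk k * tau <= _)); last first.
    apply: ler_wpM2r => //; apply: (le_trans (ler_norm _)).
    by rewrite /M1 (bigD1 k)//= lerDl sumr_ge0.
  move: Hs; rewrite /score => Hs; apply: le_trans (Hs _); last first.
    by split; rewrite ?col_mxKu ?col_mxKd.
  rewrite le_eqVlt; apply/orP; left; apply/eqP; congr `|_|.
  by apply: eq_bigr => j _; apply: eq_bigr => i _; rewrite /residual /xi /x !mxE.
have form0 j : 0 <= form j by exact: (precision_form_ge0 lmin).
have low : q1 / B * n%:R * u ^+ 2 <= \sum_(j < n) form j.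
  have nE2 : ~ E2 w by move=> h'; apply: nE; right; left.
  have H2 := HE2 w nE2 t Tt.
  have H3 : \sum_(j < n) (\sum_i shift i (x j) t ^+ 2) / wgt (x j) ^+ (m * 2) <=
      B * \sum_(j < n) form j.
    rewrite mulr_sumr; apply: ler_sum => j _.
    have W : 0 < wgt (x j) ^+ (m * 2) by rewrite exprn_gt0// wgt_gt0.
    rewrite ler_pdivrMr// -shift_sqr.
    apply: (le_trans (precision_form_lower Rc K0 lmin (x j) _ Cg)).
    rewrite -/(form j) mulrAC; apply: ler_wpM2r; first exact: ltW.
    by apply: ler_wpM2r => //; rewrite lerDl.
  have -> : q1 / B * n%:R * u ^+ 2 = (q1 * n%:R * u ^+ 2) / B by ring.
  by rewrite ler_pdivrMr// [leRHS]mulrC; exact: le_trans H2 H3.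
have up : \sum_(j < n) form j <= M3 * n%:R * u ^+ 2.
  have nE3 : ~ E3 w by move=> h'; apply: nE; right; right.
  have H3 := HE3 w nE3.
  apply: (@le_trans _ _ (\sum_(j < n) K * (d%:R * K) ^+ 2 * u ^+ 2 * wgt (x j) ^+ (m * 3))).
    apply: ler_sum => j _; apply: (le_trans (ler_norm _)).
    apply: (le_trans (precision_form_upper lmin (x j) _ Cg)).
    have lb : l1 (a (x j) t - a (x j) alpha0) <= d%:R * K * wgt (x j) ^+ m * u.
      apply: (@le_trans _ _ (\sum_(i < d) K * wgt (x j) ^+ m * u)).
        apply: ler_sum => i _; rewrite !mxE.
        exact: (shift_bound i (x j) (subset_closure Tt)).
      by rewrite sumr_const card_ord -[leLHS]mulr_natl !mulrA.
    have -> : K * (d%:R * K) ^+ 2 * u ^+ 2 * wgt (x j) ^+ (m * 3) =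
        K * wgt (x j) ^+ m * (d%:R * K * wgt (x j) ^+ m * u) ^+ 2.
      have -> : (m * 3 = m + m + m)%N by rewrite !mulnS muln0 addn0 addnA.
      by rewrite !exprD; move: (wgt (x j) ^+ m) => W; ring.
    apply: ler_wpM2l; first by rewrite mulr_ge0// wgtX_ge0.
    apply: lerXn2r; rewrite ?nnegrE ?l1_ge0//; exact: le_trans (l1_ge0 _) lb.
  rewrite -mulr_sumr; have -> : M3 * n%:R * u ^+ 2 = K * (d%:R * K) ^+ 2 * u ^+ 2 * (M2 * n%:R).
    by rewrite /M3; ring.
  apply: ler_wpM2l => //; apply: mulr_ge0; last exact: sqr_ge0.
  by apply: mulr_ge0 => //; exact: sqr_ge0.
have h2 : 0 <= h / 2 by rewrite divr_ge0// ltW.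
have low' : q1 / B / 2 * (n%:R * h) * u ^+ 2 <= h / 2 * \sum_(j < n) form j.
  have -> : q1 / B / 2 * (n%:R * h) * u ^+ 2 = h / 2 * (q1 / B * n%:R * u ^+ 2) by ring.
  exact: ler_wpM2l.
have up' : h / 2 * \sum_(j < n) form j <= M3 * (n%:R * h) * u ^+ 2.
  apply: (@le_trans _ _ (h / 2 * (M3 * n%:R * u ^+ 2))); first exact: ler_wpM2l.
  have -> : h / 2 * (M3 * n%:R * u ^+ 2) = M3 * (n%:R * h) * u ^+ 2 / 2 by ring.
  rewrite ler_pdivrMr// ler_peMr ?ler1n//.
  by apply: mulr_ge0; [apply: mulr_ge0 => //; exact: ltW|exact: sqr_ge0].
have a1 : 0 <= M3 * tau * u by apply: mulr_ge0 => //; exact: mulr_ge0.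
have a2 : 0 <= M1 * (n%:R * h) * u ^+ 2.
  by apply: mulr_ge0; [apply: mulr_ge0 => //; exact: ltW|exact: sqr_ge0].
move: lin; rewrite HD ler_norml => /andP[l1 l2].
rewrite !mulrDl; move: l1 l2 low' up' a1 a2.
move: (\sum_(j < n) mxform _ _ _) (h / 2 * _) (M1 * tau * u) (M3 * tau * u).
move: (M1 * (n%:R * h) * u ^+ 2) (M3 * (n%:R * h) * u ^+ 2) (q1 / B / 2 * (n%:R * h) * u ^+ 2).
by move=> y1 y2 y3 y4 y5 y6 y7 *; apply/andP; split; lra.
Qed.

End key_inequality.

(** * The free energy as a random variable *)

Section likelihood_regularity.
Context {R : realType} {d r pa pg : nat}.
Variables (a : 'cV[R]_d -> 'cV[R]_pa -> 'cV[R]_d)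
          (c : 'cV[R]_d -> 'cV[R]_pg -> 'M[R]_(d, r)).
Variables (Theta_a : set 'cV[R]_pa) (Theta_g : set 'cV[R]_pg).
Variables (a' : 'I_d -> 'I_pa -> 'cV[R]_d -> 'cV[R]_pa -> R)
  (c' : 'I_d * 'I_r -> 'I_pg -> 'cV[R]_d -> 'cV[R]_pg -> R) (K : R) (m : nat).
Hypotheses (Ta : bounded_convex_domain Theta_a) (Tg : bounded_convex_domain Theta_g).
Hypothesis Ra : forall i, regular_field Theta_a (fun x t => a x t i 0) (a' i) K m.
Hypothesis Rc : forall ij, regular_field Theta_g (fun x t => c x t ij.1 ij.2) (c' ij) K m.
Hypothesis lmin : forall x g, closure Theta_g g ->
  0 < lambda_min (scale_mx c x g) /\ (lambda_min (scale_mx c x g))^-1 <= K * wgt x ^+ m.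

Lemma GQL2_sum n h (x : nat -> 'cV[R]_d) al g : GQL2 a c n h x al g =
  \sum_(j < n) ((\sum_i \sum_l (x j.+1 i 0 - x j i 0) * precision c (x j) g i l * a (x j) al l 0) -
    h / 2 * (\sum_i \sum_l a (x j) al i 0 * precision c (x j) g i l * a (x j) al l 0)).
Proof.
rewrite /GQL2 big_add1 big_mkord/=; apply: eq_bigr => j _.
rewrite mxpair_outer !mxform_sum; congr (_ - _).
by apply: eq_bigr => i _; apply: eq_bigr => l _; rewrite !mxE.
Qed.

Lemma GQL2_continuous n h x g : {within closure Theta_a, continuous (fun al => GQL2 a c n h x al g)}.
Proof.
pose V := subspace (closure Theta_a).
have ca j i : continuous (fun al : V => a (x j) al i 0) := rf_cont (Ra i) (x := x j).
have cc (k : R) : continuous (fun _ : V => k) by move=> ?; exact: cvg_cst.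
rewrite (_ : (fun al => _) = (fun al : V => \sum_(j < n)
   ((\sum_i \sum_l (x j.+1 i 0 - x j i 0) * precision c (x j) g i l * a (x j) al l 0) -
    h / 2 * (\sum_i \sum_l a (x j) al i 0 * precision c (x j) g i l * a (x j) al l 0)))); last first.
  by apply/funext => al; rewrite GQL2_sum.
apply: continuous_rsum => j _; apply: continuous_subr.
  apply: continuous_rsum => i _; apply: continuous_rsum => l _.
  by apply: continuous_mulr; [exact: cc|exact: ca].
apply: continuous_mulr; first exact: cc.
apply: continuous_rsum => i _; apply: continuous_rsum => l _.
apply: continuous_mulr; last exact: ca.
by apply: continuous_mulr; [exact: ca|exact: cc].
Qed.

Lemma GQL2_measurable disp (T : measurableType disp) n h (U : nat -> T -> 'cV[R]_d)
    (V : T -> 'cV[R]_pa) (W : T -> 'cV[R]_pg) :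
  (forall j f, borel f -> measurable_fun setT (fun w => f (U j w))) ->
  (forall i, measurable_fun setT (fun w => V w i 0)) -> (forall w, closure Theta_a (V w)) ->
  (forall i, measurable_fun setT (fun w => W w i 0)) -> (forall w, closure Theta_g (W w)) ->
  measurable_fun setT (fun w => GQL2 a c n h (fun j => U j w) (V w) (W w)).
Proof.
move=> mU mV CV mW CW.
under eq_fun do rewrite GQL2_sum.
have mp j i l := precision_measurable Tg Rc lmin i l (mU j) mW CW.
have ma j i := drift_measurable Ta Ra i (mU j) mV CV.
have mu j i : measurable_fun setT (fun w => U j w i 0) := mU j _ (borel_coord i).
apply: measurable_sum => j; apply: measurable_funB.
  apply: measurable_sum => i; apply: measurable_sum => l.
  apply: measurable_funM => //; apply: measurable_funM => //.
  exact: measurable_funB.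
apply: measurable_funM => //.
apply: measurable_sum => i; apply: measurable_sum => l.
by apply: measurable_funM => //; exact: measurable_funM.
Qed.

End likelihood_regularity.

Section integrand.
Context {R : realType} {p : nat} (Theta : set 'cV[R]_p) (t0 : 'cV[R]_p).
Hypotheses (oT : open Theta) (Tt0 : Theta t0).

(** Points outside the parameter set are moved to an interior point, so that
    the integrand becomes a function of all of R^p. *)
Definition retract (t : p.-tuple R) : 'cV[R]_p :=
  if `[< Theta (tov t) >] then tov t else t0.

Lemma retract_in t : closure Theta (retract t).
Proof. by apply: subset_closure; rewrite /retract; case: asboolP. Qed.

Lemma retract_id t : Theta (tov t) -> retract t = tov t.
Proof. by move=> Tt; rewrite /retract; case: asboolP. Qed.

Lemma retract_measurable i : measurable_fun setT (fun t => retract t i 0).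
Proof.
pose S := [set t : p.-tuple R | Theta (tov t)].
have mS : measurable_fun setT (\1_S : p.-tuple R -> R).
  exact: measurable_indic (open_tuple_measurable oT).
rewrite (_ : (fun t => _) = (fun t => \1_S t * tnth t i + (1 - \1_S t) * t0 i 0)).
  apply: measurable_funD; apply: measurable_funM => //.
    exact: measurable_tnth.
  exact: measurable_funB.
apply/funext => t; rewrite /retract indicE; case: asboolP => Tt.
  by rewrite mem_set// subrr mul0r addr0 mul1r mxE.
by rewrite memNset// subr0 mul1r mul0r add0r.
Qed.

Lemma prior_measurable (prior : 'cV[R]_p -> R) :
  {within closure Theta, continuous prior} ->
  measurable_fun setT (fun t => prior (retract t)).
Proof.
move=> cp.
apply: (@measurable_random_parameter R _ _ 'I_p 'cV[R]_p (fun v i => v i 0) (closure Theta)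
  (fun v _ => prior v) retract t0).
- exact: subset_closure.
- exact: retract_in.
- exact: retract_measurable.
- by move=> x _; exact: measurable_cst.
move=> _ x Cx e e0; have [del del0 H] := within_closure_dist cp Cx e0.
by exists del.
Qed.

End integrand.

Theorem theorem4p2 (R : realType) (disp : measure_display)
  (Omega : measurableType disp) (P : probability Omega R)
  (F : R -> set_system Omega) (d r pa pg : nat)
  (a : 'cV[R]_d -> 'cV[R]_pa -> 'cV[R]_d)
  (c : 'cV[R]_d -> 'cV[R]_pg -> 'M[R]_(d, r))
  (Theta_a : set 'cV[R]_pa) (Theta_g : set 'cV[R]_pg)
  (alpha0 : 'cV[R]_pa) (gamma0 : 'cV[R]_pg)
  (Z : R -> Omega -> 'cV[R]_r) (X : R -> Omega -> 'cV[R]_d)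
  (kappa : R -> R.-pker (d.-tuple R) ~> (d.-tuple R))
  (mu : probability (d.-tuple R) R)
  (h : nat -> R) (c1 : R) (prior : 'cV[R]_pa -> R)
  (gammahat : nat -> Omega -> 'cV[R]_pg)
  (alphahat : nat -> Omega -> 'cV[R]_pa)
  (T := fun n => n%:R * h n)
  (obs := fun n w j => X (j%:R * h n) w)
  (H2n := fun n w alpha => GQL2 a c n (h n) (obs n w) alpha (gammahat n w)) :
  (* model *)
  filtration F ->
  levy_process P F Z ->
  indep_sigma P (process_sigma Z) (vec_sigma (X 0)) ->
  sde_solution P F (a ^~ alpha0) (c ^~ gamma0) Z X ->
  bounded_convex_domain Theta_a -> bounded_convex_domain Theta_g ->
  Theta_a alpha0 -> Theta_g gamma0 ->
  (* sampling design *)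
  (forall n, 0 < h n) ->
  T n @[n --> \oo] --> +oo ->
  n%:R * h n ^+ 2 @[n --> \oo] --> 0 ->
  (* estimators *)
  (forall n, random_vector (gammahat n)) ->
  (forall n, random_vector (alphahat n)) ->
  (forall n w, is_argmax (closure Theta_g) (GQL1 c n (h n) (obs n w))
                 (gammahat n w)) ->
  (forall n w, is_argmax (closure Theta_a) (H2n n w) (alphahat n w)) ->
  (* moments *)
  moments_Z P Z ->
  (* smoothness and non-degeneracy *)
  (forall i, C_sharp 2 4 Theta_a (fun x alpha => a x alpha i 0)) ->
  (forall i j, C_sharp 2 4 Theta_g (fun x gamma => c x gamma i j)) ->
  nondegenerate_scale c Theta_g ->
  (* stability *)
  transition_function P F (a ^~ alpha0) (c ^~ gamma0) Z kappa ->
  exponentially_ergodic kappa mu ->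
  bounded_moments P X ->
  (* identifiability *)
  identifiable_gamma c mu Theta_g gamma0 ->
  identifiable_alpha a c mu Theta_a alpha0 gamma0 ->
  (* prior *)
  prior_density Theta_a prior -> 0 < prior alpha0 ->
  (* T_n >~ n^c1 *)
  0 < c1 < 1 ->
  (exists2 C : R, 0 < C & \forall n \near \oo, C * n%:R `^ c1 <= T n) ->
  is_Op P
    (fun n w => free_energy (T n) Theta_a prior (H2n n w)
       - (- (T n)^-1 * H2n n w (alphahat n w)
          + pa%:R / (2 * T n) * ln (T n)))
    (fun n => (T n)^-1).
Proof.
move=> FF LZ _ SDE Ta Tg Ta0 Tg0 h0 Toc nh2 Rg Ral ag aa MZ Ca Cc [C0 [Kl [C00 ND]]] TF EE MX _ IA
  [pr0 prc [Kp prK] _] pa0 _ _.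
have Sa := @subset_closure _ Theta_a; have Sg := @subset_closure _ Theta_g.
have [a' [Ka [ma Ra0]]] := C_sharp_regular_family Ta Ca.
have [c' [Kc [mc' Rc0]]] := C_sharp_regular_family Tg
  (f := fun (ij : 'I_d * 'I_r) x g => c x g ij.1 ij.2) (fun ij => Cc ij.1 ij.2).
have [ml wl] := powR_le_wgt (d := d) C00.
pose K := `|Ka| + `|Kc| + `|Kl| * 2; pose m := (ma + mc' + ml)%N.
have K0 : 0 <= K by rewrite !addr_ge0// mulr_ge0.
have Ra i : regular_field Theta_a (fun x t => a x t i 0) (a' i) K m.
  apply: regular_field_weaken (Ra0 i); last by rewrite /m; lia.
  by apply: (le_trans (ler_norm _)); rewrite /K -addrA lerDl addr_ge0// mulr_ge0.
have Rc ij : regular_field Theta_g (fun x g => c x g ij.1 ij.2) (c' ij) K m.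
  apply: regular_field_weaken (Rc0 ij); last by rewrite /m; lia.
  apply: (le_trans (ler_norm _)); rewrite /K addrAC lerDr addr_ge0// mulr_ge0//.
have lmin x g : closure Theta_g g ->
    0 < lambda_min (scale_mx c x g) /\ (lambda_min (scale_mx c x g))^-1 <= K * wgt x ^+ m.
  move=> Cg; have [l0 l1] := ND x g Cg; split => //; apply: (le_trans l1).
  apply: (@le_trans _ _ (`|Kl| * (2 * wgt x ^+ ml))).
    apply: (@le_trans _ _ (`|Kl| * (1 + enorm x `^ C0))); last by rewrite ler_wpM2l.
    by rewrite ler_wpM2r ?ler_norm// addr_ge0// powR_ge0.
  rewrite mulrA; apply: ler_pM; rewrite ?mulr_ge0 ?wgtX_ge0//.
    by rewrite /K lerDr addr_ge0.
  by apply: wgtX_le; rewrite /m; lia.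
have SS : sde_setting P F (a ^~ alpha0) (c ^~ gamma0) Z X K m.
  split => //.
  - by move=> i x y; apply: (rf_lip (Ra i)); exact: Sa.
  - by move=> i k x y; apply: (rf_lip (Rc (i, k))); exact: Sg.
  - by move=> i x; apply: (rf_bound (Ra i)); exact: Sa.
  - by move=> i k x; apply: (rf_bound (Rc (i, k))); exact: Sg.
have Cg n w : closure Theta_g (gammahat n w) by have [] := ag n w.
have Cal n w : closure Theta_a (alphahat n w) by have [] := aa n w.
have [oTa _ _ _] := Ta.
pose S := [set t : pa.-tuple R | Theta_a (tov t)].
have mS : measurable S by exact: open_tuple_measurable.
have jh n (j : nat) : 0 <= j%:R * h n by rewrite mulr_ge0// ltW.
pose V := retract Theta_a alpha0.
(* The integrand, extended by 0 outside Theta_a and jointly measurable. *)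
pose G n (z : Omega * pa.-tuple R) : R :=
  \1_S z.2 * (expR (H2n n z.1 (V z.2)) * prior (V z.2)).
have mG n : measurable_fun setT (G n).
  apply: measurable_funM.
    have m1 : measurable_fun setT (\1_S : pa.-tuple R -> R) by exact: measurable_indic.
    exact: (measurableT_comp m1 measurable_snd).
  apply: measurable_funM; last first.
    have m1 : measurable_fun setT (fun t : pa.-tuple R => prior (V t)) by exact: prior_measurable.
    exact: (measurableT_comp m1 measurable_snd).
  suff mH : measurable_fun setT (fun z : Omega * pa.-tuple R => H2n n z.1 (V z.2)).
    exact: (measurableT_comp (@measurable_expR R) mH).
  apply: (GQL2_measurable Ta Tg Ra Rc lmin n (h n)
    (U := fun j (z : Omega * pa.-tuple R) => X (j%:R * h n) z.1)
    (V := fun z : Omega * pa.-tuple R => V z.2)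
    (W := fun z : Omega * pa.-tuple R => gammahat n z.1)).
  - move=> j f bf; exact: (measurableT_comp (sde_measurable SS (jh n j) bf) measurable_fst).
  - move=> i.
    have m1 : measurable_fun setT (fun t : pa.-tuple R => V t i 0) by exact: retract_measurable.
    exact: (measurableT_comp m1 measurable_snd).
  - by move=> z; exact: retract_in Ta0 _.
  - move=> i; exact: (measurableT_comp (random_vector_coord i (Rg n)) measurable_fst).
  - by move=> z; exact: Cg.
have G0 n z : 0 <= G n z.
  apply: mulr_ge0; first by rewrite indicE; case: (_ \in _).
  by apply: mulr_ge0; [exact: expR_ge0|apply: pr0; exact: retract_in].
have GE n w t : S t -> G n (w, t) = expR (H2n n w (tov t)) * prior (tov t).
  by move=> St; rewrite /G/= indicE mem_set// mul1r /V retract_id.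
have intE n w : \int[lebesgue_vec pa]_(t in S) (expR (H2n n w (tov t)) * prior (tov t)) =
    fine (\int[lebesgue_vec pa]_t (G n (w, t))%:E)%E.
  rewrite /Rintegral [X in fine X]integral_mkcond; congr fine.
  apply: eq_integral => t _; rewrite /patch; case: ifPn => [|tS].
    by rewrite inE => St; rewrite GE.
  by rewrite /G/= indicE (negbTE tS) mul0r.
have mI n : measurable_fun setT
    (fun w => \int[lebesgue_vec pa]_(t in S) (expR (H2n n w (tov t)) * prior (tov t))).
  under eq_fun do rewrite intE.
  have mGE : measurable_fun setT (EFin \o G n) by exact/measurable_EFinP.
  have FG0 z : (0 <= (EFin \o G n) z)%E by rewrite lee_fin.
  have := measurable_fun_fubini_tonelli_F (m2 := lebesgue_vec pa) _ mGE FG0.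
  exact: measurableT_comp (fine_measurable measurableT).
pose Y n w := free_energy (T n) Theta_a prior (H2n n w)
  - (- (T n)^-1 * H2n n w (alphahat n w) + pa%:R / (2 * T n) * ln (T n)).
have mY n : measurable_fun setT (Y n).
  apply: measurable_funB.
    by apply: measurable_funM => //; exact: (measurableT_comp (@measurable_ln R) (mI n)).
  apply: measurable_funD => //; apply: measurable_funM => //.
  apply: (GQL2_measurable Ta Tg Ra Rc lmin n (h n) (U := fun j w => X (j%:R * h n) w)).
  - by move=> j f bf; exact: (sde_measurable SS (jh n j) bf).
  - by move=> i; exact: random_vector_coord i (Ral n).
  - exact: Cal.
  - by move=> i; exact: random_vector_coord i (Rg n).
  - exact: Cg.
have [rho rho0 near0] : exists2 rho : R, 0 < rho & forall t : 'cV[R]_pa,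
    (forall i, `|t i 0 - alpha0 i 0| <= rho) -> Theta_a t /\ prior alpha0 / 2 <= prior t.
  have /nbhs_cVP[e1 e10 H1] : nbhs alpha0 Theta_a by exact: open_nbhs_nbhs.
  have p2 : 0 < prior alpha0 / 2 by rewrite divr_gt0.
  have [e2 e20 H2] := within_closure_dist prc (Sa _ Ta0) p2.
  exists (Num.min e1 e2 / 2); first by rewrite divr_gt0// lt_min e10.
  move=> t Ht.
  have lt12 i : `|t i 0 - alpha0 i 0| < e1 /\ `|t i 0 - alpha0 i 0| < e2.
    apply/andP; rewrite -lt_min; apply: (le_lt_trans (Ht i)).
    by rewrite ltr_pdivrMr// ltr_pMr ?lt_min ?e10// ltr1n.
  have Tt : Theta_a t by apply: H1 => i; exact: (proj1 (lt12 i)).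
  split => //; have := H2 t (Sa _ Tt) (fun i => proj2 (lt12 i)).
  by rewrite ltr_norml => /andP[+ _]; lra.
have [q q0 key] := key_inequality Ta Tg Ta0 Tg0 Ra Rc K0 lmin SS TF EE IA.
move=> eps eps0; have [M [T0 [M0 HM]]] := key eps eps0.
have p2 : 0 < prior alpha0 / 2 by rewrite divr_gt0.
have [C HC] := laplace M0 q0 p2 rho0 oTa (fun t Tt => pr0 t (Sa _ Tt))
  (fun t Tt => prK t (Sa _ Tt)) near0.
(* C depends on eps through M, but not on n. *)
exists C; near=> n.
have T1 : 1 <= T n by near: n; move/cvgryPge : Toc; exact.
have TT0 : T0 <= T n by near: n; move/cvgryPge : Toc; exact.
have Tr : rho^-1 ^+ 2 <= T n by near: n; move/cvgryPge : Toc; exact.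
have nh2_1 : n%:R * h n ^+ 2 < 1.
  near: n; move/cvgrPdist_lt : nh2 => /(_ 1 ltr01); apply: filterS => n.
  by rewrite sub0r normrN; apply: le_lt_trans; exact: ler_norm.
have n1 : 1 <= n%:R :> R.
  have : 0 < T n by exact: lt_le_trans T1.
  by rewrite /T pmulr_lgt0// ltr0n ler1n.
have h1 : h n <= 1.
  rewrite -(@ler_pXn2r _ 2)// ?nnegrE ?(ltW (h0 n))// expr1n; apply: le_trans (ltW nh2_1).
  by rewrite ler_peMl// sqr_ge0.
have h01 : 0 < h n <= 1 by rewrite h0.
have [E [mE pE HE]] := HM n (h n) h01 (ltW nh2_1) T1 TT0.
apply: le_trans pE; apply: prob_mono => //.
  by apply: measurable_gt_norm; exact: mY.
move=> w /= Hw; apply: contrapT => nE; move: Hw; apply/negP; rewrite -leNgt.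
apply: HC => //.
- rewrite -[leRHS]invrK lef_pV2 ?posrE ?invr_gt0 ?sqrtr_gt0 ?(lt_le_trans _ T1)//.
  rewrite -(ger0_norm (_ : 0 <= rho^-1)) ?invr_ge0 ?(ltW rho0)// -sqrtr_sqr.
  by rewrite ler_wsqrtr.
- apply: (eq_measurable_fun (fun t => G n (w, t))).
    by move=> t; rewrite inE => St; rewrite GE.
  apply: measurable_funTS.
  exact: (@measurable_fun_pair2 _ _ _ Omega _ _ _ w (mG n)).
- by have [_] := aa n w; apply; exact: Sa.
- move=> e e0.
  have cH : {within closure Theta_a, continuous (H2n n w)} by exact: (GQL2_continuous Ra).
  have [s Ts [Hs _]] := closure_approx cH (Cal n w) e0.
  exists s => //; move: Hs; rewrite ltr_norml => /andP[+ _].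
  by rewrite -/(H2n n w s) -/(H2n n w (alphahat n w)) => Hs; rewrite addrC -lerBlDl; lra.
by move=> t Tt; exact: HE nE (gammahat n w) t (Cg n w) Tt.
Unshelve. all: by end_near. Qed.
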